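(* Let $d=2$. Assume the exact solution $(\boldsymbol u,p,\boldsymbol w)$ of the micropolar Navier-Stokes equations (see context) satisfies $$\boldsymbol u,\ \boldsymbol w\in H^2(0,T;\boldsymbol H^{-1}(\Omega))\cap H^1(0,T;\boldsymbol H^2(\Omega))\cap L^\infty(0,T;\boldsymbol H^2(\Omega)).$$ Then there is a constant $C>0$, independent of $\tau$ (equivalently of $N$) and of $m$, such that for every integer $N\ge1$, with $\tau=T/N$, and every $0\le m\le N-1$, the errors of the Euler IMEX-SAV scheme satisfy $$\|e_{\boldsymbol u}^{m+1}\|^2+\nu\tau\sum_{n=0}^m\|\nabla e_{\boldsymbol u}^{n+1}\|^2+(\jmath+4\nu_r\tau)\|e_{\boldsymbol w}^{m+1}\|^2+c_1\tau\sum_{n=0}^m\|\nabla e_{\boldsymbol w}^{n+1}\|^2+2c_2\tau\sum_{n=0}^m\|\nabla\cdot e_{\boldsymbol w}^{n+1}\|^2+|e_q^{m+1}|^2+\frac{\tau}{T}\sum_{n=0}^m|e_q^{n+1}|^2\le C\tau^2 .$$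
   Context: Setting. $\Omega\subset\mathbb R^2$ is a convex polygonal domain with boundary $\Gamma$, $T>0$, $J=(0,T]$. $(\cdot,\cdot)$ and $\|\cdot\|$ are the $L^2(\Omega)$ inner product and norm. $\boldsymbol X=\boldsymbol H_0^1(\Omega)$, $\boldsymbol V=\{\boldsymbol v\in\boldsymbol X:\nabla\cdot\boldsymbol v=0\}$. The constants $\jmath,\nu,\nu_r,c_a,c_d,c_0$ are positive with $c_0+c_d-c_a>0$, and $\nu_0=\nu+\nu_r$, $c_1=c_a+c_d$, $c_2=c_0+c_d-c_a$. Convention in two dimensions: $\boldsymbol u=(u_1,u_2,0)$, $\boldsymbol w=(0,0,w)$, all functions depend on $(x,y)$ only, so $\nabla\times\boldsymbol u=(0,0,\partial_xu_2-\partial_yu_1)$ and $\nabla\times\boldsymbol w=(\partial_yw,-\partial_xw,0)$. Exact problem (micropolar Navier-Stokes equations), in $\Omega\times J$: $$\boldsymbol u_t+\boldsymbol u\cdot\nabla\boldsymbol u-\nu_0\Delta\boldsymbol u+\nabla p-2\nu_r\nabla\times\boldsymbol w=\boldsymbol 0,\qquad\nabla\cdot\boldsymbol u=0,$$ $$\jmath\boldsymbol w_t+\jmath\boldsymbol u\cdot\nabla\boldsymbol w-c_1\Delta\boldsymbol w-c_2\nabla\nabla\cdot\boldsymbol w+4\nu_r\boldsymbol w-2\nu_r\nabla\times\boldsymbol u=\boldsymbol 0,$$ with $\boldsymbol u=\boldsymbol w=\boldsymbol 0$ on $\Gamma\times J$, $\boldsymbol u(\cdot,0)=\boldsymbol u^0$,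 $\boldsymbol w(\cdot,0)=\boldsymbol w^0$ in $\Omega$. Also $q(t)=\exp(-t/T)$. Scheme. $\tau=T/N$, $t^n=n\tau$, $\delta_tv^{n+1}=(v^{n+1}-v^n)/\tau$. Start from $\boldsymbol u^0$, $\boldsymbol w^0$ (the exact initial data) and $q^0=1$. For $n=0,\dots,N-1$ find $\boldsymbol u^{n+1}\in\boldsymbol X$, $p^{n+1}\in L^2(\Omega)$ of zero mean, $\boldsymbol w^{n+1}\in\boldsymbol X$, $q^{n+1}\in\mathbb R$ such that (PDEs in the weak sense) $$\delta_t\boldsymbol u^{n+1}+\frac{q^{n+1}}{\exp(-t^{n+1}/T)}\boldsymbol u^n\cdot\nabla\boldsymbol u^n-\nu_0\Delta\boldsymbol u^{n+1}+\nabla p^{n+1}=2\nu_r\nabla\times\boldsymbol w^n,\qquad\nabla\cdot\boldsymbol u^{n+1}=0,$$ $$\jmath\,\delta_t\boldsymbol w^{n+1}+\jmath\frac{q^{n+1}}{\exp(-t^{n+1}/T)}\boldsymbol u^n\cdot\nabla\boldsymbol w^n-c_1\Delta\boldsymbol w^{n+1}-c_2\nabla\nabla\cdot\boldsymbol w^{n+1}+4\nu_r\boldsymbol w^{n+1}=2\nu_r\nabla\times\boldsymbol u^{n+1},$$ $$\delta_tq^{n+1}+\frac1Tq^{n+1}-\frac{1}{\exp(-t^{n+1}/T)}\Big((\boldsymbol u^n\cdot\nabla\boldsymbol u^n,\boldsymbol u^{n+1})+\jmath(\boldsymbol u^n\cdot\nabla\boldsymbol w^n,\boldsymbol w^{n+1})\Big)=0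 .$$ Errors. $e_{\boldsymbol u}^n=\boldsymbol u^n-\boldsymbol u(t^n)$, $e_{\boldsymbol w}^n=\boldsymbol w^n-\boldsymbol w(t^n)$, $e_q^n=q^n-q(t^n)$. The constant $C$ may depend on $\Omega$, $T$, the physical constants, the initial data and the exact solution. *)

(* Defs.v *)
From HB Require Import structures.
From mathcomp Require Import all_boot all_order all_algebra.
From mathcomp Require Import all_classical all_reals all_analysis.

Set Implicit Arguments.
Unset Strict Implicit.
Unset Printing Implicit Defensive.

Import Order.TTheory GRing.Theory Num.Theory.
Import numFieldNormedType.Exports.

Local Open Scope classical_set_scope.
Local Open Scope ring_scope.

Local Notation mu1 := (@lebesgue_measure _).
Local Notation mu2 := (@lebesgue_measure _ \x @lebesgue_measure _)%E.

(** * Sobolev spaces on a planar domain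

    Functions on [Om] are represented by functions on the plane whose values
    outside [Om] are never used; almost everywhere equal functions are not
    identified, so that the "norms" below are seminorms on representatives. *)
Section Space.
Context {R : realType}.
Implicit Types (Om : set (R * R)) (f g phi v : R * R -> R) (j : 'I_3).

(** Bounded nonempty finite intersection of open half-planes (hence open). *)
Definition convex_polygonal_domain Om : Prop :=
  [/\ Om !=set0, bounded_set Om &
   exists (n : nat) (a : 'I_n -> R * R) (c : 'I_n -> R),
     Om = [set x | forall i, (a i).1 * x.1 + (a i).2 * x.2 < c i]].

(** Functions depend on (x, y) only, but derivatives are indexed by the three
    axes: the third axis projects to the null direction of the plane, so every
    third partial derivative vanishes. *)
Definition axis (j : 'I_3) : R * R := ((j == 0)%:R, (j == 1)%:R).

Definition iter_partial (s : seq 'I_3) phi : R * R -> R :=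
  foldr (fun j g => 'D_(axis j) g) phi s.

Definition supp phi : set (R * R) := closure [set x | phi x != 0].

(** C_c^oo(Om) *)
Definition test_function Om phi : Prop :=
  [/\ forall s, continuous (iter_partial s phi),
      forall s j x, derivable (iter_partial s phi) x (axis j),
      compact (supp phi) & supp phi `<=` Om].

Definition L2 Om f : Prop :=
  measurable_fun Om f /\ mu2.-integrable Om (fun x => (f x ^+ 2)%:E).

Definition ip Om f g : R := \int[mu2]_(x in Om) (f x * g x).

Definition L2norm Om f : R := Num.sqrt (ip Om f f).

(** L^2(Om) functions of zero mean *)
Definition L20 Om f : Prop := L2 Om f /\ \int[mu2]_(x in Om) f x = 0.

Definition is_weak_partial Om j f g : Prop :=
  [/\ L2 Om f, L2 Om g &
   forall phi, test_function Om phi ->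
     ip Om f ('D_(axis j) phi) = - ip Om g phi].

(** A chosen weak derivative (unique almost everywhere in [Om]); it is the
    null function when there is none in L^2. *)
Definition pd Om j f : R * R -> R := xget (cst 0) [set g | is_weak_partial Om j f g].

Definition H1 Om f : Prop := forall j, exists g, is_weak_partial Om j f g.

Definition H1norm Om f : R :=
  Num.sqrt (L2norm Om f ^+ 2 + \sum_j L2norm Om (pd Om j f) ^+ 2).

Definition H10 Om f : Prop :=
  H1 Om f /\
  forall e : R, 0 < e -> exists2 phi, test_function Om phi & H1norm Om (f - phi) < e.

Definition H2 Om f : Prop := H1 Om f /\ forall j, H1 Om (pd Om j f).

Definition H2norm Om f : R :=
  Num.sqrt (L2norm Om f ^+ 2 + \sum_j H1norm Om (pd Om j f) ^+ 2).

(** H^{-1}(Om), the dual of H^1_0(Om); only the values of [F] on H^1_0(Om)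
    are used. *)
Definition Hm1 Om (F : (R * R -> R) -> R) : Prop :=
  (forall (a : R) f g, H10 Om f -> H10 Om g -> F (a *: f + g) = a * F f + F g) /\
  exists K : R, forall f, H10 Om f -> `|F f| <= K * H1norm Om f.

Definition Hm1norm Om (F : (R * R -> R) -> R) : R :=
  sup [set `|F f| | f in [set f | H10 Om f /\ H1norm Om f <= 1]].

End Space.

(** * Bochner spaces on (0, T)

    [B] is the set of elements of a space of representatives [V], with
    (semi)norm [nrm]. *)
Section Bochner.
Context {R : realType} {V : lmodType R}.
Variables (B : set V) (nrm : V -> R) (T : R).
Implicit Types (f g : R -> V) (v : V).

Definition time_itv : set R := `]0, T[.

Record step_function := StepFunction {
  step_card : nat;
  step_set : 'I_step_card -> set R;
  step_val : 'I_step_card -> V }.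

Definition step_eval (s : step_function) (t : R) : V :=
  \sum_i (\1_(@step_set s i) t : R) *: step_val i.

Definition step_integral (s : step_function) : V :=
  \sum_i fine (mu1 (@step_set s i `&` time_itv)) *: step_val i.

Definition step_in (s : step_function) : Prop :=
  (forall i, measurable (@step_set s i)) /\ (forall i, B (@step_val s i)).

Definition strongly_measurable f : Prop :=
  {ae mu1, forall t, 0 < t < T -> B (f t)} /\
  exists2 s : nat -> step_function, forall k, step_in (s k) &
    {ae mu1, forall t, 0 < t < T ->
       nrm (f t - step_eval (s k) t) @[k --> \oo] --> (0 : R)}.

Definition bochner_L2 f : Prop :=
  strongly_measurable f /\
  (\int[mu1]_(t in time_itv) (nrm (f t) ^+ 2)%:E < +oo)%E.

Definition bochner_Linfty f : Prop :=
  strongly_measurable f /\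
  exists M : R, {ae mu1, forall t, 0 < t < T -> nrm (f t) <= M}.

Definition is_bochner_integral f v : Prop :=
  [/\ strongly_measurable f, B v &
   exists s : nat -> step_function,
     [/\ forall k, step_in (s k),
         (\int[mu1]_(t in time_itv) (nrm (f t - step_eval (s k) t))%:E)%E
           @[k --> \oo] --> (0 : \bar R) &
         nrm (step_integral (s k) - v) @[k --> \oo] --> (0 : R)]].

(** C_c^oo(0, T) *)
Definition test_function_time (phi : R -> R) : Prop :=
  [/\ forall n x, derivable (derive1n n phi) x 1,
      compact (closure [set t | phi t != 0]) &
      closure [set t | phi t != 0] `<=` time_itv].

Definition is_weak_time_derivative f g : Prop :=
  forall phi, test_function_time phi ->
    exists2 v, is_bochner_integral (fun t => derive1 phi t *: f t) v &
               is_bochner_integral (fun t => phi t *: g t) (- v).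

(** H^k(0, T; B) *)
Fixpoint bochner_H (k : nat) f : Prop :=
  match k with
  | 0%N => bochner_L2 f
  | k'.+1 => bochner_L2 f /\
             exists2 g, is_weak_time_derivative f g & bochner_H k' g
  end.

End Bochner.

(** * Vector fields, with three components depending on (x, y) only *)
Section Fields.
Context {R : realType}.
Variable Om : set (R * R).
Implicit Types u v w : 'I_3 -> R * R -> R.

Definition div v : R * R -> R := fun x => \sum_j pd Om j (v j) x.

(** Indices modulo 3. *)
Definition curl v : 'I_3 -> R * R -> R := fun i x =>
  pd Om (i + 1) (v (i + 2)) x - pd Om (i + 2) (v (i + 1)) x.

Definition laplacian (f : R * R -> R) : R * R -> R :=
  fun x => \sum_j pd Om j (pd Om j f) x.

(** u . grad v *)
Definition conv u v : 'I_3 -> R * R -> R :=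
  fun i x => \sum_j u j x * pd Om j (v i) x.

Definition vip u v : R := \sum_i ip Om (u i) (v i).

Definition gradip u v : R :=
  \sum_i \sum_j ip Om (pd Om j (u i)) (pd Om j (v i)).

Definition planar v : Prop := forall x, Om x -> v 2 x = 0.

Definition axial v : Prop := forall x, Om x -> v 0 x = 0 /\ v 1 x = 0.

(** The space X, for the fields (u_1, u_2, 0) and (0, 0, w) respectively. *)
Definition Xplanar v : Prop := planar v /\ forall i, H10 Om (v i).

Definition Xaxial v : Prop := axial v /\ forall i, H10 Om (v i).

Definition continuous_in_L2 (T : R) (u : R -> 'I_3 -> R * R -> R) : Prop :=
  forall i t, 0 <= t <= T ->
    L2 Om (u t i) /\
    L2norm Om (u s i - u t i) @[s --> within `[0, T] (nbhs t)] --> (0 : R).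

(** Intersection of H^2(0,T;H^{-1}), H^1(0,T;H^2) and L^oo(0,T;H^2); L^2(Om) is
    embedded into H^{-1}(Om) by the inner product. *)
Definition regular (T : R) (u : R -> 'I_3 -> R * R -> R) : Prop :=
  forall i,
  [/\ bochner_H (Hm1 Om) (Hm1norm Om) T 2 (fun t => ip Om (u t i)),
      bochner_H (H2 Om) (H2norm Om) T 1 (fun t => u t i) &
      bochner_Linfty (H2 Om) (H2norm Om) T (fun t => u t i)].

End Fields.

(** * The micropolar Navier-Stokes equations and the Euler IMEX-SAV scheme *)
Record params (R : realType) := Params {
  jmath : R; nu : R; nur : R; ca : R; cd : R; c0 : R }.

Section Micropolar.
Context {R : realType}.
Variables (Om : set (R * R)) (T : R) (par : params R).

Definition admissible : Prop :=
  [/\ [/\ 0 < jmath par, 0 < nu par & 0 < nur par],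
      [/\ 0 < ca par, 0 < cd par & 0 < c0 par] &
      0 < c0 par + cd par - ca par].

Definition nu0 : R := nu par + nur par.
Definition c1 : R := ca par + cd par.
Definition c2 : R := c0 par + cd par - ca par.

(** Values at given times are those of the representatives continuous in time
    with values in L^2(Om); the equations hold almost everywhere. *)
Record exact_solution (u0 w0 : 'I_3 -> R * R -> R)
    (u : R -> 'I_3 -> R * R -> R) (p : R -> R * R -> R)
    (w : R -> 'I_3 -> R * R -> R) : Prop := ExactSolution {
  exact_planar : forall t, 0 <= t <= T -> planar Om (u t);
  exact_axial : forall t, 0 <= t <= T -> axial Om (w t);
  exact_cont_u : continuous_in_L2 Om T u;
  exact_cont_w : continuous_in_L2 Om T w;
  exact_init : forall i x, Om x -> u 0 i x = u0 i x /\ w 0 i x = w0 i x;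
  exact_bc_u : forall t, 0 < t <= T -> forall i, H10 Om (u t i);
  exact_bc_w : forall t, 0 < t <= T -> forall i, H10 Om (w t i);
  exact_div : forall t, 0 < t <= T ->
    {ae mu2, forall x, Om x -> div Om (u t) x = 0};
  exact_p : {ae mu1, forall t, 0 < t <= T -> H1 Om (p t)};
  exact_momentum : exists2 ut : R -> 'I_3 -> R * R -> R,
    forall i, is_weak_time_derivative (L2 Om) (L2norm Om) T
                (fun t => u t i) (fun t => ut t i) &
    {ae mu1, forall t, 0 < t <= T -> forall i,
      {ae mu2, forall x, Om x ->
        ut t i x + conv Om (u t) (u t) i x - nu0 * laplacian Om (u t i) x
        + pd Om i (p t) x - 2 * nur par * curl Om (w t) i x = 0}};
  exact_angular : exists2 wt : R -> 'I_3 -> R * R -> R,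
    forall i, is_weak_time_derivative (L2 Om) (L2norm Om) T
                (fun t => w t i) (fun t => wt t i) &
    {ae mu1, forall t, 0 < t <= T -> forall i,
      {ae mu2, forall x, Om x ->
        jmath par * wt t i x + jmath par * conv Om (u t) (w t) i x
        - c1 * laplacian Om (w t i) x - c2 * pd Om i (div Om (w t)) x
        + 4 * nur par * w t i x - 2 * nur par * curl Om (u t) i x = 0}} }.

Definition qexact (t : R) : R := expR (- t / T).

Definition step (N : nat) : R := T / N%:R.

Definition time (N n : nat) : R := n%:R * step N.

Definition delta {V : lmodType R} (N : nat) (v : nat -> V) (n : nat) : V :=
  (step N)^-1 *: (v n.+1 - v n).

Record sav_step (N : nat) (U : nat -> 'I_3 -> R * R -> R)
    (P : nat -> R * R -> R) (W : nat -> 'I_3 -> R * R -> R) (Q : nat -> R)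
    (n : nat) : Prop := SavStep {
  sav_U : Xplanar Om (U n.+1);
  sav_P : L20 Om (P n.+1);
  sav_W : Xaxial Om (W n.+1);
  sav_momentum : forall v, Xplanar Om v ->
    vip Om (delta N U n) v
    + Q n.+1 / expR (- time N n.+1 / T) * vip Om (conv Om (U n) (U n)) v
    + nu0 * gradip Om (U n.+1) v - ip Om (P n.+1) (div Om v)
    = 2 * nur par * vip Om (curl Om (W n)) v;
  sav_div : {ae mu2, forall x, Om x -> div Om (U n.+1) x = 0};
  sav_angular : forall z, Xaxial Om z ->
    jmath par * vip Om (delta N W n) z
    + jmath par * (Q n.+1 / expR (- time N n.+1 / T))
        * vip Om (conv Om (U n) (W n)) z
    + c1 * gradip Om (W n.+1) z + c2 * ip Om (div Om (W n.+1)) (div Om z)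
    + 4 * nur par * vip Om (W n.+1) z
    = 2 * nur par * vip Om (curl Om (U n.+1)) z;
  sav_q :
    (Q n.+1 - Q n) / step N + T^-1 * Q n.+1
    - (expR (- time N n.+1 / T))^-1
        * (vip Om (conv Om (U n) (U n)) (U n.+1)
           + jmath par * vip Om (conv Om (U n) (W n)) (W n.+1)) = 0 }.

Definition sav_scheme (u0 w0 : 'I_3 -> R * R -> R) (N : nat)
    (U : nat -> 'I_3 -> R * R -> R) (P : nat -> R * R -> R)
    (W : nat -> 'I_3 -> R * R -> R) (Q : nat -> R) : Prop :=
  [/\ U 0%N = u0, W 0%N = w0, Q 0%N = 1 &
      forall n, (n < N)%N -> sav_step N U P W Q n].

End Micropolar.

(* Main.v *)
(** Since [w] is axial, its divergence vanishes. Averaging the equations over a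
    time step [[t_n, t_(n+1)]] and testing them with a divergence-free field
    eliminates the pressure and leaves a consistency error of size
    [tau * om_n * |grad v|], where [om_n] bounds the increments over the step
    of the gradients of [u] and [w]. As [u] and [w] are in [H^1(0,T;H^2)], the
    sum of the [om_n ^ 2] is [O(tau)].

    Testing the scheme with its own solution, the convection terms cancel
    against the equation of the auxiliary variable and the coupling terms are
    absorbed by the zero-order term [4 nu_r w]; the scheme is thus stable for
    every [tau], and [tau * sum |grad e^n|^2] is bounded. By skew-symmetry and
    Ladyzhenskaya's inequality, the energy of the error satisfies a recursive
    inequality with weights [tau * (1 + |grad e^n|^2)], whose sum is
    bounded by stability, and Gronwall's lemma applies without restriction on
    [tau]. *)
Require Import Defs.
From HB Require Import structures.
From mathcomp Require Import all_boot all_order all_algebra.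
From mathcomp Require Import all_classical all_reals all_analysis.
From mathcomp Require Import measurable_realfun.
From mathcomp Require Import ring lra.

Set Implicit Arguments.
Unset Strict Implicit.
Unset Printing Implicit Defensive.

Import Order.TTheory GRing.Theory Num.Theory.
Import numFieldNormedType.Exports.

Local Open Scope classical_set_scope.
Local Open Scope ring_scope.

(** * Semi-inner products *)

(** Functions are representatives and [pd] is a choice, so differentiation is linear only almost
    everywhere. Integrated pairings are exactly bilinear on the right sets, and the energy argument
    is run for abstract semi-inner products. Bochner integrals are never manipulated: a functional
    is applied first, and the resulting scalar weak derivative is integrated by means of explicit
    cutoffs. Two points shape the rest. At time 0 the solution is known only as an L^2 limit, while
    the first step needs [u 0] in H^1_0, divergence-free and with controlled gradient increments;
    gradients are therefore estimated against test functions first, and [u 0] is recovered by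
    completeness. As for the rate, the increments satisfy [om_n ^ 2 = tau * (Gam t_(n+1) - Gam t_n)]
    with [Gam] built from an antiderivative of the squared norm of the time derivative, so their sum
    telescopes. The recursion for the error produces gradients of the previous step. Part of the
    dissipation is kept inside the energy to absorb those that come linearly; the others are
    multiplied by the L^2 error and become Gronwall weights. *)

Section SemiInner.
Context {R : realType} {V : lmodType R}.

(** [V] is a type of representatives and the integral of a non-integrable function is a default
    value, so linearity can be claimed only on a set [P] stable under combinations. Definiteness
    fails as well: a null function need not be 0. *)
Record semi_inner (P : V -> Prop) (B : V -> V -> R) : Prop := SemiInner {
  si_lin : forall (a : R) x y, P x -> P y -> P (a *: x + y);
  si_sym : forall x y, B x y = B y x;
  si_linl : forall (a : R) x y z, P x -> P y -> P z ->
    B (a *: x + y) z = a * B x z + B y z;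
  si_ge0 : forall x, P x -> 0 <= B x x }.

(** The forms are only semi-definite, so [c] may vanish; [b] must then vanish too, which is treated
    apart from the usual choice [t = - b / c]. *)
Lemma discr_le (a b c : R) : (forall t, 0 <= a + 2 * t * b + t ^+ 2 * c) ->
  b ^+ 2 <= a * c.
Proof.
move=> h; have a0 : 0 <= a by have := h 0; lra.
have [c0|c0] := lerP c 0.
  have -> : b = 0.
    apply/eqP; apply: contraT => b0.
    (* For this [t] the affine part equals -1 while [t ^+ 2 * c <= 0], against nonnegativity. *)
    have := h (- (a + 1) / (2 * b)).
    have -> : a + 2 * (- (a + 1) / (2 * b)) * b = -1 by field.
    have : (- (a + 1) / (2 * b)) ^+ 2 * c <= 0.
      by rewrite mulr_ge0_le0 // sqr_ge0.
    lra.
  have cz : 0 <= c.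
    have := h 1; have := h (-1); rewrite leNgt => h1 h2.
    rewrite leNgt; apply/negP => clt.
    have c'0 : c != 0 by rewrite lt_eqF.
    have := h ((`|b| + a + 1) / (- c) + 1).
    set t := _ + 1 => ht.
    have t1 : 1 <= t.
      by rewrite /t lerDr divr_ge0 ?oppr_ge0// !addr_ge0.
    have tc : (- c) * t = `|b| + a + 1 - c by rewrite /t; field.
    have hb := ler_norm b.
    have e : 0 <= `|b| by [].
    have h3 := h t; have : t ^+2 * c = - t * (`|b| + a + 1 - c) by rewrite -tc; ring.
    move=> e3; rewrite e3 in h3.
    by have := h (2 * (`|b| + a + 1) / (- c) + 2); set s := _ + 2; nra.
  have -> : c = 0 by apply/eqP; rewrite eq_le c0 cz.
  by rewrite expr0n mulr0.
have := h (- b / c).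
have -> : a + 2 * (- b / c) * b + (- b / c) ^+ 2 * c = (a * c - b ^+ 2) / c.
  by field; rewrite gt_eqF.
by rewrite pmulr_lge0 ?invr_gt0// subr_ge0.
Qed.

Variables (P : V -> Prop) (B : V -> V -> R) (H : semi_inner P B).

Definition si_norm (x : V) : R := Num.sqrt (B x x).

Lemma si_0 x : P x -> P 0.
Proof. by move=> Px; have := si_lin H (-1) Px Px; rewrite scaleN1r addNr. Qed.

Lemma si_Z a x : P x -> P (a *: x).
Proof. by move=> Px; have := si_lin H a Px (si_0 Px); rewrite addr0. Qed.

Lemma si_D x y : P x -> P y -> P (x + y).
Proof. by move=> Px Py; have := si_lin H 1 Px Py; rewrite scale1r. Qed.

Lemma si_N x : P x -> P (- x).
Proof. by move=> Px; rewrite -scaleN1r; exact: si_Z. Qed.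

Lemma si_B x y : P x -> P y -> P (x - y).
Proof. by move=> Px Py; apply: si_D => //; exact: si_N. Qed.

Lemma si_add x y z : P x -> P y -> P z -> B (x + y) z = B x z + B y z.
Proof. by move=> *; rewrite -[x]scale1r (si_linl H)// mul1r scale1r. Qed.

Lemma si_zerol z : P z -> B 0 z = 0.
Proof.
move=> Pz; have := si_add (si_0 Pz) (si_0 Pz) Pz; rewrite addr0 => e.
by apply: (addrI (B 0 z)); rewrite -e addr0.
Qed.

Lemma si_scale a x z : P x -> P z -> B (a *: x) z = a * B x z.
Proof.
move=> Px Pz; rewrite -[a *: x]addr0 (si_linl H)// ?si_zerol ?addr0//.
exact: si_0 Px.
Qed.

Lemma si_opp x z : P x -> P z -> B (- x) z = - B x z.
Proof. by move=> *; rewrite -scaleN1r si_scale// mulN1r. Qed.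

Lemma si_sub x y z : P x -> P y -> P z -> B (x - y) z = B x z - B y z.
Proof. by move=> *; rewrite si_add// ?si_opp//; exact: si_N. Qed.

Lemma si_addr x y z : P x -> P y -> P z -> B z (x + y) = B z x + B z y.
Proof. by move=> *; rewrite (si_sym H) si_add// !(si_sym H z). Qed.

Lemma si_subr x y z : P x -> P y -> P z -> B z (x - y) = B z x - B z y.
Proof. by move=> *; rewrite (si_sym H) si_sub// !(si_sym H z). Qed.

Lemma si_scaler a x z : P x -> P z -> B z (a *: x) = a * B z x.
Proof. by move=> *; rewrite (si_sym H) si_scale// (si_sym H z). Qed.

Lemma si_sqrD x y : P x -> P y -> B (x + y) (x + y) = B x x + 2 * B x y + B y y.
Proof.
move=> Px Py; have Pxy := si_D Px Py.
rewrite si_add// !si_addr// (si_sym H y x); ring.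
Qed.

Lemma si_sqrB x y : P x -> P y -> B (x - y) (x - y) = B x x - 2 * B x y + B y y.
Proof.
move=> Px Py; have Pxy := si_B Px Py.
rewrite si_sub// !si_subr// (si_sym H y x); ring.
Qed.

Lemma si_CS x y : P x -> P y -> B x y ^+ 2 <= B x x * B y y.
Proof.
move=> Px Py; apply: discr_le => t.
have Pty := si_Z t Py.
have := si_ge0 H (si_D Px Pty); rewrite si_sqrD// si_scaler// si_scale// si_scaler//.
by congr (_ <= _); ring.
Qed.

Lemma si_norm_ge0 x : 0 <= si_norm x. Proof. exact: sqrtr_ge0. Qed.

Lemma si_normE x : P x -> si_norm x ^+ 2 = B x x.
Proof. by move=> Px; rewrite sqr_sqrtr// (si_ge0 H). Qed.

Lemma si_le x y : P x -> P y -> `|B x y| <= si_norm x * si_norm y.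
Proof.
move=> Px Py; rewrite -ler_sqr ?nnegrE ?mulr_ge0 ?si_norm_ge0//.
by rewrite exprMn !si_normE// real_normK ?num_real// si_CS.
Qed.

Lemma si_triangle x y : P x -> P y -> si_norm (x + y) <= si_norm x + si_norm y.
Proof.
move=> Px Py; have Pxy := si_D Px Py.
rewrite -ler_sqr ?nnegrE ?addr_ge0 ?si_norm_ge0// si_normE// si_sqrD//.
rewrite sqrrD !si_normE// mulr2n.
by have := le_trans (ler_norm (B x y)) (si_le Px Py); lra.
Qed.

Lemma si_norm_opp x : P x -> si_norm (- x) = si_norm x.
Proof.
move=> Px; rewrite /si_norm si_opp ?(si_sym H _ (- x)) ?si_opp ?opprK//.
exact: si_N.
Qed.

Lemma si_norm_scale a x : P x -> si_norm (a *: x) = `|a| * si_norm x.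
Proof.
move=> Px; rewrite /si_norm si_scale ?si_scaler ?mulrA -?expr2//; last exact: si_Z.
by rewrite sqrtrM ?sqr_ge0// sqrtr_sqr.
Qed.

Lemma si_norm_sub x y : P x -> P y -> si_norm (x - y) <= si_norm x + si_norm y.
Proof.
by move=> Px Py; rewrite -[leRHS](_ : si_norm x + si_norm (- y) = _);
  [apply: si_triangle => //; exact: si_N | rewrite si_norm_opp].
Qed.

Lemma si_norm_dist x y : P x -> P y ->
  `|si_norm x - si_norm y| <= si_norm (x - y).
Proof.
move=> Px Py; have Pxy := si_B Px Py; rewrite ler_norml; apply/andP; split.
  have := si_norm_sub Px Pxy; rewrite opprB addrC subrK; lra.
have := si_triangle Pxy Py; rewrite subrK; lra.
Qed.

End SemiInner.

(** * Square-integrable functions for an arbitrary measure *)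

Section SquareIntegrable.
Context d (T : measurableType d) (R : realType).
Variables (mu : {measure set T -> \bar R}) (D : set T).
Hypothesis mD : measurable D.
Implicit Types f g : T -> R.

(** Generic version of [L2]: it serves for the domain, where the two unfold to the same thing, and
    for time intervals, in the Cauchy-Schwarz inequality of [rho_CS]. *)
Definition sqint f : Prop :=
  measurable_fun D f /\ mu.-integrable D (fun x => (f x ^+ 2)%:E).

Definition intmul f g : R := \int[mu]_(x in D) (f x * g x).

Lemma sqint_mul f g : sqint f -> sqint g ->
  mu.-integrable D (fun x => (f x * g x)%:E).
Proof.
move=> [mf If] [mg Ig]; have := integrableD mD If Ig.
apply: le_integrable => //.
  by apply/measurable_EFinP; exact: measurable_funM.
move=> x Dx /=; rewrite lee_fin [leRHS]ger0_norm ?addr_ge0 ?sqr_ge0//.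
rewrite ler_norml; nra.
Qed.

Lemma sqint_lin a f g : sqint f -> sqint g -> sqint (a *: f + g).
Proof.
move=> Sf Sg; have mf := Sf.1; have mg := Sg.1; split.
  by apply: measurable_funD => //; exact: measurable_funM.
have I := integrableD mD (integrableD mD (integrableZl mD (a ^+ 2) Sf.2)
  (integrableZl mD (2 * a) (sqint_mul Sf Sg))) Sg.2.
apply: eq_integrable I => // x _ /=.
rewrite -!EFinM -!EFinD; congr (_%:E).
have -> : (a *: f + g) x = a * f x + g x by [].
by ring.
Qed.

Lemma sqint_si : semi_inner sqint intmul.
Proof.
split.
- exact: sqint_lin.
- by move=> f g; apply: eq_Rintegral => x _; rewrite mulrC.
- move=> a f g h Sf Sg Sh; have If := sqint_mul Sf Sh; have Ig := sqint_mul Sg Sh.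
  rewrite /intmul -RintegralZl// -RintegralD//; last exact: (integrableZl mD a If).
  apply: eq_Rintegral => x _; rewrite mulrA -mulrDl //.
- by move=> f Sf; apply: Rintegral_ge0 => x _; rewrite -expr2 sqr_ge0.
Qed.

End SquareIntegrable.

(** * Smooth cutoff functions on the line *)
Section SmoothFunctions.
Context {R : realType}.
Implicit Types (f g : R -> R) (x : R).

(** The classical [exp (- 1 / x)] divided by powers of [x]. The derivative of a member is a
    combination of the next two, see [is_derive_flat], so the family is closed under differentiation
    and has to be studied as a whole. *)
Definition flat (n : nat) (x : R) : R :=
  if 0 < x then x^-1 ^+ n * expR (- x^-1) else 0.

Lemma flat_ge0 n x : 0 <= flat n x.
Proof.
by rewrite /flat; case: ifP => // x0; rewrite mulr_ge0 ?expR_ge0// exprn_ge0// invr_ge0 ltW.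
Qed.

Lemma flat_gt0 n x : 0 < x -> 0 < flat n x.
Proof. by move=> x0; rewrite /flat x0 mulr_gt0 ?expR_gt0// exprn_gt0// invr_gt0. Qed.

Lemma flat_le0 n x : x <= 0 -> flat n x = 0.
Proof. by move=> x0; rewrite /flat ltNge x0. Qed.

(** With [s = 1 / x], one term of the exponential series gives [s ^ (n + 2) / (n + 2)! <= exp s].
    Quadratic decay is what [is_derive0_sqr] turns into a zero derivative at the junction point. *)
Lemma flat_le_sqr n x : flat n x <= (n.+2)`!%:R * x ^+ 2.
Proof.
rewrite /flat; case: ifPn => [x0|_]; last by rewrite mulr_ge0 ?ler0n ?sqr_ge0.
have s0 : 0 < x^-1 by rewrite invr_gt0.
have := expR_ge1Dxn n.+1 (ltW s0); set e := expR _ => he.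
have fac : 0 < (n.+2)`!%:R :> R by rewrite ltr0n fact_gt0.
have : x^-1 ^+ n.+2 <= (n.+2)`!%:R * e.
  by rewrite mulrC -ler_pdivrMr//; apply: le_trans he; rewrite lerDr.
rewrite expRN -/e => h.
have e0 : 0 < e by exact: expR_gt0.
rewrite ler_pdivrMr//.
have -> : x^-1 ^+ n = x^-1 ^+ n.+2 * x ^+ 2.
  by rewrite 2!exprS exprVn; field; rewrite expf_neq0 ?gt_eqF.
by rewrite [leRHS]mulrAC ler_pM2r ?exprn_gt0.
Qed.

Lemma is_derive0_sqr f (K : R) : (forall x, `|f x| <= K * x ^+ 2) ->
  is_derive (0 : R) (1 : R) f 0.
Proof.
move=> fK; have f0 : f 0 = 0.
  by apply/eqP; rewrite -normr_le0; have := fK 0; rewrite expr0n mulr0.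
have h : (fun h : R => h^-1 *: ((f \o shift 0) (h *: 1) - f 0)) @ 0^' --> (0 : R).
  apply/cvgr0Pnorm_lt => e e0.
  near=> h; rewrite /= addr0 f0 subr0.
  have hn0 : h != 0 by near: h; exact: nbhs_dnbhs_neq.
  rewrite normrZ [h *: 1]mulr1 normfV.
  rewrite mulrC ltr_pdivrMr ?normr_gt0//; apply: (le_lt_trans (fK h)).
  rewrite -normr_id -[h ^+ 2]real_normK ?num_real// expr2 mulrA normr_id.
  rewrite ltr_pM2r ?normr_gt0//.
  apply: (@le_lt_trans _ _ (`|K| * `|h|)); first by rewrite ler_wpM2r// ler_norm.
  apply: (@le_lt_trans _ _ ((`|K| + 1) * `|h|)); first by rewrite ler_wpM2r// lerDl.
  rewrite mulrC -ltr_pdivlMr ?ltr_wpDl//.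
  near: h; apply: dnbhs0_lt; rewrite divr_gt0 ?ltr_wpDl//.
apply: DeriveDef; last by rewrite /derive; exact: cvg_lim h.
by apply/cvg_ex; exists 0.
Unshelve. all: by end_near. Qed.

Lemma is_derive_flat n x :
  is_derive x 1 (flat n) (flat n.+2 x - n%:R * flat n.+1 x).
Proof.
have [x0|x0|->] := ltrgtP x 0.
- rewrite !flat_le0 ?(ltW x0)// mulr0 subr0.
  apply: (@near_eq_is_derive _ _ _ (cst 0)).
  near=> y; rewrite flat_le0//; apply: ltW; near: y; exact: lt_nbhsl.
- have xn0 : x != 0 by rewrite gt_eqF.
  pose g : R -> R := (fun y => y^-1) ^+ n * (fun y => expR (- y^-1)).
  apply: (@near_eq_is_derive _ _ _ g).
    near=> y; have y0 : 0 < y by near: y; exact: lt_nbhsr.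
    by rewrite /flat y0 /g [LHS]/GRing.mul /= exprfctE.
  have dV : is_derive x 1 (fun y : R => y^-1) (- x ^- 2).
    by apply: is_derive_eq; [exact: is_deriveV|rewrite scaler1].
  rewrite /g; apply: is_derive_eq.
  rewrite /flat x0 exprfctE /GRing.scale /=.
  case: n {g} => [|n] /=; rewrite ?expr0 ?expr1 !exprS; field => //.
- rewrite !flat_le0// mulr0 subr0.
  apply: (@is_derive0_sqr _ ((n.+2)`!%:R)) => y.
  by rewrite ger0_norm ?flat_ge0// flat_le_sqr.
Unshelve. all: by end_near. Qed.

(** A syntactic class closed under differentiation: derivability of all orders follows by induction
    on the order, without Leibniz formulas for products and inverses. *)
Inductive smooth_alg : (R -> R) -> Prop :=
| sa_flat n : smooth_alg (flat n)
| sa_cst c : smooth_alg (cst c)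
| sa_id : smooth_alg id
| sa_add f g : smooth_alg f -> smooth_alg g -> smooth_alg (fun x => f x + g x)
| sa_mul f g : smooth_alg f -> smooth_alg g -> smooth_alg (fun x => f x * g x)
| sa_inv f : (forall x, f x != 0) -> smooth_alg f -> smooth_alg (fun x => (f x)^-1)
| sa_aff a b f : smooth_alg f -> smooth_alg (fun x => f (a * x + b)).

Lemma smooth_alg_derive f : smooth_alg f ->
  exists2 df, smooth_alg df & forall x, is_derive x 1 f (df x).
Proof.
elim => {f} [n|c| |f g _ [df sf hf] _ [dg sg hg]|f g af [df sf hf] ag [dg sg hg]
   |f f0 af [df sf hf]|a b f _ [df sf hf]].
- exists (fun x => flat n.+2 x + (cst (- n%:R) x) * flat n.+1 x).
    by do !constructor.
  by move=> x; rewrite /= mulNr; exact: is_derive_flat.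
- by exists (cst 0); [constructor|move=> x; exact: is_derive_cst].
- by exists (cst 1); [constructor|move=> x; exact: is_derive_id].
- exists (fun x => df x + dg x); first by constructor.
  by move=> x; apply: is_deriveD.
- exists (fun x => f x * dg x + g x * df x); first by do !constructor.
  by move=> x; apply: is_deriveM.
- exists (fun x => (cst (-1) x * ((f x)^-1 * (f x)^-1)) * df x).
    by do !constructor.
  move=> x; have h := @is_deriveV _ f x _ _ (f0 x) (hf x).
  apply: (is_derive_eq h); rewrite /GRing.scale /=.
  by have := f0 x => ?; field.
- exists (fun x => cst a x * df (a * x + b)).
    by do 2!constructor => //; apply: sa_aff.
  move=> x /=; pose h : R -> R := (fun y => a * y + b).
  have dh : is_derive x 1 h a.
    have h1 := is_deriveD (is_deriveZ a (is_derive_id x 1)) (is_derive_cst b x 1).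
    by apply: (is_derive_eq h1); rewrite addr0 [a *: 1]mulr1.
  have h2 := @is_derive1_comp _ f h x _ _ (hf (h x)) dh.
  by apply: (is_derive_eq h2); rewrite mulrC.
Qed.

Definition smooth f : Prop := forall n x, derivable (derive1n n f) x 1.

Lemma smooth_algW f : smooth_alg f -> smooth f.
Proof.
move=> af n x; suff: smooth_alg (derive1n n f).
  by move=> /smooth_alg_derive [df _ h]; have [] := h x.
elim: n => [//|n IH]; rewrite derive1nS.
have [df sf h] := smooth_alg_derive IH.
suff -> : derive1 (derive1n n f) = df by [].
by apply/funext => y; rewrite derive1E; have [] := h y.
Qed.

Lemma smooth_alg_deriv f : smooth_alg f -> smooth_alg (derive1 f).
Proof.
move=> /smooth_alg_derive [df sf h]; suff -> : derive1 f = df by [].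
by apply/funext => y; rewrite derive1E; have [] := h y.
Qed.

Lemma smooth_alg_derivable f x : smooth_alg f -> derivable f x 1.
Proof. by move=> /smooth_alg_derive[df _ h]; have [] := h x. Qed.

Lemma smooth_alg_continuous f : smooth_alg f -> continuous f.
Proof.
move=> sf x; apply: differentiable_continuous.
by apply/derivable1_diffP; exact: smooth_alg_derivable.
Qed.

Section Ramp.
Variables (a b : R).
Hypothesis ab : a < b.

Let den x := flat 0 (x - a) + flat 0 (b - x).

Let den_gt0 x : 0 < den x.
Proof.
rewrite /den; have [xa|xa] := ltrP a x.
  by rewrite ltr_wpDr ?flat_ge0// flat_gt0// subr_gt0.
by rewrite ltr_wpDl ?flat_ge0// flat_gt0// subr_gt0 (le_lt_trans xa).
Qed.

(** The standard smooth transition from 0 to 1; since [a < b], one of the two terms of the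
    denominator is always positive. Its derivative later acts as a mollifier of unit mass. *)
Definition ramp x := flat 0 (x - a) / (flat 0 (x - a) + flat 0 (b - x)).

Lemma ramp_alg : smooth_alg ramp.
Proof.
have aff c d : smooth_alg (fun x => flat 0 (c * x + d)) by apply: sa_aff; constructor.
have e1 : smooth_alg (fun x => flat 0 (x - a)).
  by rewrite (_ : (fun _ => _) = (fun x => flat 0 (1 * x - a)))//; apply/funext => x; rewrite mul1r.
have e2 : smooth_alg (fun x => flat 0 (b - x)).
  rewrite (_ : (fun _ => _) = (fun x => flat 0 (-1 * x + b)))//.
  by apply/funext => x; rewrite mulN1r addrC.
apply: sa_mul => //; apply: (@sa_inv den) => [x|]; first by rewrite gt_eqF.
exact: sa_add.
Qed.

Lemma ramp0 x : x <= a -> ramp x = 0.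
Proof. by move=> xa; rewrite /ramp flat_le0 ?mul0r// subr_le0. Qed.

Lemma ramp1 x : b <= x -> ramp x = 1.
Proof.
move=> bx; rewrite /ramp (@flat_le0 0 (b - x)) ?subr_le0// addr0 divff//.
by rewrite gt_eqF// flat_gt0// subr_gt0 (lt_le_trans ab).
Qed.

Lemma ramp_ge0 x : 0 <= ramp x.
Proof. by rewrite /ramp divr_ge0 ?addr_ge0 ?flat_ge0. Qed.

Lemma ramp_le1 x : ramp x <= 1.
Proof. by rewrite /ramp ler_pdivrMr ?(den_gt0 x)// mul1r lerDl flat_ge0. Qed.

Lemma flat0_nd : {homo flat 0 : x y / x <= y}.
Proof.
move=> x y xy; rewrite {1}/flat; case: ifPn => x0; last exact: flat_ge0.
rewrite /flat (lt_le_trans x0 xy) !expr0 !mul1r ler_expR lerN2 lef_pV2//.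
by rewrite posrE (lt_le_trans x0).
Qed.

Lemma ramp_nd : {homo ramp : x y / x <= y}.
Proof.
move=> x y xy; rewrite /ramp ler_pdivrMr ?(den_gt0 x)// mulrAC ler_pdivlMr ?(den_gt0 y)//.
have h1 : flat 0 (x - a) <= flat 0 (y - a) by apply: flat0_nd; rewrite lerB.
have h2 : flat 0 (b - y) <= flat 0 (b - x) by apply: flat0_nd; rewrite lerB.
have := flat_ge0 0 (x - a); have := flat_ge0 0 (b - y) => p1 p2.
nra.
Qed.

End Ramp.

Lemma nondecreasing_derive_ge0 f x : {homo f : x y / x <= y} ->
  derivable f x 1 -> 0 <= derive1 f x.
Proof.
move=> ndf df; rewrite derive1E; apply: limr_ge => //.
near=> h; rewrite /= [h *: 1]mulr1 /GRing.scale /=.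
have hn0 : h != 0 by near: h; exact: nbhs_dnbhs_neq.
have [h0|h0] := ltrP 0 h.
  apply: mulr_ge0; first by rewrite invr_ge0 ltW.
  by rewrite subr_ge0 ndf// lerDr ltW.
apply: mulr_le0; first by rewrite invr_le0.
by rewrite subr_le0 ndf// gerDr.
Unshelve. all: by end_near. Qed.

(** A smooth approximation from below of the indicator of []a, c[]. With [k.+2] each transition
    layer takes at most half of the interval, so the two layers do not overlap even for [k = 0], and
    they shrink as [k] grows. *)
Definition plateau (a c : R) (k : nat) x : R :=
  ramp a (a + (c - a) / k.+2%:R) x - ramp (c - (c - a) / k.+2%:R) c x.

Section Plateau.
Variables (a c : R) (k : nat).
Hypothesis ac : a < c.

Lemma plateau_eps : 0 < (c - a) / k.+2%:R.
Proof. by rewrite divr_gt0 ?subr_gt0. Qed.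

Lemma plateau_mid : a + (c - a) / k.+2%:R <= c - (c - a) / k.+2%:R.
Proof.
have : (c - a) / k.+2%:R <= (c - a) / 2.
  by rewrite ler_pM2l ?subr_gt0// lef_pV2 ?posrE// ler_nat.
by set e := _ / k.+2%:R; lra.
Qed.

Lemma plateau_alg : smooth_alg (plateau a c k).
Proof.
have e := plateau_eps.
rewrite (_ : plateau a c k = fun x => ramp a (a + (c - a) / k.+2%:R) x +
  cst (-1) x * ramp (c - (c - a) / k.+2%:R) c x); last first.
  by apply/funext => x; rewrite mulN1r.
apply: sa_add; first by apply: ramp_alg; rewrite ltrDl.
by apply: sa_mul; [constructor|apply: ramp_alg; rewrite ltrBlDr ltrDl].
Qed.

Lemma plateau_itv x : 0 <= plateau a c k x <= 1.
Proof.
have e := plateau_eps; have m := plateau_mid.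
have e2 : c - (c - a) / k.+2%:R < c by rewrite ltrBlDr ltrDl.
have e1 : a < a + (c - a) / k.+2%:R by rewrite ltrDl.
rewrite /plateau; have [xm|xm] := lerP x (c - (c - a) / k.+2%:R).
  by rewrite (@ramp0 (c - _))// subr0 ramp_ge0// ramp_le1.
rewrite ramp1//; last by rewrite (le_trans m)// ltW.
by rewrite subr_ge0 ramp_le1//= lerBlDr lerDl ramp_ge0.
Qed.

Lemma plateau_out x : x <= a \/ c <= x -> plateau a c k x = 0.
Proof.
have e := plateau_eps; have m := plateau_mid.
have e2 : c - (c - a) / k.+2%:R < c by rewrite ltrBlDr ltrDl.
have e1 : a < a + (c - a) / k.+2%:R by rewrite ltrDl.
rewrite /plateau => -[xa|cx].
  rewrite !ramp0 ?subrr//; apply: (le_trans xa); apply: (le_trans _ m); exact: ltW.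
rewrite !ramp1 ?subrr//; apply: (le_trans _ cx).
exact: (le_trans m (ltW e2)).
Qed.

Lemma plateau_in x : a + (c - a) / k.+2%:R <= x <= c - (c - a) / k.+2%:R ->
  plateau a c k x = 1.
Proof.
move=> /andP[ax xc]; have e := plateau_eps.
have e1 : a < a + (c - a) / k.+2%:R by rewrite ltrDl.
by rewrite /plateau ramp1// ramp0// subr0.
Qed.

End Plateau.

Lemma plateau_cvg (a c : R) x : a < x < c ->
  \forall k \near \oo, plateau a c k x = 1.
Proof.
move=> /andP[ax xc]; have ac := lt_trans ax xc.
have h : (fun k : nat => (c - a) / k.+2%:R) @ \oo --> (0 : R).
  rewrite -[X in _ --> X](mulr0 (c - a)); apply: cvgMr.
  by have := @cvg_harmonic R; rewrite -cvg_shiftS; apply.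
near=> k; apply: plateau_in => //.
have : `|(c - a) / k.+2%:R| < Num.min (x - a) (c - x).
  near: k; move/cvgr0Pnorm_lt : h; apply; by rewrite lt_min !subr_gt0 ax xc.
rewrite ger0_norm ?divr_ge0 ?subr_ge0 ?(ltW ac)// lt_min => /andP[h1 h2].
by apply/andP; split; move: h1 h2; set e := _ / _; lra.
Unshelve. all: by end_near. Qed.

End SmoothFunctions.

(** * Test functions on the plane *)
Section Plane.
Context {R : realType}.
Implicit Types (phi psi : R * R -> R) (U : set (R * R)).

Definition open_box (a b c d : R) : set (R * R) := `]a, b[ `*` `]c, d[.
Definition closed_box (a b c d : R) : set (R * R) := `[a, b] `*` `[c, d].

(** Rational corners make the family countable. This gives the measurability of open sets for the
    product structure, and later a countable union of exceptional null sets. *)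
Definition rbox (q : (rat * rat) * (rat * rat)) : set (R * R) :=
  open_box (ratr q.1.1) (ratr q.1.2) (ratr q.2.1) (ratr q.2.2).
Definition rcbox (q : (rat * rat) * (rat * rat)) : set (R * R) :=
  closed_box (ratr q.1.1) (ratr q.1.2) (ratr q.2.1) (ratr q.2.2).

Lemma rat_sandwich (x e : R) : 0 < e ->
  exists ab : rat * rat, [/\ ratr ab.1 < x, x < ratr ab.2,
    x - e < ratr ab.1 & ratr ab.2 < x + e].
Proof.
move=> e0; have /rat_in_itvoo[p] : x - e < x by rewrite ltrBlDr ltrDl.
have /rat_in_itvoo[q] : x < x + e by rewrite ltrDl.
by rewrite !in_itv /= => /andP[q1 q2] /andP[p1 p2]; exists (p, q).
Qed.

Lemma open_rbox U x : open U -> U x ->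
  exists q, rbox q x /\ rcbox q `<=` U.
Proof.
move=> oU Ux; have /nbhs_ballP[e /= e0 eU] := open_nbhs_nbhs (conj oU Ux).
have [ab [a1 a2 a3 a4]] := rat_sandwich x.1 e0.
have [cd [c1 c2 c3 c4]] := rat_sandwich x.2 e0.
exists (ab, cd); split.
  by split; rewrite /= in_itv /= ?a1 ?a2 ?c1 ?c2.
move=> y [/=]; rewrite !in_itv /= => /andP[y1 y2] /andP[y3 y4]; apply: eU.
by split; rewrite /= /ball /= ltr_norml; apply/andP; split; lra.
Qed.

Lemma rbox_sub q : rbox q `<=` rcbox q.
Proof.
move=> y [/=]; rewrite !in_itv /= => /andP[y1 y2] /andP[y3 y4].
by split; rewrite /= in_itv /= !ltW.
Qed.

Lemma open_boxE U : open U ->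
  U = \bigcup_(q in [set q | rcbox q `<=` U]) rbox q.
Proof.
move=> oU; apply/seteqP; split=> [x Ux|x [q /= qU qx]].
  by have [q [qx qU]] := open_rbox oU Ux; exists q.
exact/qU/rbox_sub.
Qed.

Lemma measurable_open_box a b c d : measurable (open_box a b c d).
Proof. by apply: measurableX; exact: measurable_itv. Qed.

Lemma open_measurable2 U : open U -> measurable (U : set (R * R)).
Proof.
move=> oU; rewrite (open_boxE oU) bigcup_mkcond.
apply: countable_bigcupT_measurable => // q; case: ifPn => // _.
exact: measurable_open_box.
Qed.

Lemma continuous_measurable2 phi : continuous phi -> measurable_fun setT phi.
Proof.
move=> cphi; apply: (measurability _ (RGenOInfty.measurableE R)) => //.
move=> _ [_ [x ->] <-]; rewrite setTI; apply: open_measurable2.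
by apply: open_comp => //; move=> y _; exact: cphi.
Qed.

(** A directional derivative is the derivative at 0 of the restriction to a line, with the same
    difference quotients; the one-variable rules thus apply in the plane. *)
Lemma is_derive_line phi x v df :
  is_derive (0 : R) (1 : R) (fun h : R => phi (h *: v + x)) df -> is_derive x v phi df.
Proof.
have e : (fun h : R => h^-1 *: ((phi \o shift x) (h *: v) - phi x)) =
  (fun h : R => h^-1 *: (((fun h : R => phi (h *: v + x)) \o shift 0) (h *: 1) -
     (fun h : R => phi (h *: v + x)) 0)).
  by apply/funext => h /=; rewrite addr0 scale0r add0r [h *: 1]mulr1.
by move=> [h1 h2]; constructor; [rewrite /derivable e|rewrite /derive e].
Qed.

Lemma is_derive_line_inv phi x v df : is_derive x v phi df ->
  is_derive (0 : R) (1 : R) (fun h : R => phi (h *: v + x)) df.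
Proof.
have e : (fun h : R => h^-1 *: ((phi \o shift x) (h *: v) - phi x)) =
  (fun h : R => h^-1 *: (((fun h : R => phi (h *: v + x)) \o shift 0) (h *: 1) -
     (fun h : R => phi (h *: v + x)) 0)).
  by apply/funext => h /=; rewrite addr0 scale0r add0r [h *: 1]mulr1.
by move=> [h1 h2]; constructor; [rewrite /derivable -e|rewrite /derive -e].
Qed.

Lemma is_derive_shift0 (f : R -> R) x df :
  is_derive (0 : R) (1 : R) (fun h : R => f (h + x)) df <-> is_derive x (1 : R) f df.
Proof.
have e : (fun h : R => h^-1 *: ((f \o shift x) (h *: 1) - f x)) =
  (fun h : R => h^-1 *: (((fun h : R => f (h + x)) \o shift 0) (h *: 1) -
     (fun h : R => f (h + x)) 0)).
  by apply/funext => h /=; rewrite addr0 add0r.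
split=> -[h1 h2].
  by constructor; [rewrite /derivable e|rewrite /derive e].
by constructor; [rewrite /derivable -e|rewrite /derive -e].
Qed.

Lemma axisE2 : axis 2 = 0 :> R * R. Proof. by []. Qed.

Lemma axis_line (j : 'I_3) (h x y : R) :
  h *: axis j + (x, y) = (h * (j == 0)%:R + x, h * (j == 1)%:R + y).
Proof. by []. Qed.

Lemma is_derive_slice1 phi (x y : R) : derivable phi (x, y) (axis 0) ->
  is_derive x 1 (fun r => phi (r, y)) ('D_(axis 0) phi (x, y)).
Proof.
move=> d; apply/is_derive_shift0.
have := is_derive_line_inv (derivableP d).
by apply: near_eq_is_derive; near=> h; rewrite axis_line mulr1 mulr0 add0r.
Unshelve. all: by end_near. Qed.

Lemma is_derive_slice2 phi (x y : R) : derivable phi (x, y) (axis 1) ->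
  is_derive y 1 (fun r => phi (x, r)) ('D_(axis 1) phi (x, y)).
Proof.
move=> d; apply/is_derive_shift0.
have := is_derive_line_inv (derivableP d).
by apply: near_eq_is_derive; near=> h; rewrite axis_line mulr1 mulr0 add0r.
Unshelve. all: by end_near. Qed.

Lemma ord3E (j : 'I_3) : [\/ j = 0, j = 1 | j = 2].
Proof.
case: j => -[|[|[|//]]] i; [constructor 1|constructor 2|constructor 3]; exact: val_inj.
Qed.

Definition smooth2 phi : Prop :=
  (forall s, continuous (iter_partial s phi)) /\
  (forall s j x, derivable (iter_partial s phi) x (axis j)).

(** A coinduction principle: a class of continuous functions with partial derivatives inside the
    class contains only smooth functions. It is applied to an algebra of smooth functions and to
    tensor products. *)
Lemma smooth2_ind (S : (R * R -> R) -> Prop) :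
  (forall phi, S phi -> [/\ continuous phi,
     forall j x, derivable phi x (axis j) & forall j, S ('D_(axis j) phi)]) ->
  forall phi, S phi -> smooth2 phi.
Proof.
move=> SP phi Sphi; have h s : S (iter_partial s phi).
  by elim: s => [//|j s /SP[_ _]]; exact.
by split=> s; have [c d _] := SP _ (h s).
Qed.

Lemma smooth2_D phi j : smooth2 phi -> smooth2 ('D_(axis j) phi).
Proof.
move=> [c d]; have e s : iter_partial s ('D_(axis j) phi) = iter_partial (rcons s j) phi.
  by rewrite /iter_partial foldr_rcons.
by split=> s; rewrite e.
Qed.

Lemma smooth2_continuous phi : smooth2 phi -> continuous phi.
Proof. by move=> [/(_ [::])]. Qed.

Lemma smooth2_derivable phi j x : smooth2 phi -> derivable phi x (axis j).
Proof. by move=> [_ /(_ [::])]. Qed.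

Inductive smooth2_alg : (R * R -> R) -> Prop :=
| s2_base phi : smooth2 phi -> smooth2_alg phi
| s2_add phi psi : smooth2_alg phi -> smooth2_alg psi -> smooth2_alg (phi + psi)
| s2_scale a phi : smooth2_alg phi -> smooth2_alg (a *: phi)
| s2_mul phi psi : smooth2_alg phi -> smooth2_alg psi -> smooth2_alg (phi * psi).

Lemma smooth2_algW phi : smooth2_alg phi -> smooth2 phi.
Proof.
apply: smooth2_ind => {}phi; elim=> {phi}
  [phi s|phi psi a1 [c1 d1 D1] a2 [c2 d2 D2]|a phi a1 [c1 d1 D1]
   |phi psi a1 [c1 d1 D1] a2 [c2 d2 D2]].
- split=> [|j x|j]; [exact: smooth2_continuous|exact: smooth2_derivable|].
  by constructor; exact: smooth2_D.
- split=> [x|j x|j]; [apply: cvgD; [exact: c1|exact: c2]|exact: derivableD|].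
  rewrite (_ : 'D_(axis j) (phi + psi) = 'D_(axis j) phi + 'D_(axis j) psi).
    exact: s2_add.
  by apply/funext => x; rewrite deriveD.
- split=> [x|j x|j]; [apply: cvgZr; exact: c1|exact: derivableZ|].
  rewrite (_ : 'D_(axis j) (a *: phi) = a *: 'D_(axis j) phi); first exact: s2_scale.
  by apply/funext => x; rewrite deriveZ.
- split=> [x|j x|j]; [apply: cvgM; [exact: c1|exact: c2]|exact: derivableM|].
  rewrite (_ : 'D_(axis j) (phi * psi) =
     phi * 'D_(axis j) psi + psi * 'D_(axis j) phi).
    by apply: s2_add; apply: s2_mul.
  by apply/funext => x; rewrite deriveM.
Qed.

Lemma tensor_derive (f g : R -> R) (j : 'I_3) (x : R * R) : smooth_alg f -> smooth_alg g ->
  is_derive x (axis j) (fun z => f z.1 * g z.2)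
   ((j == 0)%:R * derive1 f x.1 * g x.2 + (j == 1)%:R * f x.1 * derive1 g x.2).
Proof.
move=> sf sg; case: x => x y; apply: is_derive_line => /=.
have df := derivableP (@smooth_alg_derivable _ f x sf).
have dg := derivableP (@smooth_alg_derivable _ g y sg).
case: (ord3E j) => -> /=.
- have H := is_deriveM (is_derive_cst (g y) (0 : R) (1 : R)) (proj2 (is_derive_shift0 _ _ _) df).
  rewrite (_ : (fun h : R => _) = cst (g y) * (fun h => f (h + x))).
    apply: (is_derive_eq H); rewrite !derive1E /= !mul0r mul1r scaler0 !addr0.
    by rewrite mulrC.
  by apply/funext => h; rewrite [h *: 1]mulr1 [h *: 0]mulr0 add0r mulrC.
- have H := is_deriveM (is_derive_cst (f x) (0 : R) (1 : R)) (proj2 (is_derive_shift0 _ _ _) dg).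
  rewrite (_ : (fun h : R => _) = cst (f x) * (fun h => g (h + y))).
    by apply: (is_derive_eq H); rewrite !derive1E /= !mul0r mul1r scaler0 addr0 add0r.
  by apply/funext => h; rewrite [h *: 1]mulr1 [h *: 0]mulr0 add0r.
- rewrite !mul0r addr0 (_ : (fun h : R => _) = cst (f x * g y)); first exact: is_derive_cst.
  by apply/funext => h; rewrite [h *: 0]mulr0 !add0r.
Qed.

Lemma tensor_smooth2 (f g : R -> R) : smooth_alg f -> smooth_alg g ->
  smooth2 (fun z => f z.1 * g z.2).
Proof.
move=> sf0 sg0; pose S (phi : R * R -> R) := exists f g, [/\ smooth_alg f, smooth_alg g &
  phi = fun z => f z.1 * g z.2].
apply: (@smooth2_ind S); last by exists f, g.
move=> {f g sf0 sg0} phi [f [g [sf sg ->]]]; split.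
- move=> z; apply: cvgM; apply: continuous_comp; try exact: smooth_alg_continuous;
    [exact: cvg_fst|exact: cvg_snd].
- by move=> j x; have [] := tensor_derive j x sf sg.
- move=> j; have D z : 'D_(axis j) (fun z : R * R => f z.1 * g z.2) z =
      (j == 0)%:R * derive1 f z.1 * g z.2 + (j == 1)%:R * f z.1 * derive1 g z.2.
    by have [_ ->] := tensor_derive j z sf sg.
  case: (ord3E j) => ej.
  + exists (derive1 f), g; split=> //; first exact: smooth_alg_deriv.
    by apply/funext => z; rewrite D ej /= mul1r !mul0r addr0.
  + exists f, (derive1 g); split=> //; first exact: smooth_alg_deriv.
    by apply/funext => z; rewrite D ej /= mul1r !mul0r add0r.
  + exists (cst 0), (cst 0); split; try exact: sa_cst.
    by apply/funext => z; rewrite D ej /= !mul0r addr0.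
Qed.

Lemma test_smooth2 U phi : test_function U phi <->
  [/\ smooth2 phi, compact (supp phi) & supp phi `<=` U].
Proof.
split; first by move=> [c d k s].
by move=> [[c d] k s].
Qed.

Lemma supp_sub phi psi : (forall x, psi x = 0 -> phi x = 0) -> supp phi `<=` supp psi.
Proof. by move=> h; apply: closure_subset => x /=; apply: contra_neq; exact: h. Qed.

Lemma test_sub U phi psi : test_function U psi -> smooth2 phi ->
  supp phi `<=` supp psi -> test_function U phi.
Proof.
move=> /test_smooth2[_ k sU] s2 ss; apply/test_smooth2; split => //.
  by apply: subclosed_compact ss => //; exact: closed_closure.
exact: subset_trans sU.
Qed.

Lemma test_mul U phi psi : test_function U phi -> test_function U psi ->
  test_function U (phi * psi).
Proof.
move=> t1 t2; apply: (test_sub t1).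
  by apply: smooth2_algW; apply: s2_mul; constructor; move/test_smooth2 : t1 t2 => [? _ _] /test_smooth2[].
by apply: supp_sub => x h; rewrite /GRing.mul /= h mul0r.
Qed.

Lemma test_lin U a phi psi : test_function U phi -> test_function U psi ->
  test_function U (a *: phi + psi).
Proof.
move=> /test_smooth2[s1 k1 u1] /test_smooth2[s2 k2 u2].
have ss : supp (a *: phi + psi) `<=` supp phi `|` supp psi.
  rewrite /supp -closureU; apply: closure_subset => x /= h.
  apply/orP; apply: contraNT h; rewrite negb_or !negbK => /andP[/eqP h1 /eqP h2].
  by rewrite [_ x](_ : _ = a * phi x + psi x)// h1 h2 mulr0 addr0.
apply/test_smooth2; split.
- by apply: smooth2_algW; apply: s2_add; [apply: s2_scale|]; constructor.
- apply: (subclosed_compact _ _ ss); first exact: closed_closure.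
  exact: compactU.
- by apply: (subset_trans ss); rewrite subUset.
Qed.

(** Off the closed support [phi] vanishes in a neighbourhood, hence so does its derivative:
    differentiation does not enlarge the support. *)
Lemma test_D U phi j : test_function U phi -> test_function U ('D_(axis j) phi).
Proof.
move=> t; apply: (test_sub t); first by move/test_smooth2 : t => [s _ _]; exact: smooth2_D.
rewrite {1}/supp closureE => x; apply; split; first exact: closed_closure.
move=> {}x /=; apply: contraNP => nx.
have : \near x, phi x = cst 0 x.
  have := open_nbhs_nbhs (conj (closed_openC (@closed_closure _ [set x | phi x != 0])) nx).
  apply: filterS => y; apply: contra_notP => h.
  by apply: subset_closure; apply/eqP.
by move=> /near_eq_derive ->; rewrite derive_cst.
Qed.

Lemma closed_box_compact a b c d : compact (closed_box a b c d).
Proof. by apply: compact_setX; exact: segment_compact. Qed.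

Lemma closed_box_closed a b c d : closed (closed_box a b c d).
Proof. by apply: compact_closed; [exact: norm_hausdorff|exact: closed_box_compact]. Qed.

Lemma box_test U a b c d k : a < b -> c < d -> closed_box a b c d `<=` U ->
  test_function U (fun z => plateau a b k z.1 * plateau c d k z.2).
Proof.
move=> ab cd bU; set phi := (X in test_function _ X).
have ss : supp phi `<=` closed_box a b c d.
  rewrite /supp closureE => x; apply; split; first exact: closed_box_closed.
  move=> {}x /=; rewrite mulf_eq0 negb_or => /andP[h1 h2].
  split; rewrite /= in_itv /=; apply/andP; split; rewrite leNgt;
    [apply: contra h1|apply: contra h1|apply: contra h2|apply: contra h2] => h;
    rewrite plateau_out//; first [by left; exact: ltW|by right; exact: ltW].
apply/test_smooth2; split.
- by apply: tensor_smooth2; exact: plateau_alg.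
- by apply: (subclosed_compact _ _ ss); [exact: closed_closure|exact: closed_box_compact].
- exact: subset_trans bU.
Qed.

End Plane.

Section RealDominatedConvergence.
Context d (T : measurableType d) (R : realType).
Variables (mu : {measure set T -> \bar R}) (D : set T).
Hypothesis mD : measurable D.

Lemma Rintegral_dominated_cvg (f_ : nat -> T -> R) (f g : T -> R) :
  (forall n, measurable_fun D (f_ n)) -> measurable_fun D f ->
  (forall x, D x -> f_ n x @[n --> \oo] --> f x) ->
  mu.-integrable D (EFin \o g) ->
  (forall n x, D x -> `|f_ n x| <= g x) ->
  mu.-integrable D (EFin \o f) /\
  \int[mu]_(x in D) f_ n x @[n --> \oo] --> \int[mu]_(x in D) f x.
Proof.
move=> mf_ mf cf ig fg.
have h1 : {ae mu, forall x, D x -> (f_ n x)%:E @[n --> \oo] --> (f x)%:E}.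
  by apply: aeW => x Dx; apply: cvg_EFin; [exact: nearW|exact: cf].
have h2 : {ae mu, forall x n, D x -> (`|(f_ n x)%:E| <= (g x)%:E)%E}.
  by apply: aeW => x n Dx; rewrite /= lee_fin; exact: fg.
have [If _ h] := @dominated_convergence _ _ _ mu D mD (fun n x => (f_ n x)%:E)
  (EFin \o f) (EFin \o g) (fun n => proj2 (measurable_EFinP _ _) (mf_ n))
  (proj2 (measurable_EFinP _ _) mf) h1 ig h2.
split=> //; apply: fine_cvg; rewrite fineK ?integrable_fin_num//.
Qed.

End RealDominatedConvergence.

(** * The fundamental lemma of the calculus of variations *)

Section Uniqueness.
Context {R : realType}.
Local Notation mu2 := (@lebesgue_measure R \x @lebesgue_measure R)%E.
Variables (Om : set (R * R)) (g : R * R -> R).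
Hypothesis oOm : open Om.
Let mOm : measurable Om := open_measurable2 oOm.
Hypothesis ig : mu2.-integrable Om (EFin \o g).
Hypothesis g0 : forall phi, test_function Om phi -> \int[mu2]_(x in Om) (g x * phi x) = 0.

(** Products of plateaux are test functions, as the closed box lies in [Om], and they tend pointwise
    to the indicator of the open box; dominated convergence passes to the limit. *)
Lemma box_integral0 a b c d : closed_box a b c d `<=` Om ->
  \int[mu2]_(x in open_box a b c d) g x = 0.
Proof.
move=> bU.
have [ab|ba] := ltrP a b; last first.
  rewrite (_ : open_box a b c d = set0) ?Rintegral_set0// -subset0 => x [/=].
  by rewrite !in_itv /= => /andP[h1 h2]; have := lt_trans h1 h2; rewrite ltNge ba.
have [cd|dc] := ltrP c d; last first.
  rewrite (_ : open_box a b c d = set0) ?Rintegral_set0// -subset0 => x [/= _].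
  by rewrite !in_itv /= => /andP[h1 h2]; have := lt_trans h1 h2; rewrite ltNge dc.
have sub : open_box a b c d `<=` Om.
  move=> y [/=]; rewrite !in_itv /= => /andP[y1 y2] /andP[y3 y4]; apply: bU.
  by split; rewrite /= in_itv /= !ltW.
have mg : measurable_fun Om g by apply/measurable_EFinP; exact: measurable_int ig.
pose phi k (z : R * R) := plateau a b k z.1 * plateau c d k z.2.
have mphi k : measurable_fun Om (phi k).
  apply: measurable_funTS; apply: continuous_measurable2; apply: smooth2_continuous.
  by apply: tensor_smooth2; exact: plateau_alg.
have mb := measurable_open_box a b c d.
have mi : measurable_fun Om (\1_(open_box a b c d) : R * R -> R).
  exact: measurable_indic.
have phi1 k x : `|phi k x| <= 1.
  have /andP[p1 p2] := plateau_itv k ab x.1; have /andP[p3 p4] := plateau_itv k cd x.2.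
  by rewrite ger0_norm ?mulr_ge0// mulr_ile1.
have cphi x : phi k x @[k --> \oo] --> (\1_(open_box a b c d) x : R).
  have [xb|xb] := pselect (open_box a b c d x).
    rewrite indicE mem_set//; apply: cvg_near_cst; move: xb => [/=].
    rewrite !in_itv /= => x1 x2; near=> k; rewrite /phi.
    have -> : plateau a b k x.1 = 1 by near: k; exact: plateau_cvg.
    have -> : plateau c d k x.2 = 1 by near: k; exact: plateau_cvg.
    by rewrite mulr1.
  rewrite indicE memNset//; apply: cvg_near_cst; apply: nearW => k.
  apply/eqP; apply: contra_notT xb; rewrite mulf_eq0 negb_or => /andP[h1 h2].
  split; rewrite /= in_itv /=; apply/andP; split; rewrite ltNge;
    [apply: contra h1|apply: contra h1|apply: contra h2|apply: contra h2] => h;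
    rewrite plateau_out//; first [by left|by right].
have [_ h] := @Rintegral_dominated_cvg _ _ R mu2 Om mOm (fun k x => g x * phi k x)
  (fun x => g x * \1_(open_box a b c d) x) (fun x => `|g x|)
  (fun k => measurable_funM mg (mphi k)) (measurable_funM mg mi)
  (fun x _ => cvgM (cvg_cst (g x)) (cphi x)) (integrable_norm ig)
  (fun k x _ => ltac:(by rewrite normrM ler_piMr)).
have : (fun k => \int[mu2]_(x in Om) (g x * phi k x)) @ \oo --> (0 : R).
  apply: cvg_near_cst; apply: nearW => k; apply: g0; exact: box_test.
move=> /(cvg_unique (@norm_hausdorff _ _) h) <-.
rewrite -[in LHS](setIidr sub) Rintegral_mkcondr; apply: eq_Rintegral => x _.
by rewrite patchE indicE; case: ifPn; rewrite ?mulr1 ?mulr0.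
Unshelve. all: by end_near. Qed.

(** Quadrants form a pi-system generating the product sigma-algebra, and a quadrant cuts a box in a
    smaller box, to which [box_integral0] applies again. *)
Let rays : set (set (R * R)) :=
  [set A | exists x y : R, A = `]-oo, x[ `*` `]-oo, y[].

Let rays_setI : setI_closed rays.
Proof.
move=> _ _ [x1 [y1 ->]] [x2 [y2 ->]]; exists (Num.min x1 x2), (Num.min y1 y2).
rewrite -setXI; congr (_ `*` _); apply/seteqP; split=> z /=;
  rewrite !in_itv /= lt_min; first [by move=> [-> ->]|by move=> /andP[]].
Qed.

Let rays_gen : @measurable _ (R * R)%type `<=` <<s rays >>.
Proof.
have E1 x : <<s rays >> (`]-oo, x[ `*` setT).
  rewrite (_ : _ `*` _ = \bigcup_n (`]-oo, x[ `*` `]-oo, n%:R[)); last first.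
    apply/seteqP; split=> z /=; last by move=> [n _ []].
    move=> [z1 _]; exists (Num.bound `|z.2|) => //; split=> //.
    by rewrite /= in_itv /= (le_lt_trans (ler_norm _))// archi_boundP.
  have [_ _ U] := smallest_sigma_algebra setT rays; apply: U => n.
  by apply: sub_sigma_algebra; exists x, n%:R.
have E2 y : <<s rays >> (setT `*` `]-oo, y[).
  rewrite (_ : _ `*` _ = \bigcup_n (`]-oo, n%:R[ `*` `]-oo, y[)); last first.
    apply/seteqP; split=> z /=; last by move=> [n _ []].
    move=> [_ z1]; exists (Num.bound `|z.1|) => //; split=> //.
    by rewrite /= in_itv /= (le_lt_trans (ler_norm _))// archi_boundP.
  have [_ _ U] := smallest_sigma_algebra setT rays; apply: U => n.
  by apply: sub_sigma_algebra; exists n%:R, y.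
have m1 : measurable_fun [set: g_sigma_algebraType rays] (fst : R * R -> R).
  apply: (measurability _ (RGenInftyO.measurableE R)) => //.
  move=> _ [_ [x ->] <-]; rewrite setTI.
  have -> : fst @^-1` `]-oo, x[ = `]-oo, x[ `*` setT :> set (R * R).
    by apply/seteqP; split=> z //= [].
  exact: E1.
have m2 : measurable_fun [set: g_sigma_algebraType rays] (snd : R * R -> R).
  apply: (measurability _ (RGenInftyO.measurableE R)) => //.
  move=> _ [_ [x ->] <-]; rewrite setTI.
  have -> : snd @^-1` `]-oo, x[ = setT `*` `]-oo, x[ :> set (R * R).
    by apply/seteqP; split=> z //= [].
  exact: E2.
rewrite measurable_prod_measurableType; apply: smallest_sub.
  exact: smallest_sigma_algebra.
move=> _ [A mA [B mB <-]].
have := @measurableI _ (g_sigma_algebraType rays) _ _ (m1 measurableT _ mA) (m2 measurableT _ mB).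
by rewrite !setTI; congr (_ _); apply/seteqP; split=> z.
Qed.

Lemma box_ae0 a b c d : closed_box a b c d `<=` Om ->
  {ae mu2, forall x, open_box a b c d x -> g x = 0}.
Proof.
move=> bU; have sub : open_box a b c d `<=` Om.
  move=> y [/=]; rewrite !in_itv /= => /andP[y1 y2] /andP[y3 y4]; apply: bU.
  by split; rewrite /= in_itv /= !ltW.
have mb := measurable_open_box a b c d; set K := open_box a b c d in sub mb *.
have iK A : measurable A -> A `<=` K -> mu2.-integrable A (EFin \o g).
  by move=> mA AK; apply: integrableS ig => //; exact: subset_trans sub.
(* The Dynkin class of the sets over which [g], restricted to the box, integrates to 0. It contains
   the quadrants, hence every measurable set, which forces [g] to vanish almost everywhere in the
   box. *)
pose L := [set A : set (R * R) | measurable A /\ (\int[mu2]_(x in A `&` K) (g x)%:E = 0)%E].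
have fin A : measurable A -> A `<=` K -> \int[mu2]_(x in A) g x = 0 ->
    (\int[mu2]_(x in A) (g x)%:E = 0)%E.
  move=> mA AK h; rewrite -[LHS]fineK; last first.
    by apply: integrable_fin_num => //; exact: iK.
  by rewrite -/(Rintegral _ _ _) h.
have LG : rays `<=` L.
  move=> _ [x [y ->]]; have mr : measurable (`]-oo, x[ `*` `]-oo, y[ : set (R * R)).
    by apply: measurableX; exact: measurable_itv.
  split=> //.
  have -> : (`]-oo, x[ `*` `]-oo, y[) `&` K = open_box a (Num.min x b) c (Num.min y d).
    apply/seteqP; split=> z.
      move=> [[/= + +] [/= + +]]; rewrite !in_itv /= => h1 h2 /andP[h3 h4] /andP[h5 h6].
      by split; rewrite /= in_itv /= ?h3 ?h5 lt_min ?h1 ?h2.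
    move=> [/=]; rewrite !in_itv /= !lt_min => /andP[h1 /andP[h2 h3]] /andP[h4 /andP[h5 h6]].
    by split=> //; split; rewrite /= in_itv /= ?h1 ?h4.
  apply: fin; first exact: measurable_open_box.
    move=> z [/=]; rewrite !in_itv /= !lt_min => /andP[h1 /andP[h2 h3]] /andP[h4 /andP[h5 h6]].
    by split; rewrite /= in_itv /= ?h1 ?h4.
  apply: box_integral0 => z [/=]; rewrite !in_itv /= !le_min.
  move=> /andP[h1 /andP[h2 h3]] /andP[h4 /andP[h5 h6]].
  by apply: bU; split; rewrite /= in_itv /= ?h1 ?h4.
have K0 : (\int[mu2]_(x in K) (g x)%:E = 0)%E by apply: fin => //; exact: box_integral0.
have LD : dynkin L.
  split.
  - by split; [exact: measurableT|rewrite setTI].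
  - move=> A [mA A0]; split; first exact: measurableC.
    have := @Rintegral_setU _ _ R mu2 (A `&` K) (~` A `&` K) g.
    rewrite -setIUl setUCr setTI => /(_ (measurableI _ _ mA mb)).
    move=> /(_ (measurableI _ _ (measurableC mA) mb) (iK _ mb (@subset_refl _ _))).
    rewrite {1 2}/Rintegral A0 K0 /= add0r.
    move=> h; apply: fin; [by apply: measurableI => //; exact: measurableC|exact: subIsetr|].
    rewrite -h//; apply/disj_setPS => z [[Az _] [nAz _]]; exact: nAz.
  - move=> F tF LF; split; first by apply: bigcupT_measurable => n; have [] := LF n.
    rewrite setI_bigcupl integral_bigcup.
    + by apply: eseries0 => n _ _; have [] := LF n.
    + by apply: trivIset_setIr.
    + by move=> n; apply: measurableI => //; have [] := LF n.
    + apply: iK; last by move=> z [n _ []].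
      by apply: bigcupT_measurable => n; apply: measurableI => //; have [] := LF n.
have LM A : measurable A -> L A.
  move=> /rays_gen; rewrite -setI_closed_g_dynkin_g_sigma_algebra// => h.
  by apply: h; split.
have : ae_eq mu2 K (EFin \o g) (cst 0%E).
  apply: integral_ae_eq => //; [exact: iK|].
  move=> E EK mE.
  by rewrite integral0; have [_] := LM _ mE; rewrite setIidl.
by apply: filterS => x h Kx; have [] := h Kx.
Qed.

(** Each box has its own exceptional null set, so only countably many boxes may be used: the
    rational ones contained in [Om], enumerated through [unpickle]. *)
Lemma weak_uniqueness : {ae mu2, forall x, Om x -> g x = 0}.
Proof.
pose A n : set (R * R) := if unpickle n is Some q then
  (if `[< rcbox q `<=` Om >] then [set x | rbox q x /\ g x <> 0] else set0) else set0.
have nA n : mu2.-negligible (A n).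
  rewrite /A; case: (unpickle n) => [q|]; last exact: negligible_set0.
  case: asboolP => [qO|_]; last exact: negligible_set0.
  have [N [mN N0 sN]] := box_ae0 qO; exists N; split=> // x [qx gx]; apply: sN => /=.
  by apply/not_implyP.
have := negligible_bigcup nA; apply: negligibleS => x /= /not_implyP[Ox gx].
have [q [qx qO]] := open_rbox oOm Ox; exists (pickle q); first exact: I.
by rewrite /A pickleK; case: asboolP => [_|/(_ qO)[]]; split.
Qed.

End Uniqueness.

(** * Integration of derivatives along lines *)

Section LineIntegral.
Context {R : realType}.
Local Notation mu1 := (@lebesgue_measure R).
Variables (F f : R -> R).
Hypothesis dF : forall r : R, is_derive r (1 : R) F (f r).
Hypothesis cf : continuous f.

Let ftc (a b : R) : a < b -> (\int[mu1]_(x in `[a, b]) (f x)%:E = (F b - F a)%:E)%E.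
Proof.
move=> ab; rewrite EFinB; apply: (@continuous_FTC2 _ f F a b ab).
- exact: continuous_subspaceT.
- have cF x : {for x, continuous F}.
    by apply: differentiable_continuous; apply/derivable1_diffP; have [] := dF x.
  split; first by move=> x _; have [] := dF x.
    by apply: cvg_at_right_filter; exact: cF.
  by apply: cvg_at_left_filter; exact: cF.
- by move=> x _; rewrite derive1E; have [] := dF x.
Qed.

Lemma line_integral0 (M : R) : 0 < M ->
  (forall r, ~~ (- M < r < M) -> F r = 0 /\ f r = 0) ->
  (\int[mu1]_x (f x)%:E = 0)%E.
Proof.
move=> M0 out; have e : (fun x => (f x)%:E) = (fun x => (f x)%:E) \_ `[- M, M].
  apply/funext => x; rewrite patchE; case: ifPn => // /negP h.
  have [|_ ->//] := out x; apply/negP => /andP[h1 h2]; apply: h.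
  by rewrite inE /= in_itv /= !ltW.
pose D : set R := [set` `[- M, M]].
have -> : (\int[mu1]_x (f x)%:E = \int[mu1]_(x in D) (f x)%:E)%E.
  by rewrite [RHS]integral_mkcond -e.
rewrite ftc; last by rewrite gtrN.
have [|-> _] := out M; first by rewrite ltxx andbF.
by have [|-> _] := out (- M); rewrite ?ltxx ?subrr.
Qed.

(** From the zero at [a], the value at [x] is an integral of the derivative; extending the range to
    the whole line makes the bound independent of [x], which is what Ladyzhenskaya's inequality
    exploits. *)
Lemma line_bound (x a : R) : a < x -> F a = 0 ->
  ((`|F x|)%:E <= \int[mu1]_r (`|f r|)%:E)%E.
Proof.
move=> ax Fa; have mf := continuous_measurable_fun cf.
have -> : (`|F x|)%:E = `|\int[mu1]_(r in `[a, x]) (f r)%:E|%E by rewrite ftc// Fa subr0.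
apply: (le_trans (le_abse_integral _ _ _)) => //.
  by apply/measurable_EFinP; exact: measurable_funTS.
apply: ge0_subset_integral => //.
by apply/measurable_EFinP; exact: measurableT_comp.
Qed.

End LineIntegral.

Section AlmostEverywhere.
Context d (T : measurableType d) (R : realType) (mu : {measure set T -> \bar R}).

Lemma ae_imp (P Q : T -> Prop) : (forall x, P x -> Q x) ->
  {ae mu, forall x, P x} -> {ae mu, forall x, Q x}.
Proof. by move=> PQ; apply: filterS. Qed.

Lemma ae_imp2 (P Q S : T -> Prop) : (forall x, P x -> Q x -> S x) ->
  {ae mu, forall x, P x} -> {ae mu, forall x, Q x} -> {ae mu, forall x, S x}.
Proof. by move=> PQ; apply: filterS2. Qed.

End AlmostEverywhere.

(** * Openness and boundedness of the domain *)

Section Domain.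
Context {R : realType}.
Local Notation mu1 := (@lebesgue_measure R).
Local Notation mu2 := (@lebesgue_measure R \x @lebesgue_measure R)%E.
Implicit Types (Om : set (R * R)).

Lemma domain_open Om : convex_polygonal_domain Om -> open Om.
Proof.
move=> [_ _ [n [a [c ->]]]]; rewrite openE => x /= xi.
suff: \forall y \near x, forall i, (a i).1 * y.1 + (a i).2 * y.2 < c i by [].
apply: (@filter_forall _ _ (fun i y => (a i).1 * y.1 + (a i).2 * y.2 < c i) (nbhs x)) => i.
have h := xi i.
have cl : continuous (fun y : R * R => (a i).1 * y.1 + (a i).2 * y.2).
  by move=> y; apply: cvgD; apply: cvgMr; [exact: cvg_fst|exact: cvg_snd].
exact: (cl x _ (lt_nbhsl h)).
Qed.

Definition in_square (M : R) Om :=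
  forall x, Om x -> - M < x.1 < M /\ - M < x.2 < M.

Lemma domain_square Om : convex_polygonal_domain Om ->
  exists2 M : R, 0 < M & in_square M Om.
Proof.
move=> [_ [M0 [_ hM]] _]; exists (`|M0| + 2) => [|x Ox]; first by rewrite ltr_wpDl.
have : `|x| <= `|M0| + 1 by apply: (hM (`|M0| + 1)) => //; rewrite (le_lt_trans (ler_norm _))// ltrDl.
rewrite prod_normE ge_max => /andP[h1 h2].
by rewrite -!ltr_norml; split; lra.
Qed.

(** A type class, so that openness and a bounding square are found by inference in all the lemmas on
    Sobolev functions. *)
Class bounded_domain Om : Prop := BoundedDomain {
  domain_is_open : open Om;
  domain_in_square : exists2 M : R, 0 < M & in_square M Om }.

Lemma polygon_bounded_domain Om : convex_polygonal_domain Om -> bounded_domain Om.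
Proof. by move=> h; split; [exact: domain_open|exact: domain_square]. Qed.

End Domain.

Section SemiInnerCombine.
Context {R : realType} {V : lmodType R}.
Implicit Types (P Q : V -> Prop) (B C : V -> V -> R).

Lemma semi_inner_sub P Q B : semi_inner P B -> (forall x, Q x -> P x) ->
  (forall (a : R) x y, Q x -> Q y -> Q (a *: x + y)) -> semi_inner Q B.
Proof.
move=> H QP QL; split=> //; first exact: si_sym H.
  by move=> a x y z /QP Px /QP Py /QP Pz; exact: (si_linl H).
by move=> x /QP; exact: (si_ge0 H).
Qed.

Lemma semi_inner_sum P n (B : 'I_n -> V -> V -> R) :
  (forall (a : R) x y, P x -> P y -> P (a *: x + y)) ->
  (forall i, semi_inner P (B i)) -> semi_inner P (fun x y => \sum_i B i x y).
Proof.
move=> PL H; split=> //.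
- by move=> x y; apply: eq_bigr => i _; exact: si_sym (H i) _ _.
- move=> a x y z Px Py Pz; rewrite mulr_sumr -big_split; apply: eq_bigr => i _.
  exact: (si_linl (H i)).
- by move=> x Px; apply: sumr_ge0 => i _; exact: (si_ge0 (H i)).
Qed.

End SemiInnerCombine.

(** * Scalar consequences of Bochner integrability *)
Section LowerIntegral.
Context d (X : measurableType d) (R : realType) (mu : {measure set X -> \bar R}).

(* The integral of a nonnegative function is a supremum over simple functions,
   hence it is monotone without any measurability assumption. *)
Lemma ge0_integral_mono (D : set X) (f g : X -> \bar R) :
  (forall x, D x -> (0 <= f x)%E) -> (forall x, D x -> (f x <= g x)%E) ->
  (\int[mu]_(x in D) f x <= \int[mu]_(x in D) g x)%E.
Proof.
move=> f0 fg; rewrite !ge0_integralE//; last by move=> x Dx; exact: le_trans (f0 x Dx) (fg x Dx).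
apply: ereal_sup_le => _ [h hf <-]; exists h => // x; apply: (le_trans (hf x)).
by rewrite !patchE; case: ifPn => // /set_mem; exact: fg.
Qed.

End LowerIntegral.

Section Scalarization.
Context {R : realType} {V : lmodType R}.
Local Notation mu1 := (@lebesgue_measure R).
Variables (B : set V) (nrm : V -> R) (T : R).
Hypothesis B0 : B 0.
Hypothesis BD : forall (a : R) x y, B x -> B y -> B (a *: x + y).
Implicit Types (f : R -> V) (s : @step_function R V).

Lemma step_eval_in s t : step_in B s -> B (step_eval s t).
Proof.
move=> [_ Bs]; rewrite /step_eval; apply: big_ind => //.
  by move=> x y Bx By; have := BD 1 Bx By; rewrite scale1r.
by move=> i _; have := BD (\1_(@step_set _ _ s i) t) (Bs i) B0; rewrite addr0.
Qed.

Lemma step_integral_in s : step_in B s -> B (step_integral T s).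
Proof.
move=> [_ Bs]; rewrite /step_integral; apply: big_ind => //.
  by move=> x y Bx By; have := BD 1 Bx By; rewrite scale1r.
by move=> i _; have := BD (fine (mu1 (@step_set _ _ s i `&` time_itv T))) (Bs i) B0; rewrite addr0.
Qed.

(** A step function takes finitely many values, on measurable pieces, so [Phi] may be any function.
    The proof splits on membership in the first piece and moves its value into an offset [w], which
    the induction must therefore generalize. *)
Lemma step_measurable (Phi : V -> R) s : (forall i, measurable (@step_set _ _ s i)) ->
  measurable_fun setT (fun t => Phi (step_eval s t)).
Proof.
rewrite /step_eval; case: s => n S v /= mS.
suff H w : measurable_fun setT (fun t => Phi (w + \sum_(i < n) (\1_(S i) t : R) *: v i)).
  by have := H 0; under eq_fun do rewrite add0r.
elim: n S v mS w => [|n IH] S v mS w.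
  by under eq_fun do rewrite big_ord0 addr0; exact: measurable_cst.
rewrite (_ : (fun t => _) = fun t => if t \in S ord0
    then Phi (w + v ord0 + \sum_(i < n) (\1_(S (lift ord0 i)) t : R) *: v (lift ord0 i))
    else Phi (w + \sum_(i < n) (\1_(S (lift ord0 i)) t : R) *: v (lift ord0 i))).
  apply: measurable_fun_ifT.
  - apply: (measurable_fun_bool true); rewrite setTI (_ : _ @^-1` _ = S ord0)//.
    by apply/seteqP; split => t /=; [exact: set_mem|exact: mem_set].
  - by apply: (IH (fun i => S (lift ord0 i)) (fun i => v (lift ord0 i))) => i; exact: mS.
  - by apply: (IH (fun i => S (lift ord0 i)) (fun i => v (lift ord0 i))) => i; exact: mS.
apply/funext => t; rewrite big_ord_recl indicE; case: (t \in S ord0).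
  by rewrite scale1r addrA.
by rewrite scale0r add0r.
Qed.

(** One null set is removed once and for all, before [Phi] is given. On the rest, a functional that
    is Lipschitz for the seminorm sends the approximating step functions to a convergent sequence of
    measurable functions. [Phi] need not be linear: it is also applied to a sum of norms. *)
Lemma strongly_measurableP f : strongly_measurable B nrm T f ->
  exists D : set R, [/\ measurable D, D `<=` time_itv T,
    {ae mu1, forall t, time_itv T t -> D t}, (forall t, D t -> B (f t)) &
    forall (Phi : V -> R) (K : R),
      (forall x y, B x -> B y -> `|Phi x - Phi y| <= K * nrm (x - y)) ->
      measurable_fun D (Phi \o f)].
Proof.
move=> [Bf [s ss cs]].
have [N [mN N0 sN]] : {ae mu1, forall t, 0 < t < T ->
    B (f t) /\ nrm (f t - step_eval (s k) t) @[k --> \oo] --> (0 : R)}.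
  by move: Bf cs; apply: ae_imp2 => t h1 h2 tT; split; [exact: h1|exact: h2].
have DT t : time_itv T t -> 0 < t < T by rewrite /time_itv /= in_itv.
exists (time_itv T `\` N); split.
- by apply: measurableD => //; exact: measurable_itv.
- by move=> t [].
- exists N; split => // t /= /not_implyP [tT nD]; apply: contrapT => nN; exact: nD.
- move=> t [tT nN]; have : ~ ~ (0 < t < T ->
    B (f t) /\ nrm (f t - step_eval (s k) t) @[k --> \oo] --> (0 : R)).
    by move=> h; apply: nN; exact: sN.
  by move/contrapT => h; have [] := h (DT _ tT).
- move=> Phi K hPhi; apply: (@measurable_fun_cvg _ _ _ _ (fun k t => Phi (step_eval (s k) t))).
    by move=> k; apply: measurable_funTS; apply: step_measurable; have [] := ss k.
  move=> t [tT nN].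
  have : ~ ~ (0 < t < T -> B (f t) /\ nrm (f t - step_eval (s k) t) @[k --> \oo] --> (0 : R)).
    by move=> h; apply: nN; exact: sN.
  move/contrapT => h; have [Bt c] := h (DT _ tT).
  apply/subr_cvg0; apply/norm_cvg0P.
  apply: (@squeeze_cvgr _ _ _ _ (cst 0) (fun k => K * nrm (f t - step_eval (s k) t))).
  - by apply: nearW => k; rewrite normr_ge0 distrC hPhi//; exact: step_eval_in.
  - exact: cvg_cst.
  - by rewrite -(mulr0 K); apply: cvgMr.
Qed.

Variables (ell : V -> R) (K : R).
Hypothesis K0 : 0 < K.
Hypothesis nrm0 : forall x, 0 <= nrm x.
Hypothesis ell_lin : forall (a : R) x y, B x -> B y -> ell (a *: x + y) = a * ell x + ell y.
Hypothesis ell_bnd : forall x, B x -> `|ell x| <= K * nrm x.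

Let ell0 : ell 0 = 0.
Proof. by have := ell_lin 1 B0 B0; rewrite scaler0 addr0; lra. Qed.

Let ellB x y : B x -> B y -> ell (x - y) = ell x - ell y.
Proof. by move=> Bx By; have := ell_lin (-1) By Bx; rewrite scaleN1r addrC => ->; ring. Qed.

Let BB x y : B x -> B y -> B (x - y).
Proof. by move=> Bx By; have := BD (-1) By Bx; rewrite scaleN1r addrC. Qed.

Let ell_lip x y : B x -> B y -> `|ell x - ell y| <= K * nrm (x - y).
Proof. by move=> Bx By; rewrite -ellB//; exact/ell_bnd/BB. Qed.

Let itv_measurable : measurable (time_itv T).
Proof. exact: measurable_itv. Qed.

Lemma step_scalar s : step_in B s ->
  mu1.-integrable (time_itv T) (fun t => (ell (step_eval s t))%:E) /\
  \int[mu1]_(t in time_itv T) ell (step_eval s t) = ell (step_integral T s).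
Proof.
rewrite /step_eval /step_integral /step_in; case: s => n S v /= [mS Bv].
elim: n S v mS Bv => [|n IH] S v mS Bv.
  split; first by under eq_fun do rewrite big_ord0 ell0; exact: integrable0.
  rewrite big_ord0 ell0; under eq_Rintegral do rewrite big_ord0 ell0.
  by rewrite /Rintegral integral0.
have [I E] := IH (fun i => S (lift ord0 i)) (fun i => v (lift ord0 i)) (fun i => mS _) (fun i => Bv _).
have BS (c : 'I_n -> R) : B (\sum_(i < n) c i *: v (lift ord0 i)).
  apply: big_ind => //; first by move=> x y Bx By; have := BD 1 Bx By; rewrite scale1r.
  by move=> i _; have := BD (c i) (Bv (lift ord0 i)) B0; rewrite addr0.
have I1 : mu1.-integrable (time_itv T) (EFin \o (\1_(S ord0) : R -> R)).
  apply/integrableP; split; first by apply/measurable_EFinP; apply: measurable_funTS; apply: measurable_indic; exact: mS.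
  under eq_integral do rewrite /= ger0_norm//.
  rewrite integral_indic//; last exact: mS.
  apply: (@le_lt_trans _ _ (mu1 (time_itv T))).
    by apply: le_measure; rewrite ?inE//; exact: (measurableI _ _ (mS ord0) itv_measurable).
  by rewrite lebesgue_measure_itv; case: ifP => _; rewrite ltry.
have e t : ell (\sum_(i < n.+1) (\1_(S i) t : R) *: v i) =
    ell (v ord0) * \1_(S ord0) t + ell (\sum_(i < n) (\1_(S (lift ord0 i)) t : R) *: v (lift ord0 i)).
  by rewrite big_ord_recl ell_lin// mulrC.
have I2 : mu1.-integrable (time_itv T) (EFin \o (fun t => ell (v ord0) * \1_(S ord0) t)).
  exact: (@integrableZl _ _ R mu1 _ itv_measurable (ell (v ord0)) _ I1).
split.
  have := @integrableD _ _ R mu1 _ itv_measurable _ _ I2 I.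
  by apply: eq_integrable => // t _; rewrite e.
under eq_Rintegral do rewrite e.
rewrite RintegralD// E RintegralZl// big_ord_recl ell_lin//; congr (_ + _).
by rewrite mulrC; congr (_ * _); rewrite /Rintegral integral_indic//; exact: mS.
Qed.

(** A bounded functional commutes with the integral of step functions, and [K] times the seminorm
    controls both errors in the limit. The function [h] is [ell \o f] replaced by 0 off the good set
    [D], which makes it measurable on the line. *)
Lemma bochner_scalar f v : is_bochner_integral B nrm T f v ->
  exists h : R -> R, [/\ measurable_fun setT h,
    mu1.-integrable (time_itv T) (EFin \o h),
    {ae mu1, forall t, time_itv T t -> h t = ell (f t)} &
    \int[mu1]_(t in time_itv T) h t = ell v].
Proof.
move=> [sm Bv [s [ss c0 c1]]].
have [D [mD DT aD BfD mPhi]] := strongly_measurableP sm.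
pose h := (ell \o f) \_ D.
have mh : measurable_fun setT h by apply/(measurable_restrictT _ mD); exact: (mPhi _ _ ell_lip).
have hD t : D t -> h t = ell (f t) by move=> Dt; rewrite /h patchE mem_set.
pose sig k t := ell (step_eval (s k) t).
have msig k : measurable_fun setT (sig k) by apply: step_measurable; have [] := ss k.
have mdif k : measurable_fun setT (fun t => h t - sig k t) by exact: measurable_funB.
have mabs k : measurable_fun setT (fun t => `|h t - sig k t|) by exact: measurableT_comp.
(* The seminorm on the right is not known to be measurable in time. The comparison goes through a
   measurable [F] lying below it everywhere, and the monotonicity of the lower integral. *)
have bnd k : (\int[mu1]_(t in time_itv T) (`|h t - sig k t|)%:E <=
    K%:E * \int[mu1]_(t in time_itv T) (nrm (f t - step_eval (s k) t))%:E)%E.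
  pose F := (fun t => K^-1 * `|h t - sig k t|) \_ D.
  have mF : measurable_fun setT F.
    apply/(measurable_restrictT _ mD); apply: measurable_funTS; apply: measurable_funM => //.
  have F0 t : 0 <= F t.
    by rewrite /F patchE; case: ifPn => // _; rewrite mulr_ge0// invr_ge0 ltW.
  have -> : (\int[mu1]_(t in time_itv T) (`|h t - sig k t|)%:E =
      \int[mu1]_(t in time_itv T) (K%:E * (F t)%:E))%E.
    apply: ae_eq_integral => //.
    - by apply: measurable_funTS; apply/measurable_EFinP; exact: mabs.
    - by apply: measurable_funTS; apply/measurable_EFinP; exact: measurable_funM.
    move: aD; apply: ae_imp => t tD tT; rewrite /F patchE mem_set; last exact: tD.
    by rewrite -EFinM mulrA divff ?mul1r// gt_eqF.
  rewrite ge0_integralZl//; last 3 first.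
  - by apply: measurable_funTS; exact/measurable_EFinP.
  - by move=> t _; rewrite lee_fin.
  - by rewrite lee_fin ltW.
  apply: lee_wpmul2l; first by rewrite lee_fin ltW.
  apply: ge0_integral_mono => t tT; rewrite lee_fin ?F0//.
  rewrite /F patchE; case: ifPn => [/set_mem Dt|_].
    rewrite ler_pdivrMl// hD//; apply: ell_lip; [exact: BfD|exact: step_eval_in].
  by rewrite nrm0.
have isig k := step_scalar (ss k).
have idif k : (\int[mu1]_(t in time_itv T) (nrm (f t - step_eval (s k) t))%:E < +oo)%E ->
    mu1.-integrable (time_itv T) (EFin \o (fun t => h t - sig k t)).
  move=> fin; apply/integrableP; split; first by apply/measurable_EFinP; apply: measurable_funTS; exact: mdif.
  by apply: (le_lt_trans (bnd k)); rewrite lte_mul_pinfty// lee_fin ltW.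
(* Convergence to 0 in the extended reals only says that the integrals are eventually finite, hence
   the passage through [fine_cvgP]. *)
have n0 (e : R) : 0 < e -> \forall k \near \oo,
    (\int[mu1]_(t in time_itv T) (nrm (f t - step_eval (s k) t))%:E < e%:E)%E.
  move=> e0; have [fin c] := (fine_cvgP _ _).1 c0; have l := cvgr_lt _ c _ e0.
  by near=> k; rewrite -[X in (X < _)%E]fineK ?lte_fin; near: k; [exact: l|exact: fin].
Unshelve. all: end_near.
have ih : mu1.-integrable (time_itv T) (EFin \o h).
  have [k _ hk] := n0 1 ltr01; have := hk k (leqnn k) => /= hk1.
  have i1 := idif k (lt_trans hk1 (ltry _)).
  have := @integrableD _ _ R mu1 _ itv_measurable _ _ i1 (isig k).1.
  by apply: eq_integrable => // t _; rewrite /= -EFinD subrK.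
exists h; split => //.
  by move: aD; apply: ae_imp => t tD tT; exact/hD/tD.
apply/eqP; rewrite -subr_eq0 -normr_le0; apply/ler_addgt0Pl => e e0; rewrite addr0.
have e20 : 0 < e / 2 / K by rewrite !divr_gt0.
have [k _ hk] := filterI (n0 _ e20) (cvgr_lt _ c1 _ e20).
have [/= k1 k2] := hk k (leqnn k).
have i1 := idif k (lt_trans k1 (ltry _)).
have -> : \int[mu1]_(t in time_itv T) h t - ell v =
    \int[mu1]_(t in time_itv T) (h t - sig k t) + ell (step_integral T (s k) - v).
  rewrite RintegralB//; last exact: (isig k).1.
  by rewrite (isig k).2 ellB//; [ring|exact: step_integral_in].
apply: (le_trans (ler_normD _ _)); rewrite [leRHS](splitr e); apply: lerD.
  have q := @le_normr_Rintegral _ _ R mu1 _ (fun t => h t - sig k t) itv_measurable i1.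
  apply: (le_trans q).
  rewrite -lee_fin /Rintegral fineK; last first.
    have [] := integrableP _ _ _ i1 => _ h2; rewrite ge0_fin_numE//.
    by apply: integral_ge0 => t _; rewrite lee_fin.
  apply: (le_trans (bnd k)).
  rewrite (_ : (e / 2)%:E = K%:E * (e / 2 / K)%:E)%E; last first.
    by rewrite -EFinM mulrCA divff ?mulr1// gt_eqF.
  by apply: lee_wpmul2l; [rewrite lee_fin ltW|exact: ltW].
apply: (le_trans (ell_bnd (BB _ Bv))); first exact: step_integral_in.
by rewrite -ler_pdivlMl// mulrC ltW.
Qed.

End Scalarization.

(** * From weak time derivatives to increments *)
Section TimeTest.
Context {R : realType}.
Local Notation mu1 := (@lebesgue_measure R).
Implicit Types (A h f : R -> R) (a b c s t x T : R).

Lemma ramp_derive_out a b x : a < b -> x < a \/ b < x -> derive1 (ramp a b) x = 0.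
Proof.
move=> ab [xa|bx]; rewrite derive1E.
- rewrite (@near_eq_derive _ _ _ (ramp a b) (cst 0)) ?derive_cst//.
  by move: (lt_nbhsl xa); apply: filterS => y ya; rewrite ramp0// ltW.
- rewrite (@near_eq_derive _ _ _ (ramp a b) (cst 1)) ?derive_cst//.
  by move: (lt_nbhsr bx); apply: filterS => y ya; rewrite ramp1// ltW.
Qed.

Lemma continuous_integrable A a b (D : set R) : measurable D -> D `<=` [set` `[a, b]] ->
  {within [set` `[a, b]], continuous A} -> mu1.-integrable D (EFin \o A).
Proof.
move=> mD DT cA; apply: (@integrableS _ _ R mu1 [set` `[a, b]] D) => //.
by apply: continuous_compact_integrable; [exact: segment_compact|].
Qed.

Lemma smooth_ftc f a b : smooth_alg f -> a < b ->
  \int[mu1]_(x in `]a, b[) derive1 f x = f b - f a.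
Proof.
move=> sf ab; have cd := smooth_alg_continuous (smooth_alg_deriv sf).
have I (l r : bool) : mu1.-integrable [set` Interval (BSide l a) (BSide r b)] (EFin \o derive1 f).
  apply: (@continuous_integrable _ a b); [exact: measurable_itv| |exact: continuous_subspaceT].
  by apply: subset_itvScc; rewrite bnd_simp; case: l r => -[].
rewrite Rintegral_itv_bndo_bndc; last exact: I.
rewrite Rintegral_itv_obnd_cbnd; last exact: I.
rewrite /Rintegral (@continuous_FTC2 _ (derive1 f) f a b ab)//.
- exact: continuous_subspaceT.
- have cF := smooth_alg_continuous sf.
  split; first by move=> x _; exact: smooth_alg_derivable.
    by apply: cvg_at_right_filter; exact: cF.
  by apply: cvg_at_left_filter; exact: cF.
Qed.

Variable T : R.
Hypothesis T0 : 0 < T.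

Let mT : measurable (time_itv T). Proof. exact: measurable_itv. Qed.

Let sT : time_itv T `<=` [set` `[0, T]].
Proof. by apply: subset_itvW. Qed.

Lemma within_integrable A : {within [set` `[0, T]], continuous A} ->
  mu1.-integrable (time_itv T) (EFin \o A).
Proof.
by move=> cA; exact: (@continuous_integrable _ 0 T).
Qed.

Lemma withinM A f : continuous f -> {within [set` `[0, T]], continuous A} ->
  {within [set` `[0, T]], continuous (fun x => f x * A x)}.
Proof. by move=> cf cA x; apply: cvgM; [exact: continuous_subspaceT cf x|exact: cA]. Qed.

Lemma test_time f a c : smooth_alg f -> 0 < a -> c < T ->
  (forall x, x <= a \/ c <= x -> f x = 0) -> test_function_time T f.
Proof.
move=> sf a0 cT f0.
have sub : closure [set t | f t != 0] `<=` [set` `[a, c]].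
  have /closure_id -> : closed [set` `[a, c]] by exact: itv_closed.
  apply: closure_subset => x /= /eqP fx; rewrite in_itv /=; apply/andP; split.
    by rewrite leNgt; apply/negP => xa; apply: fx; apply: f0; left; exact: ltW.
  by rewrite leNgt; apply/negP => xa; apply: fx; apply: f0; right; exact: ltW.
split; first exact: smooth_algW.
- apply: subclosed_compact sub; [exact: closed_closure|exact: segment_compact].
- move=> x /sub /=; rewrite /time_itv /= !in_itv /= => /andP[ax xc].
  by rewrite (lt_le_trans a0 ax) (le_lt_trans xc cT).
Qed.

(** The derivative of the ramp is nonnegative, vanishes off [[a, b]] and has integral 1: the
    integral is a weighted mean of [A] over [[a, b]], hence as close to [y] as [A] is there. *)
Lemma ramp_concentrate A a b y (e : R) : 0 <= a -> a < b -> b <= T ->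
  {within [set` `[0, T]], continuous A} ->
  (forall x, a <= x <= b -> `|A x - y| <= e) ->
  `|\int[mu1]_(x in time_itv T) (derive1 (ramp a b) x * A x) - y| <= e.
Proof.
move=> a0 ab bT cA Ae; have sr := ramp_alg ab; have cr := smooth_alg_continuous (smooth_alg_deriv sr).
have tot : \int[mu1]_(x in time_itv T) derive1 (ramp a b) x = 1.
  by rewrite smooth_ftc// ramp1// ramp0// subr0.
have ir : mu1.-integrable (time_itv T) (EFin \o derive1 (ramp a b)).
  by apply: within_integrable; exact: continuous_subspaceT.
have irc k : mu1.-integrable (time_itv T) (EFin \o (fun x => k * derive1 (ramp a b) x)).
  exact: (@integrableZl _ _ R mu1 _ mT k _ ir).
have irA : mu1.-integrable (time_itv T) (EFin \o (fun x => derive1 (ramp a b) x * A x)).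
  exact/within_integrable/withinM.
have -> : \int[mu1]_(x in time_itv T) (derive1 (ramp a b) x * A x) - y =
    \int[mu1]_(x in time_itv T) (derive1 (ramp a b) x * A x - y * derive1 (ramp a b) x).
  by rewrite RintegralB// RintegralZl// tot mulr1.
have id := @integrableB _ _ R mu1 _ mT _ _ irA (irc y).
apply: (le_trans (@le_normr_Rintegral _ _ R mu1 _ (fun x => derive1 (ramp a b) x * A x - y * derive1 (ramp a b) x) mT id)).
rewrite -[leRHS]mulr1 -tot -RintegralZl//; apply: le_Rintegral => //.
  exact: integrable_abse id.
move=> x _; have r0 : 0 <= derive1 (ramp a b) x.
  by apply: nondecreasing_derive_ge0; [exact: ramp_nd|exact: smooth_alg_derivable].
rewrite mulrC -mulrBl normrM (ger0_norm r0).
have [xa|ax] := ltP x a; first by rewrite ramp_derive_out ?mulr0//; left.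
have [xb|bx] := ltP b x; first by rewrite ramp_derive_out ?mulr0//; right.
by apply: ler_wpM2r => //; apply: Ae; rewrite ax.
Qed.

Lemma plateau_derive a c k x : a < c -> derive1 (plateau a c k) x =
  derive1 (ramp a (a + (c - a) / k.+2%:R)) x - derive1 (ramp (c - (c - a) / k.+2%:R) c) x.
Proof.
move=> ac; have e := plateau_eps k ac.
have s1 : smooth_alg (ramp a (a + (c - a) / k.+2%:R)) by apply: ramp_alg; rewrite ltrDl.
have s2 : smooth_alg (ramp (c - (c - a) / k.+2%:R) c) by apply: ramp_alg; rewrite ltrBlDr ltrDl.
by rewrite !derive1E -deriveB//; exact: smooth_alg_derivable.
Qed.

Section Limit.
Variables (A h : R -> R).
Hypothesis cA : {within [set` `[0, T]], continuous A}.
Hypothesis ih : mu1.-integrable (time_itv T) (EFin \o h).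

Lemma Rintegral_indicator s t : 0 <= s -> t <= T ->
  \int[mu1]_(x in `]s, t[) h x = \int[mu1]_(x in time_itv T) (\1_[set` `]s, t[] x * h x).
Proof.
move=> s0 tT.
have -> : [set` `]s, t[] = time_itv T `&` [set` `]s, t[].
  by rewrite setIidr//; apply: subset_itv; rewrite ?bnd_simp.
rewrite Rintegral_mkcondr; apply: eq_Rintegral => x xT.
rewrite patchE indicE in_setI xT /=.
by case: (x \in _); rewrite ?mul1r ?mul0r.
Qed.

Lemma indicator_limit (chi : nat -> R -> R) s t :
  (forall k, measurable_fun setT (chi k)) -> (forall k x, `|chi k x| <= 1) ->
  (forall x, chi k x @[k --> \oo] --> (\1_[set` `]s, t[] x : R)) -> 0 <= s -> t <= T ->
  \int[mu1]_(x in time_itv T) (chi k x * h x) @[k --> \oo] --> \int[mu1]_(x in `]s, t[) h x.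
Proof.
move=> mc c1 cc s0 tT.
have [/measurable_EFinP mh _] := integrableP _ _ _ ih.
rewrite (Rintegral_indicator s0 tT).
have p1 k : measurable_fun (time_itv T) (fun x => chi k x * h x).
  by apply: measurable_funM => //; exact: measurable_funTS.
have p2 : measurable_fun (time_itv T) (fun x => \1_[set` `]s, t[] x * h x).
  by apply: measurable_funM => //; exact: measurable_indic.
have p3 x : time_itv T x -> chi k x * h x @[k --> \oo] --> (\1_[set` `]s, t[] x * h x : R).
  by move=> _; apply: cvgMl; exact: cc.
have p4 k x : time_itv T x -> `|chi k x * h x| <= `|h x|.
  by move=> _; rewrite normrM ler_piMl.
have p5 : mu1.-integrable (time_itv T) (EFin \o (fun x => `|h x|)) by exact: integrable_abse ih.
exact: (@Rintegral_dominated_cvg _ _ R mu1 _ mT (fun k x => chi k x * h x) _ _ p1 p2 p3 p5 p4).2.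
Qed.

Lemma plateau_limit s t x : s < t -> plateau s t k x @[k --> \oo] --> (\1_[set` `]s, t[] x : R).
Proof.
move=> st; rewrite indicE mem_setE.
have [sxt|n] := boolP (x \in `]s, t[); apply: cvg_near_cst.
  by rewrite in_itv /= in sxt; move: (plateau_cvg sxt); apply: filterS => k ->.
apply: nearW => k; apply: plateau_out => //.
by move: n; rewrite in_itv /= negb_and -!leNgt => /orP.
Qed.

Hypothesis weak : forall phi, test_function_time T phi ->
  \int[mu1]_(x in time_itv T) (derive1 phi x * A x) = - \int[mu1]_(x in time_itv T) (phi x * h x).

(** The weak identity is tested with [plateau s t k]. Its derivative is the difference of two unit
    masses concentrating at [s] and [t], so one side tends to [A s - A t] by continuity, while
    dominated convergence handles the other. *)
Lemma weak_ftc_interior s t : 0 < s -> s < t -> t < T ->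
  A t - A s = \int[mu1]_(x in `]s, t[) h x.
Proof.
move=> s0 st tT.
have L : \int[mu1]_(x in time_itv T) (plateau s t k x * h x) @[k --> \oo] --> \int[mu1]_(x in `]s, t[) h x.
  apply: indicator_limit; rewrite ?ltW//.
  - by move=> k; apply: continuous_measurable_fun; apply: smooth_alg_continuous; exact: plateau_alg.
  - by move=> k x; have /andP[p0 p1] := plateau_itv k st x; rewrite ger0_norm.
  - by move=> x; exact: plateau_limit.
suff L2 : \int[mu1]_(x in time_itv T) (plateau s t k x * h x) @[k --> \oo] --> A t - A s.
  exact: (cvg_unique (@norm_hausdorff _ _) L2 L).
have [ci _ _] := (continuous_within_itvP A T0).1 cA.
have cs : {for s, continuous A} by apply: ci; rewrite in_itv /= s0 (lt_trans st).
have ct : {for t, continuous A} by apply: ci; rewrite in_itv /= tT (lt_trans s0).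
apply/cvgrPdist_le => e e0.
have e2 : 0 < e / 2 by rewrite divr_gt0.
move: cs => /cvgrPdist_le /(_ _ e2) /nbhs_ballP [r1 /= r10 h1].
move: ct => /cvgrPdist_le /(_ _ e2) /nbhs_ballP [r2 /= r20 h2].
have ez : (t - s) / k.+2%:R @[k --> \oo] --> (0 : R).
  rewrite -(mulr0 (t - s)); apply: cvgMr.
  by have := @cvg_harmonic R; rewrite -cvg_shiftS; apply.
have dist x y (r d : R) : 0 <= x - y <= d -> `|d| < r -> `|y - x| < r.
  by move=> /andP[h3 h4] dr; rewrite distrC ger0_norm//; apply: le_lt_trans (le_lt_trans (ler_norm d) dr).
near=> k.
have k1 : `|(t - s) / k.+2%:R| < r1 by near: k; move/cvgr0Pnorm_lt : ez; apply.
have k2 : `|(t - s) / k.+2%:R| < r2 by near: k; move/cvgr0Pnorm_lt : ez; apply.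
have ep := plateau_eps k st; have mid := plateau_mid k st.
have w : test_function_time T (plateau s t k).
  by apply: (@test_time _ s t) => //; [exact: plateau_alg|move=> x; exact: plateau_out].
have -> : \int[mu1]_(x in time_itv T) (plateau s t k x * h x) =
    - \int[mu1]_(x in time_itv T) (derive1 (plateau s t k) x * A x) by rewrite (weak w) opprK.
have sr1 : smooth_alg (ramp s (s + (t - s) / k.+2%:R)) by apply: ramp_alg; rewrite ltrDl.
have sr2 : smooth_alg (ramp (t - (t - s) / k.+2%:R) t) by apply: ramp_alg; rewrite ltrBlDr ltrDl.
have c1 := withinM (smooth_alg_continuous (smooth_alg_deriv sr1)) cA.
have c2 := withinM (smooth_alg_continuous (smooth_alg_deriv sr2)) cA.
have -> : \int[mu1]_(x in time_itv T) (derive1 (plateau s t k) x * A x) =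
    \int[mu1]_(x in time_itv T) (derive1 (ramp s (s + (t - s) / k.+2%:R)) x * A x) -
    \int[mu1]_(x in time_itv T) (derive1 (ramp (t - (t - s) / k.+2%:R) t) x * A x).
  rewrite -RintegralB//; [|exact: within_integrable c1|exact: within_integrable c2].
  by apply: eq_Rintegral => x _; rewrite plateau_derive// mulrBl.
set d := (t - s) / _ in k1 k2 ep mid sr1 sr2 c1 c2 *.
have i1 : `|\int[mu1]_(x in time_itv T) (derive1 (ramp s (s + d)) x * A x) - A s| <= e / 2.
  apply: ramp_concentrate => //; [exact: ltW|by rewrite ltrDl| |].
    by move: mid tT ep; lra.
  move=> x /andP[sx xd]; rewrite distrC; apply: h1; rewrite /= -ball_normE /=; apply: (dist _ _ _ d) => //.
  by rewrite subr_ge0 sx lerBlDl.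
have i2 : `|\int[mu1]_(x in time_itv T) (derive1 (ramp (t - d) t) x * A x) - A t| <= e / 2.
  apply: ramp_concentrate => //; [by move: mid s0 ep; lra|by rewrite ltrBlDr ltrDl|exact: ltW|].
  move=> x /andP[sx xd]; rewrite distrC; apply: h2; rewrite /= -ball_normE /= distrC.
  by apply: (dist _ _ _ d) => //; rewrite subr_ge0 xd /=; move: sx; lra.
have gen (I1 I2 x y : R) : `|I1 - x| <= e / 2 -> `|I2 - y| <= e / 2 -> `|y - x - - (I1 - I2)| <= e.
  move=> h3 h4; rewrite (_ : y - x - _ = (I1 - x) - (I2 - y)); last by ring.
  by rewrite [leRHS](splitr e); apply: (le_trans (ler_normB _ _)); exact: lerD.
exact: gen.
Unshelve. all: by end_near. Qed.

(** When [s = 0] or [t = T], the support of the plateau reaches the boundary of []0, T[]. The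
    interval is therefore shrunk, and continuity of [A] up to the endpoints gives the limit. *)
Lemma weak_ftc s t : 0 <= s -> s < t -> t <= T ->
  A t - A s = \int[mu1]_(x in `]s, t[) h x.
Proof.
move=> s0 st tT; have [ci c0 cT] := (continuous_within_itvP A T0).1 cA.
have cs : A @ s^'+ --> A s.
  move: s0; rewrite le_eqVlt => /orP[/eqP <- //|s0]; apply: cvg_at_right_filter; apply: ci.
  by rewrite in_itv /= s0 (lt_le_trans st).
have ct : A @ t^'- --> A t.
  move: tT; rewrite le_eqVlt => /orP[/eqP -> //|tT]; apply: cvg_at_left_filter; apply: ci.
  by rewrite in_itv /= tT (le_lt_trans s0).
(* With [k.+3] the shift is at most a third of the length, so that [s + d k < t - d k] for every
   [k]. *)
pose d k := (t - s) / k.+3%:R.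
have d0 k : 0 < d k by rewrite divr_gt0 ?subr_gt0.
have dm k : s + d k < t - d k.
  have : d k <= (t - s) / 3.
    by rewrite ler_pM2l ?subr_gt0// lef_pV2 ?posrE// ler_nat.
  have : 0 < t - s by rewrite subr_gt0.
  by move: (d k) => x; lra.
have dz : d k @[k --> \oo] --> (0 : R).
  rewrite -(mulr0 (t - s)); apply: cvgMr.
  have := @cvg_harmonic R; rewrite -(cvg_shiftn 2); apply: cvg_trans; apply: near_eq_cvg.
  by apply: nearW => k; rewrite /= addn2.
have us : s + d k @[k --> \oo] --> s by rewrite -[X in _ --> X]addr0; apply: cvgD => //; exact: cvg_cst.
have ut : t - d k @[k --> \oo] --> t by rewrite -[X in _ --> X]subr0; apply: cvgB => //; exact: cvg_cst.
have As : A (s + d k) @[k --> \oo] --> A s.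
  by move/cvg_at_rightP : cs; apply; split => // k; rewrite ltrDl.
have At : A (t - d k) @[k --> \oo] --> A t.
  by move/cvg_at_leftP : ct; apply; split => // k; rewrite ltrBlDr ltrDl.
have L : A (t - d k) - A (s + d k) @[k --> \oo] --> A t - A s by exact: cvgB At As.
pose chi k := \1_[set` `]s + d k, t - d k[] : R -> R.
have L2 : \int[mu1]_(x in time_itv T) (chi k x * h x) @[k --> \oo] --> \int[mu1]_(x in `]s, t[) h x.
  apply: indicator_limit => //.
  - by move=> k; exact: measurable_indic.
  - by move=> k x; rewrite /chi indicE; case: (_ \in _); rewrite ?normr1 ?normr0.
  - move=> x; rewrite /chi !indicE !mem_setE.
    apply: cvg_near_cst; case: (boolP (x \in `]s, t[)) => [|n].
      rewrite in_itv /= => /andP[sx xt].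
      have n1 : \forall k \near \oo, s + d k < x by exact: (cvgr_lt s us).
      have n2 : \forall k \near \oo, x < t - d k by exact: (cvgr_gt t ut).
      move: n1 n2; apply: filterS2 => k h1 h2.
      by rewrite indicE mem_setE in_itv /= h1 h2.
    apply: nearW => k; rewrite indicE mem_setE; suff /negbTE -> : x \notin `]s + d k, t - d k[ by [].
    apply: contra n; rewrite !in_itv /= => /andP[h1 h2].
    by rewrite (lt_trans _ h1) ?ltrDl// (lt_trans h2)// ltrBlDr ltrDl.
apply: (cvg_unique (@norm_hausdorff _ _) L); move: L2; apply: cvg_trans; apply: near_eq_cvg.
apply: nearW => k; rewrite -Rintegral_indicator; last 2 first.
- by rewrite addr_ge0// ltW.
- by rewrite (le_trans _ tT)// lerBlDr lerDl ltW.
rewrite weak_ftc_interior//; first by rewrite (le_lt_trans s0)// ltrDl.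
by rewrite (lt_le_trans _ tT)// ltrBlDr ltrDl.
Qed.

End Limit.
End TimeTest.

(** * Completeness of L^2 *)

Section RieszFischer.
Context d (X : measurableType d) (R : realType).
Variables (mu : {measure set X -> \bar R}) (D : set X).
Hypothesis mD : measurable D.
Local Notation sq := (sqint mu D).
Local Notation nrm := (si_norm (intmul mu D)).
Let S := @sqint_si _ _ _ mu D mD.

Lemma geom_half (n : nat) : \sum_(0 <= k < n) (2^-1 : R) ^+ k = 2 - 2 * 2^-1 ^+ n.
Proof.
elim: n => [|n IH]; first by rewrite big_nil expr0 mulr1 subrr.
by rewrite big_nat_recr//= IH exprS; field.
Qed.

Lemma limn_einf_le (u : nat -> \bar R) (c : \bar R) n :
  (forall m, (n <= m)%N -> (u m <= c)%E) -> (limn_einf u <= c)%E.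
Proof.
move=> h; rewrite limn_einf_lim; apply: lime_le; first exact: is_cvg_einfs.
exists 0%N => // k _ /=; apply: (@le_trans _ _ (u (n + k)%N)); last exact: h (leq_addr _ _).
by apply: ereal_inf_lbound; exists (n + k)%N => //=; rewrite leq_addl.
Qed.

Lemma sqint_nrm f : sq f -> (\int[mu]_(x in D) (f x ^+ 2)%:E = (nrm f ^+ 2)%:E)%E.
Proof.
move=> hf; rewrite (si_normE S hf) /intmul /Rintegral fineK.
  by apply: eq_integral => x _; rewrite expr2.
by apply: integrable_fin_num => //; exact: (sqint_mul mD hf hf).
Qed.

Variable F : nat -> X -> R.
Hypothesis hF : forall n, sq (F n).
Hypothesis dF : forall n, nrm (F n.+1 - F n) <= 2^-1 ^+ n.

Let hd n m : sq (F n - F m). Proof. exact: (si_B S). Qed.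

Let far n m : (n <= m)%N -> nrm (F n - F m) <= 2 * 2^-1 ^+ n.
Proof.
(* The subtracted tail makes the induction on [m - n] close, since one more step costs [2^-1 ^+ m =
   2 * 2^-1 ^+ m - 2 * 2^-1 ^+ m.+1]. *)
move=> nm; suff : nrm (F n - F m) <= 2 * 2^-1 ^+ n - 2 * 2^-1 ^+ m.
  by move=> /le_trans; apply; rewrite gerBl mulr_ge0// exprn_ge0.
rewrite -(subnK nm); elim: (m - n)%N => [|k IH].
  by rewrite add0n !subrr /si_norm (si_zerol S) ?sqrtr0//; exact: (si_0 S (hF n)).
rewrite addSn; have -> : F n - F (k + n).+1 = (F n - F (k + n)%N) - (F (k + n).+1 - F (k + n)%N).
  by rewrite opprB addrA subrK.
apply: (le_trans (si_norm_sub S (hd _ _) (hd _ _))); apply: (le_trans (lerD IH (dF _))).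
by rewrite exprS; move: (2^-1 ^+ n) (2^-1 ^+ (k + n)) => a b; lra.
Qed.

(** The squared increments have integral at most [(2^-1 ^+ n) ^+ 2], so the weight [2 ^+ n] leaves a
    series with finite integral. The weight also bounds the increment itself by
    [(b n x + 2^-1 ^+ n) / 2], through the arithmetic-geometric inequality, whence absolute
    convergence wherever the series of the [b n] is finite. *)
Let b n x : R := 2 ^+ n * (F n.+1 - F n) x ^+ 2.

Let mb n : measurable_fun D (b n).
Proof. by apply: measurable_funM => //; apply: measurable_funX; have [] := hd n.+1 n. Qed.

Let b0 n x : 0 <= b n x.
Proof. by apply: mulr_ge0; [exact: exprn_ge0|exact: sqr_ge0]. Qed.

Let ib n : (\int[mu]_(x in D) (b n x)%:E <= (2^-1 ^+ n)%:E)%E.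
Proof.
have -> : (\int[mu]_(x in D) (b n x)%:E = (2 ^+ n)%:E * \int[mu]_(x in D) ((F n.+1 - F n) x ^+ 2)%:E)%E.
  rewrite -ge0_integralZl//.
  - by apply/measurable_EFinP; apply: measurable_funX; have [] := hd n.+1 n.
  - by move=> x _; rewrite lee_fin sqr_ge0.
rewrite sqint_nrm// -EFinM lee_fin.
have h : nrm (F n.+1 - F n) ^+ 2 <= (2^-1 ^+ n) ^+ 2.
  by rewrite ler_sqr ?nnegrE ?exprn_ge0// si_norm_ge0.
apply: (le_trans (ler_wpM2l _ h)); first by rewrite exprn_ge0.
by rewrite expr2 mulrA -exprMn divff// expr1n mul1r.
Qed.

Let sumb : (\int[mu]_(x in D) (\sum_(n <oo) (b n x)%:E) <= 2%:E)%E.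
Proof.
rewrite integral_nneseries//; last first.
- by move=> n x _; rewrite lee_fin.
- by move=> n; exact/measurable_EFinP.
apply: lime_le.
  by apply: is_cvg_nneseries => n _ _; apply: integral_ge0 => x _; rewrite lee_fin.
apply: nearW => n; apply: (@le_trans _ _ (\sum_(0 <= k < n) (2^-1 ^+ k)%:E)%E).
  by apply: lee_sum => k _; exact: ib.
by rewrite sumEFin lee_fin geom_half gerBl mulr_ge0// exprn_ge0.
Qed.

Let aeb : {ae mu, forall x, D x -> (\sum_(n <oo) (b n x)%:E)%E \is a fin_num}.
Proof.
apply: integrable_ae => //; apply/integrableP; split.
  by apply: ge0_emeasurable_sum => [n x Dx _|n _]; [rewrite lee_fin|exact/measurable_EFinP].
under eq_integral => x _.
  rewrite gee0_abs; last by apply: nneseries_ge0 => n _ _; rewrite lee_fin.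
  over.
by apply: (le_lt_trans sumb); rewrite ltry.
Qed.

Let cvgF x : (\sum_(n <oo) (b n x)%:E)%E \is a fin_num -> cvgn (F ^~ x).
Proof.
move=> fx; set M := fine (\sum_(n <oo) (b n x)%:E)%E.
have bM n : \sum_(0 <= k < n) b k x <= M.
  rewrite -lee_fin fineK// -sumEFin; apply: nneseries_lim_ge => k _ _.
  by rewrite lee_fin.
have c : cvgn (series (fun k => F k.+1 x - F k x)).
  apply: normed_cvg; apply: nondecreasing_is_cvgn.
    apply: (@nondecreasing_series _ (fun k => `|F k.+1 x - F k x|) xpredT 0%N) => k _ _.
    exact: normr_ge0.
  exists ((M + 2) / 2) => _ [n _ <-]; rewrite /series /=.
  have : \sum_(0 <= k < n) `|F k.+1 x - F k x| <= \sum_(0 <= k < n) (b k x + 2^-1 ^+ k) / 2.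
    apply: ler_sum => k _; rewrite /b; set a := (F k.+1 - F k) x.
    have -> : F k.+1 x - F k x = a by [].
    have e : 2 ^+ k * 2^-1 ^+ k = 1 :> R by rewrite -exprMn divff// expr1n.
    have p : 0 < (2 : R) ^+ k by rewrite exprn_gt0.
    have q : 0 < (2^-1 : R) ^+ k by rewrite exprn_gt0.
    have h : 0 <= (2 ^+ k * `|a| - 1) ^+ 2 by exact: sqr_ge0.
    have h2 : 0 <= 2^-1 ^+ k * (2 ^+ k * `|a| - 1) ^+ 2 by rewrite mulr_ge0// ltW.
    rewrite -[a ^+ 2](@real_normK R) ?num_real//.
    have e2 : 2^-1 ^+ k * (2 ^+ k * `|a| - 1) ^+ 2 =
      (2 ^+ k * 2^-1 ^+ k) * (2 ^+ k * `|a| ^+ 2) - 2 * (2 ^+ k * 2^-1 ^+ k) * `|a| + 2^-1 ^+ k by ring.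
    by move: h2; rewrite e2 e; lra.
  move=> h; apply: (le_trans h); rewrite -mulr_suml big_split /=.
  apply: ler_wpM2r; first by rewrite invr_ge0.
  apply: lerD; first exact: bM.
  by rewrite geom_half gerBl mulr_ge0// exprn_ge0.
rewrite (_ : F ^~ x = fun n => F 0%N x + series (fun k => F k.+1 x - F k x) n).
  by apply: is_cvgD => //; exact: is_cvg_cst.
by apply/funext => n; rewrite /series /= telescope_sumr// addrC subrK.
Qed.

(** Pointwise limits exist almost everywhere by [cvgF]. Fatou's lemma in [m], with [n] fixed,
    transfers the bound of [far] to the limit, and thereby proves that the limit is square
    integrable. *)
Lemma riesz_fischer : exists2 G : X -> R, sq G & forall n, nrm (F n - G) <= 2 * 2^-1 ^+ n.
Proof.
have [N [mN N0 sN]] := aeb; pose D' := D `\` N.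
have mD' : measurable D' by exact: measurableD.
have cD' x : D' x -> cvgn (F ^~ x).
  move=> [Dx nN]; apply: cvgF; apply: contrapT => h; apply: nN; apply: sN => /= k.
  by apply: h; exact: k.
have aD' : {ae mu, forall x, D x -> D' x}.
  exists N; split => // x /= /not_implyP [Dx nD]; apply: contrapT => nN.
  by apply: nD; split.
have D'D : D' `<=` D by move=> x [].
pose G := (fun x => limn (F ^~ x)) \_ D'.
have mG : measurable_fun setT G.
  apply/(measurable_restrictT _ mD').
  apply: (@measurable_fun_cvg _ _ _ _ (fun n => F n)); last by move=> x /cD'.
  by move=> n; apply: measurable_funS D'D _ => //; have [] := hF n.
have cG x : D' x -> F n x @[n --> \oo] --> G x.
  by move=> Dx; rewrite /G patchE mem_set//; exact: cD'.
have bnd n : (\int[mu]_(x in D) ((F n x - G x) ^+ 2)%:E <= ((2 * 2^-1 ^+ n) ^+ 2)%:E)%E.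
  pose f m := (fun x => ((F n x - F m x) ^+ 2)%:E) \_ D'.
  have mdif m : measurable_fun D (fun x => ((F n x - F m x) ^+ 2)%:E).
    by apply/measurable_EFinP; apply: measurable_funX; have [] := hd n m.
  have mf m : measurable_fun D (f m).
    apply/(measurable_restrict _ mD' mD); exact: measurable_funS (mdif m).
  have f0 m x : D x -> (0 <= f m x)%E.
    by move=> _; rewrite /f patchE; case: ifPn => // _; rewrite lee_fin sqr_ge0.
  pose g := (fun x => ((F n x - G x) ^+ 2)%:E) \_ D'.
  have mdG : measurable_fun D (fun x => ((F n x - G x) ^+ 2)%:E).
    apply/measurable_EFinP; apply: measurable_funX; apply: measurable_funB; first by have [] := hF n.
    exact: measurable_funTS.
  have -> : (\int[mu]_(x in D) ((F n x - G x) ^+ 2)%:E = \int[mu]_(x in D) g x)%E.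
    apply: ae_eq_integral => //.
      by apply/(measurable_restrict _ mD' mD); exact: measurable_funS mdG.
    by move: aD'; apply: ae_imp => x h Dx; rewrite /g patchE mem_set//; exact: h.
  have -> : (\int[mu]_(x in D) g x = \int[mu]_(x in D) (limn_einf (f ^~ x)))%E.
    apply: eq_integral => x _.
    have c : f m x @[m --> \oo] --> g x.
      rewrite /g /f; under eq_fun do rewrite patchE; rewrite patchE.
      case: ifPn => [/set_mem D'x|_]; last exact: cvg_cst.
      apply: cvg_EFin; first exact: nearW.
      have c1 : F n x - F m x @[m --> \oo] --> F n x - G x by apply: cvgB; [exact: cvg_cst|exact: cG].
      by under eq_fun do rewrite /= expr2; exact: (cvgM c1 c1).
    by rewrite (cvg_limn_einf_sup c).1.
  apply: (le_trans (fatou mu mD mf f0)); apply: (@limn_einf_le _ _ n) => m nm.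
  apply: (@le_trans _ _ (\int[mu]_(x in D) ((F n - F m) x ^+ 2)%:E)%E).
    apply: ge0_le_integral; [exact: mD|exact: f0|exact: mf|exact: mdif|].
    move=> x Dx; rewrite /f patchE; case: ifPn => // _.
    by rewrite lee_fin sqr_ge0.
  rewrite sqint_nrm// lee_fin ler_sqr ?nnegrE ?mulr_ge0 ?exprn_ge0 ?si_norm_ge0//.
  exact: far.
have sd n : sq (F n - G).
  have m : measurable_fun D (F n - G).
    by apply: measurable_funB; [have [] := hF n|exact: measurable_funTS].
  split=> //; apply/integrableP; split; first by apply/measurable_EFinP; exact: measurable_funX.
  under eq_integral do rewrite gee0_abs ?lee_fin ?sqr_ge0//.
  by apply: (le_lt_trans (bnd n)); rewrite ltry.
exists G => [|n].
  by rewrite -[G](subKr (F 0%N)); exact: (si_B S).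
rewrite -ler_sqr ?nnegrE ?mulr_ge0 ?exprn_ge0 ?si_norm_ge0// -lee_fin -sqint_nrm//.
exact: bnd.
Qed.

End RieszFischer.

(** * Weak time derivatives seen through a functional *)

Section WeakScalar.
Context {R : realType} {V : lmodType R}.
Local Notation mu1 := (@lebesgue_measure R).
Variables (B : set V) (nrm : V -> R) (T : R).
Hypothesis B0 : B 0.
Hypothesis BD : forall (a : R) x y, B x -> B y -> B (a *: x + y).
Hypothesis nrm0 : forall x, 0 <= nrm x.
Variables (ell : V -> R) (K : R).
Hypothesis K0 : 0 < K.
Hypothesis ell_lin : forall (a : R) x y, B x -> B y -> ell (a *: x + y) = a * ell x + ell y.
Hypothesis ell_bnd : forall x, B x -> `|ell x| <= K * nrm x.

Let ell0 : ell 0 = 0.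
Proof. by have := ell_lin 1 B0 B0; rewrite scaler0 addr0; lra. Qed.

(** Only the multiple is known to be in [B]: for [a != 0] one divides, and for [a = 0] both sides
    are 0 whatever [x] is. *)
Let ellZ (a : R) x : B (a *: x) -> ell (a *: x) = a * ell x.
Proof.
move=> Bx; have [->|a0] := eqVneq a 0; first by rewrite scale0r ell0 mul0r.
have Bx' : B x.
  have := BD a^-1 Bx B0; rewrite addr0 scalerA mulVf// scale1r; exact.
by have := ell_lin a Bx' B0; rewrite ell0 !addr0.
Qed.

Lemma Rintegral_ae (D : set R) (f g : R -> R) : measurable D ->
  measurable_fun D f -> measurable_fun D g ->
  {ae mu1, forall t, D t -> f t = g t} ->
  \int[mu1]_(t in D) f t = \int[mu1]_(t in D) g t.
Proof.
move=> mD mf mg e; rewrite /Rintegral; congr fine; apply: ae_eq_integral => //.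
- exact/measurable_EFinP.
- exact/measurable_EFinP.
- by move: e; apply: ae_imp => t h Dt; rewrite h.
Qed.

(** The weak derivative provides integrals of products [phi t *: g t] only, so [g t] is known to lie
    in [B] just where [phi t] is nonzero, and [h] stands for the product itself. *)
Lemma weak_scalar (f g : R -> V) (phi : R -> R) :
  is_weak_time_derivative B nrm T f g -> test_function_time T phi ->
  measurable_fun (time_itv T) (ell \o f) ->
  exists h : R -> R, [/\ measurable_fun setT h, mu1.-integrable (time_itv T) (EFin \o h),
    {ae mu1, forall t, time_itv T t -> h t = phi t * ell (g t)},
    {ae mu1, forall t, time_itv T t -> phi t != 0 -> B (g t)} &
    \int[mu1]_(t in time_itv T) (derive1 phi t * ell (f t)) = - \int[mu1]_(t in time_itv T) h t].
Proof.
move=> wd tp mf; have [v b1 b2] := wd _ tp.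
have mT : measurable (time_itv T) by exact: measurable_itv.
have inB (F : R -> V) w : is_bochner_integral B nrm T F w -> {ae mu1, forall t, time_itv T t -> B (F t)}.
  by move=> [[h _] _ _]; move: h; apply: ae_imp => t h tT; apply: h; move: tT; rewrite /time_itv /= in_itv.
have [h1 [m1 i1 a1 e1]] := bochner_scalar B0 BD K0 nrm0 ell_lin ell_bnd b1.
have [h2 [m2 i2 a2 e2]] := bochner_scalar B0 BD K0 nrm0 ell_lin ell_bnd b2.
exists h2; split => //.
  by move: a2 (inB _ _ b2); apply: ae_imp2 => t q1 q2 tT; rewrite q1// ellZ//; exact: q2.
  move: (inB _ _ b2); apply: ae_imp => t h tT p0.
  by have := BD (phi t)^-1 (h tT) B0; rewrite addr0 scalerA mulVf// scale1r; exact.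
have Bv : B v by have [] := b1.
have ellN : ell (- v) = - ell v.
  by rewrite -scaleN1r ellZ ?mulN1r//; have := BD (-1) Bv B0; rewrite addr0.
rewrite e2 ellN opprK -e1.
apply: Rintegral_ae => //.
- apply: measurable_funM => //; apply: measurable_funTS; apply: continuous_measurable_fun.
  move=> x; apply: differentiable_continuous; apply/derivable1_diffP.
  by have [d _ _] := tp; have := d 1%N x.
- exact: measurable_funTS.
by move: a1 (inB _ _ b1); apply: ae_imp2 => t q1 q2 tT; rewrite q1// ellZ//; exact: q2.
Qed.

End WeakScalar.

(** * The abstract energy estimate *)
Section Gronwall.
Context {R : realType}.

(** The dissipation [d] is accumulated along with [y]: since [1 + a >= 1], multiplying the past by
    this factor keeps the dissipation already collected, and [1 + a <= exp a] yields the
    exponential. *)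
Lemma discrete_gronwall (y d a c : nat -> R) N :
  (forall n, 0 <= y n) -> (forall n, 0 <= d n) -> (forall n, 0 <= a n) -> (forall n, 0 <= c n) ->
  (forall n, (n < N)%N -> y n.+1 + d n.+1 <= (1 + a n) * y n + c n) ->
  forall m, (m <= N)%N -> y m + \sum_(0 <= n < m) d n.+1 <=
    expR (\sum_(0 <= n < m) a n) * (y 0%N + \sum_(0 <= n < m) c n).
Proof.
move=> y0 d0 a0 c0 step; elim=> [_|m IH mN].
  by rewrite !big_nil !addr0 expR0 mul1r.
have {}IH := IH (ltnW mN); have h := step m mN.
pose S := \sum_(0 <= n < m) d n.+1; pose C := \sum_(0 <= n < m) c n.
pose E := expR (\sum_(0 <= n < m) a n); pose ea := expR (a m).
have -> : \sum_(0 <= n < m.+1) d n.+1 = S + d m.+1 by exact: big_nat_recr.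
have -> : \sum_(0 <= n < m.+1) c n = C + c m by exact: big_nat_recr.
have -> : expR (\sum_(0 <= n < m.+1) a n) = E * ea by rewrite /E /ea -expRD; congr expR; exact: big_nat_recr.
have S0 : 0 <= S by apply: sumr_ge0 => i _.
have C0 : 0 <= C by apply: sumr_ge0 => i _.
have eae : 1 + a m <= ea by exact: expR_ge1Dx.
have E1 : 1 <= E by rewrite -expR0 ler_expR sumr_ge0.
have am := a0 m; have ym := y0 m; have cm := c0 m; have y00 := y0 0%N.
rewrite -/S -/C -/E in IH; move: S C E ea S0 C0 eae E1 IH => S C E ea S0 C0 eae E1 IH.
have h1 : (1 + a m) * (y m + S) <= ea * (E * (y 0%N + C)).
  by apply: ler_pM => //; lra.
have h2 : c m <= E * ea * c m by rewrite ler_peMl// mulr_ege1//; lra.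
have h3 : 0 <= a m * S by exact: mulr_ge0.
by move: h1 h2 h3 h; lra.
Qed.

Lemma young (e p q : R) : 0 < e -> p * q <= e * p ^+ 2 + q ^+ 2 / (4 * e).
Proof.
move=> e0; rewrite -subr_ge0.
have -> : e * p ^+ 2 + q ^+ 2 / (4 * e) - p * q = e * (p - q / (2 * e)) ^+ 2.
  by field; rewrite gt_eqF.
by rewrite mulr_ge0 ?sqr_ge0// ltW.
Qed.

(** This is the remainder of [error_step]: [P] is the gradient norm of the new errors, [s] the mixed
    norm of the old ones, [r] the new error of the auxiliary variable. The squares of [P] and [r]
    are to be absorbed on the left, hence their prescribed coefficients. *)
Lemma young_terms (dlt T Kc : R) : 0 < dlt -> 0 < T -> 0 <= Kc -> exists2 K3, 0 <= K3 &
  forall P s r om tau : R, 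
  Kc * (P * s + P * s ^+ 2 + P * om + r * s + r * om + r * tau + s ^+ 2 + s * om + om ^+ 2) <=
  dlt * P ^+ 2 + r ^+ 2 / T + K3 * (s ^+ 2 + s ^+ 4 + om ^+ 2 + tau ^+ 2).
Proof.
(* Three products contain [P] and three contain [r], so each of them may spend a third of [dlt],
   respectively of [1 / T]. *)
move=> d0 T0 Kc0; pose k1 := Kc ^+ 2 / (4 * (dlt / 3)); pose k2 := Kc ^+ 2 / (4 * ((3 * T)^-1)).
have k10 : 0 <= k1 by rewrite divr_ge0 ?sqr_ge0// mulr_ge0// divr_ge0// ltW.
have k20 : 0 <= k2 by rewrite divr_ge0 ?sqr_ge0// mulr_ge0// invr_ge0 mulr_ge0// ltW.
exists (k1 + k2 + 2 * Kc) => [|P s r om tau]; first by rewrite !addr_ge0// mulr_ge0.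
have y1 x : Kc * (P * x) <= dlt / 3 * P ^+ 2 + k1 * x ^+ 2.
  have -> : Kc * (P * x) = P * (Kc * x) by ring.
  have d3 : 0 < dlt / 3 by rewrite divr_gt0.
  rewrite (_ : k1 * x ^+ 2 = (Kc * x) ^+ 2 / (4 * (dlt / 3))); first exact: young.
  by rewrite /k1 exprMn [RHS]mulrAC.
have y2 x : Kc * (r * x) <= (3 * T)^-1 * r ^+ 2 + k2 * x ^+ 2.
  have -> : Kc * (r * x) = r * (Kc * x) by ring.
  have d3 : 0 < (3 * T)^-1 by rewrite invr_gt0 mulr_gt0.
  rewrite (_ : k2 * x ^+ 2 = (Kc * x) ^+ 2 / (4 * (3 * T)^-1)); first exact: young.
  by rewrite /k2 exprMn [RHS]mulrAC.
have y3 : Kc * (s * om) <= Kc * (s ^+ 2 + om ^+ 2).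
  by apply: ler_wpM2l => //; have := sqr_ge0 (s - om); have := sqr_ge0 (s + om); rewrite sqrrB sqrrD; lra.
have e4 : s ^+ 4 = (s ^+ 2) ^+ 2 by rewrite -exprM.
have eT : (3 * T)^-1 * r ^+ 2 = r ^+ 2 / T / 3 by field; rewrite gt_eqF.
have := y1 s; have := y1 (s ^+ 2); have := y1 om; have := y2 s; have := y2 om; have := y2 tau.
rewrite -e4 eT; move: y3.
have p1 : 0 <= k1 * tau ^+ 2 by rewrite mulr_ge0 ?sqr_ge0.
have p2 : 0 <= k2 * s ^+ 4 by rewrite e4 mulr_ge0 ?sqr_ge0.
have p3 : 0 <= Kc * tau ^+ 2 by rewrite mulr_ge0 ?sqr_ge0.
have p4 : 0 <= Kc * s ^+ 4 by rewrite e4 mulr_ge0 ?sqr_ge0.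
have p5 : 0 <= Kc * s ^+ 2 by rewrite mulr_ge0 ?sqr_ge0.
have p6 : 0 <= Kc * om ^+ 2 by rewrite mulr_ge0 ?sqr_ge0.
by move: (r ^+ 2 / T) p1 p2 p3 p4 p5 p6 => x; lra.
Qed.

End Gronwall.

(** Bookkeeping on unrelated reals, so that [lra] meets only short atoms. The terms [th * bb] and
    [th * bw] of the two field equations cancel those of the auxiliary equation, and [8 * nur * iW]
    from the curl is cancelled by the zero-order term. *)
Lemma assemble (R : realType) (tau nu nur jj c1 th : R)
  (dU du gU gu cW cw bb b0 dW dw gW gw iW iw cU cu bw bw0 b1 b2 : R)
  (ie' ie iff S1 S3 C0 C1 x0 x9 x10 r2 r2' : R) :
  dU + tau * ((1 + th) * bb + (nu + nur) * gU) = tau * (2 * nur * cW) ->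
  jj * dW + tau * (jj * (1 + th) * bw + c1 * gW + 4 * nur * iW) = tau * (2 * nur * cU) ->
  - (tau * C0) <= du + tau * (b0 + (nu + nur) * gu - 2 * nur * cw) ->
  - (tau * C0) <= jj * dw + tau * (jj * bw0 + c1 * gw + 4 * nur * iw - 2 * nur * cu) ->
  - (tau * C1) <= x9 ->
  tau * (- (bb - b0)) <= tau * S1 ->
  tau * (jj * (- (bw - bw0))) <= tau * (jj * S1) ->
  tau * (th * (b1 + jj * b2)) <= tau * S3 ->
  tau * nur * (4 * (cW - cw)) <= tau * nur * ((gU - gu) + 8 * iff) ->
  tau * nur * (4 * (cU - cu)) <= tau * nur * ((gU - gu) + 8 * (iW - iw)) ->
  jj * ((iW - iw) - iff) <= jj * (2 * (dW - dw)) ->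
  r2' - r2 <= 2 * x10 ->
  ie' - ie <= 2 * (dU - du) ->
  x10 + x0 = tau * (th * (bb + b1 + jj * (bw + b2))) - x9 ->
  ie' + jj * (iW - iw) + r2' + 2 * tau * (nu * (gU - gu) + c1 * (gW - gw)) + 2 * x0
  <= ie + jj * iff + r2 + 8 * nur * tau * iff + tau * (2 * ((1 + jj) * S1 + S3 + 2 * C0 + C1)).
Proof. by lra. Qed.

Lemma assemble_closed (R : realType) (tau nur y y' ge' x0 X iff iee d2 PP rT K3 K4 s2 s4 om2 tau2 D q L I S : R) :
  y' + 2 * tau * ge' + 2 * x0 <= y + 8 * nur * tau * iff + tau * X ->
  tau * X <= tau * (d2 * PP + rT + K3 * (s2 + s4 + om2 + tau2)) ->
  tau * rT = x0 -> tau * (d2 * PP) <= tau * ge' ->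
  tau * (K3 * s2) <= tau * (d2 * D + q * I) ->
  tau * (K3 * s4) <= tau * (8 * K3 * (I * D)) ->
  I = iee + iff -> 0 <= tau * nur * iee ->
  tau * (L * ((1 + D) * I)) <= tau * (K4 * ((1 + D) * y)) ->
  tau * ((8 * nur + q) * I + 8 * K3 * (I * D)) <= tau * (L * ((1 + D) * I)) ->
  tau * (d2 * D) <= S -> 0 <= tau * (K3 + K4) * (1 + D) * S -> 0 <= tau * K3 * (1 + D) * y ->
  0 <= tau * K4 * (om2 + tau2) ->
  y' + tau / 2 * ge' + (tau / 2 * ge' + x0) <=
  (1 + tau * (K3 + K4) * (1 + D)) * (y + S) + tau * (K3 + K4) * (om2 + tau2).
Proof. by move=> h1 h2 h3 h4 h5 h6 eI; subst I; lra. Qed.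

(** * Stability and error recursion for abstract forms *)

Section Energy.
Context {R : realType} {V : lmodType R}.
(** To be read as H^1_0 fields ([H]), solenoidal planar fields ([A]) and axial fields ([Z]), with
    the L^2 product [ip], the gradient product [g], the curl form [c] and the convection form [b],
    whose first argument transports the second. *)
Variables (H A Z : set V) (ip g c : V -> V -> R) (b : V -> V -> V -> R).
Hypothesis ip_si : semi_inner H ip.
Hypothesis g_si : semi_inner H g.
Hypothesis AH : A `<=` H.
Hypothesis ZH : Z `<=` H.
Hypothesis AB : forall u v, A u -> A v -> A (u - v).
Hypothesis ZB : forall u v, Z u -> Z v -> Z (u - v).
Local Notation nn := (si_norm ip).
Local Notation gn := (si_norm g).

(* Ladyzhenskaya: up to a constant, a bound of the L^4 norm in dimension two. *)
Definition mix u : R := Num.sqrt (nn u * gn u).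

(** [kp] is the square root of a Poincaré constant, so that [mix_le] has the plain constant [kp]. *)
Variables (kp Kb : R).
Hypothesis kp0 : 0 <= kp.
Hypothesis Kb0 : 0 <= Kb.
Hypothesis poinc : forall u, H u -> nn u <= kp ^+ 2 * gn u.
Hypothesis b_bnd : forall u v w, H u -> H v -> H w -> `|b u v w| <= Kb * (gn v * (mix u * mix w)).
Hypothesis bB1 : forall u u' v w, H u -> H u' -> H v -> H w -> b (u - u') v w = b u v w - b u' v w.
Hypothesis bB2 : forall u v v' w, H u -> H v -> H v' -> H w -> b u (v - v') w = b u v w - b u v' w.
Hypothesis bB3 : forall u v w w', H u -> H v -> H w -> H w' -> b u v (w - w') = b u v w - b u v w'.
Hypothesis b_skew : forall u v w, A u -> H v -> H w -> b u v w = - b u w v.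
Hypothesis cB : forall u u' w, H u -> H u' -> H w -> c (u - u') w = c u w - c u' w.
Hypothesis c_sym : forall u w, H u -> H w -> c u w = c w u.
Hypothesis c_CS : forall u w, H u -> H w -> c u w ^+ 2 <= 2 * g u u * ip w w.

Variables (T nu nur jj c1 : R).
Hypothesis T0 : 0 < T.
Hypothesis nu_gt0 : 0 < nu.
Hypothesis nur_gt0 : 0 < nur.
Hypothesis jj_gt0 : 0 < jj.
Hypothesis c1_gt0 : 0 < c1.

Lemma mix_ge0 u : 0 <= mix u. Proof. exact: sqrtr_ge0. Qed.

Lemma mix_sqr u : mix u ^+ 2 = nn u * gn u.
Proof. by rewrite sqr_sqrtr// mulr_ge0 ?si_norm_ge0. Qed.

Lemma mix_le u : H u -> mix u <= kp * gn u.
Proof.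
move=> Hu; have g0 := si_norm_ge0 g u.
rewrite -ler_sqr ?nnegrE ?mix_ge0 ?mulr_ge0// mix_sqr exprMn [gn u ^+ 2]expr2 mulrA.
by apply: ler_wpM2r => //; exact: poinc.
Qed.

Lemma si_half u v : H u -> H v -> ip u u - ip v v <= 2 * ip (u - v) u.
Proof.
move=> Hu Hv; have h := si_ge0 ip_si (si_B ip_si Hu Hv).
move: h; rewrite (si_sqrB ip_si)// (si_sub ip_si)// (si_sym ip_si v u); lra.
Qed.

(** [(g + 8 ip) ^ 2 >= 32 g ip], which is 16 times the bound of [c ^ 2]. The weights fit the scheme:
    in twice the energy identity, the two couplings together cost [2 nur g], the share of [nur] in
    the viscosity, and the implicit one costs [8 nur ip], exactly the zero-order term. *)
Lemma c_young u w : H u -> H w -> 4 * c u w <= g u u + 8 * ip w w.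
Proof.
move=> Hu Hw; have gu := si_ge0 g_si Hu; have iw := si_ge0 ip_si Hw.
have h := c_CS Hu Hw.
apply: (le_trans (ler_norm _)); rewrite -ler_sqr ?nnegrE ?addr_ge0 ?mulr_ge0// real_normK ?num_real//.
have := sqr_ge0 (g u u - 8 * ip w w); rewrite exprMn; move: h; lra.
Qed.

(** The convection terms cancel against the equation of [Q] multiplied by [Q']. What is not absorbed
    is the curl of the old [W], treated explicitly: it costs [8 nur tau ip W W], whence the growth
    factor. *)
Lemma stability_step U U' W W' (tau kap Q Q' : R) : A U -> A U' -> Z W -> Z W' -> 0 <= tau ->
  ip (U' - U) U' + tau * (kap * b U U U' + (nu + nur) * g U' U') = tau * (2 * nur * c W U') ->
  jj * ip (W' - W) W' + tau * (jj * kap * b U W W' + c1 * g W' W' + 4 * nur * ip W' W')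
    = tau * (2 * nur * c U' W') ->
  Q' * (Q' - Q) + tau / T * Q' ^+ 2 = tau * kap * (b U U U' + jj * b U W W') ->
  (ip U' U' + jj * ip W' W' + Q' ^+ 2) + 2 * tau * (nu * g U' U' + c1 * g W' W')
    <= (1 + 8 * nur / jj * tau) * (ip U U + jj * ip W W + Q ^+ 2).
Proof.
move=> /AH HU /AH HU' /ZH HW /ZH HW' tau0 e1 e2 e3.
have y1 := c_young HU' HW; have y2 := c_young HU' HW'.
rewrite (c_sym HW HU') in e1.
have h1 := si_half HU' HU; have h2 := si_half HW' HW.
have h2j : jj * (ip W' W' - ip W W) <= jj * (2 * ip (W' - W) W') by rewrite ler_wpM2l// ltW.
have tn : 0 <= tau * nur by rewrite mulr_ge0// ltW.
have y1t : tau * nur * (4 * c U' W) <= tau * nur * (g U' U' + 8 * ip W W) by apply: ler_wpM2l.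
have y2t : tau * nur * (4 * c U' W') <= tau * nur * (g U' U' + 8 * ip W' W') by apply: ler_wpM2l.
have q0 : 0 <= tau / T * Q' ^+ 2 by rewrite mulr_ge0 ?sqr_ge0// divr_ge0// ltW.
have q1 : Q' ^+ 2 - Q ^+ 2 <= 2 * (Q' * (Q' - Q)) by have := sqr_ge0 (Q' - Q); rewrite sqrrB; lra.
have eW : 8 * nur / jj * tau * (jj * ip W W) = 8 * (tau * nur * ip W W) by field; rewrite gt_eqF.
have p1 : 0 <= 8 * nur / jj * tau * ip U U.
  by rewrite mulr_ge0 ?(si_ge0 ip_si)// mulr_ge0// divr_ge0 ?mulr_ge0 ?ltW.
have p2 : 0 <= 8 * nur / jj * tau * Q ^+ 2.
  by rewrite mulr_ge0 ?sqr_ge0// mulr_ge0// divr_ge0 ?mulr_ge0 ?ltW.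
have -> : (1 + 8 * nur / jj * tau) * (ip U U + jj * ip W W + Q ^+ 2) = ip U U + jj * ip W W + Q ^+ 2
    + 8 * nur / jj * tau * ip U U + 8 * (tau * nur * ip W W) + 8 * nur / jj * tau * Q ^+ 2.
  by rewrite -eW; ring.
move: (8 * nur / jj * tau * ip U U) (8 * nur / jj * tau * Q ^+ 2) p1 p2 => x1 x2 p1 p2.
move: (tau / T * Q' ^+ 2) q0 e3 => x3 q0 e3.
move: e1 e2 e3 h1 h2j y1t y2t q1; lra.
Qed.

Lemma stability (N : nat) (tau : R) (U W : nat -> V) (Q kap : nat -> R) :
  0 <= tau -> N%:R * tau <= T ->
  (forall n, (n <= N)%N -> A (U n) /\ Z (W n)) ->
  (forall n, (n < N)%N -> [/\
    ip (U n.+1 - U n) (U n.+1) + tau * (kap n * b (U n) (U n) (U n.+1) + (nu + nur) * g (U n.+1) (U n.+1))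
      = tau * (2 * nur * c (W n) (U n.+1)),
    jj * ip (W n.+1 - W n) (W n.+1) + tau * (jj * kap n * b (U n) (W n) (W n.+1)
      + c1 * g (W n.+1) (W n.+1) + 4 * nur * ip (W n.+1) (W n.+1)) = tau * (2 * nur * c (U n.+1) (W n.+1)) &
    Q n.+1 * (Q n.+1 - Q n) + tau / T * Q n.+1 ^+ 2
      = tau * kap n * (b (U n) (U n) (U n.+1) + jj * b (U n) (W n) (W n.+1))]) ->
  forall m, (m <= N)%N ->
    Q m ^+ 2 + \sum_(0 <= n < m) 2 * tau * (nu * g (U n.+1) (U n.+1) + c1 * g (W n.+1) (W n.+1))
    <= expR (8 * nur / jj * T) * (ip (U 0%N) (U 0%N) + jj * ip (W 0%N) (W 0%N) + Q 0%N ^+ 2).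
Proof.
move=> tau0 NT hA hs m mN.
have ip0 n : (n <= N)%N -> 0 <= ip (U n) (U n) + jj * ip (W n) (W n).
  move=> nN; have [/AH a /ZH z] := hA n nN.
  by rewrite addr_ge0 ?(si_ge0 ip_si)// mulr_ge0 ?(si_ge0 ip_si)// ltW.
(* Set to 0 beyond [N], where nothing is known, because Gronwall's lemma asks for nonnegativity at
   every index. *)
pose y n := if (n <= N)%N then ip (U n) (U n) + jj * ip (W n) (W n) + Q n ^+ 2 else 0.
pose d n := if (n <= N)%N then 2 * tau * (nu * g (U n) (U n) + c1 * g (W n) (W n)) else 0.
have y0 n : 0 <= y n by rewrite /y; case: ifP => // nN; rewrite addr_ge0 ?sqr_ge0// ip0.
have d0 n : 0 <= d n.
  rewrite /d; case: ifP => // nN; have [/AH a /ZH z] := hA n nN.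
  by rewrite mulr_ge0 ?mulr_ge0// addr_ge0// mulr_ge0 ?(si_ge0 g_si)// ltW.
have k0 : 0 <= 8 * nur / jj by rewrite divr_ge0 ?mulr_ge0// ltW.
have a0 (n : nat) : 0 <= 8 * nur / jj * tau by rewrite mulr_ge0.
have c0 (n : nat) : 0 <= (0 : R) by [].
have st n : (n < N)%N -> y n.+1 + d n.+1 <= (1 + 8 * nur / jj * tau) * y n + 0.
  move=> nN; rewrite /y /d nN (ltnW nN) addr0; have [h1 h2 h3] := hs n nN.
  have [a z] := hA n (ltnW nN); have [a' z'] := hA n.+1 nN.
  exact: (stability_step a a' z z' tau0 h1 h2 h3).
have gr := discrete_gronwall y0 d0 a0 c0 st mN.
have eE : expR (\sum_(0 <= n < m) 8 * nur / jj * tau) <= expR (8 * nur / jj * T).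
  rewrite ler_expR sumr_const_nat subn0 -[leLHS]mulr_natr -[leLHS]mulrA; apply: ler_wpM2l => //.
  apply: le_trans NT; rewrite mulrC; apply: ler_wpM2r => //; by rewrite ler_nat.
rewrite (_ : \sum_(0 <= n < m) 2 * tau * _ = \sum_(0 <= n < m) d n.+1); last first.
  by apply: eq_big_nat => n /andP[_ nm]; rewrite /d (leq_trans nm mN).
apply: (@le_trans _ _ (y m + \sum_(0 <= n < m) d n.+1)).
  by rewrite lerD2r /y mN lerDr ip0.
have z : \sum_(0 <= n < m) (0 : R) = 0 by rewrite big1.
rewrite z addr0 in gr; apply: (le_trans gr).
have ey : y 0%N = ip (U 0%N) (U 0%N) + jj * ip (W 0%N) (W 0%N) + Q 0%N ^+ 2 by rewrite /y leq0n.
by rewrite -ey; apply: ler_wpM2r.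
Qed.

Section ErrorStep.
Variables (M Rb Ei C0 C1 : R).
Hypothesis M0 : 0 <= M.
Hypothesis Rb0 : 0 <= Rb.
Hypothesis Ei0 : 0 <= Ei.
Hypothesis C00 : 0 <= C0.
Hypothesis C10 : 0 <= C1.

Let K2 := Kb * M * (kp * M + kp ^+ 2 * M + 1 + kp).
Let Kc := 2 * ((1 + jj) * (2 * (Kb * M * kp) + Kb + Ei * K2 + Ei * Rb * K2) + 2 * C0 + C1).

Let K20 : 0 <= K2.
Proof. by rewrite !mulr_ge0// !addr_ge0// ?mulr_ge0// exprn_ge0. Qed.

Let b_le (G x y : R) u v w : H u -> H v -> H w -> gn v <= G -> mix u <= x -> mix w <= y ->
  `|b u v w| <= Kb * (G * (x * y)).
Proof.
move=> hu hv hw h1 h2 h3; apply: (le_trans (b_bnd hu hv hw)).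
apply: ler_wpM2l => //; apply: ler_pM; rewrite ?si_norm_ge0 ?mulr_ge0 ?mix_ge0//.
by apply: ler_pM; rewrite ?mix_ge0.
Qed.

(* Capitals denote numerical fields and lower case letters exact ones. *)
Let convection_error (U u W w z : V) (s P : R) : A U -> A u -> H W -> H w -> H z ->
  mix (U - u) <= s -> mix (W - w) <= s -> gn z <= P -> gn u <= M -> gn w <= M -> 0 <= s ->
  `|b U W z - b u w z| <= 2 * (Kb * M * kp) * (P * s) + Kb * (P * s ^+ 2).
Proof.
move=> aU au hW hw hz m1 m2 gz gu gw s0.
have HU := AH aU; have Hu := AH au; have ae := AB aU au; have He := AH ae; have Hf := si_B ip_si hW hw.
have P0 : 0 <= P by apply: le_trans gz; exact: si_norm_ge0.
(* Skew-symmetry moves the derivative from [W - w] to [z]: gradients fall on exact fields or on the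
   new error [z], and the old errors enter only through [mix]. *)
have -> : b U W z - b u w z = b (U - u) w z - b u z (W - w) - b (U - u) z (W - w).
  have e1 : b (U - u) w z = b U w z - b u w z by exact: bB1.
  have e2 : b u z (W - w) = - (b u W z - b u w z).
    by rewrite -(bB2 (v := W))// (b_skew au hz Hf).
  have e3 : b (U - u) z (W - w) = - (b U (W - w) z - b u (W - w) z).
    by rewrite -(bB1 HU Hu Hf hz) (b_skew ae hz Hf).
  have e4 : b U (W - w) z = b U W z - b U w z by exact: bB2.
  have e5 : b u (W - w) z = b u W z - b u w z by exact: bB2.
  by rewrite e3 e2 e1 e4 e5; ring.
have mz : mix z <= kp * P by apply: (le_trans (mix_le hz)); exact: ler_wpM2l.
have mu : mix u <= kp * M by apply: (le_trans (mix_le Hu)); exact: ler_wpM2l.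
have b1 := b_le He hw hz gw m1 mz.
have b2 := b_le Hu hz Hf gz mu m2.
have b3 := b_le He hz Hf gz m1 m2.
have t1 := ler_normB (b (U - u) w z - b u z (W - w)) (b (U - u) z (W - w)).
have t2 := ler_normB (b (U - u) w z) (b u z (W - w)).
have r1 : Kb * (M * (s * (kp * P))) = Kb * M * kp * (P * s) by ring.
have r2 : Kb * (P * (kp * M * s)) = Kb * M * kp * (P * s) by ring.
have r3 : Kb * (P * (s * s)) = Kb * (P * s ^+ 2) by ring.
rewrite r1 in b1; rewrite r2 in b2; rewrite r3 in b3.
by move: b1 b2 b3 t1 t2; lra.
Qed.

(** Here [w'] is the exact field at the new time. Since [b U w' w' = 0], the form only sees
    [W - w'], that is an error plus an increment: every term is small, although no error occurs
    among the arguments of [b]. *)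
Let aux_error (U u W w w' : V) (s om : R) : A U -> A u -> H W -> H w -> H w' ->
  mix (U - u) <= s -> mix (W - w) <= s -> gn u <= M -> gn w' <= M -> gn (w - w') <= om ->
  0 <= s -> `|b U W w'| <= K2 * (s + om + s ^+ 2 + s * om).
Proof.
move=> aU au hW hw hw' m1 m2 gu gw' gd s0.
have HU := AH aU; have Hu := AH au; have ae := AB aU au; have He := AH ae; have Hf := si_B ip_si hW hw.
have Hd := si_B ip_si hw hw'.
have om0 : 0 <= om by apply: le_trans gd; exact: si_norm_ge0.
have -> : b U W w' = - b u w' (W - w) - b u w' (w - w') - b (U - u) w' (W - w) - b (U - u) w' (w - w').
  have z0 : b U w' w' = 0 by have := b_skew aU hw' hw'; lra.
  have sk : b U W w' = - b U w' W by exact: b_skew.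
  by rewrite !(bB1 (u := U))// !(bB3 (w := W))// !(bB3 (w := w))// sk z0; ring.
have mu : mix u <= kp * M by apply: (le_trans (mix_le Hu)); exact: ler_wpM2l.
have md : mix (w - w') <= kp * om by apply: (le_trans (mix_le Hd)); exact: ler_wpM2l.
have b1 := b_le Hu hw' Hf gw' mu m2.
have b2 := b_le Hu hw' Hd gw' mu md.
have b3 := b_le He hw' Hf gw' m1 m2.
have b4 := b_le He hw' Hd gw' m1 md.
have tri4 (x1 x2 x3 x4 : R) : `|- x1 - x2 - x3 - x4| <= `|x1| + `|x2| + `|x3| + `|x4|.
  have t1 := ler_normB (- x1 - x2 - x3) x4; have t2 := ler_normB (- x1 - x2) x3.
  by have t3 := ler_normB (- x1) x2; rewrite normrN in t3; lra.
apply: (le_trans (tri4 _ _ _ _)).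
apply: (@le_trans _ _ (Kb * (M * (kp * M * s)) + Kb * (M * (kp * M * (kp * om))) +
   Kb * (M * (s * s)) + Kb * (M * (s * (kp * om))))).
  by do 3?[apply: lerD => //].
have KM : 0 <= Kb * M by exact: mulr_ge0.
rewrite (_ : Kb * (M * (kp * M * s)) + _ + _ + _ =
  Kb * M * (kp * M * s + kp ^+ 2 * M * om + s ^+ 2 + kp * (s * om))); last by ring.
rewrite /K2 -[leRHS]mulrA; apply: ler_wpM2l => //.
have a1 : 0 <= kp * M by exact: mulr_ge0.
have a2 : 0 <= kp ^+ 2 * M by rewrite mulr_ge0// exprn_ge0.
have a3 : 0 <= s ^+ 2 by exact: sqr_ge0.
have a4 : 0 <= s * om by exact: mulr_ge0.
move: (kp * M) (kp ^+ 2 * M) (s ^+ 2) (s * om) a1 a2 a3 a4 => x1 x2 x3 x4 a1 a2 a3 a4.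
have q1 : 0 <= x1 * (om + x3 + x4) by rewrite mulr_ge0// !addr_ge0.
have q2 : 0 <= x2 * (s + x3 + x4) by rewrite mulr_ge0// !addr_ge0.
have q3 : 0 <= kp * (s + om + x3) by rewrite mulr_ge0// !addr_ge0.
by move: q1 q2 q3; lra.
Qed.

(** Writing [Q' / E' = 1 + th] with [th = r' / E'], the field equations are tested with the new
    errors and the auxiliary one with [r']. The products of [th] with convection against the errors
    cancel; there remains [th] times convection against the exact fields, which is of second order
    by [aux_error]. *)
Lemma error_step (U U' W W' u u' w w' : V) (tau om Q Q' E E' : R) :
  let e := U - u in let f := W - w in let e' := U' - u' in let f' := W' - w' in
  let r := Q - E in let r' := Q' - E' in
  let s := mix e + mix f in let P := gn e' + gn f' in
  A U -> A U' -> A u -> A u' -> Z W -> Z W' -> Z w -> Z w' -> 0 <= tau ->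
  0 < E' -> E'^-1 <= Ei -> `|r'| <= Rb ->
  gn u <= M -> gn u' <= M -> gn w <= M -> gn w' <= M -> gn (u - u') <= om -> gn (w - w') <= om ->
  ip (U' - U) e' + tau * (Q' / E' * b U U e' + (nu + nur) * g U' e') = tau * (2 * nur * c W e') ->
  `|ip (u' - u) e' + tau * (b u u e' + (nu + nur) * g u' e' - 2 * nur * c w e')| <= C0 * tau * om * gn e' ->
  jj * ip (W' - W) f' + tau * (jj * (Q' / E') * b U W f' + c1 * g W' f' + 4 * nur * ip W' f')
    = tau * (2 * nur * c U' f') ->
  `|jj * ip (w' - w) f' + tau * (jj * b u w f' + c1 * g w' f' + 4 * nur * ip w' f' - 2 * nur * c u' f')|
    <= C0 * tau * om * gn f' ->
  Q' - Q + tau / T * Q' = tau / E' * (b U U U' + jj * b U W W') ->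
  `|E' - E + tau / T * E'| <= C1 * tau ^+ 2 ->
  ip e' e' + jj * ip f' f' + r' ^+ 2 + 2 * tau * (nu * g e' e' + c1 * g f' f') + 2 * (tau / T * r' ^+ 2)
  <= ip e e + jj * ip f f + r ^+ 2 + 8 * nur * tau * ip f f
     + tau * (Kc * (P * s + P * s ^+ 2 + P * om + `|r'| * s + `|r'| * om + `|r'| * tau
                    + s ^+ 2 + s * om + om ^+ 2)).
Proof.
move=> e f e' f' r r' s P aU aU' au au' zW zW' zw zw' tau0 E0 EI rR gu gu' gw gw' gdu gdw.
move=> mom con_u ang con_w qe con_q.
have [HU HU' Hu Hu'] : [/\ H U, H U', H u & H u'] by split; exact: AH.
have [HW HW' Hw Hw'] : [/\ H W, H W', H w & H w'] by split; exact: ZH.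
have ae := AB aU au; have ae' := AB aU' au'; have zf := ZB zW zw; have zf' := ZB zW' zw'.
rewrite -/e in ae; rewrite -/e' in ae'; rewrite -/f in zf; rewrite -/f' in zf'.
have He := AH ae; have He' := AH ae'; have Hf := ZH zf; have Hf' := ZH zf'.
have s0 : 0 <= s by rewrite addr_ge0 ?mix_ge0.
have se : mix e <= s by rewrite lerDl mix_ge0.
have sf : mix f <= s by rewrite lerDr mix_ge0.
have P0 : 0 <= P by rewrite addr_ge0 ?si_norm_ge0.
have Pe : gn e' <= P by rewrite lerDl si_norm_ge0.
have Pf : gn f' <= P by rewrite lerDr si_norm_ge0.
have om0 : 0 <= om by apply: le_trans gdu; exact: si_norm_ge0.
have B1 := convection_error aU au HU Hu He' se se Pe gu gu s0.
have B2 := convection_error aU au HW Hw Hf' se sf Pf gu gw s0.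
have B3 := aux_error aU au HU Hu Hu' se se gu gu' gdu s0.
have B4 := aux_error aU au HW Hw Hw' se sf gu gw' gdw s0.
have i1 : ip (e' - e) e' = ip (U' - U) e' - ip (u' - u) e'.
  by rewrite /e /e' !(si_sub ip_si)//; first ring; try exact: (si_B ip_si).
have i2 : ip (f' - f) f' = ip (W' - W) f' - ip (w' - w) f'.
  by rewrite /f /f' !(si_sub ip_si)//; first ring; try exact: (si_B ip_si).
have i3 : g e' e' = g U' e' - g u' e' by rewrite {1}/e' (si_sub g_si).
have i4 : g f' f' = g W' f' - g w' f' by rewrite {1}/f' (si_sub g_si).
have i5 : ip f' f' = ip W' f' - ip w' f' by rewrite {1}/f' (si_sub ip_si).
have i6 : c f e' = c W e' - c w e' by rewrite /f cB.
have i7 : c e' f' = c U' f' - c u' f' by rewrite /e' cB.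
have i8 : b U U U' = b U U e' + b U U u' by rewrite /e' bB3//; ring.
have i9 : b U W W' = b U W f' + b U W w' by rewrite /f' bB3//; ring.
have i10 := si_half He' He; have i11 := si_half Hf' Hf.
have y1 := c_young He' Hf; have y2 := c_young He' Hf'.
rewrite (c_sym Hf He') in i6.
pose th := r' / E'.
have eth : Q' / E' = 1 + th by rewrite /th /r' mulrBl divff ?gt_eqF//; ring.
rewrite eth in mom ang.
have eq : r' * (r' - r) + tau / T * r' ^+ 2 = tau * (th * (b U U U' + jj * b U W W'))
    - r' * (E' - E + tau / T * E').
  have : r' * (Q' - Q + tau / T * Q') = tau * (th * (b U U U' + jj * b U W W')).
    by rewrite qe /th; ring.
  by rewrite /r' /r => <-; ring.
have thR : `|th| <= Ei * `|r'|.
  by rewrite /th normrM (gtr0_norm (_ : 0 < E'^-1)) ?invr_gt0// mulrC ler_wpM2r.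
pose X := s + om + s ^+ 2 + s * om.
have X0 : 0 <= X by have := sqr_ge0 s; have := mulr_ge0 s0 om0; rewrite /X; lra.
have r0 := normr_ge0 r'.
have Y : `|th * (b U U u' + jj * b U W w')| <=
    (1 + jj) * (Ei * K2 * (`|r'| * s + `|r'| * om) + Ei * Rb * K2 * (s ^+ 2 + s * om)).
  have a1 : `|b U U u' + jj * b U W w'| <= (1 + jj) * (K2 * X).
    apply: (le_trans (ler_normD _ _)); rewrite normrM (gtr0_norm jj_gt0) mulrDl mul1r.
    by apply: lerD => //; apply: ler_wpM2l => //; exact: ltW.
  rewrite normrM; apply: (le_trans (ler_pM (normr_ge0 _) (normr_ge0 _) thR a1)).
  rewrite (_ : Ei * `|r'| * ((1 + jj) * (K2 * X)) = (1 + jj) * (Ei * K2 * (`|r'| * X))); last by ring.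
  apply: ler_wpM2l; first by rewrite addr_ge0// ltW.
  have k : 0 <= Ei * K2 by exact: mulr_ge0.
  have x0 : 0 <= s ^+ 2 + s * om by rewrite addr_ge0 ?sqr_ge0 ?mulr_ge0.
  have : Ei * K2 * (`|r'| * (s ^+ 2 + s * om)) <= Ei * K2 * (Rb * (s ^+ 2 + s * om)).
    by apply: ler_wpM2l => //; exact: ler_wpM2r.
  by rewrite /X; lra.
have D : `|r' * (E' - E + tau / T * E')| <= tau * (C1 * (`|r'| * tau)).
  rewrite normrM; apply: (le_trans (ler_wpM2l r0 con_q)); rewrite le_eqVlt; apply/orP; left; apply/eqP.
  by ring.
have cu : C0 * tau * om * gn e' <= tau * (C0 * (P * om)).
  rewrite (_ : C0 * tau * om * gn e' = tau * (C0 * (gn e' * om))); last by ring.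
  by do 2?[apply: ler_wpM2l => //]; exact: ler_wpM2r.
have cw : C0 * tau * om * gn f' <= tau * (C0 * (P * om)).
  rewrite (_ : C0 * tau * om * gn f' = tau * (C0 * (gn f' * om))); last by ring.
  by do 2?[apply: ler_wpM2l => //]; exact: ler_wpM2r.
have kb : 0 <= Kb * M * kp by rewrite !mulr_ge0.
have T1 : tau * (- (b U U e' - b u u e')) <= tau * (2 * (Kb * M * kp) * (P * s) + Kb * (P * s ^+ 2)).
  by apply: ler_wpM2l => //; apply: le_trans B1; rewrite -normrN ler_norm.
have T2 : tau * (jj * (- (b U W f' - b u w f'))) <=
    tau * (jj * (2 * (Kb * M * kp) * (P * s) + Kb * (P * s ^+ 2))).
  apply: ler_wpM2l => //; apply: ler_wpM2l; first exact: ltW.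
  by apply: le_trans B2; rewrite -normrN ler_norm.
have T3 : tau * (th * (b U U u' + jj * b U W w')) <= tau *
    ((1 + jj) * (Ei * K2 * (`|r'| * s + `|r'| * om) + Ei * Rb * K2 * (s ^+ 2 + s * om))).
  by apply: ler_wpM2l => //; exact: le_trans (ler_norm _) Y.
have tn : 0 <= tau * nur by rewrite mulr_ge0// ltW.
have y1t : tau * nur * (4 * c e' f) <= tau * nur * (g e' e' + 8 * ip f f) by apply: ler_wpM2l.
have y2t : tau * nur * (4 * c e' f') <= tau * nur * (g e' e' + 8 * ip f' f') by apply: ler_wpM2l.
have jf : jj * (ip f' f' - ip f f) <= jj * (2 * ip (f' - f) f') by rewrite ler_wpM2l// ltW.
have rr : r' ^+ 2 - r ^+ 2 <= 2 * (r' * (r' - r)) by have := sqr_ge0 (r' - r); rewrite sqrrB; lra.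
have Ru := le_trans con_u cu; have Rw := le_trans con_w cw.
move: Ru Rw D; rewrite !ler_norml => /andP[Ru _] /andP[Rw _] /andP[D _].
(* [S1] is what the estimates give. All monomials being nonnegative, each coefficient may be raised
   to the total [Kc], which leaves a single constant for [young_terms]. *)
pose S1 := 2 * ((1 + jj) * (2 * (Kb * M * kp) * (P * s) + Kb * (P * s ^+ 2))
  + (1 + jj) * (Ei * K2 * (`|r'| * s + `|r'| * om) + Ei * Rb * K2 * (s ^+ 2 + s * om))
  + 2 * (C0 * (P * om)) + C1 * (`|r'| * tau)).
have fin : S1 <= Kc * (P * s + P * s ^+ 2 + P * om + `|r'| * s + `|r'| * om + `|r'| * tau
                    + s ^+ 2 + s * om + om ^+ 2).
  have j0 : 0 <= 1 + jj by rewrite addr_ge0// ltW.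
  pose k1 := (1 + jj) * (2 * (Kb * M * kp)); pose k2 := (1 + jj) * Kb.
  pose k3 := (1 + jj) * (Ei * K2); pose k4 := (1 + jj) * (Ei * Rb * K2).
  have k10 : 0 <= k1 by rewrite mulr_ge0 ?mulr_ge0.
  have k20 : 0 <= k2 by rewrite mulr_ge0.
  have k30 : 0 <= k3 := mulr_ge0 j0 (mulr_ge0 Ei0 K20).
  have k40 : 0 <= k4 := mulr_ge0 j0 (mulr_ge0 (mulr_ge0 Ei0 Rb0) K20).
  have -> : S1 = 2 * (k1 * (P * s) + k2 * (P * s ^+ 2) + k3 * (`|r'| * s + `|r'| * om)
     + k4 * (s ^+ 2 + s * om) + 2 * (C0 * (P * om)) + C1 * (`|r'| * tau)).
    by rewrite /S1 /k1 /k2 /k3 /k4; ring.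
  have -> : Kc = 2 * (k1 + k2 + k3 + k4 + 2 * C0 + C1) by rewrite /Kc /k1 /k2 /k3 /k4; ring.
  have m1 : 0 <= P * s by exact: mulr_ge0.
  have m2 : 0 <= P * s ^+ 2 by rewrite mulr_ge0 ?sqr_ge0.
  have m3 : 0 <= P * om by exact: mulr_ge0.
  have m4 : 0 <= `|r'| * s by exact: mulr_ge0.
  have m5 : 0 <= `|r'| * om by exact: mulr_ge0.
  have m6 : 0 <= `|r'| * tau by exact: mulr_ge0.
  have m7 : 0 <= s ^+ 2 by exact: sqr_ge0.
  have m8 : 0 <= s * om by exact: mulr_ge0.
  have m9 : 0 <= om ^+ 2 by exact: sqr_ge0.
  move: k1 k2 k3 k4 k10 k20 k30 k40 => k1 k2 k3 k4 k10 k20 k30 k40.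
  move: (s ^+ 2) (P * s) (P * s ^+ 2) (P * om) (`|r'| * s) (`|r'| * om) (`|r'| * tau) (s * om) (om ^+ 2)
     m1 m2 m3 m4 m5 m6 m7 m8 m9 => x7 x1 x2 x3 x4 x5 x6 x8 x9 m1 m2 m3 m4 m5 m6 m7 m8 m9.
  have p1 : 0 <= k1 * (x2 + x3 + x4 + x5 + x6 + x7 + x8 + x9) by rewrite mulr_ge0// !addr_ge0.
  have p2 : 0 <= k2 * (x1 + x3 + x4 + x5 + x6 + x7 + x8 + x9) by rewrite mulr_ge0// !addr_ge0.
  have p3 : 0 <= k3 * (x1 + x2 + x3 + x6 + x7 + x8 + x9) by rewrite mulr_ge0// !addr_ge0.
  have p4 : 0 <= k4 * (x1 + x2 + x3 + x4 + x5 + x6 + x9) by rewrite mulr_ge0// !addr_ge0.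
  have p5 : 0 <= C0 * (x1 + x2 + x4 + x5 + x6 + x7 + x8 + x9) by rewrite mulr_ge0// !addr_ge0.
  have p6 : 0 <= C1 * (x1 + x2 + x3 + x4 + x5 + x7 + x8 + x9) by rewrite mulr_ge0// !addr_ge0.
  by lra.
have {fin} tfin := ler_wpM2l tau0 fin.
apply: le_trans (lerD (lexx _) tfin); rewrite /S1.
move: (tau / T * r' ^+ 2) eq => x0 eq.
move: (r' * (E' - E + tau / T * E')) D eq => x9 D eq.
rewrite i8 i9 in eq.
move: (r' * (r' - r)) eq rr => x10 eq rr.
move: y1t y2t jf i10; rewrite i1 i2 i3 i4 i5 i6 i7 => y1t y2t jf i10.
exact: (assemble mom ang Ru Rw D T1 T2 T3 y1t y2t jf rr i10 eq).
Qed.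

End ErrorStep.

(** * Closing the recursion and applying Gronwall's lemma *)

Section ErrorEstimate.
Variables (M Ei C0 C1 X0 G : R).
Hypothesis M0 : 0 <= M.
Hypothesis Ei0 : 0 <= Ei.
Hypothesis C00 : 0 <= C0.
Hypothesis C10 : 0 <= C1.
Hypothesis X00 : 0 <= X0.
Hypothesis G0 : 0 <= G.

(** Of the dissipation [2 tau], one half absorbs [P ^+ 2], a quarter is kept as a gain and a quarter
    joins the energy. At the next step this last quarter pays for the gradients produced by
    [s ^+ 2], whereas [s ^+ 4] yields the product of the L^2 errors and the squared gradients, hence
    the weight [1 + (g e e + g f f)]. *)
Lemma closed_step (Rb : R) : 0 <= Rb -> exists2 K, 0 <= K &
  forall (U U' W W' u u' w w' : V) (tau om Q Q' E E' : R),
  let e := U - u in let f := W - w in let e' := U' - u' in let f' := W' - w' in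
  let r := Q - E in let r' := Q' - E' in
  A U -> A U' -> A u -> A u' -> Z W -> Z W' -> Z w -> Z w' -> 0 <= tau ->
  0 < E' -> E'^-1 <= Ei -> `|r'| <= Rb ->
  gn u <= M -> gn u' <= M -> gn w <= M -> gn w' <= M -> gn (u - u') <= om -> gn (w - w') <= om ->
  ip (U' - U) e' + tau * (Q' / E' * b U U e' + (nu + nur) * g U' e') = tau * (2 * nur * c W e') ->
  `|ip (u' - u) e' + tau * (b u u e' + (nu + nur) * g u' e' - 2 * nur * c w e')| <= C0 * tau * om * gn e' ->
  jj * ip (W' - W) f' + tau * (jj * (Q' / E') * b U W f' + c1 * g W' f' + 4 * nur * ip W' f')
    = tau * (2 * nur * c U' f') ->
  `|jj * ip (w' - w) f' + tau * (jj * b u w f' + c1 * g w' f' + 4 * nur * ip w' f' - 2 * nur * c u' f')|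
    <= C0 * tau * om * gn f' ->
  Q' - Q + tau / T * Q' = tau / E' * (b U U U' + jj * b U W W') ->
  `|E' - E + tau / T * E'| <= C1 * tau ^+ 2 ->
  (ip e' e' + jj * ip f' f' + r' ^+ 2 + tau / 2 * (nu * g e' e' + c1 * g f' f'))
    + (tau / 2 * (nu * g e' e' + c1 * g f' f') + tau / T * r' ^+ 2)
  <= (1 + tau * K * (1 + (g e e + g f f)))
       * (ip e e + jj * ip f f + r ^+ 2 + tau / 2 * (nu * g e e + c1 * g f f))
     + tau * K * (om ^+ 2 + tau ^+ 2).
Proof.
move=> Rb0; pose d0 := Num.min nu c1.
have d00 : 0 < d0 by rewrite lt_min nu_gt0 c1_gt0.
have dn : d0 <= nu by rewrite ge_min lexx.
have dc : d0 <= c1 by rewrite ge_min lexx orbT.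
have d02 : 0 < d0 / 2 by rewrite divr_gt0.
have j0 : 0 < jj^-1 by rewrite invr_gt0.
pose K2 := Kb * M * (kp * M + kp ^+ 2 * M + 1 + kp).
pose Kc := 2 * ((1 + jj) * (2 * (Kb * M * kp) + Kb + Ei * K2 + Ei * Rb * K2) + 2 * C0 + C1).
have K20 : 0 <= K2 by rewrite !mulr_ge0// !addr_ge0// ?mulr_ge0// exprn_ge0.
have Kc0 : 0 <= Kc.
  have a1 : 0 <= Kb * M * kp by rewrite !mulr_ge0.
  have a2 : 0 <= Ei * K2 by exact: mulr_ge0.
  have a3 : 0 <= Ei * Rb * K2 := mulr_ge0 (mulr_ge0 Ei0 Rb0) K20.
  have a4 : 0 <= (1 + jj) * (2 * (Kb * M * kp) + Kb + Ei * K2 + Ei * Rb * K2).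
    apply: mulr_ge0; first by rewrite addr_ge0// ltW.
    by do 3?[apply: addr_ge0 => //]; exact: mulr_ge0.
  by apply: mulr_ge0 => //; do 2?[apply: addr_ge0 => //]; exact: mulr_ge0.
have [K3 K30 yt] := young_terms d02 T0 Kc0.
(* Coefficients of the old L^2 errors: the explicit curl, Young's constant for [s ^+ 2], and
   [s ^+ 4]. *)
pose L := 8 * nur + (2 * K3) ^+ 2 / (4 * (d0 / 2)) + 8 * K3.
have L0 : 0 <= L.
  have a1 : 0 <= (2 * K3) ^+ 2 / (4 * (d0 / 2)) by rewrite divr_ge0 ?sqr_ge0// mulr_ge0// ltW.
  by have := ltW nur_gt0; rewrite /L; lra.
(* The factor [1 + jj^-1] compares [ip e e + ip f f] with the energy, in which [f] has weight
   [jj]. *)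
exists (K3 + (1 + jj^-1) * L) => [|U U' W W' u u' w w' tau om Q Q' E E' e f e' f' r r'].
  by rewrite addr_ge0// mulr_ge0// addr_ge0// ltW.
move=> aU aU' au au' zW zW' zw zw' tau0 E0 EI rR gu gu' gw gw' gdu gdw mom con_u ang con_w qe con_q.
have st := error_step M0 Rb0 Ei0 C00 C10 aU aU' au au' zW zW' zw zw' tau0 E0 EI rR gu gu' gw gw' gdu gdw
  mom con_u ang con_w qe con_q.
rewrite -/e -/f -/e' -/f' -/r -/r' in st.
have He := AH (AB aU au); have Hf := ZH (ZB zW zw).
have He' := AH (AB aU' au'); have Hf' := ZH (ZB zW' zw').
rewrite -/e in He; rewrite -/f in Hf; rewrite -/e' in He'; rewrite -/f' in Hf'.
set s := mix e + mix f in st; set P := gn e' + gn f' in st.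
have yts := ler_wpM2l tau0 (yt P s `|r'| om tau).
have gE : gn e' ^+ 2 = g e' e' by exact: (si_normE g_si He').
have gF : gn f' ^+ 2 = g f' f' by exact: (si_normE g_si Hf').
have ge0 := si_ge0 g_si He; have gf0 := si_ge0 g_si Hf.
have ge0' := si_ge0 g_si He'; have gf0' := si_ge0 g_si Hf'.
have ie0 := si_ge0 ip_si He; have if0 := si_ge0 ip_si Hf.
have PP : tau * (d0 / 2 * P ^+ 2) <= tau * (nu * g e' e' + c1 * g f' f').
  apply: ler_wpM2l => //.
  have : P ^+ 2 <= 2 * (g e' e' + g f' f').
    by rewrite -gE -gF /P; have := sqr_ge0 (gn e' - gn f'); rewrite sqrrB sqrrD; lra.
  move/(ler_wpM2l (ltW d02)) => h.
  have := ler_wpM2r ge0' dn; have := ler_wpM2r gf0' dc.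
  by move: h; lra.
have s2 : s ^+ 2 <= 2 * (nn e * gn e + nn f * gn f).
  by rewrite -!mix_sqr /s; have := sqr_ge0 (mix e - mix f); rewrite sqrrB sqrrD; lra.
have nE : nn e ^+ 2 = ip e e by exact: (si_normE ip_si He).
have nF : nn f ^+ 2 = ip f f by exact: (si_normE ip_si Hf).
have gE2 : gn e ^+ 2 = g e e by exact: (si_normE g_si He).
have gF2 : gn f ^+ 2 = g f f by exact: (si_normE g_si Hf).
have yng x : K3 * (2 * (nn x * gn x)) <= d0 / 2 * gn x ^+ 2 + (2 * K3) ^+ 2 / (4 * (d0 / 2)) * nn x ^+ 2.
  have := young (gn x) (2 * K3 * nn x) d02.
  by rewrite exprMn [_ ^+ 2 * nn x ^+ 2 / _]mulrAC; lra.
have A2 : K3 * s ^+ 2 <= d0 / 2 * (g e e + g f f) + (2 * K3) ^+ 2 / (4 * (d0 / 2)) * (ip e e + ip f f).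
  apply: (le_trans (ler_wpM2l K30 s2)); have := yng e; have := yng f.
  by rewrite gE2 gF2 nE nF; lra.
have A4 : K3 * s ^+ 4 <= 8 * K3 * ((ip e e + ip f f) * (g e e + g f f)).
  have -> : s ^+ 4 = (s ^+ 2) ^+ 2 by rewrite -exprM.
  have : (s ^+ 2) ^+ 2 <= (2 * (nn e * gn e + nn f * gn f)) ^+ 2.
    by rewrite ler_sqr ?nnegrE ?sqr_ge0// (le_trans _ s2)// sqr_ge0.
  have : (nn e * gn e + nn f * gn f) ^+ 2 <= 2 * ((nn e * gn e) ^+ 2 + (nn f * gn f) ^+ 2).
    by have := sqr_ge0 (nn e * gn e - nn f * gn f); rewrite sqrrB sqrrD; lra.
  rewrite !exprMn nE nF gE2 gF2 => h1 h2.
  have h3 : 0 <= ip e e * g f f + ip f f * g e e by rewrite addr_ge0 ?mulr_ge0.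
  have h4 : (s ^+ 2) ^+ 2 <= 8 * ((ip e e + ip f f) * (g e e + g f f)) by move: h1 h2 h3; lra.
  by have := ler_wpM2l K30 h4; lra.
have A2t := ler_wpM2l tau0 A2; have A4t := ler_wpM2l tau0 A4.
pose y := ip e e + jj * ip f f + r ^+ 2.
have y0 : 0 <= y by rewrite addr_ge0 ?sqr_ge0// addr_ge0// mulr_ge0// ltW.
have iy : ip e e + ip f f <= (1 + jj^-1) * y.
  have e1 : jj^-1 * y = jj^-1 * (ip e e + r ^+ 2) + ip f f by rewrite /y; field; rewrite gt_eqF.
  have : 0 <= jj^-1 * (ip e e + r ^+ 2) by rewrite mulr_ge0 ?addr_ge0 ?sqr_ge0// ltW.
  have : 0 <= jj * ip f f by rewrite mulr_ge0// ltW.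
  by rewrite mulrDl mul1r e1 /y; have := sqr_ge0 r; lra.
have dgt : tau * (d0 / 2 * (g e e + g f f)) <= tau / 2 * (nu * g e e + c1 * g f f).
  have := ler_wpM2r ge0 dn; have := ler_wpM2r gf0 dc => h1 h2.
  have h3 := ler_wpM2l tau0 (lerD h1 h2); move: h3; lra.
pose D := g e e + g f f.
have D0 : 0 <= D by exact: addr_ge0.
pose I := ip e e + ip f f.
have I0 : 0 <= I by exact: addr_ge0.
have LI : tau * (L * ((1 + D) * I)) <= tau * ((1 + jj^-1) * L * ((1 + D) * y)).
  have iy2 : (1 + D) * I <= (1 + D) * ((1 + jj^-1) * y) := ler_wpM2l (addr_ge0 ler01 D0) iy.
  rewrite (_ : (1 + jj^-1) * L * ((1 + D) * y) = L * ((1 + D) * ((1 + jj^-1) * y))); last by ring.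
  exact: (ler_wpM2l tau0 (ler_wpM2l L0 iy2)).
have LI2 : tau * ((8 * nur + (2 * K3) ^+ 2 / (4 * (d0 / 2))) * I + 8 * K3 * (I * D)) <= tau * (L * ((1 + D) * I)).
  apply: ler_wpM2l => //.
  have a0 : 0 <= (8 * nur + (2 * K3) ^+ 2 / (4 * (d0 / 2))) * (I * D) + 8 * K3 * I.
    have a1 : 0 <= (2 * K3) ^+ 2 / (4 * (d0 / 2)) by rewrite divr_ge0 ?sqr_ge0// mulr_ge0// ltW.
    have a2 : 0 <= 8 * nur + (2 * K3) ^+ 2 / (4 * (d0 / 2)) by rewrite addr_ge0// mulr_ge0// ltW.
    by rewrite addr_ge0 ?mulr_ge0.
  by rewrite /L; move: a0; lra.
pose S := tau / 2 * (nu * g e e + c1 * g f f).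
have S0 : 0 <= S.
  apply: mulr_ge0; first by rewrite divr_ge0.
  by rewrite addr_ge0// mulr_ge0// ltW.
have fS : 0 <= tau * (K3 + (1 + jj^-1) * L) * (1 + D) * S.
  apply: mulr_ge0 => //; apply: mulr_ge0; last by rewrite addr_ge0.
  by rewrite mulr_ge0// addr_ge0// mulr_ge0// addr_ge0// ltW.
have fy : 0 <= tau * K3 * (1 + D) * y.
  apply: mulr_ge0 => //; apply: mulr_ge0; last by rewrite addr_ge0.
  by rewrite mulr_ge0.
have fo : 0 <= tau * ((1 + jj^-1) * L) * (om ^+ 2 + tau ^+ 2).
  apply: mulr_ge0; last by rewrite addr_ge0 ?sqr_ge0.
  by rewrite mulr_ge0// mulr_ge0// addr_ge0// ltW.
rewrite real_normK ?num_real// in yts.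
have rT : tau * (r' ^+ 2 / T) = tau / T * r' ^+ 2 by rewrite mulrCA mulrC mulrA.
have nie : 0 <= tau * nur * ip e e by rewrite mulr_ge0// mulr_ge0// ltW.
exact: (assemble_closed st yts rT PP A2t A4t (erefl I) nie LI LI2 dgt fS fy fo).
Qed.

Definition err (U u : nat -> V) n := U n - u n.

Lemma error_estimate : exists2 C, 0 <= C &
  forall (N : nat) (tau : R) (U W u w : nat -> V) (Q E om : nat -> R),
  0 <= tau -> N%:R * tau <= T -> tau <= T ->
  (forall n, (n <= N)%N -> [/\ A (U n), Z (W n), A (u n) & Z (w n)]) ->
  (forall n, (n <= N)%N -> [/\ gn (u n) <= M, gn (w n) <= M, 0 < E n, E n <= 1 & (E n)^-1 <= Ei]) ->
  (forall n, (n < N)%N -> [/\ 0 <= om n, gn (u n - u n.+1) <= om n & gn (w n - w n.+1) <= om n]) ->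
  \sum_(0 <= n < N) om n ^+ 2 <= G * tau ->
  Q 0%N = E 0%N ->
  g (err U u 0%N) (err U u 0%N) = 0 -> g (err W w 0%N) (err W w 0%N) = 0 ->
  ip (U 0%N) (U 0%N) + jj * ip (W 0%N) (W 0%N) + Q 0%N ^+ 2 <= X0 ->
  (forall n v, (n < N)%N -> A v ->
    ip (U n.+1 - U n) v + tau * (Q n.+1 / E n.+1 * b (U n) (U n) v + (nu + nur) * g (U n.+1) v)
      = tau * (2 * nur * c (W n) v)) ->
  (forall n v, (n < N)%N -> A v ->
    `|ip (u n.+1 - u n) v + tau * (b (u n) (u n) v + (nu + nur) * g (u n.+1) v - 2 * nur * c (w n) v)|
      <= C0 * tau * om n * gn v) ->
  (forall n z, (n < N)%N -> Z z ->
    jj * ip (W n.+1 - W n) z + tau * (jj * (Q n.+1 / E n.+1) * b (U n) (W n) z + c1 * g (W n.+1) z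
      + 4 * nur * ip (W n.+1) z) = tau * (2 * nur * c (U n.+1) z)) ->
  (forall n z, (n < N)%N -> Z z ->
    `|jj * ip (w n.+1 - w n) z + tau * (jj * b (u n) (w n) z + c1 * g (w n.+1) z
      + 4 * nur * ip (w n.+1) z - 2 * nur * c (u n.+1) z)| <= C0 * tau * om n * gn z) ->
  (forall n, (n < N)%N -> Q n.+1 - Q n + tau / T * Q n.+1
     = tau / E n.+1 * (b (U n) (U n) (U n.+1) + jj * b (U n) (W n) (W n.+1))) ->
  (forall n, (n < N)%N -> `|E n.+1 - E n + tau / T * E n.+1| <= C1 * tau ^+ 2) ->
  forall m, (m <= N)%N ->
  ip (err U u m) (err U u m) + jj * ip (err W w m) (err W w m) + (Q m - E m) ^+ 2
  + \sum_(0 <= n < m) (tau / 2 * (nu * g (err U u n.+1) (err U u n.+1) + c1 * g (err W w n.+1) (err W w n.+1))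
      + tau / T * (Q n.+1 - E n.+1) ^+ 2) <= C * tau ^+ 2.
Proof.
pose S := expR (8 * nur / jj * T) * X0.
have S0 : 0 <= S by rewrite mulr_ge0// expR_ge0.
(* Bound of the auxiliary error: stability gives [Q n ^+ 2 <= S], so the absolute value of [Q n] is
   at most [S + 1], and [0 < E n <= 1]. *)
have Rb0 : 0 <= S + 2 by rewrite addr_ge0.
have [K K0 step] := closed_step Rb0.
pose d0 := Num.min nu c1.
have d00 : 0 < d0 by rewrite lt_min nu_gt0 c1_gt0.
have dn : d0 <= nu by rewrite ge_min lexx.
have dc : d0 <= c1 by rewrite ge_min lexx orbT.
(* Bound of the Gronwall factor: [T] counts the steps, [S / d0] bounds the numerical gradients by
   stability, [4 * M ^+ 2 * T] the exact ones, after [g (x - z) (x - z) <= 2 * g x x + 2 * g z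
   z]. *)
pose B := expR (K * (T + S / d0 + 4 * M ^+ 2 * T)).
exists (B * (K * (G + T))) => [|N tau U W u w Q E om].
  by rewrite mulr_ge0 ?expR_ge0// mulr_ge0// addr_ge0// ltW.
move=> tau0 NT tT hA hb hom hsum Q0 ge0 gf0 hX mom con_u ang con_w qe con_q m mN.
have hH n : (n <= N)%N -> [/\ H (U n), H (W n), H (u n) & H (w n)].
  by move=> nN; have [a1 a2 a3 a4] := hA n nN; split; [exact: AH|exact: ZH|exact: AH|exact: ZH].
have stab k : (k <= N)%N -> Q k ^+ 2 +
    \sum_(0 <= n < k) 2 * tau * (nu * g (U n.+1) (U n.+1) + c1 * g (W n.+1) (W n.+1)) <= S.
  move=> kN; apply: (@le_trans _ _ (expR (8 * nur / jj * T) *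
    (ip (U 0%N) (U 0%N) + jj * ip (W 0%N) (W 0%N) + Q 0%N ^+ 2))); last first.
    by apply: ler_wpM2l => //; exact: expR_ge0.
  apply: (stability tau0 NT (kap := fun n => Q n.+1 / E n.+1)) => // [n nN|n nN].
    by have [] := hA n nN.
  have [a1 z1 _ _] := hA n.+1 nN; split; [exact: mom|exact: ang|].
  have [_ _ En _ _] := hb n.+1 nN.
  have -> : tau * (Q n.+1 / E n.+1) * (b (U n) (U n) (U n.+1) + jj * b (U n) (W n) (W n.+1)) =
    Q n.+1 * (tau / E n.+1 * (b (U n) (U n) (U n.+1) + jj * b (U n) (W n) (W n.+1))) by ring.
  by rewrite -qe//; ring.
have gpos n : (n <= N)%N -> 0 <= g (U n) (U n) /\ 0 <= g (W n) (W n).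
  by move=> nN; have [h1 h2 _ _] := hH n nN; rewrite !(si_ge0 g_si).
have rb n : (n <= N)%N -> `|Q n - E n| <= S + 2.
  move=> nN; have [_ _ En E1 _] := hb n nN; have h := stab n nN.
  have s0 : 0 <= \sum_(0 <= k < n) 2 * tau * (nu * g (U k.+1) (U k.+1) + c1 * g (W k.+1) (W k.+1)).
    rewrite big_nat; apply: sumr_ge0 => k /andP[_ kn]; have [p1 p2] := gpos k.+1 (leq_trans kn nN).
    by rewrite mulr_ge0 ?mulr_ge0// addr_ge0// mulr_ge0// ltW.
  have q2 : Q n ^+ 2 <= S by move: h s0; lra.
  have q3 : `|Q n| <= S + 1.
    have := sqr_ge0 (`|Q n| - 1); rewrite sqrrB real_normK ?num_real// => h1.
    have := normr_ge0 (Q n); lra.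
  by apply: (le_trans (ler_normB _ _)); rewrite (gtr0_norm En); move: q3 E1; lra.
pose e n := err U u n; pose f n := err W w n; pose r n := Q n - E n.
have hE n : (n <= N)%N -> H (e n) /\ H (f n).
  by move=> nN; have [h1 h2 h3 h4] := hH n nN; split; exact: (si_B ip_si).
pose y n := if (n <= N)%N then ip (e n) (e n) + jj * ip (f n) (f n) + r n ^+ 2
   + tau / 2 * (nu * g (e n) (e n) + c1 * g (f n) (f n)) else 0.
pose d n := if (n <= N)%N then tau / 2 * (nu * g (e n) (e n) + c1 * g (f n) (f n)) + tau / T * r n ^+ 2 else 0.
pose D n := if (n <= N)%N then g (e n) (e n) + g (f n) (f n) else 0.
pose cc n := if (n < N)%N then tau * K * (om n ^+ 2 + tau ^+ 2) else 0.
have D0 n : 0 <= D n.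
  by rewrite /D; case: ifP => // nN; have [h1 h2] := hE n nN; rewrite addr_ge0 ?(si_ge0 g_si).
have T20 : 0 <= tau / 2 by rewrite divr_ge0.
have gg0 n : (n <= N)%N -> 0 <= tau / 2 * (nu * g (e n) (e n) + c1 * g (f n) (f n)).
  move=> nN; have [h1 h2] := hE n nN; apply: mulr_ge0 => //.
  by rewrite addr_ge0// mulr_ge0 ?(si_ge0 g_si)// ltW.
have yy0 n : (n <= N)%N -> 0 <= ip (e n) (e n) + jj * ip (f n) (f n) + r n ^+ 2.
  move=> nN; have [h1 h2] := hE n nN; rewrite addr_ge0 ?sqr_ge0// addr_ge0 ?(si_ge0 ip_si)//.
  by rewrite mulr_ge0 ?(si_ge0 ip_si)// ltW.
have tT0 : 0 <= tau / T by rewrite divr_ge0// ltW.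
have y0 n : 0 <= y n by rewrite /y; case: ifP => // nN; rewrite addr_ge0 ?yy0 ?gg0.
have d0' n : 0 <= d n.
  by rewrite /d; case: ifP => // nN; rewrite addr_ge0 ?gg0// mulr_ge0 ?sqr_ge0.
have a0 n : 0 <= tau * K * (1 + D n) by rewrite mulr_ge0 ?mulr_ge0// addr_ge0.
have cc0 n : 0 <= cc n.
  by rewrite /cc; case: ifP => // nN; rewrite mulr_ge0 ?mulr_ge0// addr_ge0 ?sqr_ge0.
have st n : (n < N)%N -> y n.+1 + d n.+1 <= (1 + tau * K * (1 + D n)) * y n + cc n.
  move=> nN; rewrite /y /d /D /cc nN (ltnW nN).
  have [aU zW au zw] := hA n (ltnW nN); have [aU' zW' au' zw'] := hA n.+1 nN.
  have [gu gw _ _ _] := hb n (ltnW nN); have [gu' gw' E0 _ EI] := hb n.+1 nN.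
  have [om0 gdu gdw] := hom n nN.
  apply: (step (U n) (U n.+1) (W n) (W n.+1) (u n) (u n.+1) (w n) (w n.+1) tau (om n) (Q n) (Q n.+1) (E n) (E n.+1)) => //.
  - exact: rb.
  - exact: mom (AB aU' au').
  - exact: con_u (AB aU' au').
  - exact: ang (ZB zW' zw').
  - exact: con_w (ZB zW' zw').
  - exact: qe.
  - exact: con_q.
have gr := discrete_gronwall y0 d0' a0 cc0 st mN.
(* The hypotheses give vanishing gradients of the initial errors; Poincaré's inequality then kills
   their L^2 norms. *)
have if0 : y 0%N = 0.
  have [h1 h2] := hE 0%N (leq0n N).
  have ie : ip (e 0%N) (e 0%N) = 0.
    have := poinc h1; rewrite {2}/si_norm ge0 sqrtr0 mulr0 => n0.
    by rewrite -(si_normE ip_si h1); apply/eqP; rewrite sqrf_eq0 eq_le n0 si_norm_ge0.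
  have iff : ip (f 0%N) (f 0%N) = 0.
    have := poinc h2; rewrite {2}/si_norm gf0 sqrtr0 mulr0 => n0.
    by rewrite -(si_normE ip_si h2); apply/eqP; rewrite sqrf_eq0 eq_le n0 si_norm_ge0.
  have eg : g (e 0%N) (e 0%N) = 0 := ge0; have fg : g (f 0%N) (f 0%N) = 0 := gf0.
  by rewrite /y leq0n ie iff eg fg /r Q0 subrr expr0n /= !(mulr0, addr0).
have csum : \sum_(0 <= n < m) cc n <= K * (G + T) * tau ^+ 2.
  have e1 : \sum_(0 <= n < N) cc n = tau * K * (\sum_(0 <= n < N) om n ^+ 2 + N%:R * tau ^+ 2).
    rewrite mulrDr mulr_sumr [N%:R * _]mulr_natl -[tau ^+ 2 *+ N](_ : \sum_(0 <= n < N) tau ^+ 2 = _).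
      rewrite mulr_sumr -big_split; apply: eq_big_nat => n /andP[_ nN].
      by rewrite /cc nN mulrDr.
    by rewrite sumr_const_nat subn0.
  apply: (@le_trans _ _ (\sum_(0 <= n < N) cc n)).
    by rewrite (big_cat_nat (leq0n m) mN) /= lerDl sumr_ge0.
  rewrite e1 (_ : K * (G + T) * tau ^+ 2 = tau * K * (G * tau + T * tau)); last by ring.
  apply: ler_wpM2l; first exact: mulr_ge0.
  by apply: lerD => //; rewrite expr2 mulrA; exact: ler_wpM2r.
have asum : \sum_(0 <= n < m) tau * K * (1 + D n) <= K * (T + S / d0 + 4 * M ^+ 2 * T).
  have mT : m%:R * tau <= T by apply: le_trans NT; apply: ler_wpM2r => //; rewrite ler_nat.
  have gB x z : H x -> H z -> g (x - z) (x - z) <= 2 * g x x + 2 * g z z.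
    move=> hx hz; have := si_ge0 g_si (si_D g_si hx hz).
    by rewrite (si_sqrB g_si hx hz) (si_sqrD g_si hx hz); lra.
  have gM x : H x -> gn x <= M -> g x x <= M ^+ 2.
    by move=> hx hM; rewrite -(si_normE g_si hx) ler_sqr ?nnegrE ?si_norm_ge0.
  have Dn n : (n < N)%N -> tau * D n.+1 <=
      2 * tau * (nu * g (U n.+1) (U n.+1) + c1 * g (W n.+1) (W n.+1)) / d0 + 4 * M ^+ 2 * tau.
    move=> nN; rewrite /D nN; have [h1 h2 h3 h4] := hH n.+1 nN; have [m3 m4 _ _ _] := hb n.+1 nN.
    have [p1 p2] := gpos n.+1 nN.
    have q1 := gB _ _ h1 h3; have q2 := gB _ _ h2 h4; have q3 := gM _ h3 m3; have q4 := gM _ h4 m4.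
    have k1 := ler_wpM2r p1 dn; have k2 := ler_wpM2r p2 dc.
    have q5 : g (e n.+1) (e n.+1) + g (f n.+1) (f n.+1) <=
        2 * (g (U n.+1) (U n.+1) + g (W n.+1) (W n.+1)) + 4 * M ^+ 2.
      by rewrite /e /f /err; move: q1 q2 q3 q4; lra.
    apply: (le_trans (ler_wpM2l tau0 q5)); rewrite mulrDr; apply: lerD; last by rewrite mulrC.
    rewrite ler_pdivlMr//.
    have := ler_wpM2l tau0 (lerD k1 k2); lra.
  have sD : tau * \sum_(0 <= n < m) D n <= S / d0 + 4 * M ^+ 2 * T.
    apply: (@le_trans _ _ (\sum_(0 <= n < m) tau * D n.+1)).
      rewrite -mulr_sumr; apply: ler_wpM2l => //.
      (* The weights involve [D n], stability controls [D n.+1]; the shift is free because the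
         initial gradient errors are 0. *)
      have D00 : D 0%N = 0 by rewrite /D leq0n; have -> : g (e 0%N) (e 0%N) = 0 := ge0; have -> : g (f 0%N) (f 0%N) = 0 := gf0; rewrite addr0.
      have eD : \sum_(0 <= n < m.+1) D n = D 0%N + \sum_(0 <= n < m) D n.+1 by exact: big_nat_recl.
      have eD2 : \sum_(0 <= n < m.+1) D n = \sum_(0 <= n < m) D n + D m by exact: big_nat_recr.
      by have := D0 m; move: eD eD2; rewrite D00; lra.
    apply: (@le_trans _ _ (\sum_(0 <= n < m)
      (2 * tau * (nu * g (U n.+1) (U n.+1) + c1 * g (W n.+1) (W n.+1)) / d0 + 4 * M ^+ 2 * tau))).
      by apply: ler_sum_nat => n /andP[_ nm]; apply: Dn; exact: leq_trans nm mN.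
    rewrite big_split /= -mulr_suml; apply: lerD.
      apply: ler_wpM2r; first by rewrite invr_ge0 ltW.
      by have := stab m mN; have := sqr_ge0 (Q m); lra.
    rewrite sumr_const_nat subn0 -[leLHS]mulr_natr -[leLHS]mulrA; apply: ler_wpM2l; last by rewrite mulrC.
    by rewrite mulr_ge0 ?sqr_ge0.
  rewrite -mulr_sumr big_split /= sumr_const_nat subn0.
  rewrite (_ : tau * K * (1 *+ m + \sum_(0 <= n < m) D n) = K * (m%:R * tau + tau * \sum_(0 <= n < m) D n)).
    by apply: ler_wpM2l => //; rewrite -addrA; exact: lerD.
  by ring.
have B1 : expR (\sum_(0 <= n < m) tau * K * (1 + D n)) <= B by rewrite ler_expR.
have cs0 : 0 <= \sum_(0 <= n < m) cc n by apply: sumr_ge0.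
apply: (@le_trans _ _ (y m + \sum_(0 <= n < m) d n.+1)).
  apply: lerD; first by rewrite /y mN lerDl gg0.
  rewrite le_eqVlt; apply/orP; left; apply/eqP; apply: eq_big_nat => n /andP[_ nm].
  by rewrite /d (leq_trans nm mN).
apply: (le_trans gr); rewrite if0 add0r -mulrA; apply: ler_pM => //; exact: expR_ge0.
Qed.

End ErrorEstimate.
End Energy.

(** * Sobolev functions on a bounded domain *)
Section BoundedDomain.
Context {R : realType}.
Local Notation mu1 := (@lebesgue_measure R).
Local Notation mu2 := (@lebesgue_measure R \x @lebesgue_measure R)%E.
Context (Om : set (R * R)) {dom : bounded_domain Om}.

Section TestFunctions.
Implicit Types phi psi chi : R * R -> R.

Lemma domain_measurable : measurable Om. Proof. by apply: open_measurable2; exact: domain_is_open. Qed.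
Local Notation mOm := domain_measurable.

Lemma domain_finite : (mu2 Om < +oo)%E.
Proof.
have [M M0 bOm] := domain_in_square.
apply: (@le_lt_trans _ _ (mu2 (`]-M, M[ `*` `]-M, M[))).
  apply: le_measure; rewrite ?inE; [exact: mOm| |].
    by apply: measurableX; exact: measurable_itv.
  by move=> x /bOm[h1 h2]; split; rewrite /= in_itv.
rewrite /= product_measure1E; [|exact: measurable_itv|exact: measurable_itv].
by rewrite /= lebesgue_measure_itv /= lte_fin gtrN//= -EFinB -EFinM ltry.
Qed.

Lemma bounded_L2 (f : R * R -> R) K : measurable_fun Om f ->
  (forall x, Om x -> `|f x| <= K) -> L2 Om f.
Proof.
move=> mf fK; split=> //.
have mf2 : measurable_fun Om (fun x => f x ^+ 2) by exact: measurable_funX.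
have bf2 : [bounded f x ^+ 2 | x in Om].
  exists (K ^+ 2); split; first exact: num_real.
  move=> x Kx y Oy /=; rewrite normrX (le_trans _ (ltW Kx))//.
  by rewrite ler_sqr ?nnegrE// ?fK// (le_trans _ (fK y Oy)).
exact: (@measurable_bounded_integrable _ _ _ mu2 _ Om mOm domain_finite mf2 bf2).
Qed.

Lemma L2_cst (c : R) : L2 Om (cst c).
Proof. by apply: (@bounded_L2 _ `|c|). Qed.

Lemma L2_si : semi_inner (L2 Om) (ip Om).
Proof. exact: (sqint_si mu2 mOm). Qed.

Lemma L2_mul_integrable f g : L2 Om f -> L2 Om g ->
  mu2.-integrable Om (fun x => (f x * g x)%:E).
Proof. exact: (@sqint_mul _ _ _ mu2 Om mOm). Qed.

Lemma L2_integrable f : L2 Om f -> mu2.-integrable Om (EFin \o f).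
Proof.
move=> hf; have := L2_mul_integrable hf (L2_cst 1).
by apply: eq_integrable; [exact: mOm|move=> x _; rewrite /= mulr1].
Qed.

Lemma ip_ae f f' g : L2 Om f -> L2 Om f' -> L2 Om g ->
  {ae mu2, forall x, Om x -> f x = f' x} -> ip Om f g = ip Om f' g.
Proof.
move=> hf hf' hg e; congr fine; apply: ae_eq_integral.
- exact: mOm.
- by apply/measurable_EFinP; apply: measurable_funM; [exact: hf.1|exact: hg.1].
- by apply/measurable_EFinP; apply: measurable_funM; [exact: hf'.1|exact: hg.1].
- by move: e; apply: ae_imp => x h Ox; rewrite h.
Qed.

Lemma ip0_ae f : L2 Om f -> ip Om f f = 0 -> {ae mu2, forall x, Om x -> f x = 0}.
Proof.
move=> hf h.
have h2 : (\int[mu2]_(x in Om) `|(f x * f x)%:E| = 0)%E.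
  transitivity (\int[mu2]_(x in Om) (f x * f x)%:E)%E.
    by apply: eq_integral => x _; rewrite gee0_abs// lee_fin -expr2 sqr_ge0.
  rewrite -[LHS]fineK; last by apply: integrable_fin_num; [exact: mOm|exact: L2_mul_integrable].
  by rewrite -/(Rintegral _ _ _) -/(ip Om f f) h.
have mff : measurable_fun Om (fun x => (f x * f x)%:E).
  by apply/measurable_EFinP; apply: measurable_funM; exact: hf.1.
have /= := proj1 (ae_eq_integral_abs mu2 mOm mff) h2.
apply: ae_imp => x hx Ox; have [] := hx Ox.
by move/eqP; rewrite mulf_eq0 orbb => /eqP.
Qed.

Lemma test_out phi x : test_function Om phi -> ~ Om x -> phi x = 0.
Proof.
move=> [_ _ _ sO] nO; apply/eqP; apply: contra_notT nO => h.
by apply: sO; exact: subset_closure.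
Qed.

Lemma test_out1 M phi x y : in_square M Om -> test_function Om phi -> ~~ (- M < x < M) -> phi (x, y) = 0.
Proof. by move=> bOm t h; apply: test_out t _ => /bOm /= [h1 _]; rewrite h1 in h. Qed.

Lemma test_out2 M phi x y : in_square M Om -> test_function Om phi -> ~~ (- M < y < M) -> phi (x, y) = 0.
Proof. by move=> bOm t h; apply: test_out t _ => /bOm /= [_ h1]; rewrite h1 in h. Qed.

Lemma test_continuous phi : test_function Om phi -> continuous phi.
Proof. by move=> [/(_ [::])]. Qed.

Lemma test_derivable phi j x : test_function Om phi -> derivable phi x (axis j).
Proof. by move=> [_ /(_ [::])]. Qed.

Lemma test_bounded phi : test_function Om phi -> exists K, forall x, `|phi x| <= K.
Proof.
move=> t; have [c _ k _] := t.
have := continuous_compact (continuous_subspaceT (c [::])) k.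
move=> /compact_bounded [K [_ hK]]; exists (`|K| + 1) => x.
have [h|h] := eqVneq (phi x) 0; first by rewrite h normr0 addr_ge0.
apply: (hK (`|K| + 1)); first by rewrite (le_lt_trans (ler_norm _))// ltrDl.
by exists x => //; exact: subset_closure.
Qed.

Lemma test_measurable phi D : test_function Om phi -> measurable_fun D phi.
Proof.
by move=> t; apply: measurable_funTS; apply: continuous_measurable2; exact: test_continuous.
Qed.

Lemma test_L2 phi : test_function Om phi -> L2 Om phi.
Proof.
move=> t; have [K hK] := test_bounded t.
by apply: (@bounded_L2 _ K) => //; exact: test_measurable.
Qed.

Lemma plane_integral (f : R * R -> \bar R) : (forall x, ~ Om x -> f x = 0%E) ->
  (\int[mu2]_(x in Om) f x = \int[mu2]_x f x)%E.
Proof.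
move=> out; rewrite integral_mkcond; apply: eq_integral => x _.
by rewrite patchE; case: ifPn => // /negP h; rewrite out// => Ox; apply: h; rewrite inE.
Qed.

Lemma plane_integrable (f : R * R -> R) : L2 Om f -> (forall x, ~ Om x -> f x = 0) ->
  mu2.-integrable setT (EFin \o f).
Proof.
move=> hf out; have := L2_integrable hf; rewrite integrable_mkcond; last exact: mOm.
apply: eq_integrable => // x _; rewrite patchE; case: ifPn => // /negP h /=.
by rewrite out// => Ox; apply: h; rewrite inE.
Qed.

Lemma slice1_derive phi (y r : R) : test_function Om phi ->
  is_derive r (1 : R) (fun r => phi (r, y)) ('D_(axis 0) phi (r, y)).
Proof. by move=> t; apply: is_derive_slice1; exact: test_derivable. Qed.

Lemma slice2_derive phi (x r : R) : test_function Om phi ->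
  is_derive r (1 : R) (fun r => phi (x, r)) ('D_(axis 1) phi (x, r)).
Proof. by move=> t; apply: is_derive_slice2; exact: test_derivable. Qed.

Lemma slice1_continuous phi (y : R) : test_function Om phi -> continuous (fun r => phi (r, y)).
Proof.
move=> t r; apply: (@continuous_comp _ _ _ (fun r : R => (r, y)) phi).
  by apply: (@cvg_pair _ _ _ _ (nbhs r) (nbhs y)); [exact: cvg_id|exact: cvg_cst].
exact: test_continuous.
Qed.

Lemma slice2_continuous phi (x : R) : test_function Om phi -> continuous (fun r => phi (x, r)).
Proof.
move=> t r; apply: (@continuous_comp _ _ _ (fun r : R => (x, r)) phi).
  by apply: (@cvg_pair _ _ _ _ (nbhs x) (nbhs r)); [exact: cvg_cst|exact: cvg_id].
exact: test_continuous.
Qed.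

Lemma axis2_derive phi x : 'D_(axis 2) phi x = 0.
Proof. by rewrite axisE2 derive0. Qed.

(** Fubini's theorem, integrating first along the axis [j]: on each line the derivative of a
    function vanishing outside the square has integral 0. For the third axis the derivative itself
    is 0. *)
Lemma test_integral_D phi j : test_function Om phi ->
  \int[mu2]_(x in Om) 'D_(axis j) phi x = 0.
Proof.
have [M M0 bOm] := domain_in_square.
move=> t; have tD := test_D j t; rewrite /Rintegral plane_integral; last first.
  by move=> x nO; rewrite (test_out tD nO).
have iD := plane_integrable (test_L2 tD) (fun x => @test_out _ x tD).
case: (ord3E j) => ej; rewrite ej in tD iD *.
- rewrite -integral21_prod_meas1//= /fubini_G integral0_eq// => y _.
  apply: (@line_integral0 _ (fun r => phi (r, y)) (fun r => 'D_(axis 0) phi (r, y)) _ _ M) => //.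
  + by move=> r; exact: slice1_derive.
  + exact: slice1_continuous tD.
  + by move=> r hr; rewrite (test_out1 _ bOm t)// (test_out1 _ bOm tD).
- rewrite -integral12_prod_meas1//= /fubini_F integral0_eq// => x _.
  apply: (@line_integral0 _ (fun r => phi (x, r)) (fun r => 'D_(axis 1) phi (x, r)) _ _ M) => //.
  + by move=> r; exact: slice2_derive.
  + exact: slice2_continuous tD.
  + by move=> r hr; rewrite (test_out2 _ bOm t)// (test_out2 _ bOm tD).
- by rewrite integral0_eq// => x _; rewrite axis2_derive.
Qed.

End TestFunctions.

(** * Weak derivatives, H^1 and H^1_0 *)

Section Sobolev.
Implicit Types (f g h v phi psi : R * R -> R) (j : 'I_3).

Let S2 := @L2_si.
Let mOm := @domain_measurable.

Lemma L2_lin a f g : L2 Om f -> L2 Om g -> L2 Om (a *: f + g).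
Proof. exact: (si_lin S2). Qed.

Lemma L2_sub f g : L2 Om f -> L2 Om g -> L2 Om (f - g).
Proof. exact: (si_B S2). Qed.

Lemma ip_ext f f' g g' : (forall x, Om x -> f x = f' x) ->
  (forall x, Om x -> g x = g' x) -> ip Om f g = ip Om f' g'.
Proof. by move=> h1 h2; apply: eq_Rintegral => x; rewrite inE => Ox; rewrite h1// h2. Qed.

Lemma L2_ext f f' : (forall x, Om x -> f x = f' x) -> L2 Om f -> L2 Om f'.
Proof.
move=> h [mf If]; split.
  by apply: eq_measurable_fun mf => x; rewrite inE => Ox; rewrite h.
apply: eq_integrable If; first exact: mOm.
by move=> x; rewrite inE => Ox; rewrite h.
Qed.

Lemma weak_partial_ext j f f' g : (forall x, Om x -> f x = f' x) ->
  is_weak_partial Om j f g -> is_weak_partial Om j f' g.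
Proof.
move=> h [h1 h2 h3]; split=> //; first exact: L2_ext h1.
by move=> phi t; rewrite -h3//; apply: ip_ext => // x Ox; rewrite h.
Qed.

Lemma pd_ext j f f' : (forall x, Om x -> f x = f' x) -> pd Om j f = pd Om j f'.
Proof.
move=> h; rewrite /pd; congr (xget _ _); apply/seteqP; split=> g /=.
  exact: weak_partial_ext.
by apply: weak_partial_ext => x Ox; rewrite h.
Qed.

Lemma weak_partial_test j phi : test_function Om phi ->
  is_weak_partial Om j phi ('D_(axis j) phi).
Proof.
move=> t; have tD := test_D j t; split; [exact: test_L2|exact: test_L2|].
move=> psi tp; have tpD := test_D j tp.
have := test_integral_D j (test_mul t tp).
have -> : \int[mu2]_(x in Om) 'D_(axis j) (phi * psi) x = ip Om phi ('D_(axis j) psi) +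
   ip Om ('D_(axis j) phi) psi.
  rewrite /ip -RintegralD; first last.
  - by apply: L2_mul_integrable; exact: test_L2.
  - by apply: L2_mul_integrable; exact: test_L2.
  - exact: mOm.
  apply: eq_Rintegral => x _; rewrite deriveM.
  + by rewrite /GRing.scale /= [psi x * _]mulrC.
  + exact: test_derivable t.
  + exact: test_derivable tp.
by move=> /eqP; rewrite addr_eq0 => /eqP.
Qed.

Lemma weak_partial_lin j a f g f' g' : is_weak_partial Om j f g ->
  is_weak_partial Om j f' g' -> is_weak_partial Om j (a *: f + f') (a *: g + g').
Proof.
move=> [h1 h2 h3] [h1' h2' h3']; split; [exact: L2_lin|exact: L2_lin|].
move=> phi t; have hp := test_L2 t; have hD := test_L2 (test_D j t).
by rewrite (si_linl S2)// (si_linl S2)// h3// h3'//; ring.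
Qed.

Lemma weak_partial_unique j f g g' : is_weak_partial Om j f g ->
  is_weak_partial Om j f g' -> {ae mu2, forall x, Om x -> g x = g' x}.
Proof.
move=> [_ h1 e1] [_ h2 e2]; have h12 := L2_sub h1 h2.
have := @weak_uniqueness R Om (g - g') (@domain_is_open R Om dom) (L2_integrable h12).
have e : forall phi, test_function Om phi -> \int[mu2]_(x in Om) ((g - g') x * phi x) = 0.
  move=> phi t; have hp := test_L2 t.
  rewrite -/(ip Om (g - g') phi) (si_sub S2)//.
  by have := e2 _ t; rewrite e1// => /oppr_inj ->; rewrite subrr.
move=> /(_ e); apply: ae_imp => x h Ox.
by apply/eqP; rewrite -subr_eq0; apply/eqP; exact: h.
Qed.

Lemma weak_partial_ae j f f' g g' : is_weak_partial Om j f g -> L2 Om f' -> L2 Om g' ->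
  {ae mu2, forall x, Om x -> f x = f' x} -> {ae mu2, forall x, Om x -> g x = g' x} ->
  is_weak_partial Om j f' g'.
Proof.
move=> [h1 h2 h3] hf' hg' e1 e2; split=> // phi t.
have hp := test_L2 t; have hD := test_L2 (test_D j t).
by rewrite -(ip_ae h1 hf' hD e1) -(ip_ae h2 hg' hp e2) h3.
Qed.

Lemma pdP j f : H1 Om f -> is_weak_partial Om j f (pd Om j f).
Proof. by move=> /(_ j) [g hg]; rewrite /pd; exact: (xgetPex (cst 0) (ex_intro _ g hg)). Qed.

Lemma H1_L2 f : H1 Om f -> L2 Om f.
Proof. by move=> /(pdP 0)[]. Qed.

Lemma pd_L2 j f : H1 Om f -> L2 Om (pd Om j f).
Proof. by move=> /(pdP j)[]. Qed.

Lemma pd_ae j f g : is_weak_partial Om j f g ->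
  {ae mu2, forall x, Om x -> pd Om j f x = g x}.
Proof.
move=> h; apply: (@weak_partial_unique j f) => //.
by rewrite /pd; exact: (xgetPex (cst 0) (ex_intro _ g h)).
Qed.

Lemma H1_lin a f g : H1 Om f -> H1 Om g -> H1 Om (a *: f + g).
Proof.
by move=> hf hg j; exists (a *: pd Om j f + pd Om j g); apply: weak_partial_lin; exact: pdP.
Qed.

Lemma pd_lin j a f g : H1 Om f -> H1 Om g ->
  {ae mu2, forall x, Om x -> pd Om j (a *: f + g) x = (a *: pd Om j f + pd Om j g) x}.
Proof. by move=> hf hg; apply: pd_ae; apply: weak_partial_lin; exact: pdP. Qed.

Lemma ip_pd_lin j a f g h : H1 Om f -> H1 Om g -> L2 Om h ->
  ip Om (pd Om j (a *: f + g)) h = a * ip Om (pd Om j f) h + ip Om (pd Om j g) h.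
Proof.
move=> hf hg hh; have pf := pd_L2 j hf; have pg := pd_L2 j hg.
rewrite -(si_linl S2)//; apply: ip_ae => //; first exact/pd_L2/H1_lin.
  exact: L2_lin.
exact: pd_lin.
Qed.

(** Although [pd] is a choice and linear only almost everywhere, this form is exactly bilinear on
    H^1, integrals being blind to null sets; all the norm inequalities for gradients come from this
    fact. *)
Definition pdform j f g := ip Om (pd Om j f) (pd Om j g).

Lemma pdform_si j : semi_inner (H1 Om) (pdform j).
Proof.
split.
- by move=> a x y; exact: H1_lin.
- by move=> x y; exact: (si_sym S2).
- by move=> a x y z hx hy hz; apply: ip_pd_lin => //; exact: pd_L2.
- by move=> x hx; apply: (si_ge0 S2); exact: pd_L2.
Qed.

Lemma H1_sub f g : H1 Om f -> H1 Om g -> H1 Om (f - g).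
Proof. exact: (si_B (pdform_si 0)). Qed.

Lemma test_H1 phi : test_function Om phi -> H1 Om phi.
Proof. by move=> t j; exists ('D_(axis j) phi); exact: weak_partial_test. Qed.

Lemma L2norm_ge0 f : 0 <= L2norm Om f. Proof. exact: sqrtr_ge0. Qed.

Lemma L2norm_ae f g : L2 Om f -> L2 Om g ->
  {ae mu2, forall x, Om x -> f x = g x} -> L2norm Om f = L2norm Om g.
Proof.
move=> hf hg e; rewrite /L2norm (ip_ae hf hg hf e) (si_sym S2).
by rewrite (ip_ae hf hg hg e).
Qed.

Lemma L2norm_sqr f : L2norm Om f ^+ 2 = ip Om f f.
Proof. by rewrite sqr_sqrtr//; apply: Rintegral_ge0 => x _; rewrite -expr2 sqr_ge0. Qed.

Lemma L2norm_le_H1norm f : L2norm Om f <= H1norm Om f.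
Proof.
rewrite -ler_sqr ?nnegrE ?L2norm_ge0 ?sqrtr_ge0//.
have h0 : 0 <= \sum_j L2norm Om (pd Om j f) ^+ 2 by apply: sumr_ge0 => i _; exact: sqr_ge0.
by rewrite /H1norm [leRHS]sqr_sqrtr ?addr_ge0 ?sqr_ge0// lerDl.
Qed.

Lemma pdnorm_le_H1norm j f : L2norm Om (pd Om j f) <= H1norm Om f.
Proof.
rewrite -ler_sqr ?nnegrE ?L2norm_ge0 ?sqrtr_ge0//.
have h0 k : 0 <= L2norm Om (pd Om k f) ^+ 2 by exact: sqr_ge0.
rewrite /H1norm [leRHS]sqr_sqrtr ?addr_ge0 ?sumr_ge0 ?sqr_ge0//.
by rewrite (bigD1 j)//= addrCA lerDl addr_ge0 ?sqr_ge0 ?sumr_ge0.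
Qed.

Lemma H1norm_le_H2norm f : H2 Om f -> L2norm Om f <= H2norm Om f.
Proof.
move=> _; rewrite -ler_sqr ?nnegrE ?L2norm_ge0 ?sqrtr_ge0//.
have h0 : 0 <= \sum_j H1norm Om (pd Om j f) ^+ 2 by apply: sumr_ge0 => i _; exact: sqr_ge0.
by rewrite /H2norm [leRHS]sqr_sqrtr ?addr_ge0 ?sqr_ge0// lerDl.
Qed.

Lemma pdnorm_le_H2norm j f : L2norm Om (pd Om j f) <= H2norm Om f.
Proof.
apply: (le_trans (L2norm_le_H1norm _)).
rewrite -ler_sqr ?nnegrE ?sqrtr_ge0//.
have h0 k : 0 <= H1norm Om (pd Om k f) ^+ 2 by exact: sqr_ge0.
rewrite /H2norm [leRHS]sqr_sqrtr ?addr_ge0 ?sumr_ge0 ?sqr_ge0//.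
by rewrite (bigD1 j)//= addrCA lerDl addr_ge0 ?sqr_ge0 ?sumr_ge0.
Qed.

Lemma H10_H1 f : H10 Om f -> H1 Om f. Proof. by case. Qed.

(** [H1norm] collects four squares, of the function and of its three partial derivatives, each below
    [e ^+ 2]; hence the factor 2. *)
Lemma H1norm_lt f (e : R) : 0 < e -> L2norm Om f < e ->
  (forall j, L2norm Om (pd Om j f) < e) -> H1norm Om f < 2 * e.
Proof.
move=> e0 h1 h2; have e2 : 0 < 2 * e by rewrite mulr_gt0.
rewrite -ltr_sqr ?nnegrE ?sqrtr_ge0 ?(ltW e2)//.
have h0 j : 0 <= L2norm Om (pd Om j f) ^+ 2 by exact: sqr_ge0.
rewrite sqr_sqrtr ?addr_ge0 ?sumr_ge0 ?sqr_ge0//.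
have l g : L2norm Om g < e -> L2norm Om g ^+ 2 < e ^+ 2.
  by move=> h; rewrite ltr_sqr ?nnegrE ?L2norm_ge0 ?(ltW e0).
have key (a b c d q : R) : 0 < q -> a < q -> b < q -> c < q -> d < q ->
  a + (0 + b + c + d) < 2 ^+ 2 * q by lra.
rewrite !big_ord_recr big_ord0 /=.
rewrite (_ : widen_ord _ (widen_ord _ ord_max) = 0); last exact: val_inj.
rewrite (_ : widen_ord _ ord_max = 1); last exact: val_inj.
rewrite (_ : ord_max = 2); last exact: val_inj.
by rewrite exprMn; apply: key; rewrite ?exprn_gt0//; apply: l.
Qed.

Lemma H10_seq f : H10 Om f -> exists phi : nat -> R * R -> R,
  [/\ forall k, test_function Om (phi k),
      L2norm Om (f - phi k) @[k --> \oo] --> (0 : R) &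
      forall j, L2norm Om (pd Om j f - 'D_(axis j) (phi k)) @[k --> \oo] --> (0 : R)].
Proof.
move=> [Hf hf]; have h0 k : 0 < k.+1%:R^-1 :> R by [].
have [phi hphi] := choice (fun k => let: ex_intro2 p a b := hf _ (h0 k) in
  ex_intro (fun p => test_function Om p /\ H1norm Om (f - p) < k.+1%:R^-1) p (conj a b)).
have sq (u : nat -> R) : (forall k, 0 <= u k <= k.+1%:R^-1) -> u @ \oo --> (0 : R).
  move=> hu; apply: (@squeeze_cvgr _ _ _ _ (cst 0) harmonic).
  - exact: nearW.
  - exact: cvg_cst.
  - exact: cvg_harmonic.
exists phi; split.
- by move=> k; have [] := hphi k.
- apply: sq => k; rewrite L2norm_ge0 (le_trans (L2norm_le_H1norm _))// ltW//.
  by have [] := hphi k.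
- move=> j; apply: sq => k; rewrite L2norm_ge0; have [t hk] := hphi k.
  apply: (le_trans _ (ltW hk)); apply: (le_trans _ (pdnorm_le_H1norm j _)).
  rewrite le_eqVlt; apply/orP; left; apply/eqP; apply: L2norm_ae.
  + by apply: L2_sub; [exact: pd_L2|apply: test_L2; exact: test_D].
  + by apply: pd_L2; apply: H1_sub => //; exact: test_H1.
  have := pd_ae (weak_partial_lin (-1) (weak_partial_test j t) (pdP j Hf)).
  have e2 (p q : R * R -> R) : p - q = -1 *: q + p by rewrite scaleN1r addrC.
  by apply: ae_imp => x hx Ox; rewrite !e2 hx.
Qed.

(** H^1_0 is closed in H^1: a test function close to some [phi k] is close to [f]. The limit may be
    one of H^1_0 functions, as for the initial value of the solution. *)
Lemma H10_intro f (phi : nat -> R * R -> R) : H1 Om f ->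
  (forall k, H10 Om (phi k)) ->
  L2norm Om (f - phi k) @[k --> \oo] --> (0 : R) ->
  (forall j, L2norm Om (pd Om j (f - phi k)) @[k --> \oo] --> (0 : R)) -> H10 Om f.
Proof.
move=> Hf hp h1 h2; split=> // e e0.
have e4 : 0 < e / 4 by rewrite divr_gt0.
have lt0 (u : nat -> R) : u @ \oo --> (0 : R) -> \forall k \near \oo, u k < e / 4.
  by move=> hu; exact: (cvgr_lt _ hu).
have F : \forall k \near \oo, forall j, L2norm Om (pd Om j (f - phi k)) < e / 4.
  apply: (@filter_forall _ _ (fun j k => L2norm Om (pd Om j (f - phi k)) < e / 4)) => j.
  exact: lt0.
have [k [k1 k2]] : exists k, L2norm Om (f - phi k) < e / 4 /\
    forall j, L2norm Om (pd Om j (f - phi k)) < e / 4.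
  by apply: (@filter_ex _ \oo); apply: filterI; [exact: lt0|exact: F].
have hfk := H1_sub Hf (H10_H1 (hp k)).
have [psi t hpsi] := (hp k).2 _ e4.
exists psi => //.
have Hk := H10_H1 (hp k); have Hs := test_H1 t.
have hkp := H1_sub Hk Hs.
have -> : f - psi = (f - phi k) + (phi k - psi) by rewrite addrA subrK.
rewrite (_ : e = 2 * (e / 4 + e / 4)); last by field.
apply: H1norm_lt; first by rewrite addr_gt0.
  apply: (le_lt_trans (si_triangle S2 (H1_L2 hfk) (H1_L2 hkp))).
  by apply: ltrD => //; apply: (le_lt_trans (L2norm_le_H1norm _)).
move=> j; apply: (le_lt_trans (si_triangle (pdform_si j) hfk hkp)).
by apply: ltrD; [exact: k2|apply: (le_lt_trans (pdnorm_le_H1norm j _))].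
Qed.

Lemma test_H10 phi : test_function Om phi -> H10 Om phi.
Proof.
move=> t; split; first exact: test_H1.
move=> e e0; exists phi => //; rewrite subrr.
have H0 : H1 Om 0 by rewrite -(subrr phi); apply: H1_sub; exact: test_H1.
rewrite (_ : e = 2 * (e / 2)); last by field.
have e2 : 0 < e / 2 by rewrite divr_gt0.
apply: H1norm_lt => // [|j].
  by rewrite /L2norm (si_zerol S2) ?sqrtr0//; exact: H1_L2.
by rewrite /L2norm -/(pdform j 0 0) (si_zerol (pdform_si j)) ?sqrtr0.
Qed.

Lemma H10_lin a f g : H10 Om f -> H10 Om g -> H10 Om (a *: f + g).
Proof.
move=> hf hg; have [phi [t1 a1 b1]] := H10_seq hf; have [psi [t2 a2 b2]] := H10_seq hg.
have Hf := H10_H1 hf; have Hg := H10_H1 hg.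
apply: (@H10_intro _ (fun k => a *: phi k + psi k)); first exact: H1_lin.
- by move=> k; apply: test_H10; exact: test_lin.
- apply: (@squeeze_cvgr _ _ _ _ (cst 0)
    (fun k => `|a| * L2norm Om (f - phi k) + L2norm Om (g - psi k))).
  + apply: nearW => k; rewrite L2norm_ge0 /=.
    have -> : a *: f + g - (a *: phi k + psi k) = a *: (f - phi k) + (g - psi k).
      by rewrite scalerBr opprD addrACA.
    have h1 := H1_L2 (H1_sub Hf (test_H1 (t1 k))).
    have h2 := H1_L2 (H1_sub Hg (test_H1 (t2 k))).
    apply: (le_trans (si_triangle S2 (si_Z S2 a h1) h2)).
    by rewrite (si_norm_scale S2 a h1).
  + exact: cvg_cst.
  + rewrite -[X in _ --> X]addr0 -[X in _ --> X + _](mulr0 `|a|).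
    by apply: cvgD => //; exact: cvgMr.
- move=> j; apply: (@squeeze_cvgr _ _ _ _ (cst 0)
    (fun k => `|a| * L2norm Om (pd Om j f - 'D_(axis j) (phi k)) +
     L2norm Om (pd Om j g - 'D_(axis j) (psi k)))).
  + apply: nearW => k; rewrite L2norm_ge0 /=.
    have pf := pd_L2 j Hf; have pg := pd_L2 j Hg.
    have tk := test_L2 (test_D j (t1 k)); have sk := test_L2 (test_D j (t2 k)).
    have h1 := L2_sub pf tk; have h2 := L2_sub pg sk.
    apply: (@le_trans _ _ (L2norm Om (a *: (pd Om j f - 'D_(axis j) (phi k)) +
      (pd Om j g - 'D_(axis j) (psi k))))); last first.
      apply: (le_trans (si_triangle S2 (si_Z S2 a h1) h2)).
      by rewrite (si_norm_scale S2 a h1).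
    rewrite le_eqVlt; apply/orP; left; apply/eqP; apply: L2norm_ae.
    * apply: pd_L2; apply: H1_sub; first exact: H1_lin.
      by apply: H1_lin; exact: test_H1.
    * exact: L2_lin.
    have W := weak_partial_lin a (weak_partial_lin (-1) (weak_partial_test j (t1 k)) (pdP j Hf))
      (weak_partial_lin (-1) (weak_partial_test j (t2 k)) (pdP j Hg)).
    have := pd_ae W; apply: ae_imp => x hx Ox.
    have e1 : a *: f + g - (a *: phi k + psi k) = a *: (-1 *: phi k + f) + (-1 *: psi k + g).
      by rewrite !scaleN1r scalerDr scalerN opprD addrACA; congr (_ + _); rewrite addrC.
    by rewrite e1 hx// !scaleN1r ![- 'D_(axis j) _ + _]addrC.
  + exact: cvg_cst.
  + rewrite -[X in _ --> X]addr0 -[X in _ --> X + _](mulr0 `|a|).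
    by apply: cvgD => //; exact: cvgMr.
Qed.

End Sobolev.

(** * Limits in L^2 and Poincaré's inequality *)

Section Estimates.
Implicit Types (f g h v phi psi : R * R -> R) (j : 'I_3).

Lemma L2norm_abs f : L2norm Om (fun x => `|f x|) = L2norm Om f.
Proof.
rewrite /L2norm; congr Num.sqrt; apply: eq_Rintegral => x _.
by rewrite -normrM ger0_norm// -expr2 sqr_ge0.
Qed.

Lemma L2_abs f : L2 Om f -> L2 Om (fun x => `|f x|).
Proof.
move=> [mf If]; split; first exact: measurableT_comp.
by under eq_fun do rewrite real_normK ?num_real//.
Qed.

Lemma ip_le f g : L2 Om f -> L2 Om g -> `|ip Om f g| <= L2norm Om f * L2norm Om g.
Proof. exact: (si_le L2_si). Qed.

Lemma integral_abs_le f g : L2 Om f -> L2 Om g ->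
  \int[mu2]_(x in Om) `|f x * g x| <= L2norm Om f * L2norm Om g.
Proof.
move=> hf hg; have := ip_le (L2_abs hf) (L2_abs hg); rewrite !L2norm_abs.
apply: le_trans; apply: (le_trans _ (ler_norm _)).
by rewrite le_eqVlt; apply/orP; left; apply/eqP; apply: eq_Rintegral => x _; rewrite normrM.
Qed.

Lemma ip_cvg f g (f_ g_ : nat -> R * R -> R) : L2 Om f -> L2 Om g ->
  (forall k, L2 Om (f_ k)) -> (forall k, L2 Om (g_ k)) ->
  L2norm Om (f - f_ k) @[k --> \oo] --> (0 : R) ->
  L2norm Om (g - g_ k) @[k --> \oo] --> (0 : R) ->
  ip Om (f_ k) (g_ k) @[k --> \oo] --> ip Om f g.
Proof.
move=> hf hg hf_ hg_ cf cg; apply/subr_cvg0/norm_cvg0P.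
apply: (@squeeze_cvgr _ _ _ _ (cst 0) (fun k =>
   L2norm Om f * L2norm Om (g - g_ k) + L2norm Om (f - f_ k) * L2norm Om g
   + L2norm Om (f - f_ k) * L2norm Om (g - g_ k))).
- apply: nearW => k; rewrite normr_ge0 /=.
  have h1 := L2_sub hf (hf_ k); have h2 := L2_sub hg (hg_ k).
  rewrite distrC; have e : ip Om f g - ip Om (f_ k) (g_ k) =
      ip Om f (g - g_ k) + ip Om (f - f_ k) g - ip Om (f - f_ k) (g - g_ k).
    rewrite !(si_subr L2_si)// !(si_sub L2_si)//; ring.
  rewrite e; apply: (le_trans (ler_normB _ _)); apply: lerD; last exact: ip_le.
  by apply: (le_trans (ler_normD _ _)); apply: lerD; exact: ip_le.
- exact: cvg_cst.
- rewrite [X in _ --> X](_ : 0 = L2norm Om f * 0 + 0 * L2norm Om g + 0 * 0); last first.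
    by rewrite mulr0 !mul0r !addr0.
  apply: cvgD; last exact: cvgM.
  by apply: cvgD; [exact: cvgMr|exact: cvgMl].
Qed.

Lemma L2norm_cvg f (f_ : nat -> R * R -> R) : L2 Om f -> (forall k, L2 Om (f_ k)) ->
  L2norm Om (f - f_ k) @[k --> \oo] --> (0 : R) ->
  L2norm Om (f_ k) @[k --> \oo] --> L2norm Om f.
Proof.
move=> hf hf_ c; apply: (continuous_cvg _ (@sqrt_continuous R _)).
exact: ip_cvg.
Qed.

Lemma cst_cvg0 f : L2 Om f -> L2norm Om (f - f) @[k --> \oo] --> (0 : R).
Proof. by move=> hf; rewrite subrr /L2norm (si_zerol L2_si (si_0 L2_si hf)) sqrtr0; exact: cvg_cst. Qed.

(** The definition of the weak derivative covers test functions; both pairings are continuous along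
    an approximation of [v] in H^1. *)
Lemma integration_by_parts_H10 j f v : H1 Om f -> H10 Om v ->
  ip Om f (pd Om j v) = - ip Om (pd Om j f) v.
Proof.
move=> hf hv; have [phi [t c1 c2]] := H10_seq hv; have Hv := H10_H1 hv.
have pf := pd_L2 j hf; have pv := pd_L2 j Hv.
have a1 := ip_cvg (H1_L2 hf) pv (fun=> H1_L2 hf) (fun k => test_L2 (test_D j (t k)))
  (cst_cvg0 (H1_L2 hf)) (c2 j).
have a2 := ip_cvg pf (H1_L2 Hv) (fun=> pf) (fun k => test_L2 (t k)) (cst_cvg0 pf) c1.
have e : (fun k => ip Om f ('D_(axis j) (phi k))) = (fun k => - ip Om (pd Om j f) (phi k)).
  by apply/funext => k; have [_ _ ->] := pdP j hf.
rewrite e in a1; exact: (cvg_unique (@norm_hausdorff _ _) a1 (cvgN a2)).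
Qed.

(** The multiplier [x]: the integral of the [x]-derivative of [x * phi ^ 2] is 0, so [phi ^ 2]
    integrates like [- 2 x phi] times the derivative of [phi]. On the square [x] is at most [M] in
    absolute value, which gives the constant [2 * M]. *)
Lemma poincare_test : exists2 C : R, 0 <= C & forall phi, test_function Om phi ->
  L2norm Om phi <= C * L2norm Om ('D_(axis 0) phi).
Proof.
have [M M0 bOm] := @domain_in_square _ _ dom; exists (2 * M); first by rewrite mulr_ge0// ltW.
move=> phi t.
have s1 : smooth2 (fun z : R * R => id z.1 * cst 1 z.2) by exact: (tensor_smooth2 (@sa_id R) (sa_cst 1)).
have tx : test_function Om ((fun z : R * R => id z.1 * cst 1 z.2) * phi).
  apply: (test_sub t).
    apply: smooth2_algW; apply: s2_mul; constructor => //.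
    by move/test_smooth2 : t => [].
  by apply: supp_sub => x h; rewrite [LHS]/GRing.mul /= h mulr0.
have D : forall x, 'D_(axis 0) (((fun z : R * R => id z.1 * cst 1 z.2) * phi) * phi) x =
    phi x * phi x + 2 * x.1 * phi x * 'D_(axis 0) phi x.
  move=> x; have h1 := tensor_derive 0 x (@sa_id R) (sa_cst 1).
  have d1 := derivableP (test_derivable (j := 0) (x := x) t).
  have [_ ->] := is_deriveM (is_deriveM h1 d1) d1.
  have -> : derive1 (id : R -> R) x.1 = 1 by rewrite derive1E derive_id.
  rewrite [(_ * phi) x](_ : _ = x.1 * 1 * phi x)// /GRing.scale /=.
  by ring.
have h := test_integral_D 0 (test_mul tx t); 
rewrite (_ : \int[_]_(_ in _) _ = \int[mu2]_(x in Om)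
    (phi x * phi x + 2 * x.1 * phi x * 'D_(axis 0) phi x)) in h; last first.
  by apply: eq_Rintegral => x _; exact: D.
have hp := test_L2 t; have hD := test_L2 (test_D 0 t).
have hx : L2 Om (fun x => x.1 * phi x).
  by apply: L2_ext (test_L2 tx) => x _; rewrite [LHS]/GRing.mul /= mulr1.
have I1 := L2_mul_integrable hp hp.
have I2 := L2_mul_integrable hx hD.
have key : ip Om phi phi = - (2 * ip Om (fun x => x.1 * phi x) ('D_(axis 0) phi)).
  apply/eqP; rewrite -addr_eq0; apply/eqP; rewrite -[RHS]h /ip.
  rewrite -RintegralZl; [|exact: domain_measurable|exact: I2].
  rewrite -RintegralD; [|exact: domain_measurable|exact: I1|].
    by apply: eq_Rintegral => x _; rewrite !mulrA.
  exact: (@integrableZl _ _ R mu2 Om domain_measurable 2 _ I2).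
have nx : L2norm Om (fun x => x.1 * phi x) <= M * L2norm Om phi.
  rewrite -(ger0_norm (ltW M0)) -(si_norm_scale L2_si)//.
  rewrite /L2norm /si_norm ler_wsqrtr//; apply: le_Rintegral; first exact: domain_measurable.
  - exact: L2_mul_integrable.
  - by have Z := si_Z L2_si M hp; exact: L2_mul_integrable.
  - move=> x /bOm[/andP[x1 x2] _]; rewrite /GRing.scale /=.
    rewrite mulrACA [leRHS]mulrACA; apply: ler_wpM2r; first by rewrite -expr2 sqr_ge0.
    nra.
have := le_trans (ler_norm _) (ip_le hx hD) => {}nb.
have := ip_le hx hD; rewrite -normrN => /(le_trans (ler_norm _)) nb2.
have n0 := L2norm_ge0 phi; have d0 := L2norm_ge0 ('D_(axis 0) phi).
have e2 : L2norm Om phi ^+ 2 <= 2 * M * L2norm Om ('D_(axis 0) phi) * L2norm Om phi.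
  rewrite L2norm_sqr key.
  have nb3 := ler_wpM2r d0 nx.
  by move: nb2 nb3; rewrite -mulrN; nra.
have [p0|p0] := eqVneq (L2norm Om phi) 0.
  by rewrite p0 mulr_ge0// mulr_ge0// ltW.
by rewrite -(ler_pM2r (x := L2norm Om phi)) ?lt0r ?p0// -expr2.
Qed.

Lemma poincare : exists2 C : R, 0 <= C & forall v, H10 Om v ->
  L2norm Om v <= C * L2norm Om (pd Om 0 v).
Proof.
have [C C0 hC] := poincare_test; exists C => // v hv.
have [phi [t c1 c2]] := H10_seq hv; have Hv := H10_H1 hv.
have pv := pd_L2 0 Hv.
have n1 := L2norm_cvg (H1_L2 Hv) (fun k => test_L2 (t k)) c1.
have n2 := L2norm_cvg pv (fun k => test_L2 (test_D 0 (t k))) (c2 0).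
have n3 : C * L2norm Om ('D_(axis 0) (phi k)) @[k --> \oo] --> C * L2norm Om (pd Om 0 v).
  exact: cvgMr.
by apply: (ler_cvg_to n1 n3) => //; apply: nearW => k; exact: hC.
Qed.

End Estimates.

(** * Ladyzhenskaya's inequality *)

Section Ladyzhenskaya.
Implicit Types (f g h v phi psi : R * R -> R) (j : 'I_3).

Lemma test_sqr_slice1 phi (x y : R) : test_function Om phi ->
  ((phi (x, y) ^+ 2)%:E <= \int[mu1]_r (`|2 * (phi (r, y) * 'D_(axis 0) phi (r, y))|)%:E)%E.
Proof.
move=> t; have [M M0 bOm] := @domain_in_square _ _ dom.
pose F r := phi (r, y) * phi (r, y).
pose f r := 2 * (phi (r, y) * 'D_(axis 0) phi (r, y)).
have dF (r : R) : is_derive r (1 : R) F (f r).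
  have d := slice1_derive y r t.
  apply: (is_derive_eq (is_deriveM d d)); rewrite /GRing.scale /= /f; ring.
have cf : continuous f.
  have c1 := slice1_continuous (y := y) t; have c2 := slice1_continuous (y := y) (test_D 0 t).
  by rewrite /f => r; apply: cvgMr; exact: (cvgM (c1 r) (c2 r)).
(* A starting point to the left of both the square and [x]. *)
have F0 : F (- M - `|x| - 1) = 0.
  rewrite /F (test_out1 y bOm t) ?mul0r//; apply/negP => /andP[h _].
  by have := normr_ge0 x; lra.
have ax : - M - `|x| - 1 < x by have := ler_norm (- x); rewrite normrN; lra.
have := line_bound dF cf ax F0.
by rewrite /F -expr2 ger0_norm ?sqr_ge0.
Qed.

Lemma test_sqr_slice2 phi (x y : R) : test_function Om phi ->
  ((phi (x, y) ^+ 2)%:E <= \int[mu1]_r (`|2 * (phi (x, r) * 'D_(axis 1) phi (x, r))|)%:E)%E.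
Proof.
move=> t; have [M M0 bOm] := @domain_in_square _ _ dom.
pose F r := phi (x, r) * phi (x, r).
pose f r := 2 * (phi (x, r) * 'D_(axis 1) phi (x, r)).
have dF (r : R) : is_derive r (1 : R) F (f r).
  have d := slice2_derive x r t.
  apply: (is_derive_eq (is_deriveM d d)); rewrite /GRing.scale /= /f; ring.
have cf : continuous f.
  have c1 := slice2_continuous (x := x) t; have c2 := slice2_continuous (x := x) (test_D 1 t).
  by rewrite /f => r; apply: cvgMr; exact: (cvgM (c1 r) (c2 r)).
have F0 : F (- M - `|y| - 1) = 0.
  rewrite /F (test_out2 x bOm t) ?mul0r//; apply/negP => /andP[h _].
  by have := normr_ge0 y; lra.
have ax : - M - `|y| - 1 < y by have := ler_norm (- y); rewrite normrN; lra.
have := line_bound dF cf ax F0.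
by rewrite /F -expr2 ger0_norm ?sqr_ge0.
Qed.

Lemma test_flux_integral phi j : test_function Om phi ->
  (\int[mu2]_z (`|2 * (phi z * 'D_(axis j) phi z)|)%:E <=
   (2 * (L2norm Om phi * L2norm Om ('D_(axis j) phi)))%:E)%E.
Proof.
move=> t; have hp := test_L2 t; have hD := test_L2 (test_D j t).
have I := L2_mul_integrable hp hD.
have I2 : mu2.-integrable Om (EFin \o (fun z => `|2 * (phi z * 'D_(axis j) phi z)|)).
  have I0 : mu2.-integrable Om (EFin \o (fun z => 2 * (phi z * 'D_(axis j) phi z))).
    exact: (@integrableZl _ _ R mu2 Om domain_measurable 2 _ I).
  exact: (integrable_norm I0).
rewrite -plane_integral; last first.
  by move=> x nO; rewrite (test_out t nO) mul0r mulr0 normr0.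
rewrite -[leLHS]fineK; last by apply: integrable_fin_num; [exact: domain_measurable|exact: I2].
rewrite lee_fin -/(Rintegral _ _ _).
have := integral_abs_le hp hD; rewrite -(ler_pM2l (x := 2))//.
apply: le_trans; rewrite -RintegralZl; [|exact: domain_measurable|exact: integrable_norm I].
by rewrite le_eqVlt; apply/orP; left; apply/eqP; apply: eq_Rintegral => x _; rewrite normrM ger0_norm.
Qed.

(** One factor [phi ^ 2] is bounded by an integral [A] along the horizontal line, which depends on
    [y] only, the other by an integral [B] along the vertical line, which depends on [x] only. The
    integral of [B x * A y] factorizes, and each factor brings a 2. *)
Lemma ladyzhenskaya_test phi : test_function Om phi ->
  ip Om (fun x => phi x ^+ 2) (fun x => phi x ^+ 2) <=
  4 * L2norm Om phi ^+ 2 * L2norm Om ('D_(axis 0) phi) * L2norm Om ('D_(axis 1) phi).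
Proof.
move=> t; set n := L2norm Om phi; set n0 := L2norm _ _; set n1 := L2norm _ _.
pose G (j : 'I_3) (z : R * R) := (`|2 * (phi z * 'D_(axis j) phi z)|)%:E.
have mG j : measurable_fun setT (G j).
  apply/measurable_EFinP; apply: measurableT_comp => //.
  by apply: measurable_funM => //; apply: measurable_funM; apply: test_measurable => //; exact: test_D.
have G0 j z : (0 <= G j z)%E by rewrite lee_fin.
pose A y := (\int[mu1]_r G 0%R (r, y))%E; pose B x := (\int[mu1]_r G 1%R (x, r))%E.
have A0 y : (0 <= A y)%E by apply: integral_ge0.
have B0 x : (0 <= B x)%E by apply: integral_ge0.
have mA : measurable_fun setT A := @measurable_fun_fubini_tonelli_G _ _ _ _ R mu1 (G 0) (mG 0) (G0 0).
have mB : measurable_fun setT B := @measurable_fun_fubini_tonelli_F _ _ _ _ R mu1 (G 1) (mG 1) (G0 1).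
have iA : (\int[mu1]_y A y <= (2 * (n * n0))%:E)%E.
  apply: le_trans (test_flux_integral 0 t).
  have e : (\int[mu2]_z G 0%R z = \int[mu1]_y A y)%E :=
    @fubini_tonelli2 _ _ _ _ R mu1 mu1 (G 0) (mG 0) (G0 0).
  by rewrite -e.
have iB : (\int[mu1]_x B x <= (2 * (n * n1))%:E)%E.
  apply: le_trans (test_flux_integral 1 t).
  have e : (\int[mu2]_z G 1%R z = \int[mu1]_x B x)%E :=
    @fubini_tonelli1 _ _ _ _ R mu1 mu1 (G 1) (mG 1) (G0 1).
  by rewrite -e.
have iA0 : (0 <= \int[mu1]_y A y)%E by apply: integral_ge0 => y _; exact: A0.
have iB0 : (0 <= \int[mu1]_x B x)%E by apply: integral_ge0 => x _; exact: B0.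
have key : (\int[mu2]_z ((phi z ^+ 2) * (phi z ^+ 2))%:E <= \int[mu1]_x B x * \int[mu1]_y A y)%E.
  have mp : measurable_fun setT (fun z => ((phi z ^+ 2) * (phi z ^+ 2))%:E).
    apply/measurable_EFinP; apply: measurable_funM; apply: measurable_funX;
      exact: test_measurable.
  pose F (z : R * R) := ((phi z ^+ 2) * (phi z ^+ 2))%:E.
  have F0 z : (0 <= F z)%E by rewrite lee_fin mulr_ge0 ?sqr_ge0.
  have e : (\int[mu2]_z F z = \int[mu1]_x \int[mu1]_y F (x, y))%E :=
    @fubini_tonelli1 _ _ _ _ R mu1 mu1 F mp F0.
  have mF : measurable_fun setT (fun x => \int[mu1]_y F (x, y))%E :=
    @measurable_fun_fubini_tonelli_F _ _ _ _ R mu1 F mp F0.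
  have e3 := @ge0_integralZr _ _ R mu1 setT measurableT B mB (\int[mu1]_y A y)%E (fun x _ => B0 x) iA0.
  have mBI : measurable_fun setT (fun x => B x * \int[mu1]_y A y)%E.
    exact: emeasurable_funM mB (measurable_cst _).
  suff h : (\int[mu1]_x \int[mu1]_y F (x, y) <= \int[mu1]_x (B x * \int[mu1]_y A y))%E.
    by rewrite -e3; exact: (eq_ind_r (fun s => (s <= _)%E) h e).
  apply: (@ge0_le_integral _ _ R mu1 setT measurableT _ _ _ mF mBI) => x _.
    by apply: integral_ge0 => y _; exact: F0.
  rewrite -(@ge0_integralZl _ _ R mu1 setT measurableT A mA (B x) (fun y _ => A0 y) (B0 x)).
  have mFx : measurable_fun setT (fun y => F (x, y)) by exact: measurableT_comp mp (measurable_pair1 x).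
  have mBA : measurable_fun setT (fun y => B x * A y)%E.
    exact: emeasurable_funM (measurable_cst _) mA.
  apply: (@ge0_le_integral _ _ R mu1 setT measurableT _ _ (fun y _ => F0 (x, y)) mFx mBA).
  move=> y _; rewrite /F EFinM; apply: lee_pmul; rewrite ?lee_fin ?sqr_ge0//.
    exact: test_sqr_slice2.
  exact: test_sqr_slice1.
have pos : 0 <= n * n0 by rewrite mulr_ge0 ?L2norm_ge0.
have hp2 : L2 Om (fun x => phi x ^+ 2).
  have [K hK] := test_bounded t; apply: (@bounded_L2 _ (K ^+ 2)).
    by apply: measurable_funX; exact: test_measurable.
  by move=> x _; rewrite normrX ler_sqr ?nnegrE// (le_trans _ (hK x)).
rewrite -lee_fin /ip /Rintegral fineK; last first.
  by apply: integrable_fin_num; [exact: domain_measurable|exact: L2_mul_integrable].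
rewrite plane_integral; last by move=> x nO; rewrite (test_out t nO) expr0n mul0r.
refine (le_trans key (le_trans (lee_pmul iB0 iA0 iB iA) _)).
by rewrite -EFinM lee_fin le_eqVlt; apply/orP; left; apply/eqP; ring.
Qed.

(* The truncated fourth power is Lipschitz, so limits of test functions can be
   taken before the fourth power is known to be integrable. *)
Definition clip (m : R) (s : R) := Num.min `|s| m.

Lemma clip_itv m s : 0 <= m -> 0 <= clip m s <= m.
Proof. by move=> m0; rewrite /clip le_min normr_ge0 m0 ge_min lexx orbT. Qed.

Lemma clip_lip m a b : `|clip m a - clip m b| <= `|a - b|.
Proof.
have := ler_dist_dist a b; rewrite /clip ler_norml => /andP[h3 h4].
by rewrite ler_norml; case: (leP `|a| m); case: (leP `|b| m) => h5 h6; apply/andP; split; lra.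
Qed.

Lemma clip4_lip m a b : 0 <= m ->
  clip m a ^+ 2 * clip m a ^+ 2 <= clip m b ^+ 2 * clip m b ^+ 2 + 4 * m ^+ 3 * `|a - b|.
Proof.
move=> m0; have := clip_lip m a b; rewrite ler_norml => /andP[_].
have /andP[] := clip_itv a m0; have /andP[] := clip_itv b m0.
set x := clip m a; set y := clip m b; set d := `|_| => y0 ym x0 xm xy.
have d0 : 0 <= d by rewrite /d.
have [xley|yltx] := lerP x y.
  apply: (@le_trans _ _ (y ^+ 2 * y ^+ 2)).
    by apply: ler_pM; rewrite ?sqr_ge0// ler_sqr ?nnegrE.
  by rewrite lerDl !mulr_ge0 ?exprn_ge0.
have x2 : x ^+ 2 <= m ^+ 2 by rewrite ler_sqr ?nnegrE.
have y2 : y ^+ 2 <= m ^+ 2 by rewrite ler_sqr ?nnegrE.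
have -> : x ^+ 2 * x ^+ 2 = y ^+ 2 * y ^+ 2 + (x - y) * ((x + y) * (x ^+ 2 + y ^+ 2)) by ring.
rewrite lerD2l mulrC; apply: ler_pM => //.
- by rewrite mulr_ge0 ?addr_ge0 ?sqr_ge0.
- by rewrite subr_ge0 ltW.
- apply: (@le_trans _ _ ((m + m) * (m ^+ 2 + m ^+ 2))); last first.
    by rewrite le_eqVlt; apply/orP; left; apply/eqP; ring.
  by apply: ler_pM; rewrite ?addr_ge0 ?sqr_ge0// lerD.
Qed.

Lemma clip_le m s : clip m s <= `|s|.
Proof. by rewrite /clip ge_min lexx. Qed.

Lemma clip_measurable m f : measurable_fun Om f -> measurable_fun Om (fun x => clip m (f x)).
Proof.
by move=> mf; apply: measurable_minr => //; exact: measurableT_comp.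
Qed.

(** At a fixed level [m], [clip4_lip] compares the truncated integrals of [v] and [phi k] up to a
    multiple of [L2norm Om (v - phi k)], which tends to 0; for [phi k] truncation only decreases the
    integral. *)
Lemma clip_integral_H10 v (m : R) : 0 <= m -> H10 Om v ->
  \int[mu2]_(x in Om) (clip m (v x) ^+ 2 * clip m (v x) ^+ 2) <=
  4 * L2norm Om v ^+ 2 * L2norm Om (pd Om 0 v) * L2norm Om (pd Om 1 v).
Proof.
move=> m0 hv; have [phi [t c1 c2]] := H10_seq hv; have Hv := H10_H1 hv.
have hL := H1_L2 Hv.
have n := L2norm_cvg hL (fun k => test_L2 (t k)) c1.
have n0 := L2norm_cvg (pd_L2 0 Hv) (fun k => test_L2 (test_D 0 (t k))) (c2 0).
have n1 := L2norm_cvg (pd_L2 1 Hv) (fun k => test_L2 (test_D 1 (t k))) (c2 1).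
have lim : 4 * L2norm Om (phi k) ^+ 2 * L2norm Om ('D_(axis 0) (phi k)) *
    L2norm Om ('D_(axis 1) (phi k)) + 4 * m ^+ 3 * (L2norm Om (v - phi k) * L2norm Om (cst 1))
    @[k --> \oo] --> 4 * L2norm Om v ^+ 2 * L2norm Om (pd Om 0 v) * L2norm Om (pd Om 1 v)
    + 4 * m ^+ 3 * (0 * L2norm Om (cst 1)).
  apply: cvgD; last by apply: cvgMr; exact: cvgMl.
  have nn : L2norm Om (phi k) ^+ 2 @[k --> \oo] --> L2norm Om v ^+ 2 by exact: (cvgM n n).
  have n4 : 4 * L2norm Om (phi k) ^+ 2 @[k --> \oo] --> 4 * L2norm Om v ^+ 2 by exact: cvgMr.
  exact: (cvgM (cvgM n4 n0) n1).
rewrite mul0r mulr0 addr0 in lim.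
apply: (ler_cvg_to (cvg_cst _) lim); apply: nearW => k.
have hk := test_L2 (t k); have hvk := L2_sub hL hk.
have mc f : measurable_fun Om f -> L2 Om (fun x => clip m (f x) ^+ 2).
  move=> mf; apply: (@bounded_L2 _ (m ^+ 2)).
    by apply: measurable_funX; exact: clip_measurable.
  move=> x _; have /andP[h1 h2] := clip_itv (f x) m0.
  by rewrite ger0_norm ?sqr_ge0// ler_sqr ?nnegrE.
have Iv := L2_mul_integrable (mc _ hL.1) (mc _ hL.1).
have Ik := L2_mul_integrable (mc _ hk.1) (mc _ hk.1).
have I1 := integrable_norm (L2_mul_integrable hvk (L2_cst 1)).
have I2 := @integrableZl _ _ R mu2 Om domain_measurable (4 * m ^+ 3) _ I1.
apply: (@le_trans _ _ (\int[mu2]_(x in Om) ((clip m (phi k x) ^+ 2 * clip m (phi k x) ^+ 2) +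
    4 * m ^+ 3 * `|(v - phi k) x * 1|))).
  apply: le_Rintegral; [exact: domain_measurable|exact: Iv|exact: (@integrableD _ _ R mu2 Om domain_measurable _ _ Ik I2)|].
  by move=> x _; rewrite mulr1; exact: clip4_lip.
rewrite RintegralD; [|exact: domain_measurable|exact: Ik|exact: I2].
rewrite RintegralZl; [|exact: domain_measurable|exact: I1].
apply: lerD; last first.
  apply: ler_wpM2l; first by rewrite mulr_ge0 ?exprn_ge0.
  exact: (integral_abs_le hvk (L2_cst 1)).
apply: le_trans (ladyzhenskaya_test (t k)).
have [K hK] := test_bounded (t k).
have hp2 : L2 Om (fun x => phi k x ^+ 2).
  apply: (@bounded_L2 _ (K ^+ 2)).
    by apply: measurable_funX; exact: test_measurable.
  by move=> x _; rewrite normrX ler_sqr ?nnegrE// (le_trans _ (hK x)).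
apply: le_Rintegral; [exact: domain_measurable|exact: Ik|exact: L2_mul_integrable|].
move=> x _; have /andP[h1 h2] := clip_itv (phi k x) m0.
have h3 : clip m (phi k x) ^+ 2 <= phi k x ^+ 2.
  by rewrite -[leRHS]real_normK ?num_real// ler_sqr ?nnegrE// clip_le.
by apply: ler_pM; rewrite ?sqr_ge0.
Qed.

(** Monotone convergence in the truncation level. It delivers the integrability of the fourth power
    together with the bound, and the former is what gives a meaning to the convection terms. *)
Lemma ladyzhenskaya v : H10 Om v -> L2 Om (fun x => v x ^+ 2) /\
  ip Om (fun x => v x ^+ 2) (fun x => v x ^+ 2) <=
  4 * L2norm Om v ^+ 2 * L2norm Om (pd Om 0 v) * L2norm Om (pd Om 1 v).
Proof.
move=> hv; have mv : measurable_fun Om v := (H1_L2 (H10_H1 hv)).1.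
set K := 4 * _ * _ * _.
pose g (m : nat) (x : R * R) := (clip m%:R (v x) ^+ 2 * clip m%:R (v x) ^+ 2)%:E.
have mg m : measurable_fun Om (g m).
  by apply/measurable_EFinP; apply: measurable_funM; apply: measurable_funX; exact: clip_measurable.
have g0 m x : Om x -> (0 <= g m x)%E by move=> _; rewrite lee_fin mulr_ge0 ?sqr_ge0.
have ndg x : Om x -> {homo (g ^~ x) : a b / (a <= b)%N >-> (a <= b)%E}.
  move=> _ a b ab; rewrite lee_fin.
  have h : clip a%:R (v x) <= clip b%:R (v x).
    by rewrite /clip le_min ge_min lexx /= ge_min ler_nat ab orbT.
  have /andP[h1 _] := clip_itv (v x) (ler0n R a).
  have h2 : clip a%:R (v x) ^+ 2 <= clip b%:R (v x) ^+ 2 by rewrite ler_sqr ?nnegrE// (le_trans h1).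
  by apply: ler_pM; rewrite ?sqr_ge0.
have bound m : (\int[mu2]_(x in Om) g m x <= K%:E)%E.
  have L2c : L2 Om (fun x => clip m%:R (v x) ^+ 2).
    apply: (@bounded_L2 _ (m%:R ^+ 2)).
      by apply: measurable_funX; exact: clip_measurable.
    move=> x _; have /andP[h1 h2] := clip_itv (v x) (ler0n R m).
    by rewrite ger0_norm ?sqr_ge0// ler_sqr ?nnegrE.
  rewrite -[leLHS]fineK; last first.
    by apply: integrable_fin_num; [exact: domain_measurable|exact: L2_mul_integrable].
  by rewrite lee_fin -/(Rintegral _ _ _); exact: clip_integral_H10.
have lim x : Om x -> limn (g ^~ x) = (v x ^+ 2 * v x ^+ 2)%:E.
  move=> _; apply/cvg_lim => //; apply: cvg_near_cst; near=> m.
  rewrite /g /clip min_l; last first.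
    by apply: ltW; near: m; exact: nbhs_infty_gtr.
  by rewrite real_normK ?num_real.
have := monotone_convergence mu2 domain_measurable mg g0 ndg.
move=> E0; have E : (\int[mu2]_(x in Om) (v x ^+ 2 * v x ^+ 2)%:E =
    limn (fun n => \int[mu2]_(x in Om) g n x))%E.
  by rewrite -E0; apply: eq_integral => x; rewrite inE => /lim ->.
have le : (\int[mu2]_(x in Om) (v x ^+ 2 * v x ^+ 2)%:E <= K%:E)%E.
  rewrite E; apply: lime_le; last exact: nearW.
  apply: ereal_nondecreasing_is_cvgn => a b ab.
  apply: (@ge0_le_integral _ _ R mu2 Om domain_measurable _ _ (g0 a) (mg a) (mg b)).
  by move=> x Ox; exact: ndg.
have hL : L2 Om (fun x => v x ^+ 2).
  split; first exact: measurable_funX.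
  apply/integrableP; split.
    by apply/measurable_EFinP; apply: measurable_funX; apply: measurable_funX.
  apply: le_lt_trans (ltry K); apply: le_trans le.
  rewrite le_eqVlt; apply/orP; left; apply/eqP; apply: eq_integral => x _.
  by rewrite gee0_abs ?lee_fin ?sqr_ge0// expr2.
split=> //; rewrite -lee_fin /ip /Rintegral fineK//.
by apply: integrable_fin_num; [exact: domain_measurable|exact: L2_mul_integrable].
Unshelve. all: by end_near. Qed.

End Ladyzhenskaya.

(** * Vector fields and the convection form *)
Section Fields.
Implicit Types (f g h phi psi : R * R -> R) (j : 'I_3).
Implicit Types (u v w : 'I_3 -> R * R -> R).

(** The square of the L^4 norm. *)
Definition quartic f : R := L2norm Om (fun x => f x ^+ 2).

Definition L4 f : Prop := measurable_fun Om f /\ L2 Om (fun x => f x ^+ 2).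

Lemma H10_L4 f : H10 Om f -> L4 f.
Proof. by move=> hf; split; [exact: (H1_L2 (H10_H1 hf)).1|have [] := ladyzhenskaya hf]. Qed.

Lemma L4_mul f h : L4 f -> L4 h -> L2 Om (fun x => f x * h x).
Proof.
move=> [mf f4] [mh h4]; split; first exact: measurable_funM.
have := L2_mul_integrable f4 h4.
by apply: eq_integrable; [exact: domain_measurable|move=> x _; rewrite exprMn].
Qed.

Lemma quartic_ge0 f : 0 <= quartic f. Proof. exact: L2norm_ge0. Qed.

Lemma L2norm_mul_le f h : L4 f -> L4 h ->
  L2norm Om (fun x => f x * h x) ^+ 2 <= quartic f * quartic h.
Proof.
move=> [mf f4] [mh h4]; rewrite L2norm_sqr.
have -> : ip Om (fun x => f x * h x) (fun x => f x * h x) =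
  ip Om (fun x => f x ^+ 2) (fun x => h x ^+ 2).
  by apply: eq_Rintegral => x _; rewrite mulrACA -!expr2.
exact: le_trans (ler_norm _) (ip_le f4 h4).
Qed.

(** Elementary convection term: [f] transports, [g] is a derivative and [h] tests. The two L^4
    factors are grouped into one L^2 function, paired with the L^2 function [g]. *)
Definition trip f g h : R := ip Om g (fun x => f x * h x).

Lemma trip_le f g h : L4 f -> L2 Om g -> L4 h ->
  `|trip f g h| <= L2norm Om g * Num.sqrt (quartic f * quartic h).
Proof.
move=> f4 hg h4; apply: (le_trans (ip_le hg (L4_mul f4 h4))).
apply: ler_wpM2l; first exact: L2norm_ge0.
by rewrite -[leLHS]ger0_norm ?L2norm_ge0// -sqrtr_sqr ler_wsqrtr// L2norm_mul_le.
Qed.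

(** Ladyzhenskaya's inequality applied to the difference: approximation in H^1_0 is approximation in
    L^4, as needed for limits in trilinear terms. *)
Lemma quartic_cvg0 h (psi : nat -> R * R -> R) : H10 Om h ->
  (forall k, test_function Om (psi k)) ->
  L2norm Om (h - psi k) @[k --> \oo] --> (0 : R) ->
  (forall j, L2norm Om (pd Om j h - 'D_(axis j) (psi k)) @[k --> \oo] --> (0 : R)) ->
  quartic (h - psi k) @[k --> \oo] --> (0 : R).
Proof.
move=> hh t c1 c2; have Hh := H10_H1 hh.
apply: (@squeeze_cvgr _ _ _ _ (cst 0) (fun k => Num.sqrt (4 * L2norm Om (h - psi k) ^+ 2 *
   L2norm Om (pd Om 0 h - 'D_(axis 0) (psi k)) * L2norm Om (pd Om 1 h - 'D_(axis 1) (psi k))))).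
- apply: nearW => k; rewrite quartic_ge0 /=.
  have hk : H10 Om (h - psi k).
    by have := H10_lin (-1) (test_H10 (t k)) hh; rewrite scaleN1r addrC.
  have e j : L2norm Om (pd Om j (h - psi k)) = L2norm Om (pd Om j h - 'D_(axis j) (psi k)).
    apply: L2norm_ae; first exact/pd_L2/H10_H1.
      by apply: L2_sub; [exact: pd_L2|exact: test_L2 (test_D _ (t k))].
    have := pd_ae (weak_partial_lin (-1) (weak_partial_test j (t k)) (pdP j Hh)).
    have e2 (p q : R * R -> R) : p - q = -1 *: q + p by rewrite scaleN1r addrC.
    by apply: ae_imp => x hx Ox; rewrite !e2 hx.
  have [_ hl] := ladyzhenskaya hk.
  by rewrite -!e; apply: ler_wsqrtr; exact: hl.
- exact: cvg_cst.
- rewrite -[X in _ --> X](@sqrtr0 R); apply: (continuous_cvg _ (@sqrt_continuous R _)).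
  have nn : L2norm Om (h - psi k) ^+ 2 @[k --> \oo] --> (0 : R) * 0 by exact: (cvgM c1 c1).
  have n4 : 4 * L2norm Om (h - psi k) ^+ 2 @[k --> \oo] --> 4 * ((0 : R) * 0) by exact: cvgMr.
  by have := cvgM (cvgM n4 (c2 0)) (c2 1); rewrite !mulr0; exact.
Qed.

Lemma L4_mul_cvg0 f h (psi : nat -> R * R -> R) : L4 f -> H10 Om h ->
  (forall k, test_function Om (psi k)) ->
  L2norm Om (h - psi k) @[k --> \oo] --> (0 : R) ->
  (forall j, L2norm Om (pd Om j h - 'D_(axis j) (psi k)) @[k --> \oo] --> (0 : R)) ->
  L2norm Om ((fun x => f x * h x) - (fun x => f x * psi k x)) @[k --> \oo] --> (0 : R).
Proof.
move=> f4 hh t c1 c2.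
apply: (@squeeze_cvgr _ _ _ _ (cst 0) (fun k => Num.sqrt (quartic f * quartic (h - psi k)))).
- apply: nearW => k; rewrite L2norm_ge0 /=.
  have hk : H10 Om (h - psi k).
    by have := H10_lin (-1) (test_H10 (t k)) hh; rewrite scaleN1r addrC.
  have -> : (fun x => f x * h x) - (fun x => f x * psi k x) = (fun x => f x * (h - psi k) x).
    by apply/funext => x; rewrite [RHS]mulrDr mulrN.
  rewrite -[leLHS]ger0_norm ?L2norm_ge0// -sqrtr_sqr ler_wsqrtr//.
  by apply: L2norm_mul_le => //; exact: H10_L4.
- exact: cvg_cst.
- rewrite -[X in _ --> X](@sqrtr0 R); apply: (continuous_cvg _ (@sqrt_continuous R _)).
  by rewrite -(mulr0 (quartic f)); apply: cvgMr; exact: quartic_cvg0.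
Qed.

Lemma sum3 (V : nmodType) (F : 'I_3 -> V) : \sum_i F i = F 0 + F 1 + F 2.
Proof.
rewrite !big_ord_recr big_ord0 /= add0r.
by congr (F _ + F _ + F _); exact: val_inj.
Qed.

Lemma Rintegral_sum (I : Type) (s : seq I) (F : I -> R * R -> R) :
  (forall i, mu2.-integrable Om (EFin \o F i)) ->
  \int[mu2]_(x in Om) (\sum_(i <- s) F i x) = \sum_(i <- s) \int[mu2]_(x in Om) F i x.
Proof.
move=> hF; elim: s => [|i s IH].
  rewrite big_nil; under eq_Rintegral do rewrite big_nil.
  by rewrite /Rintegral integral0_eq.
rewrite big_cons -IH -RintegralD; [|exact: domain_measurable|exact: hF|].
  by apply: eq_Rintegral => x _; rewrite big_cons.
have := @integrable_sum _ _ R mu2 Om domain_measurable _ s xpredT (fun i => EFin \o F i) (fun i _ => hF i).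
by apply: eq_integrable; [exact: domain_measurable|move=> x _; rewrite /= sumEFin].
Qed.

Definition Hfield v : Prop := forall i, H10 Om (v i).

Definition tri u v w : R := vip Om (Defs.conv Om u v) w.

(** [conv] is a product of L^4 and L^2 functions, not known to be in L^2, so the bilinearity of [ip]
    does not apply to it. Each product with a component of [w] is integrable, and the sum may be
    taken out of the integral. *)
Lemma tri_sum u v w : Hfield u -> Hfield v -> Hfield w ->
  tri u v w = \sum_i \sum_j trip (u j) (pd Om j (v i)) (w i).
Proof.
move=> hu hv hw; apply: eq_bigr => i _.
have I j : mu2.-integrable Om (EFin \o (fun x => pd Om j (v i) x * (u j x * w i x))).
  apply: L2_mul_integrable; first exact/pd_L2/H10_H1.
  by apply: L4_mul; exact: H10_L4.
rewrite /ip -Rintegral_sum//; apply: eq_Rintegral => x _.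
rewrite /Defs.conv mulr_suml; apply: eq_bigr => j _; ring.
Qed.

Lemma trip_lin1 a f f' g h : L4 f -> L4 f' -> L2 Om g -> L4 h ->
  trip (a *: f + f') g h = a * trip f g h + trip f' g h.
Proof.
move=> f4 f'4 hg h4; rewrite /trip.
have -> : (fun x => (a *: f + f') x * h x) = a *: (fun x => f x * h x) + (fun x => f' x * h x).
  by apply/funext => x; rewrite [LHS]mulrDl -mulrA.
have h1 := L4_mul f4 h4; have h2 := L4_mul f'4 h4.
by rewrite !(si_sym L2_si g) (si_linl L2_si).
Qed.

Lemma trip_lin3 a f g h h' : L4 f -> L2 Om g -> L4 h -> L4 h' ->
  trip f g (a *: h + h') = a * trip f g h + trip f g h'.
Proof.
move=> f4 hg h4 h'4.
have e k : trip f g k = trip k g f by congr (ip _ _ _); apply/funext => x; rewrite mulrC.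
by rewrite !e trip_lin1.
Qed.

Lemma trip_lin2 j a f (v v' : R * R -> R) h : L4 f -> H1 Om v -> H1 Om v' -> L4 h ->
  trip f (pd Om j (a *: v + v')) h = a * trip f (pd Om j v) h + trip f (pd Om j v') h.
Proof. by move=> f4 hv hv' h4; apply: ip_pd_lin => //; exact: L4_mul. Qed.

Lemma Hfield_lin (a : R) u v : Hfield u -> Hfield v -> Hfield (a *: u + v).
Proof. by move=> hu hv i; exact: H10_lin. Qed.

Lemma tri_lin1 (a : R) u u' v w : Hfield u -> Hfield u' -> Hfield v -> Hfield w ->
  tri (a *: u + u') v w = a * tri u v w + tri u' v w.
Proof.
move=> hu hu' hv hw; have huu := Hfield_lin a hu hu'; rewrite !tri_sum// mulr_sumr -big_split.
apply: eq_bigr => i _; rewrite mulr_sumr -big_split; apply: eq_bigr => j _.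
by apply: trip_lin1; try exact: H10_L4; exact/pd_L2/H10_H1.
Qed.

Lemma tri_lin2 (a : R) u v v' w : Hfield u -> Hfield v -> Hfield v' -> Hfield w ->
  tri u (a *: v + v') w = a * tri u v w + tri u v' w.
Proof.
move=> hu hv hv' hw; have hvv := Hfield_lin a hv hv'; rewrite !tri_sum// mulr_sumr -big_split.
apply: eq_bigr => i _; rewrite mulr_sumr -big_split; apply: eq_bigr => j _.
by apply: trip_lin2; try exact: H10_L4; exact: H10_H1.
Qed.

Lemma tri_lin3 (a : R) u v w w' : Hfield u -> Hfield v -> Hfield w -> Hfield w' ->
  tri u v (a *: w + w') = a * tri u v w + tri u v w'.
Proof.
move=> hu hv hw hw'; have hww := Hfield_lin a hw hw'; rewrite !tri_sum// mulr_sumr -big_split.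
apply: eq_bigr => i _; rewrite mulr_sumr -big_split; apply: eq_bigr => j _.
by apply: trip_lin3; try exact: H10_L4; exact/pd_L2/H10_H1.
Qed.

Lemma H1field_lin (a : R) u v : (forall i, H1 Om (u i)) -> (forall i, H1 Om (v i)) ->
  forall i, H1 Om ((a *: u + v) i).
Proof. by move=> hu hv i; exact: H1_lin. Qed.

Lemma vip_si : semi_inner (fun v => forall i, L2 Om (v i)) (vip Om).
Proof.
apply: semi_inner_sum => [a u v hu hv i|i]; first exact: L2_lin.
split.
- by move=> a u v hu hv k; exact: L2_lin.
- by move=> u v; exact: (si_sym L2_si).
- by move=> a u v w hu hv hw; exact: (si_linl L2_si).
- by move=> u hu; exact: (si_ge0 L2_si).
Qed.

Lemma gradip_si : semi_inner (fun v => forall i, H1 Om (v i)) (gradip Om).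
Proof.
apply: semi_inner_sum => [a u v hu hv i|i]; first exact: H1_lin.
apply: semi_inner_sum => [a u v hu hv k|j]; first exact: H1_lin.
split.
- by move=> a u v hu hv k; exact: H1_lin.
- by move=> u v; exact: (si_sym (pdform_si j)).
- by move=> a u v w hu hv hw; exact: (si_linl (pdform_si j)).
- by move=> u hu; exact: (si_ge0 (pdform_si j)).
Qed.

Lemma vip_Hfield_si : semi_inner Hfield (vip Om).
Proof.
apply: (semi_inner_sub vip_si) => [v hv i|]; first exact/H1_L2/H10_H1.
exact: Hfield_lin.
Qed.

Lemma gradip_Hfield_si : semi_inner Hfield (gradip Om).
Proof.
apply: (semi_inner_sub gradip_si) => [v hv i|]; first exact: H10_H1.
exact: Hfield_lin.
Qed.

Definition vnorm v : R := Num.sqrt (vip Om v v).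
Definition gnorm v : R := Num.sqrt (gradip Om v v).

Lemma L2norm_le_vnorm v i : (forall i, L2 Om (v i)) -> L2norm Om (v i) <= vnorm v.
Proof.
move=> hv; have e : vip Om v v = ip Om (v i) (v i) + \sum_(k | k != i) ip Om (v k) (v k) by exact: bigD1.
rewrite /L2norm /vnorm e; apply: ler_wsqrtr; rewrite lerDl.
by apply: sumr_ge0 => k _; exact: (si_ge0 L2_si).
Qed.

Lemma pdnorm_le_gnorm v i j : (forall i, H1 Om (v i)) -> L2norm Om (pd Om j (v i)) <= gnorm v.
Proof.
move=> hv; pose a i j := ip Om (pd Om j (v i)) (pd Om j (v i)).
have p k l : 0 <= a k l by exact: (si_ge0 (pdform_si l)).
have e : gradip Om v v = a i j + (\sum_(l | l != j) a i l + \sum_(k | k != i) \sum_l a k l).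
  by rewrite addrA -[a i j + _](bigD1 (F := a i) j isT) -[RHS](bigD1 (F := fun k => \sum_l a k l) i isT).
rewrite /gnorm e /L2norm; apply: ler_wsqrtr; rewrite lerDl.
by apply: addr_ge0; apply: sumr_ge0 => k _; [|apply: sumr_ge0 => l _]; exact: p.
Qed.

Lemma vnorm_ge0 v : 0 <= vnorm v. Proof. exact: sqrtr_ge0. Qed.
Lemma gnorm_ge0 v : 0 <= gnorm v. Proof. exact: sqrtr_ge0. Qed.

Lemma poincare_field : exists2 C : R, 0 <= C & forall v, Hfield v -> vnorm v <= C * gnorm v.
Proof.
have [C C0 hC] := poincare; exists (3 * C) => [|v hv]; first by rewrite mulr_ge0.
have hH i := H10_H1 (hv i).
have b i : ip Om (v i) (v i) <= (C * gnorm v) ^+ 2.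
  rewrite -L2norm_sqr ler_sqr ?nnegrE ?L2norm_ge0 ?mulr_ge0 ?gnorm_ge0//.
  apply: (le_trans (hC _ (hv i))); apply: ler_wpM2l => //; exact: pdnorm_le_gnorm.
have pos : 0 <= 3 * C * gnorm v by rewrite !mulr_ge0 ?gnorm_ge0.
rewrite -(ger0_norm pos) -sqrtr_sqr; apply: ler_wsqrtr.
rewrite /vip sum3; have := b 0; have := b 1; have := b 2.
have : 0 <= (C * gnorm v) ^+ 2 by exact: sqr_ge0.
have -> : (3 * C * gnorm v) ^+ 2 = 9 * (C * gnorm v) ^+ 2 by ring.
move: ((C * gnorm v) ^+ 2) => X; move: (ip _ (v 0) _) (ip _ (v 1) _) (ip _ (v 2) _) => x y z; lra.
Qed.

Lemma quartic_le v i : Hfield v -> quartic (v i) <= 2 * (vnorm v * gnorm v).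
Proof.
move=> hv; have [_ hl] := ladyzhenskaya (hv i).
have hH k := H10_H1 (hv k).
have pos : 0 <= 2 * (vnorm v * gnorm v) by rewrite !mulr_ge0 ?gnorm_ge0 ?vnorm_ge0.
rewrite -(ger0_norm pos) -sqrtr_sqr; apply: ler_wsqrtr; apply: (le_trans hl).
have n1 : L2norm Om (v i) ^+ 2 <= vnorm v ^+ 2.
  rewrite ler_sqr ?nnegrE ?L2norm_ge0 ?vnorm_ge0//; apply: L2norm_le_vnorm => k.
  exact: H1_L2.
have n2 := pdnorm_le_gnorm i 0 hH; have n3 := pdnorm_le_gnorm i 1 hH.
have -> : (2 * (vnorm v * gnorm v)) ^+ 2 = 4 * vnorm v ^+ 2 * gnorm v * gnorm v by ring.
have := L2norm_ge0 (pd Om 0 (v i)); have := L2norm_ge0 (pd Om 1 (v i)).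
move: n1 n2 n3; have : 0 <= L2norm Om (v i) ^+ 2 by exact: sqr_ge0.
generalize (gnorm v) => e; generalize (vnorm v ^+ 2) => d.
generalize (L2norm Om (v i) ^+ 2) => a.
generalize (L2norm Om (pd Om 0 (v i))) => b; generalize (L2norm Om (pd Om 1 (v i))) => c.
move=> a0 ad be ce c0 b0.
have p4 : 0 <= 4 * a by rewrite mulr_ge0.
have h4 : 4 * a <= 4 * d by exact: ler_wpM2l.
by apply: (ler_pM _ c0 (ler_pM p4 b0 h4 be) ce); exact: mulr_ge0.
Qed.

End Fields.

(** * Skew-symmetry of convection and symmetry of the curl *)

Section Forms.
Implicit Types (f g h phi psi : R * R -> R) (j : 'I_3).
Implicit Types (u v w : 'I_3 -> R * R -> R).

(** The instance of [mix] for the L^2 and gradient products, to which it unfolds. *)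
Definition lnorm v : R := Num.sqrt (vnorm v * gnorm v).

(** Nine pairs of indices, each with the factor 2 of [quartic_le]. *)
Lemma tri_le u v w : Hfield u -> Hfield v -> Hfield w ->
  `|tri u v w| <= 18 * (gnorm v * (lnorm u * lnorm w)).
Proof.
move=> hu hv hw; rewrite tri_sum//.
have b i j : `|trip (u j) (pd Om j (v i)) (w i)| <= 2 * (gnorm v * (lnorm u * lnorm w)).
  apply: (le_trans (trip_le (H10_L4 (hu j)) (pd_L2 j (H10_H1 (hv i))) (H10_L4 (hw i)))).
  rewrite mulrCA; apply: ler_pM; rewrite ?L2norm_ge0 ?sqrtr_ge0//.
    by apply: pdnorm_le_gnorm => k; exact: H10_H1.
  have pu : 0 <= vnorm u * gnorm u by rewrite mulr_ge0 ?vnorm_ge0 ?gnorm_ge0.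
  have pw : 0 <= vnorm w * gnorm w by rewrite mulr_ge0 ?vnorm_ge0 ?gnorm_ge0.
  have -> : 2 * (lnorm u * lnorm w) = Num.sqrt ((2 * (vnorm u * gnorm u)) * (2 * (vnorm w * gnorm w))).
    rewrite /lnorm; generalize (vnorm u * gnorm u) (vnorm w * gnorm w) pu pw => a b a0 b0.
    by rewrite [in RHS]mulrACA -expr2 sqrtrM ?sqr_ge0// sqrtr_sqr ger0_norm// sqrtrM.
  apply: ler_wsqrtr.
  by apply: ler_pM; rewrite ?quartic_ge0// quartic_le.
apply: (le_trans (ler_norm_sum _ _ _)).
apply: (@le_trans _ _ (\sum_(i < 3) \sum_(j < 3) 2 * (gnorm v * (lnorm u * lnorm w)))).
  apply: ler_sum => i _; apply: (le_trans (ler_norm_sum _ _ _)).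
  by apply: ler_sum => j _; exact: b.
rewrite !sumr_const !card_ord; generalize (gnorm v * (lnorm u * lnorm w)) => x.
by rewrite (_ : _ *+ 3 = 18 * x)//; ring.
Qed.

Definition divfree u : Prop := {ae mu2, forall x, Om x -> div Om u x = 0}.

(** The sum is the integral of [u] against the gradient of [phi * psi], again a test function, hence
    minus the integral of [div u] times this product. *)
Lemma trip_skew_test u phi psi : Hfield u -> divfree u ->
  test_function Om phi -> test_function Om psi ->
  \sum_j (trip (u j) ('D_(axis j) phi) psi + trip (u j) ('D_(axis j) psi) phi) = 0.
Proof.
move=> hu du t1 t2; have t := test_mul t1 t2; have ht := test_L2 t.
have hT f : test_function Om f -> L4 f by move=> tf; exact/H10_L4/test_H10.
have e j : trip (u j) ('D_(axis j) phi) psi + trip (u j) ('D_(axis j) psi) phi =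
    ip Om (u j) ('D_(axis j) (phi * psi)).
  have I1 : L2 Om (fun x => u j x * psi x) by apply: L4_mul; [exact: H10_L4|exact: hT].
  have I2 : L2 Om (fun x => u j x * phi x) by apply: L4_mul; [exact: H10_L4|exact: hT].
  rewrite /trip /ip -RintegralD; [|exact: domain_measurable|..]; first last.
  - by apply: L2_mul_integrable => //; exact: test_L2 (test_D j t2).
  - by apply: L2_mul_integrable => //; exact: test_L2 (test_D j t1).
  apply: eq_Rintegral => x _; rewrite deriveM; [|exact: test_derivable t1|exact: test_derivable t2].
  by rewrite /GRing.scale /=; ring.
have e2 j : ip Om (u j) ('D_(axis j) (phi * psi)) = - ip Om (pd Om j (u j)) (phi * psi).
  by have [_ _ ->] := pdP j (H10_H1 (hu j)).
under eq_bigr do rewrite e e2.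
rewrite sumrN; apply/eqP; rewrite oppr_eq0; apply/eqP.
have hp j := pd_L2 j (H10_H1 (hu j)).
have I j : mu2.-integrable Om (EFin \o (fun x => pd Om j (u j) x * (phi * psi) x)).
  exact: L2_mul_integrable.
rewrite /ip -Rintegral_sum//.
have hdiv : L2 Om (div Om u).
  have -> : div Om u = pd Om 0 (u 0) + pd Om 1 (u 1) + pd Om 2 (u 2).
    by apply/funext => x; rewrite /div sum3.
  by apply: (si_D L2_si) => //; exact: (si_D L2_si).
transitivity (ip Om (div Om u) (phi * psi)).
  by apply: eq_Rintegral => x _; rewrite /div mulr_suml.
have h0 := si_0 L2_si ht.
by rewrite (ip_ae hdiv h0 ht du) (si_zerol L2_si).
Qed.

(** By density. The transporting field is only in L^4, so the limit requires the product of [u j]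
    and a test function to converge in L^2, which is [L4_mul_cvg0]. *)
Lemma trip_skew u f h : Hfield u -> divfree u -> H10 Om f -> H10 Om h ->
  \sum_j (trip (u j) (pd Om j f) h + trip (u j) (pd Om j h) f) = 0.
Proof.
move=> hu du hf hh; have [phi [t1 a1 b1]] := H10_seq hf; have [psi [t2 a2 b2]] := H10_seq hh.
have hT k : L4 (phi k) by exact/H10_L4/test_H10.
have hS k : L4 (psi k) by exact/H10_L4/test_H10.
have u4 j := H10_L4 (hu j); have f4 := H10_L4 hf; have h4 := H10_L4 hh.
have c1 j : trip (u j) ('D_(axis j) (phi k)) (psi k) @[k --> \oo] --> trip (u j) (pd Om j f) h.
  apply: ip_cvg; [exact/pd_L2/H10_H1|exact: L4_mul|move=> k; exact: test_L2 (test_D j (t1 k))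
    |by move=> k; exact: L4_mul|exact: b1|].
  exact: L4_mul_cvg0.
have c2 j : trip (u j) ('D_(axis j) (psi k)) (phi k) @[k --> \oo] --> trip (u j) (pd Om j h) f.
  apply: ip_cvg; [exact/pd_L2/H10_H1|exact: L4_mul|move=> k; exact: test_L2 (test_D j (t2 k))
    |by move=> k; exact: L4_mul|exact: b2|].
  exact: L4_mul_cvg0.
pose A k j := trip (u j) ('D_(axis j) (phi k)) (psi k) + trip (u j) ('D_(axis j) (psi k)) (phi k).
have c j : A k j @[k --> \oo] --> trip (u j) (pd Om j f) h + trip (u j) (pd Om j h) f.
  exact: (cvgD (c1 j) (c2 j)).
have L : A k 0 + A k 1 + A k 2 @[k --> \oo] -->
    \sum_j (trip (u j) (pd Om j f) h + trip (u j) (pd Om j h) f).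
  by rewrite sum3; exact: (cvgD (cvgD (c 0) (c 1)) (c 2)).
have Z : A k 0 + A k 1 + A k 2 @[k --> \oo] --> (0 : R).
  under eq_fun do rewrite -sum3 (trip_skew_test hu du (t1 _) (t2 _)).
  exact: cvg_cst.
exact: (cvg_unique (@norm_hausdorff _ _) L Z).
Qed.

Lemma tri_skew u v w : Hfield u -> divfree u -> Hfield v -> Hfield w ->
  tri u v w = - tri u w v.
Proof.
move=> hu du hv hw; apply/eqP; rewrite -addr_eq0; apply/eqP.
rewrite !tri_sum// -big_split big1// => i _; rewrite -big_split.
exact: trip_skew.
Qed.

Definition cform u w : R := vip Om (curl Om u) w.

Lemma curl_L2 u i : (forall i, H1 Om (u i)) -> L2 Om (curl Om u i).
Proof. by move=> hu; apply: L2_sub; exact: pd_L2. Qed.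

Let i11 : (1 + 1 : 'I_3) = 2. Proof. exact: val_inj. Qed.
Let i12 : (1 + 2 : 'I_3) = 0. Proof. exact: val_inj. Qed.
Let i21 : (2 + 1 : 'I_3) = 0. Proof. exact: val_inj. Qed.
Let i22 : (2 + 2 : 'I_3) = 1. Proof. exact: val_inj. Qed.

Lemma curlE u : [/\ curl Om u 0 = pd Om 1 (u 2) - pd Om 2 (u 1),
  curl Om u 1 = pd Om 2 (u 0) - pd Om 0 (u 2) & curl Om u 2 = pd Om 0 (u 1) - pd Om 1 (u 0)].
Proof. by split; apply/funext => x; rewrite /curl ?add0r ?i11 ?i12 ?i21 ?i22. Qed.

Lemma cform_sum u w : (forall i, H1 Om (u i)) -> (forall i, L2 Om (w i)) ->
  cform u w = ip Om (pd Om 1 (u 2)) (w 0) - ip Om (pd Om 2 (u 1)) (w 0)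
    + (ip Om (pd Om 2 (u 0)) (w 1) - ip Om (pd Om 0 (u 2)) (w 1))
    + (ip Om (pd Om 0 (u 1)) (w 2) - ip Om (pd Om 1 (u 0)) (w 2)).
Proof.
move=> hu hw; have [e0 e1 e2] := curlE u; have P j i := pd_L2 j (hu i).
by rewrite /cform /vip sum3 e0 e1 e2; congr (_ + _ + _); apply: (si_sub L2_si).
Qed.

(** Integration by parts changes the sign of each of the six terms, and the exchange of indices in
    the curl changes it back. *)
Lemma cform_sym u w : Hfield u -> Hfield w -> cform u w = cform w u.
Proof.
move=> hu hw; have Hu i := H10_H1 (hu i); have Hw i := H10_H1 (hw i).
have ibp j a b : ip Om (pd Om j (u a)) (w b) = - ip Om (pd Om j (w b)) (u a).
  rewrite [in RHS](si_sym L2_si).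
  by rewrite (integration_by_parts_H10 j (Hu a) (hw b)) opprK.
rewrite (cform_sum Hu (fun i => H1_L2 (Hw i))) (cform_sum Hw (fun i => H1_L2 (Hu i))).
have gen (A B : 'I_3 -> 'I_3 -> 'I_3 -> R) : (forall j a b, A j a b = - B j b a) ->
    A 1 2 0 - A 2 1 0 + (A 2 0 1 - A 0 2 1) + (A 0 1 2 - A 1 0 2) =
    B 1 2 0 - B 2 1 0 + (B 2 0 1 - B 0 2 1) + (B 0 1 2 - B 1 0 2).
  by move=> AB; rewrite (AB 1 2 0) (AB 2 1 0) (AB 2 0 1) (AB 0 2 1) (AB 0 1 2) (AB 1 0 2); ring.
exact: (gen (fun j a b => ip Om (pd Om j (u a)) (w b)) (fun j a b => ip Om (pd Om j (w a)) (u b)) ibp).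
Qed.

Lemma cform_lin (a : R) u u' w : (forall i, H1 Om (u i)) -> (forall i, H1 Om (u' i)) ->
  (forall i, L2 Om (w i)) -> cform (a *: u + u') w = a * cform u w + cform u' w.
Proof.
move=> hu hu' hw; have huu := H1field_lin a hu hu'.
rewrite (cform_sum huu hw) (cform_sum hu hw) (cform_sum hu' hw).
have gen (A B D : 'I_3 -> 'I_3 -> 'I_3 -> R) : (forall j i k, A j i k = a * B j i k + D j i k) ->
    A 1 2 0 - A 2 1 0 + (A 2 0 1 - A 0 2 1) + (A 0 1 2 - A 1 0 2) =
    a * (B 1 2 0 - B 2 1 0 + (B 2 0 1 - B 0 2 1) + (B 0 1 2 - B 1 0 2)) +
    (D 1 2 0 - D 2 1 0 + (D 2 0 1 - D 0 2 1) + (D 0 1 2 - D 1 0 2)).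
  by move=> E; rewrite (E 1 2 0) (E 2 1 0) (E 2 0 1) (E 0 2 1) (E 0 1 2) (E 1 0 2); ring.
exact: (gen (fun j i k => ip Om (pd Om j ((a *: u + u') i)) (w k))
  (fun j i k => ip Om (pd Om j (u i)) (w k)) (fun j i k => ip Om (pd Om j (u' i)) (w k))
  (fun j i k => ip_pd_lin j a (hu i) (hu' i) (hw k))).
Qed.

(** The factor 2 is that of [(a - b) ^ 2 <= 2 a ^ 2 + 2 b ^ 2] in each component of the curl. *)
Lemma cform_CS u w : (forall i, H1 Om (u i)) -> (forall i, L2 Om (w i)) ->
  cform u w ^+ 2 <= 2 * gradip Om u u * vip Om w w.
Proof.
move=> hu hw; have hc i := curl_L2 i hu.
apply: (le_trans (si_CS vip_si hc hw)); apply: ler_wpM2r; first exact: (si_ge0 vip_si).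
have p k l : 0 <= ip Om (pd Om k (u l)) (pd Om k (u l)) by exact: (si_ge0 (pdform_si k)).
have b j k i l : ip Om (pd Om j (u i) - pd Om k (u l)) (pd Om j (u i) - pd Om k (u l)) <=
    2 * ip Om (pd Om j (u i)) (pd Om j (u i)) + 2 * ip Om (pd Om k (u l)) (pd Om k (u l)).
  have h1 := pd_L2 j (hu i); have h2 := pd_L2 k (hu l).
  have := si_ge0 L2_si (si_D L2_si h1 h2).
  rewrite (si_sqrB L2_si h1 h2) (si_sqrD L2_si h1 h2).
  generalize (ip Om (pd Om j (u i)) (pd Om j (u i))) (ip Om (pd Om k (u l)) (pd Om k (u l))) => x y.
  generalize (ip Om (pd Om j (u i)) (pd Om k (u l))) => z; lra.
have [e0 e1 e2] := curlE u.
have gen (A : 'I_3 -> 'I_3 -> R) x y z : (forall k l, 0 <= A k l) ->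
    x <= 2 * A 1 2 + 2 * A 2 1 -> y <= 2 * A 2 0 + 2 * A 0 2 -> z <= 2 * A 0 1 + 2 * A 1 0 ->
    x + y + z <= 2 * \sum_i \sum_j A j i.
  move=> A0; have := A0 0 0; have := A0 1 1; have := A0 2 2; rewrite !sum3.
  generalize (A 0 0) (A 1 1) (A 2 2) (A 1 2) (A 2 1) (A 2 0) (A 0 2) (A 0 1) (A 1 0).
  move=> a1 a2 a3 b1 b2 b3 c1 c2 c3; lra.
rewrite [vip Om _ _]sum3; apply: (gen (fun j i => ip Om (pd Om j (u i)) (pd Om j (u i)))) => //.
- by rewrite e0; exact: b.
- by rewrite e1; exact: b.
- by rewrite e2; exact: b.
Qed.

End Forms.

(** * Regularity in time *)
Section SobolevTime.
Implicit Types (f g h phi psi : R * R -> R) (j : 'I_3).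

Lemma L2norm_subC f g : L2 Om f -> L2 Om g -> L2norm Om (f - g) = L2norm Om (g - f).
Proof. by move=> hf hg; rewrite -opprB; apply: (si_norm_opp L2_si); exact: L2_sub. Qed.

Lemma weak_partial0 j : is_weak_partial Om j 0 0.
Proof.
have h0 : L2 Om 0 by exact: L2_cst 0.
by split => // phi t; rewrite !(si_zerol L2_si) ?oppr0//; [exact: test_L2|exact: test_L2 (test_D j t)].
Qed.

Lemma H1_ae f g : H1 Om f -> L2 Om g -> {ae mu2, forall x, Om x -> f x = g x} -> H1 Om g.
Proof.
move=> hf hg e k; exists (pd Om k f); apply: (weak_partial_ae (pdP k hf)) => //; first exact: pd_L2.
by apply: ae_imp (e).
Qed.

Lemma H2_0 : H2 Om 0.
Proof.
have h0 : H1 Om 0 by move=> j; exists 0; exact: weak_partial0.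
split=> // j; apply: (H1_ae h0); first exact: pd_L2.
by move: (pd_ae (weak_partial0 j)); apply: ae_imp => x h Ox; rewrite h.
Qed.

Lemma H2_lin (a : R) f g : H2 Om f -> H2 Om g -> H2 Om (a *: f + g).
Proof.
move=> [hf hf2] [hg hg2]; have hfg := H1_lin a hf hg; split; [exact: hfg|move=> j].
apply: (H1_ae (H1_lin a (hf2 j) (hg2 j))); first exact: pd_L2.
have e := pd_lin j a hf hg; move: e; apply: ae_imp => x h Ox; by rewrite h.
Qed.

Lemma pdnorm_sub_ae j f g : H1 Om f -> H1 Om g ->
  L2norm Om (pd Om j f - pd Om j g) = L2norm Om (pd Om j (f - g)).
Proof.
move=> hf hg; apply: L2norm_ae; [by apply: L2_sub; exact: pd_L2|exact/pd_L2/H1_sub|].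
have e p q : p - q = -1 *: q + p :> (R * R -> R) by rewrite scaleN1r addrC.
have e2 := pd_lin j (-1) hg hf; move: e2; apply: ae_imp => x h Ox; by rewrite !e h.
Qed.

(** Dominates the norm of every partial derivative and is Lipschitz for [H2norm], so that composing
    it with a strongly measurable function gives a measurable density. *)
Definition gradsum f : R := \sum_j L2norm Om (pd Om j f).

Lemma gradsum_ge0 f : 0 <= gradsum f.
Proof. by apply: sumr_ge0 => j _; exact: L2norm_ge0. Qed.

Lemma gradsum_le f : gradsum f <= 3 * H2norm Om f.
Proof.
rewrite /gradsum sum3; have := pdnorm_le_H2norm 0 f; have := pdnorm_le_H2norm 1 f.
have := pdnorm_le_H2norm 2 f.
generalize (L2norm Om (pd Om 0 f)) (L2norm Om (pd Om 1 f)) (L2norm Om (pd Om 2 f)) (H2norm Om f) => a b c d.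
lra.
Qed.

Lemma gradsum_lip f g : H2 Om f -> H2 Om g -> `|gradsum f - gradsum g| <= 3 * H2norm Om (f - g).
Proof.
move=> [hf _] [hg _]; apply: le_trans (gradsum_le (f - g)).
rewrite /gradsum -sumrB; apply: (le_trans (ler_norm_sum _ _ _)).
by apply: ler_sum => j _; exact: (si_norm_dist (pdform_si j)).
Qed.

Variable T : R.
Hypothesis T0 : 0 < T.
Let mT : measurable (time_itv T). Proof. exact: measurable_itv. Qed.

Lemma L2_scalar_continuous (f : R -> R * R -> R) chi : L2 Om chi ->
  (forall t, 0 <= t <= T -> L2 Om (f t) /\
    L2norm Om (f s - f t) @[s --> within `[0, T] (nbhs t)] --> (0 : R)) ->
  {within [set` `[0, T]], continuous (fun t => ip Om (f t) chi)}.
Proof.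
move=> hc hf; apply/subspace_continuousP => t; rewrite /= in_itv /= => tT.
have [ht ct] := hf t tT; apply/subr_cvg0; apply/norm_cvg0P.
have c : L2norm Om (f s - f t) * L2norm Om chi @[s --> within [set` `[0, T]] (nbhs t)] --> (0 : R).
  by rewrite -[X in _ --> X](mul0r (L2norm Om chi)); apply: cvgMl.
apply: (@squeeze_cvgr _ _ _ _ (cst 0) (fun s => L2norm Om (f s - f t) * L2norm Om chi)) => //; last exact: cvg_cst.
have a : within [set` `[0, T]] (nbhs t) [set` `[0, T]] by exact: withinT.
move: a; apply: filterS => s /=; rewrite in_itv /= => sT; have [hs _] := hf s sT.
by rewrite normr_ge0 -(si_sub L2_si)// ip_le//; exact: L2_sub.
Qed.

Lemma sqr_integrable (rho : R -> R) : measurable_fun setT rho ->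
  mu1.-integrable (time_itv T) (fun t => (rho t ^+ 2)%:E) -> mu1.-integrable (time_itv T) (EFin \o rho).
Proof.
move=> mrho irho.
have i1 : mu1.-integrable (time_itv T) (EFin \o (cst 1 : R -> R)).
  by apply: (@continuous_integrable _ _ 0 T) => //; [apply: subset_itvW|apply: continuous_subspaceT => x; exact: cvg_cst].
have i2 := @integrableD _ _ R mu1 _ mT _ _ i1 irho.
apply: (@le_integrable _ _ R mu1 _ mT _ _ _ _ i2).
  by apply/measurable_EFinP; exact: measurable_funTS.
move=> r _ /=; rewrite lee_fin [leRHS]ger0_norm ?addr_ge0 ?sqr_ge0// ler_norml.
have := sqr_ge0 (rho r - 1); have := sqr_ge0 (rho r + 1); rewrite sqrrB sqrrD !mulr1 expr1n.
by move: (rho r) (rho r ^+ 2) => a b h1 h2; apply/andP; split; lra.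
Qed.

Section Increments.
Variables (f g : R -> R * R -> R).
Hypothesis f_cont : forall t, 0 <= t <= T -> L2 Om (f t) /\
    L2norm Om (f s - f t) @[s --> within `[0, T] (nbhs t)] --> (0 : R).
Hypothesis f_H10 : forall t, 0 < t <= T -> H10 Om (f t).
Hypothesis f_deriv : is_weak_time_derivative (H2 Om) (H2norm Om) T f g.
Hypothesis g_L2 : bochner_L2 (H2 Om) (H2norm Om) T g.

(* The bound is stated against derivatives of test functions, so that it holds
   down to [s = 0], where [f s] is not yet known to be in H^1. *)
Lemma gradient_density : exists rho : R -> R, [/\ measurable_fun setT rho, forall t, 0 <= rho t,
  mu1.-integrable setT (fun t => (rho t ^+ 2)%:E) &
  forall j psi s t, test_function Om psi -> 0 <= s -> s < t -> t <= T ->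
    `|ip Om (f t - f s) ('D_(axis j) psi)| <= L2norm Om psi * \int[mu1]_(r in `]s, t[) rho r].
Proof.
have [sm fin] := g_L2.
have [D [mD DT aD gD mPhi]] := strongly_measurableP H2_0 H2_lin sm.
pose rho := (gradsum \o g) \_ D.
have mrho : measurable_fun setT rho.
  by apply/(measurable_restrictT _ mD); exact: mPhi gradsum_lip.
have rho0 t : 0 <= rho t by rewrite /rho patchE; case: ifPn => // _; exact: gradsum_ge0.
have rhoD t : D t -> rho t = gradsum (g t) by move=> Dt; rewrite /rho patchE mem_set.
have irho : mu1.-integrable (time_itv T) (fun t => (rho t ^+ 2)%:E).
  (* By [gradsum_le], [rho / 3] lies below [H2norm (g t)], whose square has a finite lower integral;
     hence the factors 3 and 9. *)
  have -> : (fun t => (rho t ^+ 2)%:E) = (fun t => (9%:E * ((rho t / 3) ^+ 2)%:E)%E).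
    by apply/funext => t; rewrite -EFinM; congr (_%:E); field.
  apply: (@integrableZl _ _ R mu1 _ mT 9); apply/integrableP; split.
    by apply/measurable_EFinP; apply: measurable_funTS; apply: measurable_funX; exact: measurable_funM.
  under eq_integral do rewrite gee0_abs ?lee_fin ?sqr_ge0//.
  apply: le_lt_trans fin; apply: ge0_integral_mono => t tT; rewrite lee_fin ?sqr_ge0//.
  rewrite ler_sqr ?nnegrE ?sqrtr_ge0 ?divr_ge0//.
  rewrite ler_pdivrMr// mulrC /rho patchE; case: ifPn => _; first exact: gradsum_le.
  by rewrite mulr_ge0 ?sqrtr_ge0.
exists rho; split => //.
  have -> : (fun t => (rho t ^+ 2)%:E) = (fun t => (rho t ^+ 2)%:E) \_ (time_itv T).
    apply/funext => t; rewrite patchE; case: ifPn => // /negP tT.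
    by rewrite /rho patchE memNset ?expr0n// => /DT ?; apply: tT; rewrite inE.
  exact: (proj1 (@integrable_mkcond _ _ R mu1 _ (fun t => (rho t ^+ 2)%:E) mT) irho).
move=> j psi s t tpsi s0 st tT.
have hpsi := test_L2 tpsi; have hD := test_L2 (test_D j tpsi).
set chi := 'D_(axis j) psi in hD *.
pose ell v := ip Om v chi.
have K0 : 0 < L2norm Om chi + 1 by rewrite ltr_wpDl// L2norm_ge0.
have ell_lin (a : R) v w : H2 Om v -> H2 Om w -> ell (a *: v + w) = a * ell v + ell w.
  by move=> [hv _] [hw _]; apply: (si_linl L2_si) => //; exact: H1_L2.
have ell_bnd v : H2 Om v -> `|ell v| <= (L2norm Om chi + 1) * H2norm Om v.
  move=> hv; have [hv1 _] := hv; apply: (le_trans (ip_le (H1_L2 hv1) hD)).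
  rewrite mulrC; apply: ler_pM; rewrite ?L2norm_ge0//; first by rewrite lerDl.
  exact: H1norm_le_H2norm.
have ell_psi v : H2 Om v -> `|ell v| <= L2norm Om psi * gradsum v.
  move=> [hv _]; have [_ _ e] := pdP j hv; rewrite /ell e// normrN.
  apply: (le_trans (ip_le (pd_L2 j hv) hpsi)); rewrite mulrC; apply: ler_wpM2l; first exact: L2norm_ge0.
  by rewrite /gradsum (bigD1 j)//= lerDl; apply: sumr_ge0 => k _; exact: L2norm_ge0.
have cA := L2_scalar_continuous hD f_cont.
have mA : measurable_fun (time_itv T) (ell \o f).
  by have /integrableP[/measurable_EFinP] := within_integrable cA.
pose h := (ell \o g) \_ D.
have ell_lip v w : H2 Om v -> H2 Om w -> `|ell v - ell w| <= (L2norm Om chi + 1) * H2norm Om (v - w).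
  move=> hv hw; have e : v - w = -1 *: w + v by rewrite scaleN1r addrC.
  have -> : ell v - ell w = ell (v - w) by rewrite e ell_lin//; ring.
  by apply: ell_bnd; rewrite e; exact: H2_lin.
have mh : measurable_fun setT h.
  by apply/(measurable_restrictT _ mD); exact: mPhi ell_lip.
have hbnd r : `|h r| <= L2norm Om psi * rho r.
  rewrite /h /rho !patchE; case: ifPn => [/set_mem Dr|_]; first exact/ell_psi/gD.
  by rewrite normr0 mulr0.
have ir := sqr_integrable mrho irho.
have irp : mu1.-integrable (time_itv T) (EFin \o (fun r => L2norm Om psi * rho r)).
  exact: (@integrableZl _ _ R mu1 _ mT (L2norm Om psi) _ ir).
have ih : mu1.-integrable (time_itv T) (EFin \o h).
  apply: (@le_integrable _ _ R mu1 _ mT _ _ _ _ irp).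
    by apply/measurable_EFinP; exact: measurable_funTS.
  by move=> r _ /=; rewrite lee_fin [leRHS]ger0_norm ?mulr_ge0 ?L2norm_ge0.
have weak (eta : R -> R) : test_function_time T eta ->
    \int[mu1]_(x in time_itv T) (derive1 eta x * (ell \o f) x) = - \int[mu1]_(x in time_itv T) (eta x * h x).
  move=> teta; have n0 v : 0 <= H2norm Om v by exact: sqrtr_ge0.
  have [h2 [m2 i2 a2 _ ->]] := weak_scalar H2_0 H2_lin n0 K0 ell_lin ell_bnd f_deriv teta mA.
  congr (- _); apply: Rintegral_ae => //; first exact: measurable_funTS.
    apply: measurable_funM; last exact: measurable_funTS.
    apply: measurable_funTS; apply: continuous_measurable_fun => x.
    apply: differentiable_continuous; apply/derivable1_diffP.
    by have [d _ _] := teta; have := d 0%N x.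
  move: a2 aD; apply: ae_imp2 => r q1 q2 rT; rewrite q1//; congr (_ * _).
  by rewrite /h patchE mem_set//; exact: q2.
have eq := weak_ftc T0 cA ih weak s0 st tT.
have sT : [set` `]s, t[] `<=` time_itv T by apply: subset_itv; rewrite bnd_simp.
have mst : measurable [set` `]s, t[] by exact: measurable_itv.
have -> : ip Om (f t - f s) chi = \int[mu1]_(r in `]s, t[) h r.
  rewrite -eq (si_sub L2_si)//.
    by have [] := f_cont (_ : 0 <= t <= T) => //; rewrite tT (le_trans s0 (ltW st)).
  by have [] := f_cont (_ : 0 <= s <= T) => //; rewrite s0 (le_trans (ltW st) tT).
have ihs := @integrableS _ _ R mu1 _ _ _ mT mst sT ih.
have irps := @integrableS _ _ R mu1 _ _ _ mT mst sT irp.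
have irs := @integrableS _ _ R mu1 _ _ _ mT mst sT ir.
apply: (le_trans (@le_normr_Rintegral _ _ R mu1 _ h mst ihs)).
rewrite -(@RintegralZl _ _ R mu1 _ rho (L2norm Om psi) mst irs).
apply: le_Rintegral => //; exact: (@integrable_norm _ _ R mu1 _ h ihs).
Qed.

Variable rho : R -> R.
Hypothesis mrho : measurable_fun setT rho.
Hypothesis rho0 : forall t, 0 <= rho t.
Hypothesis irho2 : mu1.-integrable setT (fun t => (rho t ^+ 2)%:E).
Hypothesis rho_bnd : forall j psi s t, test_function Om psi -> 0 <= s -> s < t -> t <= T ->
    `|ip Om (f t - f s) ('D_(axis j) psi)| <= L2norm Om psi * \int[mu1]_(r in `]s, t[) rho r.

(** The weak bound is tested with the derivative along [j] of a test function approximating the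
    increment. In the limit the left side is the square of the wanted norm and the right side
    contains this norm once, which is simplified. *)
Lemma gradient_increment j s t : 0 <= s -> s < t -> t <= T -> H10 Om (f s) -> H10 Om (f t) ->
  L2norm Om (pd Om j (f t - f s)) <= \int[mu1]_(r in `]s, t[) rho r.
Proof.
move=> s0 st tT hs ht; set I := Rintegral _ _ _.
have hd : H10 Om (f t - f s) by have := H10_lin (-1) hs ht; rewrite scaleN1r addrC.
set dd := f t - f s in hd *.
have Hd := H10_H1 hd; have hp := pd_L2 j Hd.
have [phi [tphi _ c]] := H10_seq hd.
have tD k := test_D j (tphi k); have hD k := test_L2 (tD k).
have c1 : ip Om (pd Om j dd) ('D_(axis j) (phi k)) @[k --> \oo] --> ip Om (pd Om j dd) (pd Om j dd).
  by apply: (@ip_cvg _ _ (fun _ => pd Om j dd)) => //; exact: cst_cvg0.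
have c2 : L2norm Om ('D_(axis j) (phi k)) * I @[k --> \oo] --> L2norm Om (pd Om j dd) * I.
  by apply: cvgMl; apply: L2norm_cvg => //; exact: c.
have h : ip Om (pd Om j dd) (pd Om j dd) <= L2norm Om (pd Om j dd) * I.
  apply: (ler_cvg_to c1 c2); apply: nearW => k.
  apply: (le_trans (ler_norm _)); have [_ _ e] := pdP j Hd.
  have := rho_bnd j (tD k) s0 st tT; rewrite -/dd (e _ (tD k)) normrN; exact.
move: h; rewrite -L2norm_sqr expr2.
have := L2norm_ge0 (pd Om j dd); rewrite le_eqVlt => /orP[/eqP <- _|n0].
  by apply: Rintegral_ge0 => r _.
by rewrite ler_pM2l.
Qed.

(** An antiderivative of [rho ^+ 2]. Cauchy-Schwarz bounds the squared increment by the length of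
    the interval times the increment of [energy], a quantity that telescopes over the time steps. *)
Definition energy t : R := \int[mu1]_(r in `]0, t]) (rho r ^+ 2).

Lemma energyB s t : 0 <= s -> s < t ->
  energy t - energy s = \int[mu1]_(r in `]s, t[) (rho r ^+ 2).
Proof.
move=> s0 st; have i (I : interval R) : mu1.-integrable [set` I] (fun t => (rho t ^+ 2)%:E).
  exact: (@integrableS _ _ R mu1 _ _ _ measurableT (measurable_itv I) (@subsetT _ _) irho2).
have E := @Rintegral_itvB _ (fun r => rho r ^+ 2) (BRight 0) (BRight t) s (i _).
rewrite /energy E ?bnd_simp//; last exact: ltW.
by rewrite -(@Rintegral_itv_bndo_bndc _ _ _ (fun r => rho r ^+ 2))//; exact: i.
Qed.

Lemma energy_le s t : 0 <= s -> s <= t -> energy s <= energy t.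
Proof.
move=> s0; rewrite le_eqVlt => /orP[/eqP -> //|st]; rewrite -subr_ge0 energyB//.
by apply: Rintegral_ge0 => r _; exact: sqr_ge0.
Qed.

Lemma rho_CS s t : 0 <= s -> s < t ->
  (\int[mu1]_(r in `]s, t[) rho r) ^+ 2 <= (t - s) * (energy t - energy s).
Proof.
move=> s0 st; have mst : measurable [set` `]s, t[] by exact: measurable_itv.
have q1 : sqint mu1 [set` `]s, t[] rho.
  split; first exact: measurable_funTS.
  exact: (@integrableS _ _ R mu1 _ _ _ measurableT mst (@subsetT _ _) irho2).
have q2 : sqint mu1 [set` `]s, t[] (cst 1).
  split; first exact: measurable_cst.
  apply: (@continuous_integrable _ (fun=> 1 ^+ 2) s t) => //; first exact: subset_itvW.
  by apply: continuous_subspaceT => x; exact: cvg_cst.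
have := si_CS (@sqint_si _ _ R mu1 _ mst) q1 q2.
have -> : intmul mu1 [set` `]s, t[] rho (cst 1) = \int[mu1]_(r in `]s, t[) rho r.
  by apply: eq_Rintegral => r _; rewrite mulr1.
have -> : intmul mu1 [set` `]s, t[] rho rho = energy t - energy s.
  by rewrite energyB//; apply: eq_Rintegral => r _; rewrite expr2.
have -> : intmul mu1 [set` `]s, t[] (cst 1) (cst 1) = t - s.
  rewrite /intmul /Rintegral (eq_integral (fun=> 1%:E)); last by move=> r _; rewrite mulr1.
  have e : mu1 [set` `]s, t[] = (t - s)%:E by rewrite lebesgue_measure_itv /= lte_fin st -EFinB.
  by rewrite (@integral_cst _ _ R mu1 _ mst 1) mul1e; exact: (congr1 fine e).
by rewrite mulrC.
Qed.

Lemma gradient_increment_sqr j s t : 0 <= s -> s < t -> t <= T -> H10 Om (f s) -> H10 Om (f t) ->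
  L2norm Om (pd Om j (f t - f s)) ^+ 2 <= (t - s) * (energy t - energy s).
Proof.
move=> s0 st tT hs ht; apply: le_trans (rho_CS s0 st).
rewrite ler_sqr ?nnegrE ?L2norm_ge0//; first exact: gradient_increment.
by apply: Rintegral_ge0 => r _.
Qed.

(* The gradients at the times [q ^+ k * c] form a Cauchy sequence in L^2. *)
Lemma initial_H10 : H10 Om (f 0).
Proof.
pose M := energy T - energy 0.
have M0 : 0 <= M by rewrite subr_ge0 energy_le// ltW.
(* Chosen so that [c <= T] and [c * M <= 1]. With the ratio [q = 1 / 4], the squared gradient
   increment between consecutive times is at most [q ^+ k], that is [(2^-1 ^+ k) ^+ 2], as
   [riesz_fischer] requires. *)
pose c := T / (1 + T * M).
have den : 0 < 1 + T * M by rewrite ltr_wpDr// mulr_ge0// ltW.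
have c0 : 0 < c by rewrite divr_gt0.
have cT : c <= T.
  by rewrite ler_pdivrMr//; have := mulr_ge0 (ltW T0) (mulr_ge0 (ltW T0) M0); lra.
have cM : c * M <= 1 by rewrite mulrAC ler_pdivrMr// mul1r; lra.
pose q : R := 2^-1 ^+ 2.
have q0 : 0 < q by rewrite exprn_gt0.
have q1 : q < 1 by rewrite /q expr2; lra.
pose s k := q ^+ k * c.
have s0 k : 0 < s k by rewrite mulr_gt0// exprn_gt0.
have sT k : s k <= T.
  apply: le_trans cT; rewrite -[leRHS]mul1r; apply: ler_wpM2r; first exact: ltW.
  by apply: exprn_ile1; exact: ltW.
have sS k : s k.+1 < s k.
  by rewrite /s exprS -mulrA -[ltRHS]mul1r ltr_pM2r//; exact: s0.
have sz : s k @[k --> \oo] --> (0 : R).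
  rewrite -(mul0r c); apply: cvgMl; apply: cvg_expr.
  by rewrite ger0_norm// ltW.
have hs k : H10 Om (f (s k)) by apply: f_H10; rewrite s0 sT.
have Hs k := H10_H1 (hs k).
have inc j k : L2norm Om (pd Om j (f (s k)) - pd Om j (f (s k.+1))) <= 2^-1 ^+ k.
  rewrite pdnorm_sub_ae// -ler_sqr ?nnegrE ?L2norm_ge0 ?exprn_ge0//.
  apply: (le_trans (gradient_increment_sqr j (ltW (s0 _)) (sS k) (sT k) (hs _) (hs _))).
  apply: (@le_trans _ _ (s k * M)).
    apply: ler_pM; rewrite ?subr_ge0 ?(ltW (sS k))//.
    - by apply: energy_le; apply: ltW.
    - by rewrite lerBlDr lerDl ltW.
    - apply: lerB; first by apply: energy_le => //; exact: ltW.
      by apply: energy_le => //; exact: ltW.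
  rewrite /s -mulrA; apply: (@le_trans _ _ (q ^+ k * 1)).
    by apply: ler_wpM2l => //; rewrite exprn_ge0// ltW.
  by rewrite mulr1 /q -!exprM mulnC.
have RF j : exists2 G, L2 Om G & forall k, L2norm Om (pd Om j (f (s k)) - G) <= 2 * 2^-1 ^+ k.
  apply: (@riesz_fischer _ _ R mu2 Om domain_measurable (fun k => pd Om j (f (s k)))).
    by move=> k; exact: pd_L2.
  move=> k; rewrite [leLHS](L2norm_subC (pd_L2 j (Hs k.+1)) (pd_L2 j (Hs k))); exact: inc.
have geo : 2 * 2^-1 ^+ k @[k --> \oo] --> (0 : R).
  rewrite -(mulr0 2); apply: cvgMr; apply: cvg_expr.
  by rewrite ger0_norm//; lra.
have z0 : 0 <= (0 : R) <= T by rewrite lexx ltW.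
have [h0 ct] := f_cont z0.
have cf : L2norm Om (f 0 - f (s k)) @[k --> \oo] --> (0 : R).
  have e k : L2norm Om (f 0 - f (s k)) = L2norm Om (f (s k) - f 0).
    by apply: L2norm_subC => //; exact: H1_L2.
  under eq_fun do rewrite e.
  have cs : s k @[k --> \oo] --> within [set` `[0, T]] (nbhs (0 : R)).
    move=> A nA; have n2 : \forall k \near \oo, [set` `[0, T]] (s k) -> A (s k) := sz _ nA.
    by change (\forall k \near \oo, A (s k)); move: n2; apply: filterS => k /= hA; apply: hA;
      rewrite /= in_itv /= (ltW (s0 k)) sT.
  exact: (cvg_comp _ _ cs ct).
have wp j G : L2 Om G -> (forall k, L2norm Om (pd Om j (f (s k)) - G) <= 2 * 2^-1 ^+ k) ->
    L2norm Om (G - pd Om j (f (s k))) @[k --> \oo] --> (0 : R) /\ is_weak_partial Om j (f 0) G.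
  move=> hG bG.
  have cG : L2norm Om (G - pd Om j (f (s k))) @[k --> \oo] --> (0 : R).
    apply: (@squeeze_cvgr _ _ _ _ (cst 0) (fun k => 2 * 2^-1 ^+ k)) => //; last exact: cvg_cst.
    apply: nearW => k; rewrite L2norm_ge0 /= (L2norm_subC hG (pd_L2 j (Hs k))); exact: bG.
  split=> //; split=> // psi tpsi; have hp := test_L2 tpsi; have hD := test_L2 (test_D j tpsi).
  have l1 : ip Om (f (s k)) ('D_(axis j) psi) @[k --> \oo] --> ip Om (f 0) ('D_(axis j) psi).
    by apply: (@ip_cvg _ _ _ (fun _ => 'D_(axis j) psi)) => //; [move=> k; exact: H1_L2|exact: cst_cvg0].
  have l2 : ip Om (pd Om j (f (s k))) psi @[k --> \oo] --> ip Om G psi.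
    by apply: (@ip_cvg _ _ _ (fun _ => psi)) => //; [move=> k; exact: pd_L2|exact: cst_cvg0].
  have l3 : ip Om (f (s k)) ('D_(axis j) psi) @[k --> \oo] --> - ip Om G psi.
    have e k : ip Om (f (s k)) ('D_(axis j) psi) = - ip Om (pd Om j (f (s k))) psi.
      by have [_ _ ->] := pdP j (Hs k).
    by under eq_fun do rewrite e; exact: cvgN.
  exact: (cvg_unique (@norm_hausdorff _ _) l1 l3).
have H0 : H1 Om (f 0) by move=> j; have [G hG bG] := RF j; exists G; have [] := wp j G hG bG.
apply: (H10_intro H0 hs cf) => j; have [G hG bG] := RF j; have [cG wG] := wp j G hG bG.
move: cG; apply: cvg_trans; apply: near_eq_cvg; apply: nearW => k.
rewrite -pdnorm_sub_ae//; apply: L2norm_ae; [by apply: L2_sub => //; exact: pd_L2|by apply: L2_sub; exact: pd_L2|].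
have e := pd_ae wG; move: e; apply: ae_imp => x h Ox; symmetry.
by rewrite [LHS](_ : _ = pd Om j (f 0) x - pd Om j (f (s k)) x)// h.
Qed.

End Increments.
End SobolevTime.

(** * The tested equations *)
Section Tested.
Implicit Types (f g h phi psi : R * R -> R) (j : 'I_3).
Implicit Types (u v w : 'I_3 -> R * R -> R).

(** Unlike in [ip_ae], the function [f] is only measurable: it will be a convection term, equal
    almost everywhere to an L^2 function by the equation alone. *)
Lemma ip_ae_measurable f f' g : measurable_fun Om f -> L2 Om f' -> L2 Om g ->
  {ae mu2, forall x, Om x -> f x = f' x} -> ip Om f g = ip Om f' g.
Proof.
move=> mf hf' hg e; congr fine; apply: ae_eq_integral.
- exact: domain_measurable.
- by apply/measurable_EFinP; apply: measurable_funM; [exact: mf|exact: hg.1].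
- by apply/measurable_EFinP; apply: measurable_funM; [exact: hf'.1|exact: hg.1].
- by move: e; apply: ae_imp => x h Ox; rewrite h.
Qed.

Lemma conv_measurable u v i : (forall i, H1 Om (u i)) -> (forall i, H1 Om (v i)) ->
  measurable_fun Om (Defs.conv Om u v i).
Proof.
move=> hu hv; have e : Defs.conv Om u v i = (fun x => u 0 x * pd Om 0 (v i) x +
    u 1 x * pd Om 1 (v i) x + u 2 x * pd Om 2 (v i) x).
  by apply/funext => x; rewrite /Defs.conv sum3.
have m j : measurable_fun Om (fun x => u j x * pd Om j (v i) x).
  by apply: measurable_funM; [exact: (H1_L2 (hu j)).1|exact: (pd_L2 j (hv i)).1].
by rewrite e; apply: measurable_funD => //; exact: measurable_funD.
Qed.

Lemma laplacianE f : laplacian Om f = pd Om 0 (pd Om 0 f) + pd Om 1 (pd Om 1 f) + pd Om 2 (pd Om 2 f).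
Proof. by apply/funext => x; rewrite /laplacian sum3. Qed.

Lemma laplacian_L2 f : H2 Om f -> L2 Om (laplacian Om f).
Proof.
move=> [_ hf]; rewrite laplacianE.
by apply: (si_D L2_si); [apply: (si_D L2_si)|]; exact: pd_L2.
Qed.

Lemma ip_laplacian f h : H2 Om f -> H10 Om h ->
  ip Om (laplacian Om f) h = - \sum_j ip Om (pd Om j f) (pd Om j h).
Proof.
move=> [_ hf] hh; have hL := H1_L2 (H10_H1 hh); rewrite laplacianE sum3.
have P j := pd_L2 j (hf j).
rewrite (si_add L2_si (si_D L2_si (P 0) (P 1)) (P 2) hL) (si_add L2_si (P 0) (P 1) hL).
rewrite !opprD; congr (_ + _ + _); apply: (canRL (@opprK _)); symmetry;
  exact: integration_by_parts_H10.
Qed.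

(** The equation is solved for the convection term [cv], which becomes almost everywhere the L^2
    combination [S] divided by [k]. The pairing then splits, and the Laplacian is integrated by
    parts. *)
Lemma tested_component (k m s r : R) A cv f G c h : k != 0 -> L2 Om A ->
  measurable_fun Om cv -> H2 Om f -> L2 Om G -> L2 Om c -> H10 Om h ->
  {ae mu2, forall x, Om x ->
    k * A x + k * cv x - m * laplacian Om f x + G x + s * f x - r * c x = 0} ->
  k * ip Om A h + k * ip Om cv h =
    - m * (\sum_j ip Om (pd Om j f) (pd Om j h)) - ip Om G h - s * ip Om f h + r * ip Om c h.
Proof.
move=> k0 hA mcv hf hG hc hh e; have hL := H1_L2 (H10_H1 hh).
have hl := laplacian_L2 hf; have hf1 := H1_L2 hf.1.
have h1 := L2_lin r hc (si_0 L2_si hc).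
have h2 := L2_lin (- s) hf1 h1.
have h3 := L2_lin (- 1) hG h2.
have h4 := L2_lin m hl h3.
have h5 := L2_lin (- k) hA h4.
pose S := (- k) *: A + (m *: laplacian Om f + ((- 1) *: G + ((- s) *: f + (r *: c + 0)))).
have E : ip Om cv h = ip Om (k^-1 *: S) h.
  apply: ip_ae_measurable => //; first exact: (si_Z L2_si).
  move: e; apply: ae_imp => x hx Ox; apply: (mulfI k0).
  have -> : k * (k^-1 *: S) x = S x by rewrite [LHS]mulrA mulfV// mul1r.
  have -> : S x = (- k) * A x + (m * laplacian Om f x + ((- 1) * G x + ((- s) * f x + (r * c x + 0)))) by [].
  by move: (hx Ox); lra.
rewrite E (si_scale L2_si _ h5 hL) mulrA mulfV// mul1r.
rewrite (si_linl L2_si _ hA h4 hL) (si_linl L2_si _ hl h3 hL) (si_linl L2_si _ hG h2 hL).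
rewrite (si_linl L2_si _ hf1 h1 hL) (si_linl L2_si _ hc (si_0 L2_si hc) hL) (si_zerol L2_si hL).
rewrite (ip_laplacian hf hh).
generalize (ip Om A h) (\sum_j ip Om (pd Om j f) (pd Om j h)) (ip Om G h) (ip Om f h) (ip Om c h).
by move=> *; ring.
Qed.

(* Right-hand side of both tested equations: [x] transports, [y] is transported,
   [y'] is the copy of [y] treated implicitly and [b] is the other unknown. *)
Definition form (k m s r : R) (x y y' b : 'I_3 -> R * R -> R) z : R :=
  - k * tri x y z - m * gradip Om y' z - s * vip Om y' z + r * cform b z.

Lemma tested_equation (k m s r : R) A u a b G z : k != 0 -> (forall i, L2 Om (A i)) ->
  (forall i, H1 Om (u i)) -> (forall i, H2 Om (a i)) -> (forall i, H1 Om (b i)) ->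
  (forall i, L2 Om (G i)) -> vip Om G z = 0 -> Hfield z ->
  (forall i, {ae mu2, forall x, Om x ->
    k * A i x + k * Defs.conv Om u a i x - m * laplacian Om (a i) x + G i x
      + s * a i x - r * curl Om b i x = 0}) ->
  k * vip Om A z = form k m s r u a a b z.
Proof.
move=> k0 hA hu ha hb hG G0 hz e.
have E i := tested_component k0 (hA i) (conv_measurable i hu (fun i => (ha i).1)) (ha i) (hG i)
  (@curl_L2 b i hb) (hz i) (e i).
have gen (f1 f2 f3 f4 f5 f6 : 'I_3 -> R) :
    (forall i, k * f1 i + k * f2 i = - m * f3 i - f4 i - s * f5 i + r * f6 i) -> \sum_i f4 i = 0 ->
    k * \sum_i f1 i = - k * \sum_i f2 i - m * \sum_i f3 i - s * \sum_i f5 i + r * \sum_i f6 i.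
  by move=> h; have := h 0; have := h 1; have := h 2; rewrite !sum3; lra.
exact: (gen (fun i => ip Om (A i) (z i)) (fun i => ip Om (Defs.conv Om u a i) (z i))
  (fun i => \sum_j ip Om (pd Om j (a i)) (pd Om j (z i))) (fun i => ip Om (G i) (z i))
  (fun i => ip Om (a i) (z i)) (fun i => ip Om (curl Om b i) (z i)) E G0).
Qed.

Lemma pressure_orthogonal p z : H1 Om p -> Hfield z -> divfree z ->
  vip Om (fun i => pd Om i p) z = 0.
Proof.
move=> hp hz dz; have hL := H1_L2 hp.
have P i := pd_L2 i (H10_H1 (hz i)).
have e : div Om z = pd Om 0 (z 0) + pd Om 1 (z 1) + pd Om 2 (z 2).
  by apply/funext => x; rewrite /div sum3.
have P3 := si_D L2_si (P 0) (P 1).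
have d0 : ip Om (div Om z) p = 0.
  rewrite (ip_ae _ (si_0 L2_si hL) hL dz); first exact: (si_zerol L2_si hL).
  by rewrite e; exact: (si_D L2_si P3 (P 2)).
move: d0; rewrite e (si_add L2_si P3 (P 2) hL) (si_add L2_si (P 0) (P 1) hL).
have E i : ip Om (pd Om i p) (z i) = - ip Om (pd Om i (z i)) p.
  by rewrite (si_sym L2_si _ p) (integration_by_parts_H10 i hp (hz i)) opprK.
have gen (f g : 'I_3 -> R) : (forall i, f i = - g i) -> g 0 + g 1 + g 2 = 0 -> \sum_i f i = 0.
  by move=> h; rewrite sum3 !h; lra.
exact: (gen (fun i => ip Om (pd Om i p) (z i)) (fun i => ip Om (pd Om i (z i)) p) E).
Qed.

Lemma pd_eq0 j f : {ae mu2, forall x, Om x -> f x = 0} -> L2 Om f ->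
  {ae mu2, forall x, Om x -> pd Om j f x = 0}.
Proof.
move=> e hf; have h0 : L2 Om 0 := L2_cst 0.
apply: pd_ae; apply: (weak_partial_ae (weak_partial0 j) hf h0); last exact: aeW.
by move: e; apply: ae_imp => x h Ox; rewrite h.
Qed.

Lemma pd2_eq0 f : H1 Om f -> {ae mu2, forall x, Om x -> pd Om 2 f x = 0}.
Proof.
move=> hf; have hL := H1_L2 hf; apply: pd_ae; split=> //; first exact: (L2_cst 0).
move=> phi t; have -> : 'D_(axis 2) phi = 0 by apply/funext => x; exact: axis2_derive.
rewrite (si_sym L2_si) (si_zerol L2_si hL) (si_zerol L2_si (test_L2 t)) oppr0//.
Qed.

(** The only nonzero component is differentiated along the third axis, which is the null direction
    of the plane. *)
Lemma axial_divfree z : axial Om z -> (forall i, H1 Om (z i)) -> divfree z.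
Proof.
move=> az hz; have z0 : {ae mu2, forall x, Om x -> z 0 x = 0} by apply: aeW => x /az[].
have z1 : {ae mu2, forall x, Om x -> z 1 x = 0} by apply: aeW => x /az[].
move: (pd_eq0 0 z0 (H1_L2 (hz 0))) (pd_eq0 1 z1 (H1_L2 (hz 1))) => e0 e1.
have e2 := pd2_eq0 (hz 2).
have e01 : {ae mu2, forall x, Om x -> pd Om 0 (z 0) x = 0 /\ pd Om 1 (z 1) x = 0}.
  by move: e0 e1; apply: ae_imp2 => x h0 h1 Ox; rewrite h0// h1.
move: e01 e2; apply: ae_imp2 => x h0 h2 Ox.
by have [a b] := h0 Ox; rewrite /div sum3 a b h2// !addr0.
Qed.

Lemma div_L2 z : (forall i, H1 Om (z i)) -> L2 Om (div Om z).
Proof.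
move=> hz; have -> : div Om z = pd Om 0 (z 0) + pd Om 1 (z 1) + pd Om 2 (z 2).
  by apply/funext => x; rewrite /div sum3.
by apply: (si_D L2_si); [apply: (si_D L2_si)|]; exact: pd_L2.
Qed.

Variable T : R.

Lemma momentum_tested (par : params R) ut u w p z : (forall i, L2 Om (ut i)) ->
  (forall i, H2 Om (u i)) -> (forall i, H1 Om (w i)) -> H1 Om p -> Hfield z -> divfree z ->
  (forall i, {ae mu2, forall x, Om x ->
        ut i x + Defs.conv Om u u i x - nu0 par * laplacian Om (u i) x
        + pd Om i p x - 2 * nur par * curl Om w i x = 0}) ->
  1 * vip Om ut z = form 1 (nu0 par) 0 (2 * nur par) u u u w z.
Proof.
move=> hut hu hw hp hz dz e.
have gen : forall i, {ae mu2, forall x, Om x ->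
    1 * ut i x + 1 * Defs.conv Om u u i x - nu0 par * laplacian Om (u i) x + pd Om i p x
      + 0 * u i x - 2 * nur par * curl Om w i x = 0}.
  by move=> i; have := e i; apply: ae_imp => x h Ox; move: (h Ox); lra.
exact: (tested_equation (oner_neq0 _) hut (fun i => (hu i).1) hu hw (fun i => pd_L2 i hp)
  (pressure_orthogonal hp hz dz) hz gen).
Qed.

(** The divergence of [w] vanishes almost everywhere, hence so does each weak derivative of it, and
    the term in [c2] drops out; the slot of the pressure gradient is filled with 0. *)
Lemma angular_tested (par : params R) wt u w z : jmath par != 0 -> (forall i, L2 Om (wt i)) ->
  (forall i, H1 Om (u i)) -> (forall i, H2 Om (w i)) -> axial Om w -> Hfield z ->
  (forall i, {ae mu2, forall x, Om x ->
        jmath par * wt i x + jmath par * Defs.conv Om u w i x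
        - c1 par * laplacian Om (w i) x - c2 par * pd Om i (div Om w) x
        + 4 * nur par * w i x - 2 * nur par * curl Om u i x = 0}) ->
  jmath par * vip Om wt z = form (jmath par) (c1 par) (4 * nur par) (2 * nur par) u w w u z.
Proof.
move=> j0 hwt hu hw aw hz e.
have dw := axial_divfree aw (fun i => (hw i).1).
have hd := div_L2 (fun i => (hw i).1).
have gen : forall i, {ae mu2, forall x, Om x ->
    jmath par * wt i x + jmath par * Defs.conv Om u w i x - c1 par * laplacian Om (w i) x + (0 : 'I_3 -> R * R -> R) i x
      + 4 * nur par * w i x - 2 * nur par * curl Om u i x = 0}.
  move=> i; have := pd_eq0 i dw hd; have := e i; apply: ae_imp2 => x h h2 Ox.
  rewrite (_ : (0 : 'I_3 -> R * R -> R) i x = 0)//; move: (h Ox); rewrite (h2 Ox); lra.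
have h0 i : L2 Om ((0 : 'I_3 -> R * R -> R) i) := L2_cst 0.
have z0 : vip Om (0 : 'I_3 -> R * R -> R) z = 0 := si_zerol vip_si (fun i => H1_L2 (H10_H1 (hz i))).
exact: (tested_equation j0 hwt hu hw hu h0 z0 hz gen).
Qed.

End Tested.

(** * Consistency over a time step *)

Section Consistency.
Implicit Types (f g h phi psi : R * R -> R) (j : 'I_3).
Implicit Types (u v w : 'I_3 -> R * R -> R).

Lemma tri_subl x x' y z : Hfield x -> Hfield x' -> Hfield y -> Hfield z ->
  tri (x - x') y z = tri x y z - tri x' y z.
Proof.
move=> hx hx' hy hz; have e : x - x' = -1 *: x' + x by rewrite scaleN1r addrC.
by rewrite e (@tri_lin1 _ _ _ _ _ hx' hx hy hz) mulN1r addrC.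
Qed.

Lemma tri_subm x y y' z : Hfield x -> Hfield y -> Hfield y' -> Hfield z ->
  tri x (y - y') z = tri x y z - tri x y' z.
Proof.
move=> hx hy hy' hz; have e : y - y' = -1 *: y' + y by rewrite scaleN1r addrC.
by rewrite e (@tri_lin2 _ _ _ _ _ hx hy' hy hz) mulN1r addrC.
Qed.

Lemma tri_subr x y z z' : Hfield x -> Hfield y -> Hfield z -> Hfield z' ->
  tri x y (z - z') = tri x y z - tri x y z'.
Proof.
move=> hx hy hz hz'; have e : z - z' = -1 *: z' + z by rewrite scaleN1r addrC.
by rewrite e (@tri_lin3 _ _ _ _ _ hx hy hz' hz) mulN1r addrC.
Qed.

Lemma cform_sub x x' z : Hfield x -> Hfield x' -> Hfield z ->
  cform (x - x') z = cform x z - cform x' z.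
Proof.
move=> hx hx' hz; have e : x - x' = -1 *: x' + x by rewrite scaleN1r addrC.
have H1f v : Hfield v -> forall i, H1 Om (v i) by move=> hv i; exact: H10_H1.
by rewrite e (@cform_lin _ _ _ _ (H1f _ hx') (H1f _ hx) (fun i => H1_L2 (H1f _ hz i))) mulN1r addrC.
Qed.

Let cform_aux (C gx vz gz g2 v2 : R) : gx ^+ 2 = g2 -> vz ^+ 2 = v2 -> 0 <= vz -> vz <= C * gz ->
  2 * g2 * v2 <= (2 * C * (gx * gz)) ^+ 2.
Proof.
move=> <- <- vz0 h; have gx2 := sqr_ge0 gx; have hh := ler_wpM2l gx2 (ler_pM vz0 vz0 h h).
rewrite (_ : (2 * C * (gx * gz)) ^+ 2 = 4 * (gx ^+ 2 * (C * gz * (C * gz)))); last by ring.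
rewrite (_ : 2 * gx ^+ 2 * vz ^+ 2 = 2 * (gx ^+ 2 * (vz * vz))); last by ring.
rewrite [leRHS](_ : _ = 2 * (gx ^+ 2 * (C * gz * (C * gz))) + 2 * (gx ^+ 2 * (C * gz * (C * gz)))); last by ring.
apply: ler_wpDr; first by rewrite mulr_ge0// mulr_ge0// -expr2 sqr_ge0.
exact: ler_wpM2l.
Qed.

(** In the convection term one argument is changed at a time, so the gradient bound [M] is used for
    [x1] and [y2], and [36] is twice the constant of [tri_le]. Poincaré's inequality reduces all
    other norms to gradients. *)
Lemma form_diff (k m s r M : R) : 0 <= M -> exists2 K : R, 0 <= K &
  forall (x1 x2 y1 y2 y1' y2' b1 b2 z : 'I_3 -> R * R -> R) (d : R),
    [/\ Hfield x1, Hfield y1, Hfield y1' & Hfield b1] ->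
    [/\ Hfield x2, Hfield y2, Hfield y2' & Hfield b2] -> Hfield z ->
    gnorm x1 <= M -> gnorm y2 <= M ->
    [/\ gnorm (x1 - x2) <= d, gnorm (y1 - y2) <= d, gnorm (y1' - y2') <= d & gnorm (b1 - b2) <= d] ->
  `|form k m s r x1 y1 y1' b1 z - form k m s r x2 y2 y2' b2 z| <= K * (d * gnorm z).
Proof.
move=> M0; have [C C0 hC] := poincare_field.
exists (`|k| * (36 * C * M) + `|m| + `|s| * C ^+ 2 + `|r| * (2 * C)).
  by do !apply: addr_ge0; do ?apply: mulr_ge0; rewrite ?exprn_ge0.
move=> x1 x2 y1 y2 y1' y2' b1 b2 z d [hx1 hy1 hy1' hb1] [hx2 hy2 hy2' hb2] hz xM yM [dx dy dy' db].
have gi := @gradip_Hfield_si; have vi := @vip_Hfield_si.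
have H1f v : Hfield v -> forall i, H1 Om (v i) by move=> hv i; exact: H10_H1.
have T3 x y : Hfield x -> Hfield y -> `|tri x y z| <= 18 * C * (gnorm x * gnorm y * gnorm z).
  move=> hx hy; apply: (le_trans (@tri_le _ _ _ hx hy hz)).
  have l v : Hfield v -> lnorm v <= Num.sqrt C * gnorm v.
    move=> hv; rewrite -[leRHS](_ : Num.sqrt (C * (gnorm v * gnorm v)) = _); last first.
      by rewrite sqrtrM// -expr2 sqrtr_sqr ger0_norm// gnorm_ge0.
    rewrite /lnorm; apply: ler_wsqrtr; rewrite mulrA; apply: ler_wpM2r; first exact: gnorm_ge0.
    exact: hC.
  have gen (lx lz gx gy gz sC : R) : 0 <= lx -> 0 <= lz -> 0 <= gy -> lx <= sC * gx -> lz <= sC * gz ->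
      sC ^+ 2 = C -> 18 * (gy * (lx * lz)) <= 18 * C * (gx * gy * gz).
    move=> lx0 lz0 gy0 h1 h2 <-; have h := ler_wpM2l gy0 (ler_pM lx0 lz0 h1 h2).
    rewrite (_ : 18 * sC ^+ 2 * _ = 18 * (gy * (sC * gx * (sC * gz)))); last by ring.
    exact: ler_wpM2l.
  exact: (gen _ _ _ _ _ _ (sqrtr_ge0 _) (sqrtr_ge0 _) (gnorm_ge0 y) (l x hx) (l z hz) (sqr_sqrtr C0)).
have V3 x : Hfield x -> `|vip Om x z| <= C ^+ 2 * (gnorm x * gnorm z).
  move=> hx; apply: (le_trans (si_le vi hx hz)).
  by rewrite expr2 -mulrACA; apply: ler_pM; rewrite ?vnorm_ge0//; exact: hC.
have G3 x : Hfield x -> `|gradip Om x z| <= gnorm x * gnorm z by move=> hx; exact: (si_le gi hx hz).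
have C3 x : Hfield x -> `|cform x z| <= 2 * C * (gnorm x * gnorm z).
  move=> hx; rewrite -ler_sqr ?nnegrE ?mulr_ge0 ?gnorm_ge0// real_normK ?num_real//.
  apply: (le_trans (@cform_CS _ _ (H1f _ hx) (fun i => H1_L2 (H1f _ hz i)))).
  exact: (cform_aux (si_normE gi hx) (si_normE vi hz) (vnorm_ge0 z) (hC z hz)).
have S v w : Hfield v -> Hfield w -> Hfield (v - w) by exact: (si_B gi).
have hx := S _ _ hx1 hx2; have hy := S _ _ hy1 hy2; have hy' := S _ _ hy1' hy2'; have hb := S _ _ hb1 hb2.
have E : form k m s r x1 y1 y1' b1 z - form k m s r x2 y2 y2' b2 z =
    - k * (tri x1 (y1 - y2) z + tri (x1 - x2) y2 z) - m * gradip Om (y1' - y2') z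
    - s * vip Om (y1' - y2') z + r * cform (b1 - b2) z.
  rewrite /form (tri_subm hx1 hy1 hy2 hz) (tri_subl hx1 hx2 hy2 hz) (si_sub gi hy1' hy2' hz).
  rewrite (si_sub vi hy1' hy2' hz) (cform_sub hb1 hb2 hz).
  generalize (tri x1 y1 z) (tri x1 y2 z) (tri x2 y2 z) (gradip Om y1' z) (gradip Om y2' z)
    (vip Om y1' z) (vip Om y2' z) (cform b1 z) (cform b2 z) => *; ring.
have g0 := gnorm_ge0 z.
have d0 : 0 <= d := le_trans (gnorm_ge0 _) dx.
have B1 : `|tri x1 (y1 - y2) z + tri (x1 - x2) y2 z| <= 36 * C * M * (d * gnorm z).
  apply: (le_trans (ler_normD _ _)).
  have h1 := T3 _ _ hx1 hy; have h2 := T3 _ _ hx hy2.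
  have k1 := ler_wpM2r g0 (ler_pM (gnorm_ge0 _) (gnorm_ge0 _) xM dy).
  have k2 := ler_wpM2r g0 (ler_pM (gnorm_ge0 _) (gnorm_ge0 _) dx yM).
  have C18 : 0 <= 18 * C by rewrite mulr_ge0.
  have -> : 36 * C * M * (d * gnorm z) = 18 * C * (M * d * gnorm z) + 18 * C * (d * M * gnorm z) by ring.
  by apply: lerD; [apply: le_trans h1 _|apply: le_trans h2 _]; exact: ler_wpM2l.
have B2 : `|gradip Om (y1' - y2') z| <= d * gnorm z.
  exact: le_trans (G3 _ hy') (ler_wpM2r g0 dy').
have B3 : `|vip Om (y1' - y2') z| <= C ^+ 2 * (d * gnorm z).
  exact: le_trans (V3 _ hy') (ler_wpM2l (sqr_ge0 C) (ler_wpM2r g0 dy')).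
have C20 : 0 <= 2 * C by rewrite mulr_ge0.
have B4 : `|cform (b1 - b2) z| <= 2 * C * (d * gnorm z).
  exact: le_trans (C3 _ hb) (ler_wpM2l C20 (ler_wpM2r g0 db)).
rewrite E; move: B1 B2 B3 B4.
generalize (tri x1 (y1 - y2) z + tri (x1 - x2) y2 z) (gradip Om (y1' - y2') z) (vip Om (y1' - y2') z)
  (cform (b1 - b2) z) (d * gnorm z) => a1 a2 a3 a4 D B1 B2 B3 B4.
have -> : (`|k| * (36 * C * M) + `|m| + `|s| * C ^+ 2 + `|r| * (2 * C)) * D =
  `|k| * (36 * C * M * D) + `|m| * D + `|s| * (C ^+ 2 * D) + `|r| * (2 * C * D) by ring.
apply: (le_trans (ler_normD _ _)); apply: lerD; last by rewrite normrM; apply: ler_wpM2l.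
apply: (le_trans (ler_normB _ _)); apply: lerD; last by rewrite normrM; apply: ler_wpM2l.
apply: (le_trans (ler_normB _ _)); apply: lerD; last by rewrite normrM; apply: ler_wpM2l.
by rewrite normrM normrN; apply: ler_wpM2l.
Qed.

Section Average.
Variables (T : R) (T0 : 0 < T).
Let mT : measurable (time_itv T). Proof. exact: measurable_itv. Qed.
(** [a] is the unknown of the equation, with weak derivative [at_]; [u] transports it, and [b]
    enters through the curl. The instances are [(u, u, w)] for momentum and [(u, w, u)] for angular
    momentum. *)
Variables (k m s0 r : R) (u a b at_ : R -> 'I_3 -> R * R -> R) (Gam : R -> R) (M : R).
Let F z t := form k m s0 r (u t) (a t) (a t) (b t) z.
(** Not a distance but a modulus of continuity, increasing with the interval; over one time step it
    is the [om_n] of the error analysis. *)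
Let dist t1 t2 := Num.sqrt ((t2 - t1) * (Gam t2 - Gam t1)).
Hypothesis M0 : 0 <= M.
Hypothesis Gam_le : forall t1 t2, 0 <= t1 -> t1 <= t2 -> t2 <= T -> Gam t1 <= Gam t2.
Hypothesis fields : forall t, 0 <= t <= T -> [/\ Hfield (u t), Hfield (a t) & Hfield (b t)].
Hypothesis bounded : forall t, 0 <= t <= T -> gnorm (u t) <= M /\ gnorm (a t) <= M.
Hypothesis increments : forall t1 t2, 0 <= t1 -> t1 < t2 -> t2 <= T ->
  [/\ gnorm (u t2 - u t1) <= dist t1 t2, gnorm (a t2 - a t1) <= dist t1 t2 &
      gnorm (b t2 - b t1) <= dist t1 t2].
Hypothesis a_cont : continuous_in_L2 Om T a.
Hypothesis a_deriv : forall i, is_weak_time_derivative (L2 Om) (L2norm Om) T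
  (fun t => a t i) (fun t => at_ t i).

Let gC x y : Hfield x -> Hfield y -> gnorm (x - y) = gnorm (y - x).
Proof.
move=> hx hy; rewrite -[in LHS](opprB y x).
have gi := @gradip_Hfield_si.
by apply: (si_norm_opp gi); exact: (si_B gi).
Qed.

Let gxx x : Hfield x -> gnorm (x - x) = 0.
Proof.
move=> hx; have gi := @gradip_Hfield_si.
by rewrite /gnorm subrr (si_zerol gi (si_0 gi hx)) sqrtr0.
Qed.

Let dist_le t1 t2 t3 t4 : 0 <= t1 -> t1 <= t2 -> t2 <= t3 -> t3 <= t4 -> t4 <= T ->
  dist t2 t3 <= dist t1 t4.
Proof.
move=> h1 h12 h23 h34 h4; apply: ler_wsqrtr.
have g1 := Gam_le h1 h12 (le_trans h23 (le_trans h34 h4)).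
have g3 := Gam_le (le_trans h1 (le_trans h12 h23)) h34 h4.
have g2 := Gam_le (le_trans h1 h12) h23 (le_trans h34 h4).
by apply: ler_pM; lra.
Qed.

Lemma increments_le t1 t2 t3 t4 : 0 <= t1 -> t1 <= t2 -> t2 <= t3 -> t3 <= t4 -> t4 <= T ->
  [/\ gnorm (u t3 - u t2) <= dist t1 t4, gnorm (a t3 - a t2) <= dist t1 t4 &
      gnorm (b t3 - b t2) <= dist t1 t4].
Proof.
move=> h1 h12 h23 h34 h4; have hd := dist_le h1 h12 h23 h34 h4.
have t2T : 0 <= t2 <= T by rewrite (le_trans h1 h12) (le_trans h23 (le_trans h34 h4)).
have [hu ha hb] := fields t2T.
move: h23; rewrite le_eqVlt => /orP[/eqP <-|h23].
  by rewrite !gxx// sqrtr_ge0.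
have [d1 d2 d3] := increments (le_trans h1 h12) h23 (le_trans h34 h4).
by split; [exact: le_trans d1 hd|exact: le_trans d2 hd|exact: le_trans d3 hd].
Qed.

(** The arguments are frozen as in the scheme: convection at the old time, diffusion and zero-order
    term at the new one. The curl is explicit in the momentum equation ([t' = s]) and implicit in
    the angular one ([t' = t]). *)
Lemma form_increment : exists2 K : R, 0 <= K & forall z (s q t t' : R), Hfield z ->
  0 <= s -> s <= q -> q <= t -> t <= T -> t' = s \/ t' = t ->
  `|F z q - form k m s0 r (u s) (a s) (a t) (b t') z| <= K * (dist s t * gnorm z).
Proof.
have [K K0 hK] := form_diff k m s0 r M0; exists K => // z s q t t' hz hs sq qt tT et'.
have sT : 0 <= s <= T by rewrite hs (le_trans sq (le_trans qt tT)).
have qT : 0 <= q <= T by rewrite (le_trans hs sq) (le_trans qt tT).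
have tT' : 0 <= t <= T by rewrite tT (le_trans hs (le_trans sq qt)).
have [hus has hbs] := fields sT; have [huq haq hbq] := fields qT; have [hut hat hbt] := fields tT'.
have [i1 i2 i3] := increments_le hs (lexx s) sq qt tT.
have [i4 i5 i6] := increments_le hs sq qt (lexx t) tT.
have [Mu _] := bounded qT; have [_ Ma] := bounded sT.
have hbt' : Hfield (b t') by case: et' => ->.
have d4 : gnorm (a q - a t) <= dist s t by rewrite (gC haq hat); exact: i5.
have d3 : gnorm (b q - b t') <= dist s t.
  by case: et' => ->; [exact: i3|rewrite (gC hbq hbt); exact: i6].
exact: (hK _ _ _ _ _ _ _ _ z _ (And4 huq haq haq hbq) (And4 hus has hat hbt') hz Mu Ma (And4 i1 i2 d4 d3)).
Qed.

(** The values at two times are both compared with the same frozen form, which yields a Hölder bound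
    of exponent one half. Continuity is used to integrate [F z] in time. *)
Lemma form_continuous z : Hfield z -> {within [set` `[0, T]], continuous (F z)}.
Proof.
move=> hz; have [K K0 hK] := form_increment.
pose G := Gam T - Gam 0.
have G0 : 0 <= G by rewrite subr_ge0 Gam_le// ltW.
have bnd s t : 0 <= s -> s <= t -> t <= T ->
    `|F z t - F z s| <= 2 * (K * gnorm z * Num.sqrt (G * `|t - s|)).
  move=> hs st tT.
  have h1 := hK z s t t t hz hs st (lexx t) tT (or_intror erefl).
  have h2 := hK z s s t t hz hs (lexx s) st tT (or_intror erefl).
  have d : dist s t <= Num.sqrt (G * `|t - s|).
    apply: ler_wsqrtr; rewrite mulrC ger0_norm ?subr_ge0//; apply: ler_wpM2r; first by rewrite subr_ge0.
    by apply: lerB; apply: Gam_le => //; [exact: le_trans hs st|exact: le_trans st tT].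
  rewrite (le_trans (ler_distD (form k m s0 r (u s) (a s) (a t) (b t) z) _ _))// [X in _ + X]distrC.
  rewrite mulr_natl mulr2n; apply: lerD; [apply: le_trans h1 _|apply: le_trans h2 _];
    by rewrite -mulrA [gnorm z * _]mulrC; apply: ler_wpM2l => //; apply: ler_wpM2r => //; exact: gnorm_ge0.
have bnd2 s t : 0 <= s <= T -> 0 <= t <= T ->
    `|F z s - F z t| <= 2 * (K * gnorm z * Num.sqrt (G * `|s - t|)).
  move=> /andP[hs sT] /andP[ht tT]; have [st|ts] := leP s t.
    by rewrite distrC [`|s - t|]distrC; exact: bnd.
  by apply: bnd => //; exact: ltW.
apply/subspace_continuousP => t; rewrite /= in_itv /= => tT.
apply/subr_cvg0; apply/norm_cvg0P.
apply: (@squeeze_cvgr _ _ _ _ (cst 0) (fun s => 2 * (K * gnorm z * Num.sqrt (G * `|s - t|)))).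
- have h : within [set` `[0, T]] (nbhs t) [set` `[0, T]] by exact: withinT.
  move: h; apply: filterS => s; rewrite /= in_itv /= => sT.
  by rewrite normr_ge0 bnd2.
- exact: cvg_cst.
have c : 2 * (K * gnorm z * Num.sqrt (G * `|s - t|)) @[s --> t] --> (0 : R).
  rewrite -[X in _ --> X](_ : 2 * (K * gnorm z * Num.sqrt (G * `|t - t|)) = 0); last first.
    by rewrite subrr normr0 mulr0 sqrtr0 !mulr0.
  apply: cvgMr; apply: cvgMr; apply: (@continuous_cvg _ _ _ _ _ _ (fun x => Num.sqrt x)); first exact: sqrt_continuous.
  apply: cvgMr; apply: cvg_norm; apply: cvgB; [exact: cvg_id|exact: cvg_cst].
by apply: cvg_trans c; apply: cvg_fmap2; exact: cvg_within.
Qed.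

Variable P : set ('I_3 -> R * R -> R).
Hypothesis PH : forall z, P z -> Hfield z.
(** The L^2 membership of [at_ t] is a premise because a weak derivative grants it only at times
    where some test function is nonzero. *)
Hypothesis equation : forall z, P z -> {ae mu1, forall t, 0 < t < T -> (forall i, L2 Om (at_ t i)) ->
  k * vip Om (at_ t) z = F z t}.

Let scalar_continuous z i : Hfield z -> {within [set` `[0, T]], continuous (fun t => ip Om (a t i) (z i))}.
Proof. by move=> hz; exact: (L2_scalar_continuous (H1_L2 (H10_H1 (hz i))) (a_cont i)). Qed.

Let derive1_continuous (eta : R -> R) : test_function_time T eta -> continuous (derive1 eta).
Proof.
move=> [d _ _] x; apply: differentiable_continuous; apply/derivable1_diffP.
exact: (d 1%N x).
Qed.

Let test_time_continuous (eta : R -> R) : test_function_time T eta -> continuous eta.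
Proof.
move=> [d _ _] x; apply: differentiable_continuous; apply/derivable1_diffP.
exact: (d 0%N x).
Qed.

Let weak_component z i (eta : R -> R) : Hfield z -> test_function_time T eta ->
  exists h : R -> R, [/\ measurable_fun setT h, mu1.-integrable (time_itv T) (EFin \o h),
    {ae mu1, forall t, time_itv T t -> h t = eta t * ip Om (at_ t i) (z i)},
    {ae mu1, forall t, time_itv T t -> eta t != 0 -> L2 Om (at_ t i)} &
    \int[mu1]_(t in time_itv T) (derive1 eta t * ip Om (a t i) (z i)) = - \int[mu1]_(t in time_itv T) h t].
Proof.
move=> hz teta; have hL := H1_L2 (H10_H1 (hz i)).
have K0 : 0 < L2norm Om (z i) + 1 by rewrite ltr_wpDl// L2norm_ge0.
have ell_bnd f : L2 Om f -> `|ip Om f (z i)| <= (L2norm Om (z i) + 1) * L2norm Om f.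
  move=> hv; apply: (le_trans (ip_le hv hL)); rewrite mulrC.
  by apply: ler_wpM2r; [exact: L2norm_ge0|rewrite lerDl].
have mA : measurable_fun (time_itv T) ((fun f => ip Om f (z i)) \o (fun t => a t i)).
  by have /integrableP[/measurable_EFinP] := within_integrable (@scalar_continuous z i hz).
exact: (@weak_scalar R _ (L2 Om) (L2norm Om) T (L2_cst 0) (fun c x y => @L2_lin c x y)
  (fun x => L2norm_ge0 x) (fun f => ip Om f (z i)) (L2norm Om (z i) + 1) K0
  (fun c x y hx hy => si_linl L2_si c hx hy hL) ell_bnd _ _ eta (a_deriv i) teta mA).
Qed.

(** The pairing with [z] is a scalar function with weak derivative [F z]: the weak derivatives of
    the three components are added up, then [weak_ftc] applies. No value of [at_] remains. *)
Lemma average z s t : P z -> 0 <= s -> s < t -> t <= T ->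
  k * vip Om (a t) z - k * vip Om (a s) z = \int[mu1]_(q in `]s, t[) F z q.
Proof.
move=> Pz hs st tT; have hz := PH Pz; pose A (q : R) := k * vip Om (a q) z.
have sc i := @scalar_continuous z i hz.
have eA q : A q = k * (ip Om (a q 0) (z 0) + ip Om (a q 1) (z 1) + ip Om (a q 2) (z 2)).
  by rewrite /A /vip sum3.
have cA : {within [set` `[0, T]], continuous A}.
  rewrite (funext eA) => x; apply: cvgM; first exact: cvg_cst.
  by apply: cvgD; [apply: cvgD|]; exact: sc.
have cF := form_continuous hz.
have iF := within_integrable cF.
apply: (weak_ftc T0 cA iF _ hs st tT) => eta teta.
have ceta := test_time_continuous teta; have cd := derive1_continuous teta.
have [h0 [m0 i0 a0 b0 e0]] := @weak_component z 0 eta hz teta.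
have [h1 [m1 i1 a1 b1 e1]] := @weak_component z 1 eta hz teta.
have [h2 [m2 i2 a2 b2 e2]] := @weak_component z 2 eta hz teta.
have I i := within_integrable (withinM cd (sc i)).
have I01 := @integrableD _ _ R mu1 _ mT _ _ (I 0) (I 1).
have I012 := @integrableD _ _ R mu1 _ mT _ _ I01 (I 2).
have J01 := @integrableD _ _ R mu1 _ mT _ _ i0 i1.
have J012 := @integrableD _ _ R mu1 _ mT _ _ J01 i2.
have -> : \int[mu1]_(q in time_itv T) (derive1 eta q * A q) =
   k * (- (\int[mu1]_(q in time_itv T) h0 q) + - (\int[mu1]_(q in time_itv T) h1 q) + - (\int[mu1]_(q in time_itv T) h2 q)).
  rewrite -e0 -e1 -e2 -(@RintegralD _ _ R mu1 _ (fun q => derive1 eta q * ip Om (a q 0) (z 0)) _ mT (I 0) (I 1)).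
  rewrite -(@RintegralD _ _ R mu1 _ (fun q => derive1 eta q * ip Om (a q 0) (z 0) +
    derive1 eta q * ip Om (a q 1) (z 1)) _ mT I01 (I 2)).
  rewrite -(@RintegralZl _ _ R mu1 _ (fun q => derive1 eta q * ip Om (a q 0) (z 0) +
    derive1 eta q * ip Om (a q 1) (z 1) + derive1 eta q * ip Om (a q 2) (z 2)) k mT I012).
  by apply: eq_Rintegral => q _; rewrite eA; ring.
rewrite -!opprD mulrN -(@RintegralD _ _ R mu1 _ h0 h1 mT i0 i1).
rewrite -(@RintegralD _ _ R mu1 _ (fun q => h0 q + h1 q) h2 mT J01 i2).
rewrite -(@RintegralZl _ _ R mu1 _ (fun q => h0 q + h1 q + h2 q) k mT J012); congr (- _).
have mh : measurable_fun (time_itv T) (fun q => k * (h0 q + h1 q + h2 q)).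
  by apply: measurable_funM => //; apply: measurable_funTS; apply: measurable_funD => //; exact: measurable_funD.
have mf : measurable_fun (time_itv T) (fun q => eta q * F z q).
  by have /integrableP[/measurable_EFinP] := within_integrable (withinM ceta cF).
apply: (Rintegral_ae mT mh mf).
have A1 : {ae mu1, forall q, time_itv T q -> h0 q = eta q * ip Om (at_ q 0) (z 0) /\
    h1 q = eta q * ip Om (at_ q 1) (z 1)}.
  by move: a0 a1; apply: ae_imp2 => q x y qT; split; [exact: x|exact: y].
have A2 : {ae mu1, forall q, time_itv T q -> h0 q + h1 q + h2 q = eta q * vip Om (at_ q) z}.
  move: A1 a2; apply: ae_imp2 => q x y qT; have [x1 x2] := x qT.
  by rewrite x1 x2 y// /vip sum3 !mulrDr.
have B1 : {ae mu1, forall q, time_itv T q -> eta q != 0 -> L2 Om (at_ q 0) /\ L2 Om (at_ q 1)}.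
  by move: b0 b1; apply: ae_imp2 => q x y qT q0; split; [exact: x|exact: y].
have B2 : {ae mu1, forall q, time_itv T q -> eta q != 0 -> forall i, L2 Om (at_ q i)}.
  move: B1 b2; apply: ae_imp2 => q x y qT q0 i; have [x1 x2] := x qT q0; have x3 := y qT q0.
  case: i => [[|[|[|n]]] hn] //; [move: x1|move: x2|move: x3]; congr (L2 _ (at_ q _)); exact: val_inj.
have E := equation Pz.
have E2 : {ae mu1, forall q, time_itv T q -> eta q != 0 -> k * vip Om (at_ q) z = F z q}.
  move: B2 E; apply: ae_imp2 => q x y qT q0; apply: y; last exact: x.
  by move: qT; rewrite /time_itv /= in_itv.
move: A2 E2; apply: ae_imp2 => q x y qT; rewrite x//.
(* Where [eta] vanishes, [at_ q] may fail to be in L^2, but both sides are 0. *)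
have [->|q0] := eqVneq (eta q) 0; first by rewrite !mul0r mulr0.
by rewrite mulrCA y.
Qed.

(** By [average] the time difference is exactly an integral of the form, so the only error is that
    of freezing the arguments, uniformly small over the step. *)
Lemma consistency : exists2 K : R, 0 <= K & forall z (s t t' : R), P z ->
  0 <= s -> s < t -> t <= T -> t' = s \/ t' = t ->
  `|k * vip Om (a t) z - k * vip Om (a s) z - (t - s) * form k m s0 r (u s) (a s) (a t) (b t') z|
    <= K * (t - s) * (dist s t * gnorm z).
Proof.
have [K K0 hK] := form_increment; exists K => // z s t t' Pz hs st tT et'.
have hz := PH Pz; rewrite average//; set c := form _ _ _ _ _ _ _ _ _.
have mst : measurable [set` `]s, t[] by exact: measurable_itv.
have cc (x : R) : mu1.-integrable [set` `]s, t[] (EFin \o (fun=> x)).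
  apply: (@continuous_integrable _ _ s t) => //; first exact: subset_itvW.
  by apply: continuous_subspaceT => y; exact: cvg_cst.
have Ic (x : R) : \int[mu1]_(q in `]s, t[) x = (t - s) * x.
  have e : mu1 [set` `]s, t[] = (t - s)%:E by rewrite lebesgue_measure_itv /= lte_fin st -EFinB.
  rewrite /Rintegral (@integral_cst _ _ R mu1 _ mst x%:E) [X in (_ * X)%E]e -EFinM /=; exact: mulrC.
have sT : [set` `]s, t[] `<=` time_itv T by apply: subset_itv; rewrite bnd_simp.
have iF := @integrableS _ _ R mu1 _ _ _ mT mst sT (within_integrable (form_continuous hz)).
rewrite -(Ic c) -(@RintegralB _ _ R mu1 _ (F z) (fun=> c) mst iF (cc c)).
have iD := @integrableB _ _ R mu1 _ mst _ _ iF (cc c).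
apply: (le_trans (@le_normr_Rintegral _ _ R mu1 _ (fun q => F z q - c) mst iD)).
rewrite -mulrA mulrCA -Ic; apply: le_Rintegral; [exact: mst|exact: (@integrable_norm _ _ R mu1 _ (fun q => F z q - c) iD)|exact: cc|].
move=> q; rewrite /= in_itv /= => /andP[sq qt].
exact: (hK z s q t t' hz hs (ltW sq) (ltW qt) tT et').
Qed.

End Average.
End Consistency.

(** * Energy and initial value of the exact fields *)

Section FieldRegularity.
Implicit Types (f g h phi psi : R * R -> R) (j : 'I_3).
Implicit Types (u v w : 'I_3 -> R * R -> R).

Let gi := @gradip_Hfield_si.
Let vi := @vip_Hfield_si.

Lemma pd_lin_sum (a : R) u v i j : Hfield u -> Hfield v ->
  {ae mu2, forall x, Om x -> pd Om j ((a *: u + v) i) x = a * pd Om j (u i) x + pd Om j (v i) x}.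
Proof. by move=> hu hv; exact: (pd_lin j a (H10_H1 (hu i)) (H10_H1 (hv i))). Qed.

Lemma div_lin (a : R) u v : Hfield u -> Hfield v ->
  {ae mu2, forall x, Om x -> div Om (a *: u + v) x = a * div Om u x + div Om v x}.
Proof.
move=> hu hv; have e0 := pd_lin_sum a 0 0 hu hv; have e1 := pd_lin_sum a 1 1 hu hv.
have e2 := pd_lin_sum a 2 2 hu hv.
have e01 : {ae mu2, forall x, Om x ->
    pd Om 0 ((a *: u + v) 0) x = a * pd Om 0 (u 0) x + pd Om 0 (v 0) x /\
    pd Om 1 ((a *: u + v) 1) x = a * pd Om 1 (u 1) x + pd Om 1 (v 1) x}.
  by move: e0 e1; apply: ae_imp2 => x h0 h1 Ox; split; [exact: h0|exact: h1].
move: e01 e2; apply: ae_imp2 => x h h2 Ox; have [p q] := h Ox; have r := h2 Ox.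
have gen (k1 k2 k3 : 'I_3 -> R) : k1 0 = a * k2 0 + k3 0 -> k1 1 = a * k2 1 + k3 1 ->
    k1 2 = a * k2 2 + k3 2 -> \sum_i k1 i = a * \sum_i k2 i + \sum_i k3 i.
  by move=> h4 h5 h6; rewrite !sum3 h4 h5 h6; ring.
exact: (gen (fun j => pd Om j ((a *: u + v) j) x) (fun j => pd Om j (u j) x) (fun j => pd Om j (v j) x) p q r).
Qed.

Lemma divfree_lin (a : R) u v : Hfield u -> Hfield v -> divfree u -> divfree v -> divfree (a *: u + v).
Proof.
move=> hu hv du dv; have e := div_lin a hu hv.
have e2 : {ae mu2, forall x, Om x -> div Om u x = 0 /\ div Om v x = 0}.
  by move: du dv; apply: ae_imp2 => x h1 h2 Ox; split; [exact: h1|exact: h2].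
move: e e2; apply: ae_imp2 => x h h2 Ox; have [p q] := h2 Ox.
by rewrite h// p q mulr0 addr0.
Qed.

Lemma div_norm_le v : Hfield v -> L2norm Om (div Om v) <= 3 * gnorm v.
Proof.
move=> hv; have H1v i := H10_H1 (hv i).
have -> : div Om v = pd Om 0 (v 0) + pd Om 1 (v 1) + pd Om 2 (v 2).
  by apply/funext => x; rewrite /div sum3.
have P j := pd_L2 j (H1v j).
apply: (le_trans (si_triangle L2_si (si_D L2_si (P 0) (P 1)) (P 2))).
have b j : L2norm Om (pd Om j (v j)) <= gnorm v by exact: pdnorm_le_gnorm.
have h := si_triangle L2_si (P 0) (P 1).
have h3 := lerD (le_trans h (lerD (b 0) (b 1))) (b 2).
apply: (le_trans h3); rewrite le_eqVlt; apply/orP; left; apply/eqP; ring.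
Qed.

Lemma H1norm_ext f g : (forall x, Om x -> f x = g x) -> H1norm Om f = H1norm Om g.
Proof.
move=> e; have n1 : L2norm Om f = L2norm Om g by rewrite /L2norm (ip_ext e e).
have n2 : \sum_j L2norm Om (pd Om j f) ^+ 2 = \sum_j L2norm Om (pd Om j g) ^+ 2.
  by apply: eq_bigr => j _; rewrite (pd_ext j e).
exact: (f_equal2 (fun a b => Num.sqrt (a ^+ 2 + b)) n1 n2).
Qed.

(** The initial data and the value of the solution at time 0 agree on [Om] only, so membership has
    to be transported along such equalities. *)
Lemma H10_ext f g : (forall x, Om x -> f x = g x) -> H10 Om f -> H10 Om g.
Proof.
move=> e [hf af]; split=> [j|r r0]; first by have [k hk] := hf j; exists k; exact: weak_partial_ext hk.
have [phi t h] := af r r0; exists phi; first exact: t.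
have e2 x : Om x -> (f - phi) x = (g - phi) x by move=> Ox; exact: (congr1 (fun y => y - phi x) (e x Ox)).
by rewrite -(H1norm_ext e2); exact: h.
Qed.

Lemma norms_eq0 v : Hfield v -> (forall i x, Om x -> v i x = 0) -> vip Om v v = 0 /\ gradip Om v v = 0.
Proof.
move=> hv e.
have e2 i x : Om x -> v i x = (0 : 'I_3 -> R * R -> R) i x by move=> /e ->.
split.
  rewrite -(si_zerol vi (si_0 vi hv)); apply: eq_bigr => i _; exact: (ip_ext (e2 i) (e2 i)).
rewrite -(si_zerol gi (si_0 gi hv)); apply: eq_bigr => i _; apply: eq_bigr => j _.
by rewrite (pd_ext j (e2 i)).
Qed.

Variables (T : R) (T0 : 0 < T).
Variable u : R -> 'I_3 -> R * R -> R.
Hypothesis u_cont : continuous_in_L2 Om T u.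
Hypothesis u_bc : forall t, 0 < t <= T -> Hfield (u t).
Hypothesis u_reg : forall i, bochner_H (H2 Om) (H2norm Om) T 1 (fun t => u t i).

Lemma component_energy i : exists E : R -> R,
  [/\ forall s t, 0 <= s -> s <= t -> E s <= E t,
      forall j s t, 0 <= s -> s < t -> t <= T -> H10 Om (u s i) -> H10 Om (u t i) ->
        L2norm Om (pd Om j (u t i - u s i)) ^+ 2 <= (t - s) * (E t - E s) & H10 Om (u 0 i)].
Proof.
have [_ [g wg g2]] := u_reg i.
have [rho [mr r0 ir br]] := gradient_density T0 (u_cont i) wg g2.
exists (energy rho); split.
- by move=> s t; exact: energy_le.
- by move=> j s t; exact: (@gradient_increment_sqr T (fun t => u t i) rho).
- exact: (@initial_H10 T T0 (fun t => u t i) (u_cont i) (fun t tT => u_bc tT i) rho).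
Qed.

Let three_le (a x y z : R) : x <= a -> y <= a -> z <= a -> x + y + z <= 3 * a.
Proof. by move=> xa ya za; rewrite (_ : 3 * a = a + a + a); [apply: lerD => //; exact: lerD|ring]. Qed.

Lemma field_energy : exists Gam : R -> R,
  [/\ forall s t, 0 <= s -> s <= t -> Gam s <= Gam t,
      forall t, 0 <= t <= T -> Hfield (u t) &
      forall s t, 0 <= s -> s < t -> t <= T ->
        gnorm (u t - u s) <= Num.sqrt ((t - s) * (Gam t - Gam s))].
Proof.
have [E hE] := choice component_energy.
have h0 t : 0 <= t <= T -> Hfield (u t).
  move=> /andP[]; rewrite le_eqVlt => /orP[/eqP <- _ i|t0 tT]; first by have [] := hE i.
  by apply: u_bc; rewrite t0.
(* The factor 3 counts the partial derivatives of a component, each bounded by the increment of the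
   same [E i]. *)
exists (fun t => 3 * \sum_i E i t); split=> // [s t hs st|s t hs st tT].
  by rewrite ler_pM2l//; apply: ler_sum => i _; have [h _ _] := hE i; exact: h.
apply: ler_wsqrtr.
have sT : 0 <= s <= T by rewrite hs (le_trans (ltW st)).
have tT' : 0 <= t <= T by rewrite tT (le_trans hs (ltW st)).
rewrite -mulrBr -sumrB mulrCA !mulr_sumr; apply: ler_sum => i _.
have [_ h _] := hE i.
have b j : ip Om (pd Om j ((u t - u s) i)) (pd Om j ((u t - u s) i)) <= (t - s) * (E i t - E i s).
  by rewrite -L2norm_sqr; exact: (h j s t hs st tT (h0 s sT i) (h0 t tT' i)).
rewrite sum3; exact: (three_le (b 0) (b 1) (b 2)).
Qed.

(** The constraint is given for positive times. At such a [t], up to sign, [div (u 0)] is the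
    divergence of [u t - u 0], of squared norm at most [9 * (t * G)]; letting [t] decrease to 0
    gives the claim. *)
Lemma initial_divfree : (forall t, 0 < t <= T -> divfree (u t)) -> divfree (u 0).
Proof.
move=> du; have [Gam [gm hf inc]] := field_energy.
have z0 : 0 <= (0 : R) <= T by rewrite lexx ltW.
have hu0 := hf 0 z0; have hd : L2 Om (div Om (u 0)) by exact: div_L2 (fun i => H10_H1 (hu0 i)).
pose G := Gam T - Gam 0.
have G0 : 0 <= G by rewrite subr_ge0; exact: gm (lexx 0) (ltW T0).
have TG : 0 <= T * G by apply: mulr_ge0 => //; exact: ltW.
have b t : 0 < t <= T -> ip Om (div Om (u 0)) (div Om (u 0)) <= 9 * (t * G).
  move=> tT; have [t0 tT'] := andP tT; have hut : Hfield (u t) by apply: hf; rewrite tT' ltW.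
  have hD : Hfield (u t - u 0) := si_B gi hut hu0.
  have e := div_lin (-1) hu0 hut.
  have e2 : {ae mu2, forall x, Om x -> div Om (u t - u 0) x = (- div Om (u 0)) x}.
    have -> : u t - u 0 = -1 *: u 0 + u t by rewrite scaleN1r addrC.
    move: e (du t tT); apply: ae_imp2 => x h1 h2 Ox; rewrite h1// h2// addr0 mulN1r//.
  have hdD : L2 Om (div Om (u t - u 0)) by exact: div_L2 (fun i => H10_H1 (hD i)).
  have n1 := L2norm_ae hdD (si_N L2_si hd) e2.
  have n2 : L2norm Om (- div Om (u 0)) = L2norm Om (div Om (u 0)) := si_norm_opp L2_si hd.
  have n3 := div_norm_le hD.
  rewrite -L2norm_sqr -n2 -n1.
  have i0 := inc 0 t (lexx 0) t0 tT'; rewrite subr0 in i0.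
  have tG : 0 <= t * (Gam t - Gam 0).
    by apply: mulr_ge0; [exact: ltW|rewrite subr_ge0; exact: gm (lexx 0) (ltW t0)].
  have n4 : L2norm Om (div Om (u t - u 0)) <= 3 * Num.sqrt (t * (Gam t - Gam 0)).
    by apply: (le_trans n3); rewrite ler_pM2l.
  have n5 : L2norm Om (div Om (u t - u 0)) ^+ 2 <= (3 * Num.sqrt (t * (Gam t - Gam 0))) ^+ 2.
    by rewrite ler_sqr ?nnegrE ?L2norm_ge0// mulr_ge0// sqrtr_ge0.
  apply: (le_trans n5); rewrite exprMn sqr_sqrtr//.
  rewrite (_ : 3 ^+ 2 = 9 :> R); last by ring.
  rewrite ler_pM2l//; apply: ler_wpM2l; first exact: ltW.
  by apply: lerB => //; exact: gm (ltW t0) tT'.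
apply: (ip0_ae hd); apply/eqP; rewrite eq_le (si_ge0 L2_si hd) andbT.
move: b; generalize (ip Om (div Om (u 0)) (div Om (u 0))) => x b.
rewrite leNgt; apply/negP => x0.
have den : 0 < 9 * (T * G) + x by rewrite ltr_wpDl// mulr_ge0.
(* An explicit time at which the bound would give [9 * (T * G) * x / (9 * (T * G) + x) >= x],
   impossible for [x > 0]. *)
have tT : 0 < T * x / (9 * (T * G) + x) <= T.
  apply/andP; split; first by apply: divr_gt0 => //; exact: mulr_gt0.
  by rewrite ler_pdivrMr// ler_pM2l// lerDr; apply: mulr_ge0.
have := b _ tT; rewrite (_ : 9 * (T * x / (9 * (T * G) + x) * G) = (9 * (T * G)) * x / (9 * (T * G) + x)); last by ring.
rewrite ler_pdivlMr// mulrDr [x * (9 * _)]mulrC gerDl leNgt; apply/negP; rewrite negbK; exact: mulr_gt0.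
Qed.

Lemma field_bound : exists2 M : R, 0 <= M & forall t, 0 <= t <= T -> gnorm (u t) <= M.
Proof.
have [Gam [gm hf inc]] := field_energy.
have z0 : 0 <= (0 : R) <= T by rewrite lexx ltW.
exists (gnorm (u 0) + Num.sqrt (T * (Gam T - Gam 0))) => [|t]; first by rewrite addr_ge0 ?gnorm_ge0 ?sqrtr_ge0.
move=> /andP[]; rewrite le_eqVlt => /orP[/eqP <- _|t0 tT]; first by rewrite lerDl sqrtr_ge0.
have hut : Hfield (u t) by apply: hf; rewrite tT ltW.
have hu0 := hf 0 z0.
have := si_triangle gi hu0 (si_B gi hut hu0); rewrite addrC subrK => h.
apply: (le_trans h); apply: lerD => //; apply: (le_trans (inc 0 t (lexx 0) t0 tT)); rewrite subr0.
apply: ler_wsqrtr; apply: ler_pM; [exact: ltW|by rewrite subr_ge0; exact: gm (lexx 0) (ltW t0)|exact: tT|].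
by apply: lerB => //; exact: gm (ltW t0) tT.
Qed.

End FieldRegularity.

(** * Convergence of the scheme *)
Section Convergence.
Implicit Types (f g h phi psi : R * R -> R) (j : 'I_3).
Implicit Types (u v w : 'I_3 -> R * R -> R).

Lemma ae_ord3 (P : 'I_3 -> R -> Prop) : (forall i, {ae mu1, forall x, P i x}) ->
  {ae mu1, forall x, forall i, P i x}.
Proof.
move=> h; have h01 : {ae mu1, forall x, P 0 x /\ P 1 x}.
  by move: (h 0) (h 1); apply: ae_imp2 => x a b; split.
move: h01 (h 2); apply: ae_imp2 => x [a0 a1] a2 i.
by case: i => [[|[|[|n]]] hn] //; [move: a0|move: a1|move: a2]; congr (P _ x); exact: val_inj.
Qed.

Variables (T : R) (T0 : 0 < T) (par : params R).
Hypothesis adm : admissible par.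
Variables (u0 w0 : 'I_3 -> R * R -> R).
Variables (u w : R -> 'I_3 -> R * R -> R) (p : R -> R * R -> R).
Hypothesis Hex : exact_solution Om T par u0 w0 u p w.
Hypothesis Hu : regular Om T u.
Hypothesis Hw : regular Om T w.

Definition solenoidal : set ('I_3 -> R * R -> R) := [set v | Xplanar Om v /\ divfree v].

Let reg1 (v : R -> 'I_3 -> R * R -> R) : regular Om T v ->
  forall i, bochner_H (H2 Om) (H2norm Om) T 1 (fun t => v t i).
Proof. by move=> hv i; have [_ h _] := hv i. Qed.

Lemma ae_H2 (v : R -> 'I_3 -> R * R -> R) : regular Om T v ->
  {ae mu1, forall t, 0 < t < T -> forall i, H2 Om (v t i)}.
Proof.
move=> hv; have h : {ae mu1, forall t, forall i, 0 < t < T -> H2 Om (v t i)}.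
  by apply: ae_ord3 => i; have [_ [[[h _] _] _] _] := hv i.
by move: h; apply: ae_imp => t h tT i; exact: h.
Qed.

Let jj0 : jmath par != 0.
Proof. by have [[h _ _] _ _] := adm; rewrite gt_eqF. Qed.

(** One modulus [Gam] and one bound [M] for both fields, by adding those of [u] and [w]. *)
Lemma exact_energy : exists Gam : R -> R, exists2 M : R, 0 <= M &
  [/\ forall s t, 0 <= s -> s <= t -> Gam s <= Gam t,
      forall t, 0 <= t <= T -> Hfield (u t) /\ Hfield (w t),
      forall t, 0 <= t <= T -> gnorm (u t) <= M /\ gnorm (w t) <= M &
      forall s t, 0 <= s -> s < t -> t <= T ->
        gnorm (u t - u s) <= Num.sqrt ((t - s) * (Gam t - Gam s)) /\
        gnorm (w t - w s) <= Num.sqrt ((t - s) * (Gam t - Gam s))].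
Proof.
have bu := exact_bc_u Hex; have bw := exact_bc_w Hex.
have [Gu [mu_ hu iu]] := field_energy T0 (exact_cont_u Hex) bu (reg1 Hu).
have [Gw [mw hw iw]] := field_energy T0 (exact_cont_w Hex) bw (reg1 Hw).
have [Mu Mu0 bMu] := field_bound T0 (exact_cont_u Hex) bu (reg1 Hu).
have [Mw Mw0 bMw] := field_bound T0 (exact_cont_w Hex) bw (reg1 Hw).
exists (fun t => Gu t + Gw t); exists (Mu + Mw); first exact: addr_ge0.
split.
- by move=> s t hs st; apply: lerD; [exact: mu_|exact: mw].
- by move=> t tT; split; [exact: hu|exact: hw].
- by move=> t tT; split; [apply: (le_trans (bMu t tT)); rewrite lerDl|apply: (le_trans (bMw t tT)); rewrite lerDr].
- move=> s t hs st tT; have d1 := mu_ s t hs (ltW st); have d2 := mw s t hs (ltW st).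
  have ts : 0 <= t - s by rewrite subr_ge0 ltW.
  split; [apply: (le_trans (iu s t hs st tT))|apply: (le_trans (iw s t hs st tT))];
    by apply: ler_wsqrtr; apply: ler_wpM2l => //; lra.
Qed.

Section Consistent.
Variables (Gam : R -> R) (M : R).
Hypothesis M0 : 0 <= M.
Hypothesis Gam_le : forall s t, 0 <= s -> s <= t -> Gam s <= Gam t.
Hypothesis fields : forall t, 0 <= t <= T -> Hfield (u t) /\ Hfield (w t).
Hypothesis bounds : forall t, 0 <= t <= T -> gnorm (u t) <= M /\ gnorm (w t) <= M.
Hypothesis increments : forall s t, 0 <= s -> s < t -> t <= T ->
  gnorm (u t - u s) <= Num.sqrt ((t - s) * (Gam t - Gam s)) /\
  gnorm (w t - w s) <= Num.sqrt ((t - s) * (Gam t - Gam s)).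

Lemma momentum_consistency : exists2 K : R, 0 <= K & forall z (s t : R), solenoidal z ->
  0 <= s -> s < t -> t <= T ->
  `|vip Om (u t - u s) z + (t - s) * (tri (u s) (u s) z + nu0 par * gradip Om (u t) z
      - 2 * nur par * cform (w s) z)|
    <= K * (t - s) * (Num.sqrt ((t - s) * (Gam t - Gam s)) * gnorm z).
Proof.
have [ut wd eqn] := exact_momentum Hex.
have PH z : solenoidal z -> Hfield z by move=> [[_ h] _].
have eq2 z : solenoidal z -> {ae mu1, forall t, 0 < t < T -> (forall i, L2 Om (ut t i)) ->
    1 * vip Om (ut t) z = form 1 (nu0 par) 0 (2 * nur par) (u t) (u t) (u t) (w t) z}.
  move=> sz; have [_ dz] := sz.
  have e1 : {ae mu1, forall t, 0 < t < T -> (forall i, H2 Om (u t i)) /\ H1 Om (p t)}.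
    move: (ae_H2 Hu) (exact_p Hex); apply: ae_imp2 => t h1 h2 tT; split; first exact: h1.
    by apply: h2; have [-> /ltW] := andP tT.
  move: e1 eqn; apply: ae_imp2 => t h1 h2 tT hL; have [hH hp] := h1 tT.
  have tT2 : 0 < t <= T by have [-> /ltW] := andP tT.
  have tT3 : 0 <= t <= T by have [/ltW -> ->] := andP tT2.
  have [_ hwt] := fields tT3.
  have hw1 i : H1 Om (w t i) := H10_H1 (hwt i).
  exact: (@momentum_tested par (ut t) (u t) (w t) (p t) z hL hH hw1 hp (PH z sz) dz (h2 tT2)).
have fs t : 0 <= t <= T -> [/\ Hfield (u t), Hfield (u t) & Hfield (w t)].
  by move=> /fields[h1 h2]; split; [exact: h1|exact: h1|exact: h2].
have bs t : 0 <= t <= T -> gnorm (u t) <= M /\ gnorm (u t) <= M.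
  by move=> /bounds[h1 _]; split; exact: h1.
have is_ t1 t2 : 0 <= t1 -> t1 < t2 -> t2 <= T ->
    [/\ gnorm (u t2 - u t1) <= Num.sqrt ((t2 - t1) * (Gam t2 - Gam t1)),
      gnorm (u t2 - u t1) <= Num.sqrt ((t2 - t1) * (Gam t2 - Gam t1)) &
      gnorm (w t2 - w t1) <= Num.sqrt ((t2 - t1) * (Gam t2 - Gam t1))].
  by move=> h1 h2 h3; have [h4 h5] := increments h1 h2 h3; split; [exact: h4|exact: h4|exact: h5].
have [K K0 hK] := @consistency T T0 1 (nu0 par) 0 (2 * nur par) u u w ut Gam M M0
  (fun t1 t2 a1 a2 _ => Gam_le a1 a2) fs bs is_ (exact_cont_u Hex) wd solenoidal PH eq2.
exists K => // z s t sz hs st tT.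
have sT : 0 <= s <= T by rewrite hs (le_trans (ltW st)).
have tT' : 0 <= t <= T by rewrite tT (le_trans hs (ltW st)).
have [hus _] := fields sT; have [hut _] := fields tT'.
have := hK z s t s sz hs st tT (or_introl erefl); rewrite /form.
rewrite (si_sub (@vip_Hfield_si) hut hus (PH z sz)).
apply: le_trans; rewrite le_eqVlt; apply/orP; left; apply/eqP; congr (`| _ |).
generalize (vip Om (u t) z) (vip Om (u s) z) (tri (u s) (u s) z) (gradip Om (u t) z) (cform (w s) z).
by move=> *; ring.
Qed.

Lemma angular_consistency : exists2 K : R, 0 <= K & forall z (s t : R), Xaxial Om z ->
  0 <= s -> s < t -> t <= T ->
  `|jmath par * vip Om (w t - w s) z + (t - s) * (jmath par * tri (u s) (w s) z
      + c1 par * gradip Om (w t) z + 4 * nur par * vip Om (w t) z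
      - 2 * nur par * cform (u t) z)|
    <= K * (t - s) * (Num.sqrt ((t - s) * (Gam t - Gam s)) * gnorm z).
Proof.
have [wt wd eqn] := exact_angular Hex.
have PH z : Xaxial Om z -> Hfield z by move=> [_ h].
have eq2 z : Xaxial Om z -> {ae mu1, forall t, 0 < t < T -> (forall i, L2 Om (wt t i)) ->
    jmath par * vip Om (wt t) z =
      form (jmath par) (c1 par) (4 * nur par) (2 * nur par) (u t) (w t) (w t) (u t) z}.
  move=> sz; move: (ae_H2 Hw) eqn; apply: ae_imp2 => t h1 h2 tT hL; have hH := h1 tT.
  have tT2 : 0 < t <= T by have [-> /ltW] := andP tT.
  have tT3 : 0 <= t <= T by have [/ltW -> ->] := andP tT2.
  have [hut _] := fields tT3.
  have hu1 i : H1 Om (u t i) := H10_H1 (hut i).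
  exact: (@angular_tested par (wt t) (u t) (w t) z jj0 hL hu1 hH (exact_axial Hex tT3) (PH z sz) (h2 tT2)).
have fs t : 0 <= t <= T -> [/\ Hfield (u t), Hfield (w t) & Hfield (u t)].
  by move=> /fields[h1 h2]; split; [exact: h1|exact: h2|exact: h1].
have is_ t1 t2 : 0 <= t1 -> t1 < t2 -> t2 <= T ->
    [/\ gnorm (u t2 - u t1) <= Num.sqrt ((t2 - t1) * (Gam t2 - Gam t1)),
      gnorm (w t2 - w t1) <= Num.sqrt ((t2 - t1) * (Gam t2 - Gam t1)) &
      gnorm (u t2 - u t1) <= Num.sqrt ((t2 - t1) * (Gam t2 - Gam t1))].
  by move=> h1 h2 h3; have [h4 h5] := increments h1 h2 h3; split; [exact: h4|exact: h5|exact: h4].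
have [K K0 hK] := @consistency T T0 (jmath par) (c1 par) (4 * nur par) (2 * nur par)
  u w u wt Gam M M0
  (fun t1 t2 a1 a2 _ => Gam_le a1 a2) fs bounds is_ (exact_cont_w Hex) wd (Xaxial Om) PH eq2.
exists K => // z s t sz hs st tT.
have sT : 0 <= s <= T by rewrite hs (le_trans (ltW st)).
have tT' : 0 <= t <= T by rewrite tT (le_trans hs (ltW st)).
have [_ hws] := fields sT; have [_ hwt] := fields tT'.
have := hK z s t t sz hs st tT (or_intror erefl); rewrite /form.
rewrite (si_sub (@vip_Hfield_si) hwt hws (PH z sz)).
apply: le_trans; rewrite le_eqVlt; apply/orP; left; apply/eqP; congr (`| _ |).
generalize (vip Om (w t) z) (vip Om (w s) z) (tri (u s) (w s) z) (gradip Om (w t) z) (cform (u t) z).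
by move=> *; ring.
Qed.

End Consistent.

(** Used with [y = t_n / T] and [x = tau / T]. The quantity is minus [exp (- y)] times
    [1 - exp (- x) * (1 + x)]; the latter is between 0 and [x ^+ 2], because [1 + x <= exp x] and
    [1 - x <= exp (- x)]. *)
Lemma decay_consistency (y x : R) : 0 <= y -> 0 <= x ->
  `|expR (- (y + x)) - expR (- y) + x * expR (- (y + x))| <= x ^+ 2.
Proof.
move=> y0 x0; have a1 : 1 - x <= expR (- x) by exact: expR_ge1Dx.
have a2 : 1 + x <= expR x by exact: expR_ge1Dx.
have a3 : expR (- x) * expR x = 1 by rewrite -expRD addNr expR0.
have a0 := expR_gt0 (- x).
have e1 : expR (- y) <= 1 by rewrite -(expR0 R) ler_expR oppr_le0.
have e0 := expR_ge0 (- y).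
have b1 : expR (- x) * (1 + x) <= 1 by rewrite -[leRHS]a3 ler_pM2l.
have b2 : 1 - x ^+ 2 <= expR (- x) * (1 + x).
  have x1 : 0 <= 1 + x by rewrite addr_ge0.
  by have := ler_wpM2r x1 a1; rewrite (_ : (1 - x) * (1 + x) = 1 - x ^+ 2)//; ring.
rewrite opprD expRD (_ : _ + _ = - (expR (- y) * (1 - expR (- x) * (1 + x)))); last by ring.
have c0 : 0 <= 1 - expR (- x) * (1 + x) by rewrite subr_ge0.
rewrite normrN ger0_norm ?mulr_ge0//; apply: (@le_trans _ _ (1 * (1 - expR (- x) * (1 + x)))).
  exact: ler_wpM2r.
by rewrite mul1r lerBlDr addrC -lerBlDr.
Qed.

Lemma solenoidal_Hfield v : solenoidal v -> Hfield v. Proof. by move=> [[_ h] _]. Qed.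
Lemma axial_Hfield v : Xaxial Om v -> Hfield v. Proof. by move=> [_ h]. Qed.

Let sub_lin v v' : v - v' = -1 *: v' + v. Proof. by rewrite scaleN1r addrC. Qed.

Lemma solenoidalB v v' : solenoidal v -> solenoidal v' -> solenoidal (v - v').
Proof.
move=> [[p1 h1] d1] [[p2 h2] d2].
have hp x : Om x -> (-1 *: v' + v) 2 x = 0.
  move=> Ox; have e1 := p1 x Ox; have e2 := p2 x Ox.
  by rewrite [LHS](_ : _ = -1 * v' 2 x + v 2 x)// e1 e2 mulr0 addr0.
rewrite sub_lin; exact: (conj (conj hp (@Hfield_lin (-1) _ _ h2 h1))
  (@divfree_lin (-1) _ _ h2 h1 d2 d1)).
Qed.

Lemma axialB v v' : Xaxial Om v -> Xaxial Om v' -> Xaxial Om (v - v').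
Proof.
move=> [p1 h1] [p2 h2].
have e i x : (-1 *: v' + v) i x = -1 * v' i x + v i x by [].
have hp x : Om x -> (-1 *: v' + v) 0 x = 0 /\ (-1 *: v' + v) 1 x = 0.
  move=> Ox; have [a0 a1] := p1 x Ox; have [b0 b1] := p2 x Ox.
  by rewrite !e a0 a1 b0 b1 mulr0 addr0.
rewrite sub_lin; exact: (conj hp (@Hfield_lin (-1) _ _ h2 h1)).
Qed.

Lemma exact_solenoidal t : 0 <= t <= T -> solenoidal (u t) /\ Xaxial Om (w t).
Proof.
move=> tT; have [Gam [M M0 [_ hf _ _]]] := exact_energy; have [hu hw] := hf t tT.
split; split; [split; [exact: exact_planar Hex _ tT|exact: hu]| |exact: exact_axial Hex _ tT|exact: hw].
have [t0 tT'] := andP tT; move: t0; rewrite le_eqVlt => /orP[/eqP <-|t0].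
  by apply: (initial_divfree T0 (exact_cont_u Hex) (exact_bc_u Hex) (reg1 Hu)); exact: exact_div Hex.
by apply: (exact_div Hex); rewrite t0.
Qed.

Let z0T : 0 <= (0 : R) <= T. Proof. by rewrite lexx ltW. Qed.

Lemma initial_solenoidal : solenoidal u0 /\ Xaxial Om w0.
Proof.
have [[[pu hu] du] [aw hw]] := exact_solenoidal z0T.
have eu i x : Om x -> u 0 i x = u0 i x by move=> Ox; have [] := exact_init Hex i Ox.
have ew i x : Om x -> w 0 i x = w0 i x by move=> Ox; have [] := exact_init Hex i Ox.
split; split; [split| | |].
- by move=> x Ox; rewrite -eu// pu.
- by move=> i; exact: H10_ext (eu i) (hu i).
- have e : div Om u0 = div Om (u 0).
    by apply/funext => x; apply: eq_bigr => j _; rewrite (pd_ext j (eu j)).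
  by rewrite /divfree e.
- by move=> x Ox; rewrite -!ew//; exact: aw.
- by move=> i; exact: H10_ext (ew i) (hw i).
Qed.

Lemma initial_error : gradip Om (u0 - u 0) (u0 - u 0) = 0 /\ gradip Om (w0 - w 0) (w0 - w 0) = 0.
Proof.
have [su sw] := exact_solenoidal z0T; have [su0 sw0] := initial_solenoidal.
have hu := solenoidal_Hfield (solenoidalB su0 su); have hw := axial_Hfield (axialB sw0 sw).
have eu i x : Om x -> (u0 - u 0) i x = 0.
  by move=> Ox; have [e _] := exact_init Hex i Ox; rewrite [LHS](_ : _ = u0 i x - u 0 i x)// e subrr.
have ew i x : Om x -> (w0 - w 0) i x = 0.
  by move=> Ox; have [_ e] := exact_init Hex i Ox; rewrite [LHS](_ : _ = w0 i x - w 0 i x)// e subrr.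
by split; [have [] := norms_eq0 hu eu|have [] := norms_eq0 hw ew].
Qed.

Section Scheme.
Variables (N : nat) (U : nat -> 'I_3 -> R * R -> R) (P : nat -> R * R -> R).
Variables (W : nat -> 'I_3 -> R * R -> R) (Q : nat -> R).
Hypothesis N_gt0 : (1 <= N)%N.
Hypothesis scheme : sav_scheme Om T par u0 w0 N U P W Q.
Local Notation tau := (step T N).
Let E n : R := expR (- time T N n / T).

Let N0 : 0 < N%:R :> R. Proof. by rewrite ltr0n. Qed.

Lemma step_gt0 : 0 < tau. Proof. by rewrite divr_gt0. Qed.

Lemma step_mul : N%:R * tau = T.
Proof. by rewrite /step mulrCA mulfV ?mulr1// gt_eqF. Qed.

Lemma step_le : tau <= T.
Proof. by rewrite ler_pdivrMr// ler_peMr ?ler1n// ltW. Qed.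

Lemma time_succ n : time T N n.+1 = time T N n + tau.
Proof. by rewrite /time mulrSr mulrDl mul1r. Qed.

Lemma time_itv_le n : (n <= N)%N -> 0 <= time T N n <= T.
Proof.
move=> nN; rewrite /time mulr_ge0 ?ler0n ?(ltW step_gt0)//= -[leRHS]step_mul.
by apply: ler_wpM2r; [exact: (ltW step_gt0)|rewrite ler_nat].
Qed.

Lemma scheme_fields n : (n <= N)%N -> solenoidal (U n) /\ Xaxial Om (W n).
Proof.
have [U0 W0 _ hs] := scheme; case: n => [_|n nN]; first by rewrite U0 W0; exact: initial_solenoidal.
have st := hs n nN; split; last exact: sav_W st.
exact: (conj (sav_U st) (sav_div st)).
Qed.

Lemma scheme_momentum n v : (n < N)%N -> solenoidal v ->
  vip Om (U n.+1 - U n) v + tau * (Q n.+1 / E n.+1 * tri (U n) (U n) v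
    + (nu par + nur par) * gradip Om (U n.+1) v) = tau * (2 * nur par * cform (W n) v).
Proof.
move=> nN sv; have [_ _ _ hs] := scheme; have st := hs n nN; have [pv dv] := sv.
have hv := solenoidal_Hfield sv.
have [[hU _] [hU' _]] := (scheme_fields (ltnW nN), scheme_fields nN).
have hd := solenoidal_Hfield (solenoidalB hU' hU).
have P0 : ip Om (P n.+1) (div Om v) = 0.
  have [hP _] := sav_P st; have hD : L2 Om (div Om v) by exact: div_L2 (fun i => H10_H1 (hv i)).
  by rewrite (si_sym L2_si) (ip_ae hD (si_0 L2_si hP) hP dv) (si_zerol L2_si hP).
have := sav_momentum st pv.
rewrite /delta (si_scale (@vip_Hfield_si) _ hd hv) P0 -/(E n.+1) /tri /cform.
have t0 : tau != 0 by rewrite gt_eqF// step_gt0.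
move=> <-; rewrite /nu0; move: t0.
generalize (vip Om (U n.+1 - U n) v) (vip Om (Defs.conv Om (U n) (U n)) v) (gradip Om (U n.+1) v).
generalize (Q n.+1 / E n.+1) (nu par) (nur par) (step T N) => a b c d x y z d0.
by field.
Qed.

Lemma scheme_angular n z : (n < N)%N -> Xaxial Om z ->
  jmath par * vip Om (W n.+1 - W n) z + tau * (jmath par * (Q n.+1 / E n.+1) * tri (U n) (W n) z
    + c1 par * gradip Om (W n.+1) z + 4 * nur par * vip Om (W n.+1) z)
  = tau * (2 * nur par * cform (U n.+1) z).
Proof.
move=> nN sz; have [_ _ _ hs] := scheme; have st := hs n nN.
have hz := axial_Hfield sz.
have [[_ hW] [_ hW']] := (scheme_fields (ltnW nN), scheme_fields nN).
have hd := axial_Hfield (axialB hW' hW).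
have D0 : ip Om (div Om (W n.+1)) (div Om z) = 0.
  have dW : divfree (W n.+1) by exact: axial_divfree hW'.1 (fun i => H10_H1 (hW'.2 i)).
  have hD : L2 Om (div Om z) by exact: div_L2 (fun i => H10_H1 (hz i)).
  have hD2 : L2 Om (div Om (W n.+1)) by exact: div_L2 (fun i => H10_H1 (hW'.2 i)).
  by rewrite (ip_ae hD2 (si_0 L2_si hD) hD dW) (si_zerol L2_si hD).
have := sav_angular st sz.
rewrite /delta (si_scale (@vip_Hfield_si) _ hd hz) D0 -/(E n.+1) /tri /cform.
have t0 : tau != 0 by rewrite gt_eqF// step_gt0.
move=> <-; move: t0.
generalize (vip Om (W n.+1 - W n) z) (vip Om (Defs.conv Om (U n) (W n)) z) (gradip Om (W n.+1) z).
generalize (vip Om (W n.+1) z) (Q n.+1 / E n.+1) (nur par) (c1 par) (c2 par) (jmath par) (step T N).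
by move=> a b c d e f g x y k g0; field.
Qed.

Lemma scheme_auxiliary n : (n < N)%N -> Q n.+1 - Q n + tau / T * Q n.+1
  = tau / E n.+1 * (tri (U n) (U n) (U n.+1) + jmath par * tri (U n) (W n) (W n.+1)).
Proof.
move=> nN; have [_ _ _ hs] := scheme; have := sav_q (hs n nN).
rewrite -/(E n.+1) /tri.
have t0 : tau != 0 by rewrite gt_eqF// step_gt0.
have T00 : T != 0 by rewrite gt_eqF.
have E0 : E n.+1 != 0 by rewrite gt_eqF// expR_gt0.
move: t0 E0; generalize (vip Om (Defs.conv Om (U n) (U n)) (U n.+1)) (vip Om (Defs.conv Om (U n) (W n)) (W n.+1)).
generalize (Q n.+1) (Q n) (E n.+1) (jmath par) (step T N) => q' q e j t x y t0 e0 h.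
apply/eqP; rewrite -subr_eq0; apply/eqP; rewrite -[RHS](mulr0 t) -h.
by field; rewrite T00 t0 e0.
Qed.

Lemma scheme_decay n : (n < N)%N -> `|E n.+1 - E n + tau / T * E n.+1| <= (T^-1) ^+ 2 * tau ^+ 2.
Proof.
move=> nN; have /andP[t0 _] := time_itv_le (ltnW nN).
have y0 : 0 <= time T N n / T by rewrite divr_ge0// ltW.
have x0 : 0 <= tau / T by rewrite divr_ge0 ?ltW// step_gt0.
have := decay_consistency y0 x0; rewrite -mulrDl -time_succ -!(mulNr _ T^-1) exprMn [_ * T^-1 ^+ 2]mulrC.
exact.
Qed.

Lemma decay_bounds n : (n <= N)%N -> [/\ 0 < E n, E n <= 1 & (E n)^-1 <= expR 1].
Proof.
move=> nN; have /andP[t0 tT] := time_itv_le nN; split; first exact: expR_gt0.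
  rewrite -[leRHS](expR0 R) ler_expR mulNr oppr_le0; apply: divr_ge0 => //; exact: ltW.
by rewrite /E mulNr expRN invrK ler_expR ler_pdivrMr// mul1r.
Qed.

End Scheme.

Definition estimate (N : nat) (C : R) (U W : nat -> 'I_3 -> R * R -> R) (Q : nat -> R) m :=
  vip Om (U m - u (time T N m)) (U m - u (time T N m))
  + jmath par * vip Om (W m - w (time T N m)) (W m - w (time T N m))
  + (Q m - expR (- time T N m / T)) ^+ 2
  + \sum_(0 <= n < m) (step T N / 2 * (nu par * gradip Om (U n.+1 - u (time T N n.+1)) (U n.+1 - u (time T N n.+1))
      + c1 par * gradip Om (W n.+1 - w (time T N n.+1)) (W n.+1 - w (time T N n.+1)))
      + step T N / T * (Q n.+1 - expR (- time T N n.+1 / T)) ^+ 2) <= C * step T N ^+ 2.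

Lemma scheme_estimate : exists2 C : R, 0 <= C &
  forall (N : nat) U P W Q, (1 <= N)%N -> sav_scheme Om T par u0 w0 N U P W Q ->
  forall m, (m <= N)%N -> estimate N C U W Q m.
Proof.
have [[j_gt0 nu_gt0 nur_gt0] [ca_gt0 cd_gt0 _] _] := adm.
have c1_gt0 : 0 < c1 par := addr_gt0 ca_gt0 cd_gt0.
have [Cp Cp0 hCp] := poincare_field.
have [Gam [M M0 [gle flds bnds incs]]] := exact_energy.
have [K1 K10 hK1] := momentum_consistency M0 gle flds bnds incs.
have [K2 K20 hK2] := angular_consistency M0 gle flds bnds incs.
have gi := @gradip_Hfield_si; have vi := @vip_Hfield_si.
have G0 : 0 <= Gam T - Gam 0 by rewrite subr_ge0; exact: gle (lexx 0) (ltW T0).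
have [su0 sw0] := initial_solenoidal.
(* Initial energy of the scheme; the last term is the square of [Q 0 = 1]. *)
pose X0 := vip Om u0 u0 + jmath par * vip Om w0 w0 + 1 ^+ 2.
have X00 : 0 <= X0.
  apply: addr_ge0; last exact: sqr_ge0.
  apply: addr_ge0; first exact: (si_ge0 vi (solenoidal_Hfield su0)).
  by apply: mulr_ge0; [exact: ltW|exact: (si_ge0 vi (axial_Hfield sw0))].
have K0 : 0 <= 18 :> R by [].
have poinc v : Hfield v -> vnorm v <= Num.sqrt Cp ^+ 2 * gnorm v.
  by move=> hv; rewrite sqr_sqrtr//; exact: hCp.
have H1f v : Hfield v -> forall i, H1 Om (v i) by move=> hv i; exact: H10_H1.
have skew v v' v'' : solenoidal v -> Hfield v' -> Hfield v'' -> tri v v' v'' = - tri v v'' v'.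
  by move=> sv h1' h2'; exact: (@tri_skew _ _ _ (solenoidal_Hfield sv) sv.2 h1' h2').
have cCS v v' : Hfield v -> Hfield v' -> cform v v' ^+ 2 <= 2 * gradip Om v v * vip Om v' v'.
  by move=> a b; exact: (@cform_CS _ _ (H1f _ a) (fun i => H1_L2 (H1f _ b i))).
have Ei0 := ltW (expR_gt0 (1 : R)).
have CC0 : 0 <= K1 + K2 by exact: addr_ge0.
have C10 : 0 <= (T^-1) ^+ 2 := sqr_ge0 _.
(* Constants: [18] from [tri_le], [expR 1] bounding the inverse of [exp (- t / T)] on [[0, T]],
   [K1 + K2] serving both consistency errors, and [Gam T - Gam 0] as the telescoped sum of the
   squared [om n] divided by [tau]. *)
have [C C0 hC] := @error_estimate R _ Hfield solenoidal (Xaxial Om) (vip Om) (gradip Om) cform tri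
  vi gi solenoidal_Hfield axial_Hfield solenoidalB axialB (Num.sqrt Cp) 18 (sqrtr_ge0 _) K0 poinc
  (@tri_le) (@tri_subl) (@tri_subm) (@tri_subr) skew
  (@cform_sub) (@cform_sym) cCS
  T (nu par) (nur par) (jmath par) (c1 par) T0 nu_gt0 nur_gt0 j_gt0 c1_gt0
  M (expR 1) (K1 + K2) ((T^-1) ^+ 2) X0 (Gam T - Gam 0) M0 Ei0 CC0 C10 X00 G0.
exists C => // N U P W Q N1 sch m mN.
have [U0 W0 Q0 _] := sch.
have t0 := step_gt0 N1.
pose om n := Num.sqrt (step T N * (Gam (time T N n.+1) - Gam (time T N n))).
have tn n : (n < N)%N -> [/\ 0 <= time T N n, time T N n < time T N n.+1, time T N n.+1 <= T &
    time T N n.+1 - time T N n = step T N].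
  move=> nN; have [/andP[a _] /andP[_ b]] := (time_itv_le N1 (ltnW nN), time_itv_le N1 nN).
  by split=> //; rewrite time_succ ?ltrDl// addrAC subrr add0r.
have dG n : (n < N)%N -> 0 <= step T N * (Gam (time T N n.+1) - Gam (time T N n)).
  move=> nN; have [a b _ _] := tn n nN; apply: mulr_ge0; first exact: ltW.
  by rewrite subr_ge0; exact: gle a (ltW b).
have gC v v' : Hfield v -> Hfield v' -> gnorm (v - v') = gnorm (v' - v).
  by move=> a b; rewrite -opprB; exact: (si_norm_opp gi (si_B gi b a)).
have time0 : time T N 0 = 0 by rewrite /time mul0r.
refine (hC N (step T N) U W (fun n => u (time T N n)) (fun n => w (time T N n)) Q
  (fun n => expR (- time T N n / T)) om (ltW t0) _ (step_le N1) _ _ _ _ _ _ _ _ _ _ _ _ _ _ m mN).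
- by rewrite (step_mul N1).
- move=> n nN; have [a b] := scheme_fields sch nN; have [c d] := exact_solenoidal (time_itv_le N1 nN).
  by split; [exact: a|exact: b|exact: c|exact: d].
- move=> n nN; have [a b c] := decay_bounds N1 nN; have [d e] := bnds _ (time_itv_le N1 nN).
  by split; [exact: d|exact: e|exact: a|exact: b|exact: c].
- move=> n nN; have [a b c d] := tn n nN; have [e f] := incs _ _ a b c.
  have [h1 h2] := flds _ (time_itv_le N1 nN); have [h3 h4] := flds _ (time_itv_le N1 (ltnW nN)).
  rewrite d (gC _ _ h1 h3) in e; rewrite d (gC _ _ h2 h4) in f.
  by split; [exact: sqrtr_ge0|exact: e|exact: f].
- rewrite (_ : \sum_(0 <= n < N) om n ^+ 2 =
      \sum_(0 <= n < N) (step T N * Gam (time T N n.+1) - step T N * Gam (time T N n))).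
    rewrite telescope_sumr// time0 /time (step_mul N1) -mulrBr mulrC//.
  by apply: eq_big_nat => n /andP[_ nN]; rewrite /om sqr_sqrtr ?mulrBr// -mulrBr dG.
- by rewrite Q0 time0 oppr0 mul0r expR0.
- by rewrite /err U0 time0; exact: initial_error.1.
- by rewrite /err W0 time0; exact: initial_error.2.
- by rewrite U0 W0 Q0.
- by move=> n v nN sv; exact: (scheme_momentum N1 sch nN sv).
- move=> n v nN sv; have [a b c d] := tn n nN; have := hK1 v _ _ sv a b c; rewrite d => h.
  apply: (le_trans h); rewrite -[leRHS]mulrA -/(om n); apply: ler_wpM2r.
    by apply: mulr_ge0; [exact: sqrtr_ge0|exact: gnorm_ge0].
  by apply: ler_wpM2r; [exact: ltW|rewrite lerDl].
- by move=> n z nN sz; exact: (scheme_angular N1 sch nN sz).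
- move=> n v nN sv; have [a b c d] := tn n nN; have := hK2 v _ _ sv a b c; rewrite d => h.
  apply: (le_trans h); rewrite -[leRHS]mulrA -/(om n); apply: ler_wpM2r.
    by apply: mulr_ge0; [exact: sqrtr_ge0|exact: gnorm_ge0].
  by apply: ler_wpM2r; [exact: ltW|rewrite lerDr].
- by move=> n nN; exact: (scheme_auxiliary N1 sch nN).
- by move=> n nN; exact: (scheme_decay N1 nN).
Qed.

Lemma axial_div_sqr z : Xaxial Om z -> ip Om (div Om z) (div Om z) = 0.
Proof.
move=> [az hz]; have dz : divfree z by exact: axial_divfree az (fun i => H10_H1 (hz i)).
have hD : L2 Om (div Om z) by exact: div_L2 (fun i => H10_H1 (hz i)).
by rewrite (ip_ae hD (si_0 L2_si hD) hD dz) (si_zerol L2_si hD).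
Qed.

(** The factor 2 compensates for the halved dissipation in [estimate]. The extra weight [4 * nr * t]
    on the microrotation error is at most [4 * nr * T / j] times its share of the energy, and the
    final [+ 1] makes the constant positive. *)
Let collect (t n nr j k t' C x y q SG SH SQ d : R) : 0 < j -> 0 <= nr -> 0 <= n -> 0 <= k -> 0 <= t -> t <= T ->
  0 <= t' -> 0 <= C -> 0 <= x -> 0 <= y -> 0 <= q -> 0 <= SG -> 0 <= SH -> 0 <= SQ ->
  x + j * y + q + (t / 2 * (n * SG + k * SH) + t' * SQ) <= C * d -> 0 <= d ->
  x + n * t * SG + (j + 4 * nr * t) * y + k * t * SH + q + t' * SQ <= ((2 + 4 * nr * T / j) * C + 1) * d.
Proof.
move=> j0 nr0 n0 k0 t0 tT t'0 C0 x0 y0 q0 SG0 SH0 SQ0 hL d0.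
have p1 := mulr_ge0 t0 (mulr_ge0 n0 SG0); have p2 := mulr_ge0 t0 (mulr_ge0 k0 SH0).
have p3 := mulr_ge0 t'0 SQ0; have p4 := mulr_ge0 (ltW j0) y0.
have p5 : 4 * nr * t * y <= 4 * nr * T / j * (j * y).
  rewrite (_ : 4 * nr * T / j * (j * y) = 4 * (nr * y) * T); last by field; rewrite gt_eqF.
  by rewrite (_ : 4 * nr * t * y = 4 * (nr * y) * t); [apply: ler_wpM2l; rewrite ?mulr_ge0|ring].
have c0 : 0 <= 4 * nr * T / j by apply: divr_ge0; [apply: mulr_ge0; [exact: mulr_ge0|exact: ltW]|exact: ltW].
have p6 : j * y <= C * d by move: hL p1 p2 p3 p4 x0 q0; lra.
have p7 := ler_wpM2l c0 p6; move: p7 p5 hL p1 p2 p3 p4 x0 q0 d0; lra.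
Qed.

Lemma convergence : exists2 C : R, 0 < C &
  forall (N : nat) (U : nat -> 'I_3 -> R * R -> R) (P : nat -> R * R -> R)
    (W : nat -> 'I_3 -> R * R -> R) (Q : nat -> R),
    (1 <= N)%N -> sav_scheme Om T par u0 w0 N U P W Q ->
    let tau := T / N%:R in
    let eu n := U n - u (n%:R * tau) in
    let ew n := W n - w (n%:R * tau) in
    let eQ n := Q n - qexact T (n%:R * tau) in
    forall m : nat, (m <= N - 1)%N ->
    vip Om (eu m.+1) (eu m.+1)
    + nu par * tau * \sum_(0 <= n < m.+1) gradip Om (eu n.+1) (eu n.+1)
    + (jmath par + 4 * nur par * tau) * vip Om (ew m.+1) (ew m.+1)
    + c1 par * tau * \sum_(0 <= n < m.+1) gradip Om (ew n.+1) (ew n.+1)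
    + 2 * c2 par * tau
      * \sum_(0 <= n < m.+1) ip Om (div Om (ew n.+1)) (div Om (ew n.+1))
    + `|eQ m.+1| ^+ 2
    + tau / T * \sum_(0 <= n < m.+1) `|eQ n.+1| ^+ 2
    <= C * tau ^+ 2.
Proof.
have [[j_gt0 nu_gt0 nur_gt0] [ca_gt0 cd_gt0 _] _] := adm.
have c1_gt0 : 0 < c1 par := addr_gt0 ca_gt0 cd_gt0.
have [C C0 hC] := scheme_estimate.
exists ((2 + 4 * nur par * T / jmath par) * C + 1).
  rewrite ltr_wpDl// mulr_ge0// addr_ge0// divr_ge0 ?(ltW j_gt0)//.
  by apply: mulr_ge0; [apply: mulr_ge0 => //; exact: ltW|exact: ltW].
move=> N U P W Q N1 sch tau eu ew eQ m mN1.
have mN : (m.+1 <= N)%N by rewrite -(subnK N1) addn1 ltnS.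
have gi := @gradip_Hfield_si; have vi := @vip_Hfield_si.
have mem n : (n <= N)%N -> Hfield (eu n) /\ Xaxial Om (ew n).
  move=> nN; have [a b] := scheme_fields sch nN; have [c d] := exact_solenoidal (time_itv_le N1 nN).
  by split; [exact: (solenoidal_Hfield (solenoidalB a c))|exact: axialB b d].
have D0 : \sum_(0 <= n < m.+1) ip Om (div Om (ew n.+1)) (div Om (ew n.+1)) = 0.
  rewrite big_nat; apply: big1 => n /andP[_ nm]; apply: axial_div_sqr.
  by have [] := mem n.+1 (leq_trans nm mN).
have SG0 : 0 <= \sum_(0 <= n < m.+1) gradip Om (eu n.+1) (eu n.+1).
  rewrite big_nat; apply: sumr_ge0 => n /andP[_ nm]; have [a _] := mem n.+1 (leq_trans nm mN).
  exact: (si_ge0 gi a).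
have SH0 : 0 <= \sum_(0 <= n < m.+1) gradip Om (ew n.+1) (ew n.+1).
  rewrite big_nat; apply: sumr_ge0 => n /andP[_ nm]; have [_ a] := mem n.+1 (leq_trans nm mN).
  exact: (si_ge0 gi (axial_Hfield a)).
have SQ0 : 0 <= \sum_(0 <= n < m.+1) (eQ n.+1) ^+ 2 by apply: sumr_ge0 => n _; exact: sqr_ge0.
have [hm hm'] := mem m.+1 mN.
have eQE n : `|eQ n| ^+ 2 = (eQ n) ^+ 2 by rewrite real_normK ?num_real.
under [X in tau / T * X]eq_bigr do rewrite eQE.
rewrite eQE D0 mulr0 addr0.
have tt0 : 0 <= tau / T by rewrite divr_ge0 ?ltW// (step_gt0 N1).
apply: (collect j_gt0 (ltW nur_gt0) (ltW nu_gt0) (ltW c1_gt0) (ltW (step_gt0 N1)) (step_le N1) tt0 C0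
  (si_ge0 vi hm) (si_ge0 vi (axial_Hfield hm')) (sqr_ge0 _) SG0 SH0 SQ0 _ (sqr_ge0 _)).
have split_sum (a b : R) (F G H : nat -> R) k :
    \sum_(0 <= n < k) (a * (nu par * F n + c1 par * G n) + b * H n) =
    a * (nu par * \sum_(0 <= n < k) F n + c1 par * \sum_(0 <= n < k) G n) + b * \sum_(0 <= n < k) H n.
  by rewrite big_split /= -!mulr_sumr big_split /= -!mulr_sumr.
have h := hC N U P W Q N1 sch m.+1 mN; rewrite /estimate in h.
by rewrite -(split_sum (tau / 2) (tau / T) (fun n => gradip Om (eu n.+1) (eu n.+1))
  (fun n => gradip Om (ew n.+1) (ew n.+1)) (fun n => eQ n.+1 ^+ 2)); exact: h.
Qed.

End Convergence.

End BoundedDomain.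

Theorem theorem4p1 (R : realType) (Om : set (R * R)) (T : R) (par : params R)
    (u0 w0 : 'I_3 -> R * R -> R)
    (u : R -> 'I_3 -> R * R -> R) (p : R -> R * R -> R)
    (w : R -> 'I_3 -> R * R -> R)
    (HOm : convex_polygonal_domain Om) (HT : 0 < T) (Hpar : admissible par)
    (Hex : exact_solution Om T par u0 w0 u p w)
    (Hu : regular Om T u) (Hw : regular Om T w) :
  exists2 C : R, 0 < C &
  forall (N : nat) (U : nat -> 'I_3 -> R * R -> R) (P : nat -> R * R -> R)
    (W : nat -> 'I_3 -> R * R -> R) (Q : nat -> R),
    (1 <= N)%N -> sav_scheme Om T par u0 w0 N U P W Q ->
    let tau := T / N%:R in
    let eu n := U n - u (n%:R * tau) in
    let ew n := W n - w (n%:R * tau) in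
    let eQ n := Q n - qexact T (n%:R * tau) in
    forall m : nat, (m <= N - 1)%N ->
    vip Om (eu m.+1) (eu m.+1)
    + nu par * tau * \sum_(0 <= n < m.+1) gradip Om (eu n.+1) (eu n.+1)
    + (jmath par + 4 * nur par * tau) * vip Om (ew m.+1) (ew m.+1)
    + c1 par * tau * \sum_(0 <= n < m.+1) gradip Om (ew n.+1) (ew n.+1)
    + 2 * c2 par * tau
      * \sum_(0 <= n < m.+1) ip Om (div Om (ew n.+1)) (div Om (ew n.+1))
    + `|eQ m.+1| ^+ 2
    + tau / T * \sum_(0 <= n < m.+1) `|eQ n.+1| ^+ 2
    <= C * tau ^+ 2.
Proof.
have dom := polygon_bounded_domain HOm.
exact: (convergence HT Hpar Hex Hu Hw).
Qed.
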